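(* Let $\boldsymbol{M}$ be a semisimple $\mathbb{R}$-algebraic subgroup of $\boldsymbol{G}$ without compact factors, let $\boldsymbol{D}$ be a maximal $\mathbb{R}$-split torus in $\boldsymbol{\mathrm{Z}}_{\boldsymbol{G}}(\boldsymbol{M})$, let $A$ be a Lie subgroup contained in $D$, and let $H=AM$. Assume that $\boldsymbol{D}\subset\boldsymbol{T}$. Let $\Lambda$ be a finitely generated Zariski dense subgroup of $M$ and $H'=A\Lambda$. Then the action of $H'$ on $G/\Gamma$ is uniformly non-divergent if and only if the action of $H$ on $G/\Gamma$ is uniformly non-divergent.
   Context: Boldface capitals denote algebraic groups and the corresponding Roman capitals denote their groups of real points. $\boldsymbol{G}$ is a connected semisimple $\mathbb{Q}$-algebraic group, $\Gamma\subset G$ is an arithmetic lattice, and $\boldsymbol{T}$ is a fixed maximal $\mathbb{R}$-split torus of $\boldsymbol{G}$ containing a maximal $\mathbb{Q}$-split torus. $\boldsymbol{\mathrm{Z}}_{\boldsymbol{G}}(\cdot)$ denotes the centralizer. The action of a subgroup $H\subset G$ on $X=G/\Gamma$ is uniformly non-divergent if there is a compact subset $C\subset X$ such that $Hx\cap C\neq\emptyset$ for every $x\in X$. *)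

(* Defs.v *)
From HB Require Import structures.
From mathcomp Require Import all_boot all_order all_algebra.
From mathcomp Require Import all_classical all_reals all_analysis.
From mathcomp Require Import complex.
From mathcomp Require Import -(notations) mpoly.

Set Implicit Arguments.
Unset Strict Implicit.
Unset Printing Implicit Defensive.

Import Order.TTheory GRing.Theory Num.Theory.
Import numFieldNormedType.Exports.

Local Open Scope classical_set_scope.
Local Open Scope ring_scope.

(* Linear algebraic groups are handled through their groups of complex points,
   as subgroups of GL_n(R[i]); their groups of real points, the arithmetic
   group, etc. are subgroups of GL_n(R). *)

Section MatrixGroups.
Context {F : fieldType} {n : nat}.

Record mxgroup := MxGroup {
  mxset :> set 'M[F]_n ;
  mxgroup_unit : mxset `<=` [set g | g \in unitmx] ;
  mxgroup1 : mxset 1%:M ;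
  mxgroupM : forall g h, mxset g -> mxset h -> mxset (g *m h) ;
  mxgroupV : forall g, mxset g -> mxset (invmx g) }.

Definition gen (S : set 'M[F]_n) : set 'M[F]_n :=
  [set g | forall K : mxgroup, S `<=` K -> mxset K g].

Definition finitely_generated (G : mxgroup) : Prop :=
  exists s : seq 'M[F]_n, mxset G = gen [set` s].

Definition normal_in (N G : mxgroup) : Prop :=
  N `<=` G /\ forall g h, mxset G g -> mxset N h -> mxset N (g *m h *m invmx g).

Definition mxcentralizer (G M : set 'M[F]_n) : set 'M[F]_n :=
  [set g | G g /\ forall m, M m -> g *m m = m *m g].

Definition derived (S : set 'M[F]_n) : set 'M[F]_n :=
  gen [set c | exists g h,
         [/\ S g, S h & c = g *m h *m invmx g *m invmx h]].

Definition solvable_mx (G : mxgroup) : Prop :=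
  exists k, iter k derived G = [set 1%:M].

Definition mxprod (A B : set 'M[F]_n) : set 'M[F]_n :=
  [set g | exists2 a, A a & exists2 b, B b & g = a *m b].

Definition lcoset_mx (K : set 'M[F]_n) (g : 'M[F]_n) : set 'M[F]_n :=
  [set g *m k | k in K].

Definition finite_index (K G : set 'M[F]_n) : Prop :=
  finite_set (lcoset_mx K @` G).

Definition countable_index (K G : set 'M[F]_n) : Prop :=
  countable (lcoset_mx K @` G).

Definition commensurable (G1 G2 : set 'M[F]_n) : Prop :=
  finite_index (G1 `&` G2) G1 /\ finite_index (G1 `&` G2) G2.

End MatrixGroups.

Arguments mxgroup : clear implicits.

Section Zariski.
Context {C : fieldType}.

Definition eval_at (K : fieldType) (iota : {rmorphism K -> C}) (n : nat)
    (p : mpoly (n * n) K) (g : 'M[C]_n) : C :=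
  mmap iota (fun i => mxvec g 0 i) p.

(* In characteristic 0, a subvariety that is the zero locus of polynomials over
   K is defined over K.  No power of 1 / det is needed to describe the closed
   subsets of GL_n: denominators can be cleared. *)
Definition zclosed_over (K : fieldType) (iota : {rmorphism K -> C}) (n : nat)
    (S : set 'M[C]_n) : Prop :=
  exists I : set (mpoly (n * n) K),
    S = [set g | g \in unitmx /\ forall p, I p -> eval_at iota p g = 0].

Definition zclosed (n : nat) (S : set 'M[C]_n) : Prop :=
  zclosed_over (idfun : {rmorphism C -> C}) S.

Definition zdense (n : nat) (S T : set 'M[C]_n) : Prop :=
  S `<=` T /\ forall Z, zclosed Z -> S `<=` Z -> T `<=` Z.

Definition zconnected (n : nat) (S : set 'M[C]_n) : Prop :=
  forall Z1 Z2, zclosed Z1 -> zclosed Z2 ->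
    S `<=` Z1 `|` Z2 -> S `&` Z1 `&` Z2 = set0 -> S `<=` Z1 \/ S `<=` Z2.

(* The radical, i.e. the largest connected solvable closed normal subgroup, is
   trivial.  Connectedness of G itself is not part of the notion. *)
Definition semisimple (n : nat) (G : mxgroup C n) : Prop :=
  forall N : mxgroup C n, zclosed N -> zconnected N -> normal_in N G ->
    solvable_mx N -> mxset N = [set 1%:M].

(* f restricts to a morphism of K-varieties from S, closed in GL_m, to GL_n:
   its entries are the restrictions to S of elements of K[x_ij, 1 / det]. *)
Definition regular_over (K : fieldType) (iota : {rmorphism K -> C}) (m n : nat)
    (S : set 'M[C]_m) (f : 'M[C]_m -> 'M[C]_n) : Prop :=
  exists (P : 'I_n -> 'I_n -> mpoly (m * m) K) (e : nat),
    forall g, S g ->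
      forall i j, f g i j = eval_at iota (P i j) g / \det g ^+ e.

(* The group GL_1^r, as the group of invertible diagonal matrices. *)
Definition diag_torus (r : nat) : set 'M[C]_r :=
  [set g | g \in unitmx /\ is_diag_mx g].

Definition split_torus (K : fieldType) (iota : {rmorphism K -> C}) (n : nat)
    (T : mxgroup C n) : Prop :=
  zclosed_over iota T /\
  exists (r : nat) (phi : 'M[C]_r -> 'M[C]_n) (psi : 'M[C]_n -> 'M[C]_r),
    [/\ (forall g, @diag_torus r g -> mxset T (phi g) /\ psi (phi g) = g),
        (forall t, mxset T t -> @diag_torus r (psi t) /\ phi (psi t) = t),
        (forall g h, @diag_torus r g -> @diag_torus r h ->
           phi (g *m h) = phi g *m phi h),
        regular_over iota (@diag_torus r) phi
      & regular_over iota T psi].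

Definition maximal_split_torus (K : fieldType) (iota : {rmorphism K -> C})
    (n : nat) (S : set 'M[C]_n) (T : mxgroup C n) : Prop :=
  [/\ split_torus iota T, T `<=` S
    & forall T' : mxgroup C n, split_torus iota T' -> T' `<=` S ->
        T `<=` T' -> T' `<=` T].

End Zariski.

Section RealPoints.
Context {R : realType} {n : nat}.
Implicit Types G M N T : mxgroup R[i] n.

Definition iotaQ : {rmorphism rat -> R[i]} := ratr.
Definition iotaR : {rmorphism R -> R[i]} := real_complex R.

Definition complexify (g : 'M[R]_n) : 'M[R[i]]_n := map_mx iotaR g.

Lemma rpoints_unit G : complexify @^-1` G `<=` [set g | g \in unitmx].
Proof. by move=> g /(@mxgroup_unit _ _ G); rewrite /= map_unitmx. Qed.

Lemma rpoints1 G : (complexify @^-1` G) 1%:M.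
Proof. by rewrite /= /complexify map_mx1; exact: mxgroup1. Qed.

Lemma rpointsM G g h : (complexify @^-1` G) g -> (complexify @^-1` G) h ->
  (complexify @^-1` G) (g *m h).
Proof. by rewrite /= /complexify map_mxM; exact: mxgroupM. Qed.

Lemma rpointsV G g : (complexify @^-1` G) g -> (complexify @^-1` G) (invmx g).
Proof. by rewrite /= /complexify map_invmx; exact: mxgroupV. Qed.

Definition rpoints G : mxgroup R n :=
  MxGroup (@rpoints_unit G) (@rpoints1 G) (@rpointsM G) (@rpointsV G).

(* Almost R-simple factors: minimal among the nontrivial connected normal
   R-subgroups. *)
Definition normal_Rsubgroup M N : Prop :=
  [/\ zclosed_over iotaR N, zconnected N, normal_in N M
    & mxset N <> [set 1%:M]].

Definition simple_factor M N : Prop :=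
  normal_Rsubgroup M N /\
  forall N', normal_Rsubgroup M N' -> N' `<=` N -> N `<=` N'.

Definition no_compact_factors M : Prop :=
  forall N, simple_factor M N -> ~ compact (rpoints N : set 'M[R]_n).

Definition zdense_real (L : set 'M[R]_n) M : Prop :=
  zdense (complexify @` L) (complexify @` rpoints M).

Definition integral_points G : set 'M[R]_n :=
  [set g | mxset (rpoints G) g /\
     forall i j, g i j \is a Num.int /\ invmx g i j \is a Num.int].

Definition expmx (X : 'M[R]_n) : 'M[R]_n :=
  limn (series (fun k => (k`!%:R)^-1 *: X ^+ k)).

(* Immersed, second countable Lie subgroups: the identity component is the
   analytic subgroup generated by the exponentials of a Lie subalgebra, and
   there are countably many components.  Closed subgroups are a special case. *)
Definition lie_subgroup (A : mxgroup R n) : Prop :=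
  exists a : {vspace 'M[R]_n},
    [/\ (forall X Y, X \in a -> Y \in a -> X *m Y - Y *m X \in a),
        (forall X, X \in a -> mxset A (expmx X))
      & countable_index (gen [set expmx X | X in [set` a]]) A].

End RealPoints.

Section CosetSpace.
Context {R : realType} {n : nat}.
Variables (G Gamma : mxgroup R n).

Definition points : Type := set_type (mxset G).
HB.instance Definition _ := Topological.copy points (set_type (mxset G)).
HB.instance Definition _ :=
  isPointed.Build points (SigSub (mem_set (mxgroup1 G))).

Definition same_coset (g h : points) : bool :=
  `[< lcoset_mx Gamma (val g) = lcoset_mx Gamma (val h) >].

Lemma same_coset_refl : reflexive same_coset.
Proof. by move=> g; apply/asboolP. Qed.

Lemma same_coset_sym : ssrbool.symmetric same_coset.
Proof. by move=> g h; apply/asboolP/asboolP. Qed.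

Lemma same_coset_trans : transitive same_coset.
Proof. by move=> h g k /asboolP gh /asboolP hk; apply/asboolP; rewrite gh. Qed.

Definition coset_equiv : equiv_rel points :=
  EquivRel same_coset same_coset_refl same_coset_sym same_coset_trans.

(* G / Gamma with the quotient topology (Gamma a subgroup of G). *)
Definition coset_space : ptopologicalType :=
  quotient_topology {eq_quot coset_equiv}%qT.

Definition coset_proj (g : points) : coset_space := (\pi_({eq_quot coset_equiv}) g)%qT.

(* y = h x in G / Gamma *)
Definition translates (h : 'M[R]_n) (x y : coset_space) : Prop :=
  exists g g' : points,
    [/\ x = coset_proj g, val g' = h *m val g & y = coset_proj g'].

Definition orbit_of (H : set 'M[R]_n) (x : coset_space) : set coset_space :=
  [set y | exists2 h, H h & translates h x y].

Definition uniformly_nondivergent (H : set 'M[R]_n) : Prop :=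
  exists C : set coset_space,
    compact C /\ forall x, orbit_of H x `&` C !=set0.

Definition translate_set (h : 'M[R]_n) (B : set coset_space) :
    set coset_space :=
  [set y | exists2 x, B x & translates h x y].

(* Discrete, with a nonzero finite G-invariant Borel measure on G / Gamma. *)
Definition lattice : Prop :=
  [/\ Gamma `<=` G,
      isolated (mxset Gamma) = mxset Gamma
    & exists mu : {measure set (g_sigma_algebraType (@open coset_space)) -> \bar R},
        [/\ (0 < mu [set: coset_space])%E, (mu [set: coset_space] < +oo)%E
          & forall h B, mxset G h -> <<s (@open coset_space) >> B ->
              mu (translate_set h B) = mu B]].

End CosetSpace.

Definition arithmetic_lattice (R : realType) (n : nat) (G : mxgroup R[i] n)
    (Gamma : mxgroup R n) : Prop :=
  lattice (rpoints G) Gamma /\ commensurable Gamma (integral_points G).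

(* Main.v *)
(** Since A commutes with M, it suffices to show that if no sublattice of Z^n u m, for some m in M(R), has
    small covolume, then Z^n u l has no short vector for some l in Lambda.  Covolumes are norms of vectors in
    exterior powers of R^n, all of which sit in a tensor power V of R + R^n.

    A subgroup L0 of finite index in Lambda is Zariski irreducible and has the same Lie algebra as M.  This Lie
    algebra is semisimple, hence V is a sum of irreducible L0-modules on which L0 acts with determinant one.
    On a bounded summand L0, and therefore its Zariski closure, preserves a definite quadratic form.  By an
    argument of general position, some element of a finite subset F of L0 expands all the unbounded components
    of a given finite family of vectors.

    Weigh the covolumes of the sublattices by powers of a large constant.  By submodularity the sublattices of
    nearly minimal weight form a flag, so some element of F shrinks none of them and doubles their unbounded
    components.  Iterating, only sublattices without unbounded component can stay small, and their covolume
    is comparable to the one they had in Z^n u m.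

    Two points replace analytic arguments.  A vector killed by the Lie algebra of an irreducible group is fixed
    by the group: the functions measuring its displacement lie in the square of the ideal of 1, squaring
    g multiplies the k-th graded piece by 2 ^ k, so they lie in all powers of this ideal and vanish by Krull's
    intersection theorem.  And the trace form of M is nondegenerate because its radical generates a closed
    normal unipotent subgroup, while complete reducibility follows from Casimir elements of trace forms. *)
Require Import Defs.
From HB Require Import structures.
From mathcomp Require Import all_boot all_order all_algebra all_fingroup spectral.
From mathcomp Require Import all_classical all_reals all_analysis.
From mathcomp Require Import complex.
From mathcomp Require Import -(notations) mpoly.
From mathcomp Require Import ring lra zify.

Set Implicit Arguments.
Unset Strict Implicit.
Unset Printing Implicit Defensive.

Import Order.TTheory GRing.Theory Num.Theory.

Local Open Scope classical_set_scope.

(** * Tensor powers *)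

Section Tensor.
Local Open Scope ring_scope.
Variable R : comNzRingType.

(** A coset [g Gamma] stands for the lattice Z^n g^-1 of row vectors, on which M acts on the right
    through inverses. Enlarging Lambda to M only enlarges orbits; the converse has to bring a point
    that M moves into C within reach of Lambda. The obstacle is that Lambda is an abstract group: it
    may contain no unipotent element, so the quantitative nondivergence of unipotent flows is out of
    reach, and the dynamics reduces to choosing, at each time, one element of a finite set. Such a
    choice must suit all dangerous sublattices at once, which works because those of a given rank
    span a single rational subspace.

    Covolumes control lattices, not yet cosets: lattices of the form Z^n g^-1 without short vectors
    must come from a compact part of G / Gamma. For this G is recovered as the stabilizer of the
    space of its equations of a fixed degree. The orbit of this subspace, seen as a vector, stays
    bounded because it does so along Gamma and because translates of small open sets must return, in
    the finite invariant measure, to the region where the vector is bounded. *)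

Definition tdim (n k : nat) : nat := #|{ffun 'I_k -> 'I_n}|.

Definition tidx {n k} (a : 'I_(tdim n k)) : {ffun 'I_k -> 'I_n} := enum_val a.

(** Vectors are rows and matrices act on the right. Rectangular matrices are allowed because the
    inclusion of R^n into R + R^n is also raised to tensor powers. *)
Definition tpow (k : nat) {n m} (g : 'M[R]_(n, m)) : 'M[R]_(tdim n k, tdim m k) :=
  \matrix_(a, b) \prod_(l < k) g (tidx a l) (tidx b l).

(** The wedge of the rows, written as an antisymmetric tensor: all index maps are kept, not only the
    increasing ones, so that [tpow] acts on it without a separate exterior power. *)
Definition minors {k n} (L : 'M[R]_(k, n)) : 'rV[R]_(tdim n k) :=
  \row_a \det (\matrix_(i, j) L i (tidx a j)).

Definition tvec {k n} (u : 'I_k -> 'rV[R]_n) : 'rV[R]_(tdim n k) :=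
  \row_a \prod_(l < k) u l 0 (tidx a l).

Definition upd {k} {T : Type} (u : 'I_k -> T) (l : 'I_k) (x : T) : 'I_k -> T :=
  fun j => if j == l then x else u j.

(** The extension of X as a derivation, acting on one factor at a time; it is the differential of
    [tpow] at 1. *)
Definition dtens (k : nat) {n} (X : 'M[R]_n) : 'M[R]_(tdim n k) :=
  \matrix_(a, b) \sum_(l < k) X (tidx a l) (tidx b l) *
    \prod_(j < k | j != l) (tidx a j == tidx b j)%:R.

Lemma sum_tidx n k (F : {ffun 'I_k -> 'I_n} -> R) :
  \sum_(a < tdim n k) F (tidx a) = \sum_f F f.
Proof.
rewrite /tdim /tidx; symmetry.
by rewrite (reindex (@enum_val _ {ffun 'I_k -> 'I_n})) //; exact: onW_bij (enum_val_bij _).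
Qed.

Lemma tpowM k n m p (g : 'M[R]_(n, m)) (h : 'M[R]_(m, p)) :
  tpow k (g *m h) = tpow k g *m tpow k h.
Proof.
apply/matrixP=> a b; rewrite !mxE.
under eq_bigr do rewrite mxE.
rewrite bigA_distr_bigA /= -sum_tidx; apply: eq_bigr => c _.
by rewrite !mxE -big_split.
Qed.

Lemma tvecE k n (u : 'I_k -> 'rV[R]_n) a : tvec u 0 a = \prod_(l < k) u l 0 (tidx a l).
Proof. by rewrite mxE. Qed.

Lemma eq_tvec k n (u v : 'I_k -> 'rV[R]_n) : u =1 v -> tvec u = tvec v.
Proof. by move=> uv; apply/rowP=> a; rewrite !mxE; apply: eq_bigr => l _; rewrite uv. Qed.

Lemma tvec_tpow k n m (u : 'I_k -> 'rV[R]_n) (g : 'M[R]_(n, m)) :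
  tvec u *m tpow k g = tvec (fun l => u l *m g).
Proof.
apply/rowP=> b; rewrite !mxE.
under [RHS]eq_bigr do rewrite mxE.
rewrite bigA_distr_bigA /= -sum_tidx; apply: eq_bigr => c _.
by rewrite !mxE -big_split.
Qed.

Lemma prod_delta k n (a b : {ffun 'I_k -> 'I_n}) :
  \prod_(l < k) (a l == b l)%:R = (a == b)%:R :> R.
Proof.
case: eqP => [->|/eqP neq]; first by rewrite big1 // => l _; rewrite eqxx.
have [l nl] : exists l, a l != b l.
  by apply/existsP; apply: contraR neq; rewrite negb_exists => /forallP E;
    apply/eqP/ffunP=> l; apply/eqP; rewrite -[_ == _]negbK E.
by rewrite (bigD1 l) //= (negPf nl) mul0r.
Qed.

Lemma delta_tvec k n (a : 'I_(tdim n k)) :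
  delta_mx 0 a = tvec (fun l => delta_mx 0 (tidx a l)).
Proof.
apply/rowP=> b; rewrite !mxE eqxx /=.
under eq_bigr do rewrite !mxE eqxx /=.
by rewrite prod_delta (inj_eq enum_val_inj).
Qed.

Lemma tpow1 k n : tpow k (1%:M : 'M[R]_n) = 1%:M.
Proof.
apply/matrixP=> a b; rewrite !mxE; under eq_bigr do rewrite mxE.
by rewrite prod_delta (inj_eq enum_val_inj).
Qed.

(** The standard basis consists of pure tensors. *)
Lemma tens_eq k n p (A B : 'M[R]_(tdim n k, p)) :
  (forall u : 'I_k -> 'rV[R]_n, tvec u *m A = tvec u *m B) -> A = B.
Proof.
move=> AB; apply/row_matrixP=> a.
by rewrite !rowE delta_tvec AB.
Qed.

Lemma prod_upd k n (u : 'I_k -> 'rV[R]_n) l x (F : 'I_k -> 'I_n) :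
  \prod_(j < k) upd u l x j 0 (F j) = x 0 (F l) * \prod_(j < k | j != l) u j 0 (F j).
Proof.
rewrite (bigD1 l) //= /upd eqxx; congr (_ * _).
by apply: eq_bigr => j /negPf ->.
Qed.

Lemma tvec_dtens k n (u : 'I_k -> 'rV[R]_n) (X : 'M[R]_n) :
  tvec u *m dtens k X = \sum_(l < k) tvec (upd u l (u l *m X)).
Proof.
apply/rowP=> b; rewrite !mxE summxE.
under eq_bigr do rewrite !mxE mulr_sumr.
rewrite exchange_big; apply: eq_bigr => l _ /=.
rewrite mxE prod_upd mxE.
transitivity (\sum_(f : {ffun 'I_k -> 'I_n}) \prod_(j < k)
   (u j 0 (f j) * (if j == l then X (f j) (tidx b j) else (f j == tidx b j)%:R))).
  rewrite -sum_tidx; apply: eq_bigr => a _.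
  rewrite big_split /= [in RHS](bigD1 l) //= [X in _ = _ * X](bigD1 l) //= eqxx.
  rewrite [in LHS](bigD1 l) //=; congr (_ * (_ * _)).
  by apply: eq_bigr => j /negPf ->.
rewrite -(bigA_distr_bigA (fun j i =>
  u j 0 i * (if j == l then X i (tidx b j) else (i == tidx b j)%:R))) /=.
rewrite (bigD1 l) //= eqxx; congr (_ * _).
apply: eq_bigr => j /negPf ->.
rewrite (bigD1 (tidx b j)) //= eqxx mulr1 big1 ?addr0 // => i /negPf ->.
by rewrite mulr0.
Qed.

Lemma updE k T (u : 'I_k -> T) l x : upd u l x l = x.
Proof. by rewrite /upd eqxx. Qed.

Lemma tvec_updD k n (u : 'I_k -> 'rV[R]_n) l x y :
  tvec (upd u l (x + y)) = tvec (upd u l x) + tvec (upd u l y).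
Proof. by apply/rowP=> a; rewrite !mxE !prod_upd mxE mulrDl. Qed.

Lemma tvec_updZ k n (u : 'I_k -> 'rV[R]_n) l c x :
  tvec (upd u l (c *: x)) = c *: tvec (upd u l x).
Proof. by apply/rowP=> a; rewrite !mxE !prod_upd mxE mulrA. Qed.

Lemma dtens_is_linear k n : linear (@dtens k n).
Proof.
move=> c X Y; apply/matrixP=> a b; rewrite !mxE mulr_sumr -big_split /=.
by apply: eq_bigr => l _; rewrite !mxE mulrDl mulrA.
Qed.
HB.instance Definition _ k n :=
  GRing.isLinear.Build R _ _ _ (@dtens k n) (@dtens_is_linear k n).

(** Applied to a pure tensor, both products give terms acting twice on one factor, which produce the
    bracket, and terms acting on two different factors, which are symmetric in the two derivations
    and cancel. *)
Lemma dtens_bracket k n (X Y : 'M[R]_n) :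
  dtens k (X *m Y - Y *m X) = dtens k X *m dtens k Y - dtens k Y *m dtens k X.
Proof.
apply: tens_eq => u.
have E (A B : 'M[R]_n) : tvec u *m (dtens k A *m dtens k B) =
   \sum_(l < k) tvec (upd u l (u l *m A *m B)) +
   \sum_(l < k) \sum_(j < k | j != l) tvec (upd (upd u l (u l *m A)) j (u j *m B)).
  rewrite mulmxA tvec_dtens mulmx_suml -big_split /=; apply: eq_bigr => l _.
  rewrite tvec_dtens (bigD1 l) //= updE; congr (_ + _).
    by apply: eq_tvec => j; rewrite /upd; case: eqP.
  by apply: eq_bigr => j /negPf jl; rewrite {3}/upd jl.
rewrite raddfB /= !mulmxBr !tvec_dtens.
rewrite !E opprD addrACA.
rewrite [X in _ = _ + X](_ : _ = 0) ?addr0; last first.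
  apply/eqP; rewrite subr_eq0; apply/eqP.
  rewrite (exchange_big_dep xpredT) //=; apply: eq_bigr => j _.
  apply: eq_big => l; first by rewrite eq_sym.
  move=> jl; apply: eq_tvec => i; rewrite /upd.
  case: (eqVneq i j) => [->|//]; case: (eqVneq j l) => // jl'.
  by rewrite jl' eqxx in jl.
by congr (_ - _); apply: eq_bigr => l _; rewrite mulmxA.
Qed.

Lemma minorsE k n (L : 'M[R]_(k, n)) a :
  minors L 0 a = \det (colsub (tidx a) L).
Proof. by rewrite mxE; congr (\det _); apply/matrixP=> i j; rewrite !mxE. Qed.

Lemma minorsMl k n (P : 'M[R]_k) (L : 'M[R]_(k, n)) :
  minors (P *m L) = \det P *: minors L.
Proof.
apply/rowP=> a; rewrite [RHS]mxE !minorsE.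
rewrite -det_mulmx; congr (\det _).
by apply/matrixP=> i j; rewrite !mxE; apply: eq_bigr => l _; rewrite !mxE.
Qed.

(** By the Leibniz formula [minors] is the antisymmetrization of the tensor product of the rows, and
    every summand is equivariant; this contains the Cauchy-Binet formula. *)
Lemma minors_tpow k n m (L : 'M[R]_(k, n)) (g : 'M[R]_(n, m)) :
  minors (L *m g) = minors L *m tpow k g.
Proof.
have E p (A : 'M[R]_(k, p)) : minors A =
   \sum_(s : 'S_k) (-1) ^+ s *: tvec (fun l => row (s^-1%g l) A).
  apply/rowP=> a; rewrite mxE summxE; apply: eq_bigr => s _.
  rewrite !mxE (reindex_inj (@perm_inj _ s^-1%g)) /=; congr (_ * _).
  by apply: eq_bigr => i _; rewrite !mxE permKV.
rewrite !E mulmx_suml; apply: eq_bigr => s _.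
rewrite -scalemxAl tvec_tpow; congr (_ *: _); apply: eq_tvec => l.
by rewrite row_mul.
Qed.

End Tensor.

(** * Minors and norms *)

Section Minor.
Local Open Scope ring_scope.

(** The entrywise l1 norm is submultiplicative for all rectangular products, with constant 1. *)
Definition nrm {F : numDomainType} {m n} (A : 'M[F]_(m, n)) : F :=
  \sum_i \sum_j `|A i j|.

Section Norm.
Variable F : numDomainType.
Implicit Types m n p : nat.

Lemma nrm_ge0 m n (A : 'M[F]_(m, n)) : 0 <= nrm A.
Proof. by apply: sumr_ge0 => i _; apply: sumr_ge0. Qed.

Lemma nrm_entry m n (A : 'M[F]_(m, n)) i j : `|A i j| <= nrm A.
Proof.
rewrite /nrm (bigD1 i) //= (bigD1 j) //= -addrA lerDl.
by apply: addr_ge0; [apply: sumr_ge0 | apply: sumr_ge0 => k _; apply: sumr_ge0].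
Qed.

Lemma nrm_eq0 m n (A : 'M[F]_(m, n)) : (nrm A == 0) = (A == 0).
Proof.
apply/eqP/eqP => [A0|->]; last first.
  by rewrite /nrm big1 // => i _; rewrite big1 // => j _; rewrite mxE normr0.
apply/matrixP=> i j; rewrite mxE; apply/eqP; rewrite -normr_eq0 eq_le normr_ge0 andbT.
by rewrite -A0 nrm_entry.
Qed.

Lemma nrm0 m n : nrm (0 : 'M[F]_(m, n)) = 0.
Proof. by apply/eqP; rewrite nrm_eq0. Qed.

Lemma nrmD m n (A B : 'M[F]_(m, n)) : nrm (A + B) <= nrm A + nrm B.
Proof.
rewrite /nrm -big_split; apply: ler_sum => i _ /=.
by rewrite -big_split; apply: ler_sum => j _; rewrite mxE ler_normD.
Qed.

Lemma nrmN m n (A : 'M[F]_(m, n)) : nrm (- A) = nrm A.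
Proof. by apply: eq_bigr => i _; apply: eq_bigr => j _; rewrite mxE normrN. Qed.

Lemma nrmC m n (A B : 'M[F]_(m, n)) : nrm (A - B) = nrm (B - A).
Proof. by rewrite -nrmN opprB. Qed.

Lemma nrmZ m n c (A : 'M[F]_(m, n)) : nrm (c *: A) = `|c| * nrm A.
Proof.
rewrite /nrm mulr_sumr; apply: eq_bigr => i _; rewrite mulr_sumr.
by apply: eq_bigr => j _; rewrite mxE normrM.
Qed.

Lemma nrm_sum m n (I : Type) (r : seq I) P (A : I -> 'M[F]_(m, n)) :
  nrm (\sum_(i <- r | P i) A i) <= \sum_(i <- r | P i) nrm (A i).
Proof.
elim/big_rec2: _ => [|i x y _ h]; first by rewrite nrm0.
by apply: le_trans (nrmD _ _) _; rewrite lerD2l.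
Qed.

Lemma nrmM m n p (A : 'M[F]_(m, n)) (B : 'M[F]_(n, p)) : nrm (A *m B) <= nrm A * nrm B.
Proof.
rewrite /nrm mulr_suml; apply: ler_sum => i _.
apply: (@le_trans _ _ (\sum_j \sum_k `|A i k| * `|B k j|)).
  apply: ler_sum => j _; rewrite mxE; apply: le_trans (ler_norm_sum _ _ _) _.
  by apply: ler_sum => k _; rewrite normrM.
rewrite exchange_big mulr_suml /=; apply: ler_sum => k _.
rewrite -mulr_sumr; apply: ler_wpM2l => //.
by rewrite [leRHS](bigD1 k) //= lerDl; apply: sumr_ge0 => l _; apply: sumr_ge0.
Qed.

Lemma nrm_le m n (A : 'M[F]_(m, n)) (c : F) :
  (forall i j, `|A i j| <= c) -> nrm A <= (m * n)%:R * c.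
Proof.
move=> h; apply: (@le_trans _ _ (\sum_(i < m) \sum_(j < n) c)).
  by apply: ler_sum => i _; apply: ler_sum => j _.
by rewrite !sumr_const !card_ord -!mulrnA mulr_natl mulnC.
Qed.

End Norm.

Definition minor {R : comNzRingType} {k n} (L : 'M[R]_(k, n)) (f : 'I_k -> 'I_n) : R :=
  \det (colsub f L).

Lemma eq_minor (R : comNzRingType) k n (L : 'M[R]_(k, n)) f g : f =1 g -> minor L f = minor L g.
Proof.
by move=> fg; congr (\det _); apply/matrixP=> i j; rewrite !mxE fg.
Qed.

Lemma minors_minor (R : comNzRingType) k n (L : 'M[R]_(k, n)) f :
  minor L f = minors L 0 (enum_rank [ffun x => f x]).
Proof. by rewrite minorsE /tidx enum_rankK; apply: eq_minor => i; rewrite ffunE. Qed.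

Section Field.
Variable F : fieldType.

Lemma row_free_minor k n (L : 'M[F]_(k, n)) : row_free L -> exists f, minor L f != 0.
Proof.
move=> fL; have fT : row_full L^T by rewrite /row_full mxrank_tr.
exists (fullrankfun fT); rewrite /minor -unitfE -unitmxE -unitmx_tr.
have := fullrowsub_unit fT; congr (_ \in unitmx).
by apply/matrixP=> i j; rewrite !mxE.
Qed.

Lemma minor_row_free k n (L : 'M[F]_(k, n)) f : minor L f != 0 -> row_free L.
Proof.
rewrite /minor -unitfE -unitmxE => U.
apply: inj_row_free => v vL; rewrite -[v](mulmxK U) mulmx_colsub vL.
by rewrite (_ : colsub f 0 = 0) ?mul0mx //; apply/matrixP=> i j; rewrite !mxE.
Qed.

Lemma minorMl k n (P : 'M[F]_k) (L : 'M[F]_(k, n)) f : minor (P *m L) f = \det P * minor L f.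
Proof. by rewrite /minor -mulmx_colsub det_mulmx. Qed.

Lemma row_freeMl k n (P : 'M[F]_k) (L : 'M[F]_(k, n)) :
  P \in unitmx -> row_free L -> row_free (P *m L).
Proof. by rewrite -row_free_unit => U fL; rewrite /row_free mxrankMfree. Qed.

Lemma row_free_col_mxl k l n (A : 'M[F]_(k, n)) (B : 'M[F]_(l, n)) :
  row_free (col_mx A B) -> row_free A.
Proof.
move=> h; apply: inj_row_free => v vA.
have: row_mx v (0 : 'rV[F]_l) *m col_mx A B = 0 by rewrite mul_row_col vA mul0mx addr0.
move=> /(congr1 (fun M => M *m pinvmx (col_mx A B))); rewrite mulmxKp // mul0mx.
by rewrite -row_mx0 => /eq_row_mx [].
Qed.

Lemma row_free_col_mxr k l n (A : 'M[F]_(k, n)) (B : 'M[F]_(l, n)) :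
  row_free (col_mx A B) -> row_free B.
Proof.
move=> h; apply: inj_row_free => v vB.
have: row_mx (0 : 'rV[F]_k) v *m col_mx A B = 0 by rewrite mul_row_col vB mul0mx addr0.
move=> /(congr1 (fun M => M *m pinvmx (col_mx A B))); rewrite mulmxKp // mul0mx.
by rewrite -row_mx0 => /eq_row_mx [].
Qed.

End Field.

Section Auerbach.
Variable F : realFieldType.

(* A maximal minor, in absolute value, makes all the coordinates in the
   corresponding columns at most 1. *)
Lemma max_minor_factor k n (L : 'M[F]_(k, n)) : row_free L ->
  exists (f : 'I_k -> 'I_n) (Lh : 'M[F]_(k, n)),
    [/\ minor L f != 0, L = colsub f L *m Lh, colsub f Lh = 1%:M,
        forall i j, `|Lh i j| <= 1 & forall g, `|minor L g| <= `|minor L f|].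
Proof.
move=> /row_free_minor [f0 nz0].
pose a0 : {ffun 'I_k -> 'I_n} := [ffun x => f0 x].
case: (@Order.TotalTheory.arg_maxP _ _ _ a0 predT (fun a => `|minor L a|)) => // f _ fmax.
have fmax' (g : 'I_k -> 'I_n) : `|minor L g| <= `|minor L f|.
  have := fmax [ffun x => g x] isT.
  by rewrite (@eq_minor _ _ _ L [ffun x => g x] g) // => i; rewrite ffunE.
have nz : minor L f != 0.
  by rewrite -normr_gt0 (lt_le_trans _ (fmax' f0)) // normr_gt0.
have U : colsub f L \in unitmx by rewrite unitmxE unitfE.
exists f, (invmx (colsub f L) *m L).
have E1 : colsub f (invmx (colsub f L) *m L) = 1%:M by rewrite -mulmx_colsub mulVmx.
split=> //; first by rewrite mulKVmx.
move=> i j; set Lh := _ *m L in E1 *.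
(* Cramer's rule: the entry is the minor of [Lh] in which the i-th chosen column is replaced by
   column j, hence a quotient of two minors of [L]. *)
have -> : Lh i j = minor Lh (upd f i j).
  rewrite /minor (expand_det_row _ i) (bigD1 i) //= big1 ?addr0; last first.
    move=> c ci; rewrite !mxE /upd (negPf ci).
    have := congr1 (fun M : 'M[F]_k => M i c) E1; rewrite !mxE eq_sym (negPf ci) => ->.
    by rewrite mul0r.
  rewrite [X in X * _]mxE /upd eqxx /cofactor -signr_odd oddD addbb expr0 mul1r.
  rewrite (_ : row' i _ = 1%:M) ?det1 ?mulr1 //.
  apply/matrixP=> r c; rewrite !mxE; case: eqP => [/esym/eqP|_]; first by rewrite (negPf (neq_lift i c)).
  have := congr1 (fun M : 'M[F]_k => M (lift i r) (lift i c)) E1.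
  by rewrite !mxE (inj_eq lift_inj).
rewrite /Lh minorMl det_inv normrM normfV -/(minor L f) mulrC ler_pdivrMr ?normr_gt0 //.
by rewrite mul1r.
Qed.

Lemma det_le_fact k (A : 'M[F]_k) : (forall i j, `|A i j| <= 1) -> `|\det A| <= k`!%:R.
Proof.
move=> h; apply: le_trans (ler_norm_sum _ _ _) _.
apply: (@le_trans _ _ (\sum_(s : 'S_k) 1)).
  apply: ler_sum => s _; rewrite normrM normrX normrN1 expr1n mul1r normr_prod.
  by apply: prodr_ile1 => i _; rewrite normr_ge0 h.
by rewrite sumr_const card_Sn.
Qed.

Definition joinf {a b n} (f : 'I_a -> 'I_n) (g : 'I_b -> 'I_n) (x : 'I_(a + b)) : 'I_n :=
  match fintype.split x with inl i => f i | inr j => g j end.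

Lemma colsub_joinf a b k n (L : 'M[F]_(k, n)) (f : 'I_a -> 'I_n) (g : 'I_b -> 'I_n) :
  colsub (joinf f g) L = row_mx (colsub f L) (colsub g L).
Proof. by apply/matrixP=> i j; rewrite !mxE /joinf; case: fintype.split => x; rewrite mxE. Qed.

Lemma colsub_col_mx a b k n (A : 'M[F]_(a, n)) (B : 'M[F]_(b, n)) (f : 'I_k -> 'I_n) :
  colsub f (col_mx A B) = col_mx (colsub f A) (colsub f B).
Proof. by apply/matrixP=> i j; rewrite !mxE; case: fintype.split => x; rewrite mxE. Qed.

Lemma submod_aux (p b c K x y : F) : 0 <= p -> 0 <= b -> 0 <= c -> 0 <= x -> 0 <= y ->
  x <= p -> y <= K -> x * (p * (b * c) * y) <= K * ((p * b) * (p * c)).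
Proof.
move=> p0 b0 c0 x0 y0 xp yK.
rewrite [leRHS](_ : _ = p * (p * (b * c)) * K); last by ring.
by rewrite mulrA; apply: ler_pM => //; rewrite ?ler_wpM2r ?mulr_ge0.
Qed.

(** Reduce B and C modulo A on the columns of a maximal minor of A. The minors of (A, B), (A, C) and
    (A, B, C) then factor through that minor and those of the remainders [Bt] and [Ct]; what is left
    is a determinant with entries at most 1, bounded by the factorial. *)
Lemma minor_submodular a b c n
    (A : 'M[F]_(a, n)) (B : 'M[F]_(b, n)) (C : 'M[F]_(c, n)) :
  row_free (col_mx A (col_mx B C)) ->
  exists f1 f2, forall g h,
    `|minor A g| * `|minor (col_mx A (col_mx B C)) h| <=
    (a + (b + c))`!%:R * (`|minor (col_mx A B) f1| * `|minor (col_mx A C) f2|).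
Proof.
move=> free; have fA := row_free_col_mxl free.
have [f [Ah [nzA EA fAh Ah1 Amax]]] := max_minor_factor fA.
set P := colsub f A in EA.
have UP : P \in unitmx by rewrite unitmxE unitfE.
pose Bt := B - colsub f B *m Ah; pose Ct := C - colsub f C *m Ah.
pose Q := block_mx P 0 (col_mx (colsub f B) (colsub f C)) (1%:M : 'M[F]_(b + c)).
have EQ : col_mx A (col_mx B C) = Q *m col_mx Ah (col_mx Bt Ct).
  rewrite mul_block_col mul0mx addr0 mul1mx -EA mul_col_mx add_col_mx.
  by rewrite /Bt /Ct !subrKC.
have UQ : Q \in unitmx by rewrite unitmxE det_lblock det1 mulr1 -unitmxE.
have free2 : row_free (col_mx Ah (col_mx Bt Ct)).
  by rewrite -(mulKmx UQ (col_mx Ah _)) -EQ row_freeMl ?unitmx_inv.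
have fB := row_free_col_mxl (row_free_col_mxr free2).
have fC := row_free_col_mxr (row_free_col_mxr free2).
have [fb [Bh [nzB EB fBh Bh1 _]]] := max_minor_factor fB.
have [fc [Ch [nzC EC fCh Ch1 _]]] := max_minor_factor fC.
have join2 k (X : 'M[F]_(k, n)) (Xt := X - colsub f X *m Ah) g :
   minor (col_mx A X) (joinf f g) = \det P * minor Xt g.
  have -> : col_mx A X = block_mx P 0 (colsub f X) 1%:M *m col_mx Ah Xt.
    by rewrite mul_block_col mul0mx addr0 mul1mx -EA /Xt subrKC.
  rewrite minorMl det_lblock det1 mulr1; congr (_ * _).
  rewrite /minor colsub_joinf !colsub_col_mx -block_mxEh fAh.
  rewrite /Xt (_ : colsub f _ = 0) ?det_ublock ?det1 ?mul1r //.
  apply/matrixP=> i j; rewrite !mxE.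
  under eq_bigr => l _.
    have := congr1 (fun M : 'M[F]_a => M l j) fAh; rewrite mxE => ->.
    rewrite !mxE; over.
  rewrite (bigD1 j) //= eqxx mulr1 big1 ?addr0 ?subrr // => l /negPf ->.
  by rewrite mulr0.
exists (joinf f fb), (joinf f fc) => g h.
rewrite !join2 -/Bt -/Ct.
have -> : minor (col_mx A (col_mx B C)) h =
   \det P * (minor Bt fb * minor Ct fc) * minor (col_mx Ah (col_mx Bh Ch)) h.
  rewrite EQ minorMl det_lblock det1 mulr1 -mulrA; congr (_ * _).
  have -> : col_mx Ah (col_mx Bt Ct) = block_mx (1%:M : 'M[F]_a) 0 0
     (block_mx (colsub fb Bt) 0 0 (colsub fc Ct)) *m col_mx Ah (col_mx Bh Ch).
    by rewrite !mul_block_col !mul0mx !mul1mx !(add0r, addr0) -EB -EC.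
  by rewrite minorMl det_lblock det1 mul1r det_lblock.
have le1 : `|minor (col_mx Ah (col_mx Bh Ch)) h| <= (a + (b + c))`!%:R.
  apply: det_le_fact => i j; rewrite !mxE; case: fintype.split => x; rewrite ?mxE ?Ah1 //.
  by case: fintype.split => y; rewrite ?Bh1 ?Ch1.
rewrite !normrM.
by apply: (@submod_aux `|\det P|); rewrite ?normr_ge0 //; apply: Amax.
Qed.

End Auerbach.
End Minor.

(** * Submodularity of covolumes *)

Section Lattice.
Local Open Scope ring_scope.

Definition imx (F : nzRingType) {m n} (A : 'M[int]_(m, n)) : 'M[F]_(m, n) := map_mx intr A.

Lemma imxM (F : nzRingType) m n p (A : 'M[int]_(m, n)) (B : 'M[int]_(n, p)) :
  imx F (A *m B) = imx F A *m imx F B.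
Proof. exact: map_mxM. Qed.

Lemma imx_col (F : nzRingType) m1 m2 n (A : 'M[int]_(m1, n)) (B : 'M[int]_(m2, n)) :
  imx F (col_mx A B) = col_mx (imx F A) (imx F B).
Proof. exact: map_col_mx. Qed.

Lemma imx_cast (F : nzRingType) m m' n (e : m = m') (A : 'M[int]_(m, n)) :
  imx F (castmx (e, erefl) A) = castmx (e, erefl) (imx F A).
Proof. by rewrite /imx map_castmx. Qed.

Lemma imx_unit (F : fieldType) n (V : 'M[int]_n) : V \in unitmx -> imx F V \in unitmx.
Proof. by rewrite !unitmxE /imx det_map_mx => u; rewrite rmorph_unit. Qed.

Lemma unit_int_norm (F : numDomainType) n (V : 'M[int]_n) : V \in unitmx ->
  `|\det (imx F V)| = 1.
Proof.
rewrite unitmxE /imx det_map_mx; move: (\det V) => d.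
by case/orP => /eqP ->; rewrite ?rmorphN ?rmorph1 ?normrN normr1.
Qed.

Lemma row_free_ratr (F : numFieldType) m n (A : 'M[int]_(m, n)) :
  row_free (imx F A) = row_free (imx rat A).
Proof.
rewrite -(row_free_map (ratr : {rmorphism rat -> F})); congr row_free.
by apply/matrixP=> i j; rewrite !mxE /= ratr_int.
Qed.

Lemma rat_mx_scale m n (Y : 'M[rat]_(m, n)) :
  exists (D : int) (Z : 'M[int]_(m, n)), D != 0 /\ imx rat Z = D%:~R *: Y.
Proof.
pose D := \prod_(x : 'I_m * 'I_n) denq (Y x.1 x.2).
exists D, (\matrix_(i, j) (numq (Y i j) *
   \prod_(x : 'I_m * 'I_n | x != (i, j)) denq (Y x.1 x.2))); split.
  by apply/prodf_neq0 => x _; exact: denq_neq0.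
apply/matrixP=> i j; rewrite !mxE [in RHS]/D [X in _ = X%:~R * _](bigD1 (i, j)) //= !intrM.
rewrite -[X in _ = _ * X](divq_num_den (Y i j)); set e := (\prod_(_ | _) _)%:~R.
have : (denq (Y i j))%:~R != 0 :> rat by rewrite intr_eq0 denq_neq0.
by move: (denq _)%:~R => d d0; field.
Qed.

(** Smith normal form of the coordinates of W with respect to L, after clearing denominators: W is
    spanned by multiples of the first rows of the new basis [V *m L]. *)
Lemma adapted_basis i n (L : 'M[int]_(i, n)) k (W : 'M[rat]_(k, n)) a b (e : (a + b)%N = i) :
  (W <= imx rat L)%MS -> \rank W = a ->
  exists (A : 'M[int]_(a, n)) (B : 'M[int]_(b, n)) (V : 'M[int]_i),
    [/\ V \in unitmx, (imx rat A <= W)%MS & castmx (e, erefl) (col_mx A B) = V *m L].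
Proof.
case: i / e L => L WL rW.
have [D [Z [D0 EZ]]] := rat_mx_scale (row_base W *m pinvmx (imx rat L)).
have [P uP [V uV [d _ ZE]]] := int_Smith_normal_form Z.
exists (usubmx (V *m L)), (dsubmx (V *m L)), V; split=> //; last first.
  by rewrite castmx_id vsubmxK.
have EW : row_base W *m pinvmx (imx rat L) *m imx rat L = row_base W.
  by rewrite mulmxKpV // eq_row_base.
have D0' : D%:~R != 0 :> rat by rewrite intr_eq0.
have ZW : imx rat Z *m imx rat L = D%:~R *: row_base W by rewrite EZ -scalemxAl EW.
set Dm := \matrix_(i0, j) _ in ZE.
have uP' : imx rat P \in unitmx by exact: imx_unit.
have E : imx rat Dm *m (imx rat V *m imx rat L) = D%:~R *: (invmx (imx rat P) *m row_base W).
  by rewrite scalemxAr -ZW ZE !imxM !mulmxA mulVmx // mul1mx.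
set N := imx rat Dm *m _ in E.
have NW : (N <= W)%MS by rewrite E scalemx_sub // mulmx_sub // eq_row_base.
have rN : row_free N.
  rewrite E -mul_scalar_mx mulmxA row_freeMl ?row_base_free //.
  by rewrite unitmx_mul unitmx_inv uP' andbT unitmxE det_scalar unitfE expf_neq0.
have rowN (j : 'I_a) (k0 : 'I_(\rank W)) : k0 = j :> nat ->
    row k0 N = (d`_j)%:~R *: row (lshift b j) (imx rat (V *m L)).
  move=> kj; rewrite row_mul imxM; apply/rowP=> c; rewrite !mxE.
  rewrite (bigD1 (lshift b j)) //= [X in _ + X]big1 ?addr0.
    by rewrite !mxE /= kj eqxx mulr1n.
  move=> l /negP lj; rewrite !mxE kj; case: eqP => [jl|_]; last by rewrite mulr0n mul0r.
  by case: lj; apply/eqP/val_inj.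
apply/row_subP => j.
have k0P : (j < \rank W)%N by rewrite rW.
have := rowN j (Ordinal k0P) erefl.
have -> : row (lshift b j) (imx rat (V *m L)) = row j (imx rat (usubmx (V *m L))).
  by apply/rowP=> c; rewrite !mxE.
(* A vanishing invariant factor would give a zero row in the independent family [N]. *)
move=> Er; have nz : (d`_j)%:~R != 0 :> rat.
  apply/negP=> /eqP d0; move: Er; rewrite d0 scale0r rowE => /eqP.
  rewrite mulmx_free_eq0 // => /eqP /rowP /(_ (Ordinal k0P)) /eqP.
  by rewrite !mxE !eqxx oner_eq0.
by rewrite -(eqmx_scale _ nz) -Er (submx_trans _ NW) // row_sub.
Qed.

Section Submod.
Variable F : realFieldType.

Lemma minor_uncast k k' n p (e : k = k') (X : 'M[int]_(k, n)) (L : 'M[int]_(k', n))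
    (V : 'M[int]_k') (u : 'M[F]_(n, p)) f :
  V \in unitmx -> castmx (e, erefl) X = V *m L ->
  `|minor (imx F X *m u) f| = `|minor (imx F L *m u) (f \o cast_ord (esym e))|.
Proof.
case: k' / e L V => L V uV; rewrite castmx_id => ->.
rewrite imxM -mulmxA minorMl normrM unit_int_norm // mul1r.
by congr `|_|; apply: eq_minor => i /=; rewrite cast_ord_id.
Qed.

Lemma row_free_imx m n (A : 'M[int]_(m, n)) : row_free (imx rat A) -> row_free (imx F A).
Proof. by move=> fA; rewrite row_free_ratr. Qed.

(** Replacing the basis of the common part, in the second factor, by one of larger covolume only
    increases the right-hand side. *)
Lemma submod_aux2 a b n (A A2 : 'M[int]_(a, n)) (B C : 'M[int]_(b, n)) (Q : 'M[rat]_a)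
    (u : 'M[F]_n) : u \in unitmx ->
  row_free (imx rat (col_mx A (col_mx B C))) -> imx rat A2 = Q *m imx rat A -> 1 <= `|\det Q| ->
  exists f1 f2, forall g h,
   `|minor (imx F A *m u) g| * `|minor (imx F (col_mx A (col_mx B C)) *m u) h| <=
    (a + (b + b))`!%:R * (`|minor (imx F (col_mx A B) *m u) f1| *
                          `|minor (imx F (col_mx A2 C) *m u) f2|).
Proof.
move=> uu free EA2 Q1.
have := @minor_submodular F a b b n (imx F A *m u) (imx F B *m u) (imx F C *m u).
rewrite -!mul_col_mx -!imx_col.
have fr : row_free (imx F (col_mx A (col_mx B C)) *m u).
  by rewrite /row_free mxrankMfree ?row_free_unit //; apply: row_free_imx.
move=> /(_ fr) [f1 [f2 H]]; exists f1, f2 => g h; apply: le_trans (H g h) _.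
rewrite ler_wpM2l // ler_wpM2l //.
have EA2F : imx F A2 = map_mx ratr Q *m imx F A.
  have := congr1 (map_mx (ratr : {rmorphism rat -> F})) EA2.
  rewrite map_mxM -!map_mx_comp => E.
  have EE m' (X : 'M[int]_(m', n)) : imx F X = map_mx ((ratr : {rmorphism rat -> F}) \o intr) X.
    by apply/matrixP=> i j; rewrite !mxE /= ratr_int.
  by rewrite !EE.
have -> : imx F (col_mx A2 C) *m u =
   block_mx (map_mx ratr Q) 0 0 1%:M *m (imx F (col_mx A C) *m u).
  by rewrite mulmxA !imx_col EA2F mul_block_col !mul0mx mul1mx addr0 add0r.
rewrite minorMl det_ublock det1 mulr1 normrM det_map_mx.
rewrite ler_peMl // -[1](rmorph1 (ratr : {rmorphism rat -> F})).
by rewrite -ratr_norm ler_rat.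
Qed.

Lemma col_mx_swap a b n (X : 'M[rat]_(a, n)) (Y Z : 'M[rat]_(b, n)) :
  (col_mx X (col_mx Y Z) <= col_mx X (col_mx Z Y))%MS.
Proof.
have S : (col_mx Z Y <= col_mx X (col_mx Z Y))%MS by rewrite -(addsmxE X) addsmxSr.
rewrite !col_mx_sub -{1}(addsmxE X) addsmxSl /=.
by apply/andP; split; apply: submx_trans S; rewrite -addsmxE ?addsmxSl ?addsmxSr.
Qed.

Lemma row_free_swap a b n (X : 'M[int]_(a, n)) (Y Z : 'M[int]_(b, n)) :
  row_free (imx rat (col_mx X (col_mx Y Z))) -> row_free (imx rat (col_mx X (col_mx Z Y))).
Proof.
move=> /eqP free; apply/eqP; apply: etrans free; rewrite !imx_col.
by apply/eqP; rewrite eqn_leq !mxrankS ?col_mx_swap.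
Qed.

(** Only the rational spans are intersected: L1 and L2 have bases adapted to the common subspace,
    but the parts [A1] and [A2] of these bases may generate different lattices in it. The rank of
    the sum is a + 2 b because both lattices have rank a + b. *)
Lemma lattice_submodular i n (L1 L2 : 'M[int]_(i, n)) :
  row_free (imx rat L1) -> row_free (imx rat L2) ->
  ~~ (imx rat L1 <= imx rat L2)%MS ->
  exists a b (A : 'M[int]_(a, n)) (S : 'M[int]_(a + (b + b), n)),
  [/\ (0 < b)%N, i = (a + b)%N, row_free (imx rat A), row_free (imx rat S) &
    forall u : 'M[F]_n, u \in unitmx -> exists f1 f2, forall g h,
     `|minor (imx F A *m u) g| * `|minor (imx F S *m u) h| <=
     (a + (b + b))`!%:R * (`|minor (imx F L1 *m u) f1| * `|minor (imx F L2 *m u) f2|)].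
Proof.
move=> free1 free2 nle.
pose W := (imx rat L1 :&: imx rat L2)%MS.
have W1 : (W <= imx rat L1)%MS by apply: capmxSl.
have W2 : (W <= imx rat L2)%MS by apply: capmxSr.
have rlt : (\rank W < i)%N.
  rewrite -[X in (_ < X)%N](eqP free1); apply: rank_ltmx.
  by rewrite /ltmx W1 /= sub_capmx submx_refl.
pose a := \rank W; pose b := (i - a)%N.
have e : (a + b)%N = i by rewrite subnKC // ltnW.
have [A1 [B [V1 [uV1 A1W E1]]]] := adapted_basis e W1 erefl.
have [A2 [C [V2 [uV2 A2W E2]]]] := adapted_basis e W2 erefl.
have span (X : 'M[int]_(a + b, n)) (V : 'M[int]_i) (L : 'M[int]_(i, n)) :
    V \in unitmx -> castmx (e, erefl) X = V *m L -> (imx rat X :=: imx rat L)%MS.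
  move=> uV E; have f : row_full (imx rat V) by rewrite row_full_unit imx_unit.
  apply: eqmx_trans (eqmxMfull (imx rat L) f).
  by rewrite -imxM -E imx_cast; apply/eqmx_sym/eqmx_cast.
have S1 := span _ _ _ uV1 E1; have S2 := span _ _ _ uV2 E2.
have fS1 : row_free (imx rat (col_mx A1 B)) by rewrite /row_free S1 e.
have fS2 : row_free (imx rat (col_mx A2 C)) by rewrite /row_free S2 e.
have fA1 : row_free (imx rat A1) by move: fS1; rewrite imx_col => /row_free_col_mxl.
have fA2 : row_free (imx rat A2) by move: fS2; rewrite imx_col => /row_free_col_mxl.
have eqA1 : (imx rat A1 :=: W)%MS.
  by apply/eqmxP; rewrite -(geq_leqif (mxrank_leqif_eq A1W)) (eqP fA1).
have eqA2 : (imx rat A2 :=: W)%MS.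
  by apply/eqmxP; rewrite -(geq_leqif (mxrank_leqif_eq A2W)) (eqP fA2).
have rsum : (\rank (imx rat L1 + imx rat L2)%MS = a + (b + b))%N.
  have := mxrank_sum_cap (imx rat L1) (imx rat L2).
  rewrite (eqP free1) (eqP free2) -/W -/a; lia.
have fS (X : 'M[int]_(a, n)) : (imx rat X :=: W)%MS -> row_free (imx rat (col_mx X (col_mx B C))).
  move=> XW; rewrite /row_free; apply/eqP; apply: etrans rsum.
  suff -> : (imx rat (col_mx X (col_mx B C)) :=: imx rat L1 + imx rat L2)%MS by [].
  apply/eqmxP; rewrite !imx_col.
  have h1 := S1; have h2 := S2; rewrite !imx_col in h1 h2.
  apply/andP; split.
    rewrite !col_mx_sub XW (submx_trans W1) ?addsmxSl //=; apply/andP; split.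
      by rewrite (submx_trans _ (addsmxSl _ _)) // -h1 -addsmxE addsmxSr.
    by rewrite (submx_trans _ (addsmxSr _ _)) // -h2 -addsmxE addsmxSr.
  have XS : (W <= col_mx (imx rat X) (col_mx (imx rat B) (imx rat C)))%MS.
    by rewrite -XW -(addsmxE (imx rat X)) addsmxSl.
  have BCS : (col_mx (imx rat B) (imx rat C) <=
              col_mx (imx rat X) (col_mx (imx rat B) (imx rat C)))%MS.
    by rewrite -(addsmxE (imx rat X)) addsmxSr.
  rewrite addsmx_sub -h1 -h2 !col_mx_sub eqA1 eqA2 XS /=.
  by apply/andP; split; apply: submx_trans BCS; rewrite -addsmxE ?addsmxSl ?addsmxSr.
have [Q EQ] : exists Q, imx rat A2 = Q *m imx rat A1.
  by apply/submxP; rewrite eqA2 eqA1.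
have nQ : \det Q != 0.
  rewrite -unitfE -unitmxE -row_free_unit; apply: inj_row_free => v vQ.
  by apply: (row_free_inj fA2); rewrite EQ mulmxA vQ !mul0mx.
(* Of the two lattices in the common subspace, the one with the smaller covolume is taken. *)
case: (lerP 1 `|\det Q|) => hQ.
  exists a, b, A1, (col_mx A1 (col_mx B C)); split=> //; first by rewrite subn_gt0.
  - exact: fS.
  move=> u uu; have [f1 [f2 H]] := submod_aux2 uu (fS _ eqA1) EQ hQ.
  exists (f1 \o cast_ord (esym e)), (f2 \o cast_ord (esym e)) => g h.
  by rewrite -(minor_uncast _ _ uV1 E1) -(minor_uncast _ _ uV2 E2).
exists a, b, A2, (col_mx A2 (col_mx C B)); split=> //; first by rewrite subn_gt0.
  exact/row_free_swap/fS.
move=> u uu.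
have EQ' : imx rat A1 = invmx Q *m imx rat A2.
  by rewrite EQ mulKmx // unitmxE unitfE.
have hQ' : 1 <= `|\det (invmx Q)|.
  by rewrite det_inv normfV invf_ge1 ?normr_gt0 // ltW.
have fr := row_free_swap (fS _ eqA2).
have [f1 [f2 H]] := submod_aux2 uu fr EQ' hQ'.
exists (f2 \o cast_ord (esym e)), (f1 \o cast_ord (esym e)) => g h.
rewrite -(minor_uncast _ _ uV1 E1) -(minor_uncast _ _ uV2 E2).
by apply: le_trans (H g h) _; rewrite ler_wpM2l // mulrC.
Qed.

End Submod.
End Lattice.

(** * Recurrence to a compact part *)

Section Dyn.
Local Open Scope classical_set_scope.
Local Open Scope ring_scope.
Variables (R : realType) (n : nat).

Lemma nrm_row_minors k (L : 'M[R]_(k, n)) : nrm (minors L) = \sum_a `|minor L (tidx a)|.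
Proof. by rewrite /nrm big_ord1; apply: eq_bigr => a _; rewrite minorsE. Qed.

Lemma nrm_minors_ge1 i (L : 'M[int]_(i, n)) : row_free (imx rat L) ->
  1 <= nrm (minors (imx R L)).
Proof.
move=> /(@row_free_imx R)/row_free_minor [f nz].
apply: le_trans (nrm_entry _ 0 (enum_rank [ffun x => f x])).
rewrite -minors_minor; move: nz; rewrite /minor.
have -> : colsub f (imx R L) = imx R (colsub f L) by apply/matrixP=> x y; rewrite !mxE.
by rewrite /imx det_map_mx intr_eq0 -intr_norm ler1z; lia.
Qed.

Lemma minors_submod : exists2 K : R, 0 < K &
  forall i (L1 L2 : 'M[int]_(i, n)),
  row_free (imx rat L1) -> row_free (imx rat L2) -> ~~ (imx rat L1 <= imx rat L2)%MS ->
  exists a b (A : 'M[int]_(a, n)) (S : 'M[int]_(a + (b + b), n)),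
  [/\ (0 < b)%N, i = (a + b)%N, row_free (imx rat A), row_free (imx rat S) &
    forall u : 'M[R]_n, u \in unitmx ->
     nrm (minors (imx R A *m u)) * nrm (minors (imx R S *m u)) <=
     K * (nrm (minors (imx R L1 *m u)) * nrm (minors (imx R L2 *m u)))].
Proof.
(* At most [d] coordinates occur in each rank; the constant bounds the factorial times the number of
   pairs of coordinates. *)
pose d := (\max_(i < n.+1) tdim n i)%N.
have dP k (A : 'M[int]_(k, n)) : row_free (imx rat A) -> (k <= n)%N /\ (tdim n k <= d)%N.
  move=> fA; have kn : (k <= n)%N by rewrite -(eqP fA) rank_leq_col.
  by split=> //; rewrite -ltnS in kn; exact: (leq_bigmax (Ordinal kn)).
exists ((n`! * (d * d)).+1%:R); first by rewrite ltr0n.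
move=> i L1 L2 f1 f2 nle.
have [a [b [A [S [b0 e fA fS H]]]]] := lattice_submodular R f1 f2 nle.
exists a, b, A, S; split=> // u uu.
have [g1 [g2 {}H]] := H u uu.
have [_ dA] := dP _ _ fA; have [an dS] := dP _ _ fS.
set X := nrm (minors (imx R L1 *m u)); set Y := nrm (minors (imx R L2 *m u)).
have XY0 : 0 <= X * Y by rewrite mulr_ge0 ?nrm_ge0.
have le1 g h : `|minor (imx R A *m u) g| * `|minor (imx R S *m u) h| <= n`!%:R * (X * Y).
  apply: le_trans (H g h) _; apply: ler_pM; rewrite ?mulr_ge0 //.
    rewrite ler_nat; have [->|k0] := posnP (a + (b + b))%N; first exact: fact_gt0.
    by rewrite leq_pfact // inE (leq_trans k0).
  by apply: ler_pM => //; rewrite minors_minor; apply: nrm_entry.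
rewrite !nrm_row_minors mulr_suml.
apply: (@le_trans _ _ ((tdim n a * tdim n (a + (b + b)))%:R * (n`!%:R * (X * Y)))).
  rewrite natrM -mulrA -[in leRHS](card_ord (tdim n a)) mulr_natl -sumr_const.
  apply: ler_sum => x _; rewrite mulr_sumr.
  rewrite -[in leRHS](card_ord (tdim n (a + (b + b)))) mulr_natl -sumr_const.
  by apply: ler_sum => y _; exact: le1.
rewrite mulrA ler_wpM2r // -natrM ler_nat.
by rewrite (leq_trans _ (leqnSn _)) // mulnC leq_mul // leq_mul.
Qed.

(** The exponents i (m - i) are strictly concave in the rank i. The gain 2 b^2 is the power of the
    weight that defeats the constant in submodularity. *)
Lemma exponent_convexity (a b i m : nat) : (a + (b + b) <= m)%N -> i = (a + b)%N ->
  (a * (m - a) + (a + (b + b)) * (m - (a + (b + b))) + 2 * b ^ 2 = i * (m - i) + i * (m - i))%N.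
Proof.
move=> /subnKC <- ->; set k := (m - _)%N.
have -> : (a + (b + b) + k - a = b + b + k)%N by rewrite -addnA addKn.
have -> : (a + (b + b) + k - (a + (b + b)) = k)%N by rewrite addKn.
have -> : (a + (b + b) + k - (a + b) = b + k)%N by rewrite addnA -addnA addKn.
by rewrite expnS expn1; ring.
Qed.

(** [N] is comparable to the norm in each rank; [E] measures the part of a vector that some element
    of the finite set [F] expands. *)
Variables (N E : forall i, 'rV[R]_(tdim n i) -> R) (c1 c2 : R).
Variable F : seq 'M[R]_n.
Hypothesis c1_gt0 : 0 < c1.
Hypothesis NZ : forall i c v, (i <= n)%N -> N (i := i) (c *: v) = `|c| * N v.
Hypothesis Nge : forall i v, (i <= n)%N -> c1 * nrm v <= N (i := i) v.
Hypothesis Nle : forall i v, (i <= n)%N -> N (i := i) v <= c2 * nrm v.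
Hypothesis EZ : forall i c v, (i <= n)%N -> E (i := i) (c *: v) = `|c| * E v.
Hypothesis ENle : forall i v, (i <= n)%N -> E (i := i) v <= N v.
Hypothesis E_ge0 : forall i v, (i <= n)%N -> 0 <= E (i := i) v.
Hypothesis Funit : forall g, g \in F -> g \in unitmx.
(** One vector per rank is enough: all nearly minimal sublattices of the same rank will turn out to
    have proportional Plücker vectors. *)
Hypothesis Fgood : forall v : forall i, 'rV[R]_(tdim n i),
  exists2 g, g \in F & forall i, (i <= n)%N ->
    N (v i) <= N (v i *m tpow i g) /\ 2 * E (v i) <= E (v i *m tpow i g).

Let rowfree i (L : 'M[int]_(i, n)) := row_free (imx rat L).

Lemma rowfree_le i (L : 'M[int]_(i, n)) : rowfree L -> (i <= n)%N.
Proof. by move=> /eqP <-; rewrite rank_leq_col. Qed.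

Lemma c2_gt0 : 0 < c2.
Proof.
have d0 : (0 < tdim n 0)%N by rewrite /tdim card_ffun !card_ord expn0.
pose v : 'rV[R]_(tdim n 0) := delta_mx 0 (Ordinal d0).
have v0 : 0 < nrm v.
  by rewrite lt_def nrm_ge0 andbT nrm_eq0; apply/eqP => /rowP/(_ (Ordinal d0))/eqP;
    rewrite !mxE !eqxx oner_eq0.
have := le_trans (Nge v (leq0n n)) (Nle v (leq0n n)).
by rewrite ler_pM2r // => /(lt_le_trans c1_gt0).
Qed.

(** The inverses of the finitely many elements of [F] have bounded tensor powers, so no single step
    contracts by more than B. *)
Lemma step_bound : exists2 B : R, 1 <= B &
  forall g i v, g \in F -> (i <= n)%N -> N v <= B * N (v *m tpow i g) (i := i).
Proof.
pose b := \sum_(g <- F) \sum_(i < n.+1) nrm (tpow i (invmx g)).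
have b0 : 0 <= b by apply: sumr_ge0 => g _; apply: sumr_ge0 => i _; apply: nrm_ge0.
have hb g i : g \in F -> (i <= n)%N -> nrm (tpow i (invmx g)) <= b.
  move=> gF ni; rewrite /b (perm_big _ (perm_to_rem gF)) big_cons /=.
  rewrite (bigD1 (Ordinal (ni : (i < n.+1)%N))) //= -addrA lerDl addr_ge0 //.
    by apply: sumr_ge0 => *; apply: nrm_ge0.
  by apply: sumr_ge0 => h _; apply: sumr_ge0 => *; apply: nrm_ge0.
have c20 := c2_gt0.
exists (c2 * b / c1 + 1).
  by rewrite lerDr divr_ge0 ?mulr_ge0 // ltW.
move=> g i v gF ni.
have -> : N v = N (v *m tpow i g *m tpow i (invmx g)).
  by rewrite -mulmxA -tpowM mulmxV ?Funit // tpow1 mulmx1.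
set w := v *m _; apply: le_trans (Nle _ ni) _.
have w0 : 0 <= N w by apply: le_trans (Nge _ ni); rewrite mulr_ge0 ?nrm_ge0 // ltW.
apply: (@le_trans _ _ (c2 * b / c1 * N w)); last by rewrite ler_wpM2r // lerDl.
rewrite -!mulrA ler_pM2l //.
apply: le_trans (nrmM _ _) _; rewrite mulrC; apply: ler_pM; rewrite ?nrm_ge0 ?hb //.
by rewrite -ler_pdivrMl ?invr_gt0 // invrK Nge.
Qed.

(** The two bases differ by a rational matrix, whose determinant is the factor; in particular it
    does not depend on u. *)
Lemma same_span i (L1 L2 : 'M[int]_(i, n)) : rowfree L1 -> (imx rat L1 <= imx rat L2)%MS ->
  exists2 c : R, c != 0 & forall u : 'M[R]_n, minors (imx R L1 *m u) = c *: minors (imx R L2 *m u).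
Proof.
move=> f1 /submxP [Q EQ].
have nQ : \det Q != 0.
  rewrite -unitfE -unitmxE -row_free_unit; apply: inj_row_free => v vQ.
  by apply: (row_free_inj f1); rewrite EQ mulmxA vQ !mul0mx.
exists (ratr (\det Q)); first by rewrite fmorph_eq0.
move=> u; have -> : imx R L1 = map_mx ratr Q *m imx R L2.
  have := congr1 (map_mx (ratr : {rmorphism rat -> R})) EQ.
  have EE m' (X : 'M[int]_(m', n)) : imx R X = map_mx (ratr : {rmorphism rat -> R}) (imx rat X).
    by apply/matrixP=> x y; rewrite !mxE /= ratr_int.
  by rewrite map_mxM -!EE.
by rewrite -mulmxA minorsMl det_map_mx.
Qed.

(** * Recurrence along one orbit *)

Section Orbit.
Variable O : 'M[R]_n -> Prop.
Hypothesis Ounit : forall u, O u -> u \in unitmx.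
Hypothesis Ostep : forall u g, O u -> g \in F -> O (u *m g).
Variable delta : R.
(** Sublattices without expanding part cannot be repaired by the dynamics, so their size must be
    bounded below beforehand, along the whole orbit. *)
Hypothesis Ofixed : forall u i (L : 'M[int]_(i, n)), O u -> rowfree L ->
  E (minors (imx R L *m u)) = 0 -> delta <= N (minors (imx R L *m u)).
Variables (K B : R).
Hypothesis K_gt0 : 0 < K.
Hypothesis B_ge1 : 1 <= B.
Hypothesis HB : forall g i v, g \in F -> (i <= n)%N -> N v <= B * N (v *m tpow i g) (i := i).
Hypothesis HK : forall i (L1 L2 : 'M[int]_(i, n)),
  row_free (imx rat L1) -> row_free (imx rat L2) -> ~~ (imx rat L1 <= imx rat L2)%MS ->
  exists a b (A : 'M[int]_(a, n)) (S : 'M[int]_(a + (b + b), n)),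
  [/\ (0 < b)%N, i = (a + b)%N, row_free (imx rat A), row_free (imx rat S) &
    forall u : 'M[R]_n, u \in unitmx ->
     N (minors (imx R A *m u)) * N (minors (imx R S *m u)) <=
     K * (N (minors (imx R L1 *m u)) * N (minors (imx R L2 *m u)))].
Variable w : R.
Hypothesis w_ge1 : 1 <= w.
Hypothesis w_big : K * (4 * B) ^+ 2 < w.

(** A strictly concave function of the rank is added to the logarithm of the covolume; for large [w]
    two nearly minimal sublattices of equal rank can then no longer span different subspaces. *)
Definition height i (L : 'M[int]_(i, n)) (u : 'M[R]_n) : R :=
  N (minors (imx R L *m u)) * w ^+ (i * (n - i)).

Definition hinf (u : 'M[R]_n) : R :=
  inf [set x | exists i (L : 'M[int]_(i, n)), rowfree L /\ x = height L u].

Let w_gt0 : 0 < w. Proof. exact: lt_le_trans w_ge1. Qed.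

Lemma N_ge0 i v : (i <= n)%N -> 0 <= N v (i := i).
Proof. by move=> ni; apply: le_trans (E_ge0 _ ni) (ENle _ ni). Qed.

Lemma height_ge_N i (L : 'M[int]_(i, n)) u : rowfree L -> N (minors (imx R L *m u)) <= height L u.
Proof.
by move=> fL; rewrite /height ler_peMr ?N_ge0 ?(rowfree_le fL) // exprn_ege1.
Qed.

Lemma height_le_N i (L : 'M[int]_(i, n)) u : rowfree L ->
  height L u <= w ^+ (n * n) * N (minors (imx R L *m u)).
Proof.
move=> fL; rewrite /height mulrC ler_wpM2r ?N_ge0 ?(rowfree_le fL) //.
by rewrite ler_weXn2l // leq_mul ?(rowfree_le fL) // leq_subr.
Qed.

(** Integral lattices have covolume at least 1, and u distorts it by a bounded factor. This makes
    the infimum of the heights positive. *)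
Lemma height_lb u : u \in unitmx -> exists2 c, 0 < c &
  forall i (L : 'M[int]_(i, n)), rowfree L -> c <= height L u.
Proof.
move=> uu; pose b := 1 + \sum_(i < n.+1) nrm (tpow i (invmx u)).
have b0 : 0 < b by rewrite ltr_pwDl // sumr_ge0 // => *; apply: nrm_ge0.
exists (c1 / b) => [|i L fL]; first by rewrite divr_gt0.
have ni := rowfree_le fL.
apply: le_trans (height_ge_N _ fL); apply: le_trans (Nge _ ni).
rewrite ler_pM2l // -[b^-1]mul1r ler_pdivrMr //.
apply: le_trans (nrm_minors_ge1 fL) _.
rewrite -{1}[imx R L](mulmxK uu) minors_tpow; apply: le_trans (nrmM _ _) _.
apply: ler_pM; rewrite ?nrm_ge0 //.
rewrite /b (bigD1 (Ordinal (ni : (i < n.+1)%N))) //= addrCA lerDl.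
by rewrite addr_ge0 // sumr_ge0 // => *; apply: nrm_ge0.
Qed.

Lemma hinf_le u i (L : 'M[int]_(i, n)) : u \in unitmx -> rowfree L -> hinf u <= height L u.
Proof.
move=> uu fL; apply: ge_inf; last by exists i, L.
by have [c _ h] := height_lb uu; exists c => _ [j [L' [f' ->]]]; apply: h.
Qed.

Definition L0 : 'M[int]_(0, n) := 0.
Lemma rowfree0 : rowfree L0. Proof. by rewrite /rowfree /row_free flatmx0 mxrank0. Qed.

Lemma hinf_ge u x : (forall i (L : 'M[int]_(i, n)), rowfree L -> x <= height L u) -> x <= hinf u.
Proof.
move=> h; apply: lb_le_inf; first by exists (height L0 u), 0%N, L0; split; rewrite ?rowfree0.
by move=> _ [i [L [fL ->]]]; apply: h.
Qed.

Lemma hinf_gt0 u : u \in unitmx -> 0 < hinf u.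
Proof. by move=> uu; have [c c0 h] := height_lb uu; apply: lt_le_trans (hinf_ge h). Qed.

Lemma hinf_lt u x : hinf u < x -> exists i (L : 'M[int]_(i, n)), rowfree L /\ height L u < x.
Proof.
move=> /inf_lt [|_ [i [L [fL ->]]] lt]; last by exists i, L.
by exists (height L0 u), 0%N, L0; split; rewrite ?rowfree0.
Qed.

(** Otherwise submodularity produces two sublattices whose heights have a product of at most K (4
    B)^2 / w times the square of [hinf u], which is less than this square. *)
Lemma near_min_span u i (L1 L2 : 'M[int]_(i, n)) : u \in unitmx -> rowfree L1 -> rowfree L2 ->
  height L1 u <= 4 * B * hinf u -> height L2 u <= 4 * B * hinf u ->
  (imx rat L1 <= imx rat L2)%MS.
Proof.
move=> uu f1 f2 h1 h2; apply/negPn/negP => nle.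
have [a [b [A [S [b0 e fA fS H]]]]] := HK f1 f2 nle.
have := H u uu; have := hinf_le uu fA; have := hinf_le uu fS; have := hinf_gt0 uu.
have sn := rowfree_le fS; have an := rowfree_le fA; have i_n := rowfree_le f1.
move: h1 h2; rewrite /height; set h := hinf u.
set x1 := N _; set x2 := N _; set xS := N _; set xA := N _ => h1 h2 hp hS hA hh.
have x1p : 0 <= x1 by apply: N_ge0. have x2p : 0 <= x2 by apply: N_ge0.
have xAp : 0 <= xA by apply: N_ge0. have xSp : 0 <= xS by apply: N_ge0.
set e1 := (i * (n - i))%N in h1 h2; set eA := (a * (n - a))%N in hA.
set eS := ((a + (b + b)) * (n - (a + (b + b))))%N in hS.
have ee : (eA + eS + 2 * b ^ 2 = e1 + e1)%N.
  by rewrite /eA /eS /e1; apply: exponent_convexity.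
have step1 : h ^+ 2 <= xA * w ^+ eA * (xS * w ^+ eS).
  by rewrite expr2 ler_pM // ltW.
have step2 : xA * w ^+ eA * (xS * w ^+ eS) * w ^+ (2 * b ^ 2) <=
    K * ((x1 * w ^+ e1) * (x2 * w ^+ e1)).
  have -> : xA * w ^+ eA * (xS * w ^+ eS) * w ^+ (2 * b ^ 2) = xA * xS * w ^+ (e1 + e1).
    by rewrite -ee !exprD; ring.
  have -> : K * ((x1 * w ^+ e1) * (x2 * w ^+ e1)) = K * (x1 * x2) * w ^+ (e1 + e1).
    by rewrite exprD; ring.
  by rewrite ler_wpM2r // exprn_ge0 // ltW.
have step3 : K * ((x1 * w ^+ e1) * (x2 * w ^+ e1)) <= K * (4 * B) ^+ 2 * h ^+ 2.
  rewrite -[leRHS]mulrA -exprMn ler_pM2l // expr2 ler_pM // mulr_ge0 // exprn_ge0 // ltW //.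
have h2p : 0 < h ^+ 2 by rewrite exprn_gt0.
have : h ^+ 2 * w <= K * (4 * B) ^+ 2 * h ^+ 2.
  apply: le_trans step3; apply: le_trans step2.
  apply: ler_pM; rewrite ?(ltW h2p) ?(ltW w_gt0) //.
  rewrite -[leLHS]expr1 ler_weXn2l //.
  by rewrite muln_gt0 /= expn_gt0 b0.
by rewrite mulrC ler_pM2r // leNgt w_big.
Qed.

(** The threshold 4 B [hinf u] separates two regimes. Below it the sublattices of one rank have
    proportional vectors, so one g serves them all; above it a loss by the factor B still leaves a
    height of at least 4 [hinf u]. *)
Lemma orbit_step u S : O u -> S <= 4 * hinf u -> exists g, [/\ g \in F, hinf u <= hinf (u *m g) &
  forall i (L : 'M[int]_(i, n)), rowfree L -> height L (u *m g) <= S ->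
    height L u <= S /\ 2 * E (minors (imx R L *m u)) <= E (minors (imx R L *m (u *m g)))].
Proof.
move=> Ou uS; have uu := Ounit Ou; have h0 := hinf_gt0 uu.
have B0 : 0 < B by apply: lt_le_trans B_ge1.
have vP (i : nat) : {v : 'rV[R]_(tdim n i) | forall L : 'M[int]_(i, n), rowfree L ->
   height L u <= 4 * B * hinf u -> exists c, minors (imx R L *m u) = c *: v}.
  apply: cid; have [[L1 [f1 h1]]|no] := pselect (exists L : 'M[int]_(i, n),
      rowfree L /\ height L u <= 4 * B * hinf u).
    exists (minors (imx R L1 *m u)) => L fL hL.
    have [c _ H] := same_span fL (near_min_span uu fL f1 hL h1).
    by exists c; rewrite H.
  (* Default vector for a rank without nearly minimal sublattices. *)
  by exists 0 => L fL hL; case: no; exists L.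
have [g gF Hg] := Fgood (fun i => sval (vP i)); exists g.
have good i (L : 'M[int]_(i, n)) : rowfree L -> height L u <= 4 * B * hinf u ->
    height L u <= height L (u *m g) /\
    2 * E (minors (imx R L *m u)) <= E (minors (imx R L *m (u *m g))).
  move=> fL hL; have ni := rowfree_le fL; have [c Ec] := svalP (vP i) L fL hL.
  have [HN HE] := Hg i ni; rewrite /height mulmxA [in X in _ <= X /\ _]minors_tpow.
  rewrite [in X in _ /\ _ <= X]minors_tpow Ec -scalemxAl.
  rewrite !NZ // !EZ //; split.
    by rewrite ler_wpM2r ?ler_wpM2l // exprn_ge0 // ltW.
  by rewrite mulrCA ler_wpM2l.
have far i (L : 'M[int]_(i, n)) : rowfree L -> height L u <= B * height L (u *m g).
  move=> fL; rewrite /height mulrA ler_wpM2r ?exprn_ge0 ?(ltW w_gt0) //.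
  by rewrite mulmxA [X in _ <= B * N X]minors_tpow HB // (rowfree_le fL).
split=> // [|i L fL hS].
  apply: hinf_ge => i L fL.
  have [near|nfar] := lerP (height L u) (4 * B * hinf u).
    by have [h _] := good _ _ fL near; apply: le_trans h; apply: hinf_le.
  have : 4 * hinf u <= height L (u *m g).
    rewrite -(ler_pM2l B0); apply: le_trans (far _ _ fL).
    by rewrite mulrA (mulrC B) ltW.
  by apply: le_trans; rewrite ler_peMl ?(ltW h0) //; lra.
have near : height L u <= 4 * B * hinf u.
  apply: le_trans (far _ _ fL) _; rewrite (mulrC 4) -[leRHS]mulrA ler_pM2l //.
  exact: le_trans hS uS.
by have [h1 h2] := good _ _ fL near; split=> //; apply: le_trans hS.
Qed.

Lemma uniform_pos (P : nat -> R -> Prop) m :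
  (forall i a b, P i a -> 0 < b -> b <= a -> P i b) ->
  (forall i, (i < m)%N -> exists2 r, 0 < r & P i r) ->
  exists2 r, 0 < r & forall i, (i < m)%N -> P i r.
Proof.
move=> Pdown; elim: m => [|m IH] h; first by exists 1.
have [i im|r r0 Pr] := IH; first by apply: h; rewrite ltnS ltnW.
have [s s0 Ps] := h m (ltnSn m).
have m0 : 0 < Num.min r s by rewrite lt_min r0.
exists (Num.min r s) => // i; rewrite ltnS leq_eqVlt => /orP [/eqP ->|im].
  by apply: Pdown Ps m0 _; rewrite ge_min lexx orbT.
by apply: Pdown (Pr _ im) m0 _; rewrite ge_min lexx.
Qed.

(** Otherwise let s be the supremum of [hinf] on the orbit and start within a factor 2 of it. A
    sublattice that is low after t steps was low all along, and its E has doubled at each step. At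
    the start E does not vanish on low sublattices, since their N is below [delta], and it is
    bounded below, since they are proportional within each rank. So after enough steps none is low,
    although [hinf] is at most s. *)
Lemma orbit_high u0 : O u0 -> exists2 u, O u & delta <= 4 * hinf u.
Proof.
move=> Ou0; apply: contrapT => no.
have small u : O u -> 4 * hinf u < delta.
  by move=> Ou; rewrite ltNge; apply/negP => h; apply: no; exists u.
pose A := [set x | exists2 u, O u & x = hinf u].
have Aub : ubound A (delta / 4).
  by move=> _ [u Ou ->]; have := small u Ou; lra.
pose s := sup A.
have sub u : O u -> hinf u <= s by move=> Ou; apply: ub_le_sup; [exists (delta / 4) | exists u].
have s0 : 0 < s by apply: lt_le_trans (sub _ Ou0); apply/hinf_gt0/Ounit.
have sd : s <= delta / 4 by apply: ge_sup => //; exists (hinf u0), u0.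
(* From here on [hinf] stays between s / 2 and s, so that 2 s is below the threshold 4 [hinf] at
   every step. *)
have [_ [u1 Ou1 ->] hu1] : exists2 y, A y & s / 2 < y.
  by apply: sup_gt; [exists (hinf u0), u0 | rewrite -/s; lra].
have uu1 := Ounit Ou1; have h1 := hinf_gt0 uu1.
have seq t : exists u, [/\ O u, hinf u1 <= hinf u & forall i (L : 'M[int]_(i, n)), rowfree L ->
    height L u <= 2 * s -> height L u1 <= 2 * s /\
    2 ^+ t * E (minors (imx R L *m u1)) <= E (minors (imx R L *m u))].
  elim: t => [|t [u [Ou hu IH]]].
    by exists u1; split=> // i L fL hL; rewrite expr0 mul1r.
  have [|g [gF hg H]] := @orbit_step u (2 * s) Ou; first by lra.
  exists (u *m g); split=> [||i L fL hL]; first exact: Ostep.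
    exact: le_trans hu hg.
  have [h2 h3] := H _ _ fL hL; have [h4 h5] := IH _ _ fL h2.
  split=> //; apply: le_trans h3; rewrite exprS -mulrA ler_pM2l //.
have Epos i (L : 'M[int]_(i, n)) : rowfree L -> height L u1 <= 2 * s ->
    0 < E (minors (imx R L *m u1)).
  move=> fL hL; rewrite lt_def E_ge0 ?(rowfree_le fL) // andbT; apply/eqP => E0.
  have := Ofixed Ou1 fL E0; rewrite leNgt; apply/negP; rewrite negbK.
  by apply: le_lt_trans (height_ge_N _ fL) _; lra.
have B0 : 0 < B by apply: lt_le_trans B_ge1.
have w0 : 0 < w by apply: lt_le_trans w_ge1.
have [r r0 Pr] : exists2 r, 0 < r & forall i, (i < n.+1)%N -> forall L : 'M[int]_(i, n),
    rowfree L -> height L u1 <= 2 * s -> r <= E (minors (imx R L *m u1)).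
  apply: (@uniform_pos (fun i r => forall L : 'M[int]_(i, n),
    rowfree L -> height L u1 <= 2 * s -> r <= E (minors (imx R L *m u1)))).
    by move=> i a b H b0 ba L fL hL; apply: le_trans ba (H L fL hL).
  move=> i ni; have [[L1 [f1 hL1]]|none] := pselect (exists L : 'M[int]_(i, n),
      rowfree L /\ height L u1 <= 2 * s); last first.
    by exists 1 => // L fL hL; case: none; exists L.
  have e1 := Epos _ _ f1 hL1; set v := minors _ in e1.
  have n1 : 0 < N v by apply: lt_le_trans (ENle _ _).
  (* The low sublattices of this rank are proportional to v: the ratio E / N is constant on them,
     and N is bounded below through [hinf]. *)
  exists (E v / N v * (hinf u1 / w ^+ (n * n))).
    by rewrite mulr_gt0 ?divr_gt0 // exprn_gt0.
  move=> L fL hL.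
  have le4 x : x <= 2 * s -> x <= 4 * B * hinf u1.
    move=> xs; apply: le_trans xs _; apply: (@le_trans _ _ (1 * (4 * hinf u1))); first by lra.
    by rewrite mulrAC [leRHS]mulrC ler_wpM2r //; lra.
  have [c _ H] := same_span fL (near_min_span uu1 fL f1 (le4 _ hL) (le4 _ hL1)).
  have := le_trans (hinf_le uu1 fL) (height_le_N u1 fL).
  rewrite H -/v NZ // EZ // => hle.
  have -> : E v / N v * (hinf u1 / w ^+ (n * n)) = E v * (hinf u1 / w ^+ (n * n) / N v).
    by rewrite -!mulrA [(N v)^-1 * _]mulrC !mulrA.
  rewrite [leRHS]mulrC ler_pM2l // ler_pdivrMr // ler_pdivrMr ?exprn_gt0 //.
  by rewrite mulrC.
(* After t steps a sublattice of height below 2 s would have E at least 2^t r, which exceeds 2 s. *)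
pose t := Num.Def.archi_bound (2 * s / r).
have [ut [Out hut Ht]] := seq t.
have [|i [L [fL hL]]] := @hinf_lt ut (2 * s); first by have := sub _ Out; lra.
have [h2 h3] := Ht _ _ fL (ltW hL).
have ni := rowfree_le fL.
have : 2 ^+ t * r <= 2 * s.
  apply: le_trans (le_trans (height_ge_N ut fL) (ltW hL)).
  apply: le_trans (ENle _ ni); apply: le_trans h3.
  by rewrite ler_pM2l ?exprn_gt0 // Pr.
rewrite leNgt => /negP; apply; rewrite -ltr_pdivrMr //.
have : 2 * s / r < t%:R by apply: archi_boundP; rewrite divr_ge0 ?mulr_ge0 // ltW.
move=> /lt_le_trans; apply; rewrite -natrX ler_nat.
exact/ltnW/ltn_expl.
Qed.
End Orbit.

(** [K'] is the constant of submodularity for N in place of the norm, and [w] is chosen just above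
    what the separation of nearly minimal sublattices requires. The final constant undoes the
    weight, of exponent at most n n, and the comparison of N with the norm. *)
Lemma orbit_nondivergent (delta : R) : 0 < delta -> exists2 eps : R, 0 < eps &
  forall O : 'M[R]_n -> Prop, (forall u, O u -> u \in unitmx) ->
  (forall u g, O u -> g \in F -> O (u *m g)) -> (exists u, O u) ->
  (forall u i (L : 'M[int]_(i, n)), O u -> rowfree L ->
    E (minors (imx R L *m u)) = 0 -> delta <= N (minors (imx R L *m u))) ->
  exists2 u, O u & forall i (L : 'M[int]_(i, n)), rowfree L ->
    eps <= nrm (minors (imx R L *m u)).
Proof.
move=> d0; have [K K0 HK] := minors_submod; have [B B1 HB] := step_bound.
have c20 := c2_gt0.
pose K' := K * (c2 ^+ 2 / c1 ^+ 2).
have K'0 : 0 < K' by rewrite mulr_gt0 // divr_gt0 // exprn_gt0.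
pose w := 1 + K' * (4 * B) ^+ 2.
have B0 : 0 < B by apply: lt_le_trans B1.
have t0 : 0 < K' * (4 * B) ^+ 2 by rewrite mulr_gt0 // exprn_gt0 // mulr_gt0.
have w1 : 1 <= w by rewrite lerDl ltW.
have wb : K' * (4 * B) ^+ 2 < w by rewrite ltrDr.
have w0 : 0 < w by apply: lt_le_trans w1.
exists (delta / 4 / w ^+ (n * n) / c2).
  by rewrite !divr_gt0 // exprn_gt0.
move=> O Ounit Ostep [u0 Ou0] Ofixed.
have HK' i (L1 L2 : 'M[int]_(i, n)) :
  row_free (imx rat L1) -> row_free (imx rat L2) -> ~~ (imx rat L1 <= imx rat L2)%MS ->
  exists a b (A : 'M[int]_(a, n)) (S : 'M[int]_(a + (b + b), n)),
  [/\ (0 < b)%N, i = (a + b)%N, row_free (imx rat A), row_free (imx rat S) &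
    forall u : 'M[R]_n, u \in unitmx ->
     N (minors (imx R A *m u)) * N (minors (imx R S *m u)) <=
     K' * (N (minors (imx R L1 *m u)) * N (minors (imx R L2 *m u)))].
  move=> f1 f2 nle; have [a [b [A [S [b0 e fA fS H]]]]] := HK _ _ _ f1 f2 nle.
  exists a, b, A, S; split=> // u uu; move: (H u uu).
  have an := rowfree_le fA; have sn := rowfree_le fS; have ni := rowfree_le f1.
  set x := minors _; set y := minors _; set z := minors _; set t := minors _ => h.
  apply: (@le_trans _ _ (c2 * nrm x * (c2 * nrm y))).
    by apply: ler_pM; rewrite ?Nle // (le_trans _ (Nge _ _)) // mulr_ge0 ?nrm_ge0 ?ltW.
  apply: (@le_trans _ _ (K' * (c1 * nrm z * (c1 * nrm t)))); last first.
    by rewrite ler_pM2l // ler_pM ?Nge // mulr_ge0 ?nrm_ge0 ?ltW.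
  have -> : K' * (c1 * nrm z * (c1 * nrm t)) = c2 ^+ 2 * (K * (nrm z * nrm t)).
    by rewrite /K'; field; rewrite gt_eqF.
  have -> : c2 * nrm x * (c2 * nrm y) = c2 ^+ 2 * (nrm x * nrm y) by ring.
  by rewrite ler_pM2l ?exprn_gt0.
have [u Ou hu] := orbit_high Ounit Ostep Ofixed K'0 B1 HB HK' w1 wb Ou0.
exists u => // i L fL; have ni := rowfree_le fL.
rewrite ler_pdivrMr // ler_pdivrMr ?exprn_gt0 //.
have uu := Ounit _ Ou.
apply: (@le_trans _ _ (hinf w u)); first by rewrite ler_pdivrMr //; lra.
apply: le_trans (hinf_le w1 uu fL) _; apply: le_trans (height_le_N w1 u fL) _.
by rewrite mulrC ler_wpM2r ?exprn_ge0 ?(ltW w0) // mulrC Nle.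
Qed.
End Dyn.

(** * Reduction of lattices *)

Section Mahler.
Local Open Scope classical_set_scope.
Local Open Scope ring_scope.
Variable R : realType.

Definition qform k (S : 'M[R]_k) (x : 'rV[R]_k) : R := (x *m S *m x^T) 0 0.

Definition qmin k (S : 'M[R]_k) (m : R) : Prop :=
  forall x : 'rV[int]_k, x != 0 -> m <= qform S (imx R x).

Definition psd k (S : 'M[R]_k) : Prop := S^T = S /\ forall x, 0 <= qform S x.

Lemma qformM k l (S : 'M[R]_k) (V : 'M[R]_(l, k)) x :
  qform (V *m S *m V^T) x = qform S (x *m V).
Proof. by rewrite /qform trmx_mul !mulmxA. Qed.

Lemma qformZ k (S : 'M[R]_k) c x : qform S (c *: x) = c ^+ 2 * qform S x.
Proof. by rewrite /qform linearZ /= -!scalemxAl -scalemxAr scalerA mxE expr2. Qed.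

Lemma psd_conj k l (S : 'M[R]_k) (V : 'M[R]_(l, k)) : psd S -> psd (V *m S *m V^T).
Proof.
move=> [sS pS]; split; first by rewrite !trmx_mul trmxK sS mulmxA.
by move=> x; rewrite qformM.
Qed.

Lemma qform_diag k (S : 'M[R]_k) i : S i i = qform S (delta_mx 0 i).
Proof. by rewrite /qform -rowE mxE (bigD1 i) //= big1 ?addr0 => [|j /negPf ji]; rewrite !mxE ?eqxx ?ji ?mulr1 ?mulr0. Qed.

Lemma near_int (z : R) : exists t : int, (t%:~R + z) ^+ 2 <= 4^-1.
Proof.
exists (- Num.floor (z + 2^-1)); rewrite rmorphN /=.
have h1 := ge_floor (z + 2^-1); have h2 := floorD1_gt (z + 2^-1).
rewrite rmorphD /= in h2.
set f := _%:~R in h1 h2 *; nra.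
Qed.

(* The first basis vector is taken within a factor 2 of a shortest one. *)
Lemma shortest_basis k (S : 'M[R]_k.+1) e : psd S -> 0 < e -> qmin S e ->
  exists (V : 'M[int]_k.+1) (m : R), [/\ V \in unitmx, e <= m,
    qmin (imx R V *m S *m (imx R V)^T) m &
    (imx R V *m S *m (imx R V)^T) 0 0 <= 2 * m].
Proof.
move=> pS e0 qS.
pose A := [set y | exists2 x : 'rV[int]_k.+1, x != 0 & y = qform S (imx R x)].
have A0 : A !=set0.
  exists (qform S (imx R (delta_mx 0 0))), (delta_mx 0 0) => //.
  by apply/eqP => /rowP/(_ 0)/eqP; rewrite !mxE.
have Alb : lbound A e by move=> _ [x x0 ->]; apply: qS.
pose m := inf A.
have em : e <= m by apply: lb_le_inf.
have mle x : x != 0 -> m <= qform S (imx R x).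
  by move=> x0; apply: ge_inf; [exists e | exists x].
have [_ [x x0 ->] hx] : exists2 y, A y & y < 2 * m by apply: inf_lt => //; rewrite -/m; lra.
have [P uP [V uV [d _ xE]]] := int_Smith_normal_form x.
have xE' : x = (P 0 0 * d`_0) *: row 0 V.
  rewrite xE; apply/rowP=> j; rewrite !mxE (bigD1 0) //= big1 ?addr0.
    by rewrite !mxE big_ord1 !mxE eqxx mulr1n.
  move=> l; rewrite !mxE big_ord1 !mxE => /negPf.
  rewrite -val_eqE /= eq_sym => ->.
  by rewrite mulr0n mulr0 mul0r.
set c := P 0 0 * d`_0 in xE'.
have r0 : row 0 V != 0.
  apply/eqP => V0; move: x0; rewrite xE' V0 scaler0 eqxx //.
have c0 : c != 0 by apply: contraNneq x0 => c0; rewrite xE' c0 scale0r.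
have Eq : qform S (imx R x) = c%:~R ^+ 2 * qform S (imx R (row 0 V)).
  by rewrite xE' /imx map_mxZ qformZ.
have hr := mle _ r0.
(* A value c^2 >= 2 would give the form at x a value of at least 2 m; hence x is, up to sign, the
   first vector of the basis V. *)
have c1 : c%:~R ^+ 2 = 1 :> R.
  have : (c%:~R ^+ 2 : R) < 2.
    rewrite ltNge; apply/negP => c2; move: hx; rewrite Eq ltNge => /negP; apply.
    apply: ler_pM => //; lra.
  rewrite -rmorphXn /= -[2%R]/(2%:~R) ltr_int => c2.
  have -> : c ^+ 2 = 1 by move: c0 c2; rewrite expr2; nia.
  by [].
exists V, m; split=> //.
  move=> y y0; rewrite qformM -imxM; apply: mle.
  apply: contraNneq y0 => yV; rewrite -[y](mulmxK uV) yV mul0mx //.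
rewrite qform_diag qformM.
have -> : delta_mx 0 0 *m imx R V = imx R (row 0 V) by rewrite -rowE; apply/rowP=> j; rewrite !mxE.
by move: hx; rewrite Eq c1 mul1r => /ltW.
Qed.

(** The Schur complement: the form on the quotient by the first basis vector, identified with its
    orthogonal complement. *)
Definition schur k (S : 'M[R]_(1 + k)) : 'M[R]_k :=
  drsubmx S - (S 0 0)^-1 *: (dlsubmx S *m ursubmx S).

Lemma schur_qform k (S : 'M[R]_(1 + k)) (t : 'rV[R]_1) y : S^T = S -> S 0 0 != 0 ->
  qform S (row_mx t y) = S 0 0 * (t 0 0 + (S 0 0)^-1 * (y *m dlsubmx S) 0 0) ^+ 2 + qform (schur S) y.
Proof.
move=> sS a0; have usym : ursubmx S = (dlsubmx S)^T by rewrite trmx_dlsub sS.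
rewrite /qform -{1}[S]submxK mul_row_block tr_row_mx mul_row_col !mulmxDl.
have eD (A B : 'M[R]_1) : (A + B) 0 0 = A 0 0 + B 0 0 by rewrite mxE.
have eB (A B : 'M[R]_1) : (A - B) 0 0 = A 0 0 - B 0 0 by rewrite !mxE.
rewrite /schur mulmxBr mulmxBl eB !eD.
have -> : (t *m ulsubmx S *m t^T) 0 0 = S 0 0 * (t 0 0) ^+ 2.
  rewrite !mxE !big_ord1 !mxE !big_ord1 !mxE.
  have -> : lshift k 0 = 0 :> 'I_(1 + k) by apply: val_inj.
  by ring.
set b := y *m dlsubmx S.
have -> : (b *m t^T) 0 0 = b 0 0 * t 0 0 by rewrite mxE big_ord1 [t^T 0 0]mxE.
have -> : (t *m ursubmx S *m y^T) 0 0 = b 0 0 * t 0 0.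
  by rewrite usym -mulmxA -trmx_mul mxE big_ord1 [(y *m _)^T 0 0]mxE mulrC.
have -> : (y *m ((S 0 0)^-1 *: (dlsubmx S *m ursubmx S)) *m y^T) 0 0 = (S 0 0)^-1 * (b 0 0) ^+ 2.
  rewrite -scalemxAr -scalemxAl mxE mulmxA -/b usym -mulmxA -trmx_mul -/b [X in _ * X]mxE big_ord1 [b^T 0 0]mxE.
  by rewrite expr2.
by field.
Qed.

Lemma schur_det k (S : 'M[R]_(1 + k)) : S 0 0 != 0 -> \det S = S 0 0 * \det (schur S).
Proof.
move=> a0; pose c := (S 0 0)^-1 *: dlsubmx S.
have ul : ulsubmx S = (S 0 0)%:M.
  by apply/matrixP=> i j; rewrite !ord1 !mxE eqxx mulr1n; congr (S _ _); apply: val_inj.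
rewrite [in LHS](_ : S = block_mx 1%:M 0 c 1%:M *m block_mx (S 0 0)%:M (ursubmx S) 0 (schur S)); last first.
  rewrite -[LHS]submxK mulmx_block !mul1mx !mul0mx ?mulmx0 !addr0 ul; congr block_mx.
    by rewrite /c mul_mx_scalar scalerA mulfV // scale1r.
  by rewrite /c /schur -scalemxAl subrKC.
by rewrite det_mulmx det_lblock !det1 !mul1r det_ublock det_scalar1.
Qed.

Lemma schur_psd k (S : 'M[R]_(1 + k)) : psd S -> 0 < S 0 0 -> psd (schur S).
Proof.
move=> [sS pS] a0; split.
  rewrite /schur linearB linearZ /= trmx_mul trmx_drsub trmx_dlsub trmx_ursub sS.
  by congr (_ - _ *: _).
move=> y; pose t : 'rV[R]_1 := (- ((S 0 0)^-1 * (y *m dlsubmx S) 0 0))%:M.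
have := pS (row_mx t y); rewrite schur_qform ?gt_eqF // [t 0 0]mxE eqxx mulr1n addNr.
by rewrite expr0n /= mulr0 add0r.
Qed.

(** Lift y with a first coordinate within 1/2 of the optimal one: this costs at most S 0 0 / 4 <= m
    / 2, and m / 2 remains for the quotient form. *)
Lemma schur_qmin k (S : 'M[R]_(1 + k)) m : psd S -> 0 < S 0 0 -> S 0 0 <= 2 * m -> qmin S m ->
  qmin (schur S) (m / 2).
Proof.
move=> [sS pS] a0 a2 qS y y0.
have [t ht] := near_int ((S 0 0)^-1 * (imx R y *m dlsubmx S) 0 0).
have := qS (row_mx t%:M y); have -> : row_mx t%:M y != 0.
  by apply: contraNneq y0; rewrite -row_mx0 => /eq_row_mx [_ ->].
move=> /(_ isT); have -> : imx R (row_mx t%:M y) = row_mx (t%:~R)%:M (imx R y).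
  by rewrite /imx map_row_mx map_scalar_mx.
rewrite schur_qform ?gt_eqF // [_%:M 0 0]mxE eqxx mulr1n.
set z := (_ + _) ^+ 2 in ht *; set q := qform _ _; nra.
Qed.

(** Hermite's inequality, by induction through the Schur complement of a nearly shortest vector;
    passing to the quotient halves the minimum, whence the powers of 2. *)
Lemma det_qmin_lower k : exists2 c : R, 0 < c & forall (S : 'M[R]_k) m, psd S -> 0 < m ->
  qmin S m -> c * m ^+ k <= \det S.
Proof.
elim: k => [|k [c c0 IH]].
  by exists 1 => // S m _ _ _; rewrite expr0 mulr1 det_mx00.
exists (c / 2 ^+ k); first by rewrite divr_gt0 // exprn_gt0.
move=> S e pS e0 qS.
have [V [m [uV em qm a2]]] := shortest_basis pS e0 qS.
set S' := _ *m _ *m _ in qm a2; have pS' : psd S' by apply: psd_conj.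
have m0 : 0 < m by apply: lt_le_trans em.
have a0 : m <= S' 0 0.
  rewrite qform_diag; have -> : delta_mx 0 0 = imx R (delta_mx 0 0) :> 'rV_k.+1.
    by rewrite /imx map_delta_mx.
  by apply: qm; apply/eqP => /rowP/(_ 0)/eqP; rewrite !mxE.
have a0' : 0 < S' 0 0 by apply: lt_le_trans a0.
have -> : \det S = \det S'.
  rewrite /S' !det_mulmx det_tr mulrAC -expr2 -real_normK ?num_real //.
  by rewrite unit_int_norm // expr1n mul1r.
rewrite (@schur_det k S') ?gt_eqF //.
have := IH (@schur k S') (m / 2) (schur_psd pS' a0') _ (schur_qmin pS' a0' a2 qm).
rewrite divr_gt0 // => /(_ isT) h.
apply: (@le_trans _ _ (m * (c * (m / 2) ^+ k))).
  rewrite expr_div_n.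
  have -> : m * (c * (m ^+ k / 2 ^+ k)) = (c / 2 ^+ k) * (m ^+ k.+1) by rewrite exprS; ring.
  rewrite ler_wpM2l ?divr_ge0 ?exprn_ge0 ?(ltW c0) //.
  by rewrite lerXn2r // nnegrE ltW.
by apply: ler_pM => //; rewrite ?mulr_ge0 ?exprn_ge0 ?divr_ge0 // ltW.
Qed.

(** The first basis vector is bounded because the determinant bounds the minimum. A reduced basis of
    the quotient is lifted with first coordinates as close as possible to the optimal ones. *)
Lemma reduced_basis k (D : R) : forall e, 0 < e -> exists B : R, forall S : 'M[R]_k, psd S -> qmin S e -> \det S <= D ->
  exists2 P : 'M[int]_k, P \in unitmx & forall i, (imx R P *m S *m (imx R P)^T) i i <= B.
Proof.
elim: k D => [|k IH] D e e0.
  by exists 0 => S _ _ _; exists 1%:M => [|[]//]; apply: unitmx1.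
have [B HB] := IH (D / e) (e / 2) (divr_gt0 e0 (ltr0n _ 2)).
have [c c0 Hc] := det_qmin_lower k.+1.
(* A bound for 2 m: either m <= 1, or m <= m^(k+1) <= D / c. *)
pose a := 2 * (1 + `|D / c|).
exists (a + `|B|) => S pS qS dS.
have [V [m [uV em qm a2]]] := shortest_basis pS e0 qS.
set S' := _ *m _ *m _ in qm a2; have pS' : psd S' by apply: psd_conj.
have m0 : 0 < m by apply: lt_le_trans em.
have a0 : m <= S' 0 0.
  rewrite qform_diag; have -> : delta_mx 0 0 = imx R (delta_mx 0 0) :> 'rV_k.+1.
    by rewrite /imx map_delta_mx.
  by apply: qm; apply/eqP => /rowP/(_ 0)/eqP; rewrite !mxE.
have a0' : 0 < S' 0 0 by apply: lt_le_trans a0.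
have ES : \det S = \det S'.
  rewrite /S' !det_mulmx det_tr mulrAC -expr2 -real_normK ?num_real //.
  by rewrite unit_int_norm // expr1n mul1r.
have ma : 2 * m <= a.
  rewrite /a ler_pM2l //; have [m1|m1] := lerP m 1.
    by apply: le_trans m1 _; rewrite lerDl.
  apply: (@le_trans _ _ (D / c)); last by apply: le_trans (ler_norm _) _; rewrite lerDr.
  rewrite ler_pdivlMr //; apply: le_trans dS; rewrite ES.
  apply: le_trans (Hc _ _ pS' m0 qm); rewrite mulrC ler_pM2l // exprS.
  by rewrite ler_peMr ?(ltW m0) // exprn_ege1 // ltW.
have dS' : \det (@schur k S') <= D / e.
  rewrite ler_pdivlMr //; apply: le_trans dS; rewrite ES (@schur_det k S') ?gt_eqF //.
  have pd : 0 <= \det (@schur k S').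
    have [c' c'0 Hc'] := det_qmin_lower k.
    apply: le_trans (Hc' (@schur k S') (m / 2) (schur_psd pS' a0') _ (schur_qmin pS' a0' a2 qm)).
      by rewrite mulr_ge0 ?exprn_ge0 ?divr_ge0 // ltW.
    by rewrite divr_gt0.
  by rewrite mulrC ler_wpM2r // (le_trans em).
have qS' : qmin (@schur k S') (e / 2).
  move=> y y0; have h := schur_qmin pS' a0' a2 qm y0. by apply: le_trans h; rewrite ler_pM2r ?invr_gt0 ?ltr0n //; exact: em.
have [P uP HP] := HB (@schur k S') (schur_psd pS' a0') qS' dS'.
have tP i : exists t : int,
   (t%:~R + (S' 0 0)^-1 * (row i (imx R P) *m @dlsubmx _ 1 k 1 k S') 0 0) ^+ 2 <= 4^-1.
  exact: near_int.
pose t : 'M[int]_(k, 1) := \matrix_(i, j) sval (cid (tP i)).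
pose Q : 'M[int]_(1 + k) := block_mx 1%:M 0 t P.
have uQ : Q \in unitmx.
  by rewrite unitmxE (@det_lblock _ 1 k) det1 mul1r -unitmxE.
exists (Q *m V) => [|i]; first by rewrite (@unitmx_mul _ k.+1 Q V) uV uQ.
rewrite qform_diag qformM imxM mulmxA -qformM -/S' -rowE.
have aB : `|B| >= 0 by [].
have a_ge0 : 0 <= a by rewrite /a mulr_ge0 // addr_ge0.
case: (@split_ordP 1 k i) => j -> {i}.
  have -> : row (lshift k j) (imx R Q) = delta_mx 0 0.
    rewrite /Q /imx (@map_block_mx _ _ _ 1 k 1 k) rowKu map_scalar_mx map_mx0 ord1.
    apply/rowP=> l; rewrite !mxE; case: (@split_ordP 1 k l) => x ->.
      by rewrite !ord1 !mxE !eqxx.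
    by rewrite !mxE.
  by rewrite -qform_diag (le_trans a2) // (le_trans ma) // lerDl.
have -> : row (rshift 1 j) (imx R Q) = row_mx (((t j 0)%:~R)%:M) (row j (imx R P)).
  rewrite /Q /imx (@map_block_mx _ _ _ 1 k 1 k) rowKd; apply/rowP=> l.
  rewrite !mxE; case: (@split_ordP 1 k l) => x _; rewrite ?ord1 !mxE ?eqxx ?mulr1n //.
  by rewrite [RHS]mxE eqxx mulr1n.
have htj : ((t j 0)%:~R + (S' 0 0)^-1 * (row j (imx R P) *m @dlsubmx _ 1 k 1 k S') 0 0) ^+ 2
    <= 4^-1 by rewrite [t j 0]mxE; apply: svalP (cid (tP j)).
have Hq := @schur_qform k S' (((t j 0)%:~R)%:M) (row j (imx R P)) pS'.1 (lt0r_neq0 a0').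
move: (t j 0) htj Hq => tj; rewrite [_%:M 0 0]mxE eqxx mulr1n.
set z := _ ^+ 2 => hz Hq; rewrite [leLHS]Hq.
apply: lerD; last first.
  apply: le_trans (ler_norm B); apply: le_trans (HP j).
  by rewrite qform_diag qformM -rowE.
apply: le_trans (ler_wpM2l (ltW a0') hz) _; lra.
Qed.

(** The Gram matrix [u *m u^T] turns this into the reduction of quadratic forms; [e'] comes from the
    fact that a vector of l1 norm at least e has a coordinate of size at least e / (n + 1). *)
Lemma lattice_reduction n (e D : R) : 0 < e -> exists B : R, forall u : 'M[R]_n,
  (forall x : 'rV[int]_n, x != 0 -> e <= nrm (imx R x *m u)) -> `|\det u| <= D ->
  exists2 P : 'M[int]_n, P \in unitmx & nrm (imx R P *m u) <= B.
Proof.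
move=> e0; pose e' := (e / n.+1%:R) ^+ 2.
have e'0 : 0 < e' by rewrite exprn_gt0 // divr_gt0.
have [B HB] := @reduced_basis n (D ^+ 2) e' e'0.
exists ((n * n)%:R * (1 + `|B|)) => u qu du.
have qE x : qform (u *m u^T) x = \sum_j ((x *m u) 0 j) ^+ 2.
  have -> : u *m u^T = u *m 1%:M *m u^T by rewrite mulmx1.
  rewrite qformM /qform mulmx1 mxE; apply: eq_bigr => j _.
  by rewrite [_^T _ _]mxE expr2.
have pS : psd (u *m u^T).
  split=> [|x]; first by rewrite trmx_mul trmxK.
  by rewrite qE; apply: sumr_ge0 => j _; apply: sqr_ge0.
have qS : qmin (u *m u^T) e'.
  move=> x x0; have := qu x x0; rewrite qE; set y := imx R x *m u => hy.
  have [j hj] : exists j, e / n.+1%:R <= `|y 0 j|.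
    apply: contrapT => no; have lt j : `|y 0 j| < e / n.+1%:R.
      by rewrite ltNge; apply/negP => h; apply: no; exists j.
    have : nrm y <= (1 * n)%:R * (e / n.+1%:R).
      by apply: nrm_le => i j; rewrite ord1 ltW.
    rewrite mul1n mulrCA => /(le_trans hy); apply/negP; rewrite -ltNge.
    rewrite -[ltRHS]mulr1 ltr_pM2l // ltr_pdivrMr // mul1r ltr_nat //.
  rewrite (bigD1 j) //= -[leLHS]addr0 lerD //.
    rewrite /e' -[leRHS]real_normK ?num_real // lerXn2r // nnegrE // divr_ge0 // ltW //.
  by apply: sumr_ge0 => *; apply: sqr_ge0.
have dS : \det (u *m u^T) <= D ^+ 2.
  rewrite det_mulmx det_tr -expr2 -real_normK ?num_real // lerXn2r // nnegrE //.
  by apply: le_trans du.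
have [P uP HP] := HB _ pS qS dS.
exists P => //; apply: nrm_le => i j.
have := HP i; rewrite qform_diag qformM -rowE qE (bigD1 j) //= => h.
have h2 : `|(row i (imx R P) *m u) 0 j| ^+ 2 <= `|B|.
  rewrite real_normK ?num_real //; apply: le_trans (ler_norm _); apply: le_trans h.
  by rewrite lerDl; apply: sumr_ge0 => *; apply: sqr_ge0.
rewrite -row_mul mxE in h2.
set z := `|_ i j| in h2 *; have z0 : 0 <= z by apply: normr_ge0.
have b0 : 0 <= `|B| by [].
by rewrite leNgt; apply/negP => hz; nra.
Qed.

End Mahler.

(** * The topology of the coset space *)

Section TopPart.
Import numFieldNormedType.Exports.
Section Top.
Local Open Scope classical_set_scope.
Local Open Scope ring_scope.
Variables (R : realType) (n : nat) (Gr Gamma : mxgroup R n).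
Hypothesis GammaGr : Gamma `<=` Gr.

Local Notation points := (points Gr).
Local Notation X := (coset_space Gr Gamma).
Local Notation proj := (@coset_proj R n Gr Gamma).

Lemma coset_projP (g h : points) :
  proj g = proj h <-> exists2 k, mxset Gamma k & val h = val g *m k.
Proof.
split=> [/eqquotP /asboolP E|[k Gk E]].
  have : lcoset_mx Gamma (val h) (val h) by exists 1%:M; [exact: mxgroup1 | rewrite mulmx1].
  by rewrite -E => -[k Gk <-]; exists k.
apply/eqquotP/asboolP; rewrite E; apply/seteqP; split=> _ [l Gl <-].
  exists (invmx k *m l); first by apply: mxgroupM => //; apply: mxgroupV.
  have /= uk := mxgroup_unit Gk.
  by rewrite -mulmxA mulKVmx.
by exists (k *m l); [apply: mxgroupM | rewrite mulmxA].
Qed.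

Lemma coset_proj_surj (x : X) : exists g, x = proj g.
Proof. by exists (generic_quotient.repr x); rewrite /coset_proj reprK. Qed.

Lemma nbhs_mxP m p (M : 'M[R]_(m, p)) (A : set 'M[R]_(m, p)) :
  nbhs M A <-> exists2 e, 0 < e & forall M', nrm (M' - M) < e -> A M'.
Proof.
split=> [/nbhs_ballP [e /= e0 eA]|[e e0 eA]].
  exists e => // M' hM; apply: eA; split=> // i j.
  rewrite /ball /= distrC; apply: le_lt_trans hM.
  by apply: le_trans (nrm_entry _ i j); rewrite !mxE.
apply/nbhs_ballP; exists (e / (m * p).+1%:R); first by rewrite /= divr_gt0.
move=> M' [_ hM]; apply: eA.
apply: (@le_lt_trans _ _ ((m * p)%:R * (e / (m * p).+1%:R))).
  by apply: nrm_le => i j; rewrite !mxE distrC ltW // hM.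
by rewrite mulrCA -[ltRHS]mulr1 ltr_pM2l // ltr_pdivrMr // mul1r ltr_nat.
Qed.

Lemma nbhs_pointsP (g : points) (A : set points) :
  nbhs g A <-> exists2 e, 0 < e & forall g', nrm (val g' - val g) < e -> A g'.
Proof.
split=> [|[e e0 eA]].
  rewrite nbhsE /= => -[B [[W oW EB] Bg] BA].
  have : nbhs (val g) W.
    by apply: open_nbhs_nbhs; split=> //; move: Bg; rewrite -EB.
  move=> /nbhs_mxP [e e0 eW]; exists e => // g' hg'; apply: BA; rewrite -EB.
  exact: eW.
have : nbhs (val g) [set M | nrm (M - val g) < e] by apply/nbhs_mxP; exists e.
rewrite nbhsE => -[W [oW Wg] WA]; rewrite nbhsE /=; exists (val @^-1` W).
  by split=> //; exists W.
by move=> g' /WA; apply: eA.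
Qed.

Lemma open_pointsP (A : set points) :
  open A <-> forall g, A g -> exists2 e, 0 < e & forall g', nrm (val g' - val g) < e -> A g'.
Proof.
rewrite openE; split=> [h g Ag|h g Ag]; first by apply/nbhs_pointsP/h.
exact/nbhs_pointsP/h.
Qed.

Definition pmul (g h : points) : points :=
  SigSub (mem_set (mxgroupM (set_valP g) (set_valP h))).

Lemma pmulE g h : val (pmul g h) = val g *m val h. Proof. by []. Qed.

Definition pinv (g : points) : points := SigSub (mem_set (mxgroupV (set_valP g))).

Lemma pinvE g : val (pinv g) = invmx (val g). Proof. by []. Qed.

Lemma punit (g : points) : val g \in unitmx.
Proof. exact: (mxgroup_unit (set_valP g)). Qed.

Lemma point_of (M : 'M[R]_n) : mxset Gr M -> exists g : points, val g = M.
Proof. by move=> GM; exists (SigSub (mem_set GM)). Qed.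

Lemma open_translate (g h : points) (A : set points) : open A ->
  open [set x | A (pmul (pmul g x) h)].
Proof.
move=> /open_pointsP oA; apply/open_pointsP => x /= /oA [e e0 eA].
pose c := 1 + nrm (val g) * nrm (val h).
have c0 : 0 < c by rewrite ltr_pwDl // mulr_ge0 ?nrm_ge0.
exists (e / c); first by rewrite divr_gt0.
move=> y hy; apply: eA; rewrite !pmulE -mulmxBl -mulmxBr.
apply: le_lt_trans (nrmM _ _) _.
apply: (@le_lt_trans _ _ (nrm (val g) * nrm (val y - val x) * nrm (val h))).
  by rewrite ler_wpM2r ?nrm_ge0 // nrmM.
rewrite mulrAC; apply: (@le_lt_trans _ _ (c * nrm (val y - val x))).
  by rewrite ler_wpM2r ?nrm_ge0 // /c lerDr.
by rewrite mulrC -ltr_pdivlMr.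
Qed.

Definition pone : points := SigSub (mem_set (mxgroup1 Gr)).

(** The saturation of A is the union of its right translates by Gamma, each of which is open. *)
Lemma open_proj (A : set points) : open A -> open (proj @` A).
Proof.
move=> oA; rewrite /open /= /quotient_open.
have -> : \pi_X%qT @^-1` (proj @` A) =
    \bigcup_(k in [set k : points | mxset Gamma (val k)]) [set x | A (pmul (pmul pone x) k)].
  apply/seteqP; split=> x.
    case=> g Ag /esym/coset_projP [k Gk Ek].
    have [k' Ek'] := point_of (GammaGr Gk).
    exists k'; rewrite /= ?Ek' //.
    suff -> : pmul (pmul pone x) k' = g by [].
    by apply: val_inj; rewrite !pmulE mul1mx Ek' -Ek.
  case=> k Gk /= Ak; exists (pmul (pmul pone x) k) => //.
  by apply/esym/coset_projP; exists (val k) => //; rewrite !pmulE mul1mx.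
by apply: bigcup_open => k _; apply: open_translate.
Qed.

(** The images of the open balls of integral radius form an open cover; the sum of the finitely many
    radii in a subcover bounds them all. *)
Lemma compact_bounded_reps (C : set X) : compact C -> exists b : R,
  forall x, C x -> exists2 g, x = proj g & nrm (val g) <= b.
Proof.
rewrite compact_cover => coC.
pose U (k : nat) : set X := proj @` [set g | nrm (val g) < k%:R].
have oU k : [set: nat] k -> open (U k).
  move=> _; apply: open_proj; apply/open_pointsP => g /= hg.
  exists (k%:R - nrm (val g)); first by rewrite subr_gt0.
  move=> g' h; rewrite -[val g'](subrK (val g)); apply: le_lt_trans (nrmD _ _) _.
  by rewrite -ltrBrDr.
have CU : C `<=` \bigcup_k U k.
  move=> x _; have [g ->] := coset_proj_surj x.
  exists (Num.Def.archi_bound (nrm (val g))) => //; exists g => //=.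
  by apply: archi_boundP; apply: nrm_ge0.
have [D _ CD] := coC _ _ _ oU CU.
exists (\sum_(k <- finmap.enum_fset D) k%:R) => x /CD [k /= kD [g hg <-]]; exists g => //.
apply: ltW; apply: (lt_le_trans hg).
rewrite (big_rem k) //= lerDl; apply: sumr_ge0 => *; exact: ler0n.
Qed.

(** S is bounded and, by the second hypothesis, closed among all matrices. It is compact by
    Heine-Borel for vectorized matrices, and so is its continuous image. *)
Lemma bounded_closed_compact_proj (S : set points) (b : R) :
  (forall g, S g -> nrm (val g) <= b) ->
  (forall M, (forall e, 0 < e -> exists2 g, S g & nrm (val g - M) < e) -> exists2 g, S g & val g = M) ->
  compact (proj @` S).
Proof.
move=> Sb Scl; apply: continuous_compact.
  by apply: continuous_subspaceT; exact: pi_continuous.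
move=> F FF FS.
pose phi (g : points) : 'rV[R]_(n * n) := mxvec (val g).
have := @rV_compact R (n * n) (fun=> `[- b, b]%classic) (fun=> @segment_compact _ _ _).
move=> /(_ (phi @ F) _)[|v [_ clv]].
  suff : F [set g | forall i, `[- b, b]%classic (phi g ord0 i)] by [].
  apply: filterS FS => g Sg i /=; rewrite in_itv /= -ler_norml.
  apply: le_trans (Sb _ Sg).
  by case/mxvec_indexP: i => i j; rewrite /phi mxvecE nrm_entry.
pose M := vec_mx v : 'M[R]_n.
have near (A : set points) (e : R) : F A -> 0 < e -> exists2 g, (A `&` S) g & nrm (val g - M) < e.
  move=> FA e0.
  have Fphi : (phi @ F) (phi @` (A `&` S)).
    suff : F [set g | (phi @` (A `&` S)) (phi g)] by [].
    by apply: filterS (filterI FA FS) => g gA; exists g.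
  have nb : nbhs v [set w | nrm (vec_mx w - M) < e].
    apply/nbhs_mxP; exists e => // w /=; congr (_ < _).
    rewrite /M -linearB /= /nrm big_ord1.
    rewrite pair_bigA /= (reindex _ (curry_mxvec_bij _ _)) /=.
    by apply: eq_bigr => -[i j] _; rewrite [in RHS]mxE.
  have [_ [[g gAS <-] /= hg]] := clv _ _ Fphi nb; exists g => //.
  by move: hg; rewrite /phi mxvecK.
have [g0 Sg0 Eg0] : exists2 g, S g & val g = M.
  by apply: Scl => e e0; have [g [_ Sg] hg] := near _ _ FS e0; exists g.
exists g0; split=> // A B FA /nbhs_pointsP [e e0 eB].
by have [g [Ag _] hg] := near _ _ FA e0; exists g; split=> //; apply: eB; rewrite Eg0.
Qed.

End Top.
End TopPart.

(** * Bounded orbits from an invariant measure *)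

Section MeasPart.
Import numFieldNormedType.Exports.
Section Meas.
Local Open Scope classical_set_scope.
Local Open Scope ring_scope.
Variables (R : realType) (n : nat) (Gr Gamma : mxgroup R n).
Hypothesis latt : lattice Gr Gamma.

Local Notation points := (points Gr).
Local Notation X := (coset_space Gr Gamma).
Local Notation proj := (@coset_proj R n Gr Gamma).

Let GammaGr : Gamma `<=` Gr. Proof. by case: latt. Qed.

Lemma translate_proj (h : points) (A : set points) :
  @translate_set R n Gr Gamma (val h) (proj @` A) = proj @` [set g | A (pmul (pinv h) g)].
Proof.
apply/seteqP; split=> y.
  case=> _ [a Aa <-] [g [g' [Eg Eg' ->]]].
  have [k Gk Ek] := (coset_projP Gamma a g).1 Eg.
  exists (pmul h a); rewrite /=.
    by rewrite (_ : pmul _ _ = a) //; apply: val_inj; rewrite !pmulE pinvE mulKmx ?punit.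
  by apply/coset_projP; exists k; rewrite // pmulE -mulmxA -Ek Eg'.
case=> g Ag <-; exists (proj (pmul (pinv h) g)); first by exists (pmul (pinv h) g).
exists (pmul (pinv h) g), g; split=> //.
by rewrite !pmulE pinvE mulKVmx ?punit.
Qed.

(** For every rational matrix and radius 1 / (j + 1) one point of S in that ball is selected, if
    there is one, and [M0] otherwise; the selected points are dense in S. *)
Lemma separable_subset m p (S : set 'M[R]_(m, p)) : exists d : nat -> 'M[R]_(m, p),
  forall M e, S M -> 0 < e -> exists2 k, S (d k) & nrm (d k - M) < e.
Proof.
have [[M0 SM0]|none] := pselect (S !=set0); last first.
  by exists (fun=> 0) => M e SM; case: none; exists M.
pose good (q : 'M[rat]_(m, p) * nat) M := S M /\ nrm (M - map_mx ratr q.1) < q.2.+1%:R^-1.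
have dP k : exists M, S M /\
    forall q, unpickle k = Some q -> (exists M', good q M') -> good q M.
  case: (unpickle k) => [q|]; last by exists M0.
  have [[M gM]|no] := pselect (exists M', good q M').
    by exists M; split=> [|_ [<-] _ //]; case: gM.
  by exists M0; split=> // _ [<-].
exists (fun k => sval (cid (dP k))) => M e SM e0.
pose j := Num.Def.archi_bound (2 / e).
have j0 : j.+1%:R^-1 < e / 2 :> R.
  rewrite -[e / 2]invrK ltf_pV2 ?posrE ?invr_gt0 ?divr_gt0 // invf_div.
  apply: lt_le_trans (archi_boundP _) _; first by rewrite divr_ge0 // ltW.
  by rewrite ler_nat.
have [q hq] : exists q : 'M[rat]_(m, p), nrm (M - map_mx ratr q) < j.+1%:R^-1.
  pose e' : R := j.+1%:R^-1 / (m * p).+1%:R.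
  have e'0 : 0 < e' by rewrite divr_gt0.
  have qP i k : exists x : rat, `|M i k - ratr x| <= e'.
    have [x] := @rat_in_itvoo R (M i k - e') (M i k + e') ltac:(lra).
    by rewrite in_itv /= => /andP[h1 h2]; exists x; rewrite ler_norml; lra.
  exists (\matrix_(i, k) sval (cid (qP i k))).
  apply: (@le_lt_trans _ _ ((m * p)%:R * e')).
    by apply: nrm_le => i k; rewrite !mxE; apply: svalP (cid (qP i k)).
  rewrite /e' mulrCA -[ltRHS]mulr1 ltr_pM2l ?invr_gt0 //.
  by rewrite ltr_pdivrMr // mul1r ltr_nat.
exists (pickle (q, j)); first by case: (svalP (cid (dP (pickle (q, j))))).
have [_ /(_ (q, j))] := svalP (cid (dP (pickle (q, j)))).
move=> /(_ (pickleK (q, j))) [|_ /=]; first by exists M.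
set N := sval _ => hN.
have -> : N - M = (N - map_mx ratr q) + - (M - map_mx ratr q) by rewrite opprB addrA subrK.
apply: le_lt_trans (nrmD _ _) _; rewrite nrmN.
move: hN hq j0; set z := j.+1%:R^-1 : R.
set x := nrm _; set y := nrm _ => hN hq j0; move: hN hq j0 => /=; rewrite -/z; lra.
Qed.

Let mu_ex := let: And3 _ _ h := latt in h.
Let mu := sval (cid mu_ex).
Let mu_gt0 : (0 < mu setT)%E. Proof. by case: (svalP (cid mu_ex)). Qed.
Let mu_fin : (mu setT < +oo)%E. Proof. by case: (svalP (cid mu_ex)). Qed.
Let mu_inv h B : mxset Gr h -> <<s (@open X) >> B ->
  mu (@translate_set R n Gr Gamma h B) = mu B.
Proof. by case: (svalP (cid mu_ex)) => _ _; apply. Qed.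

Lemma mu_translate (h : points) (A : set points) : open A ->
  mu (proj @` [set g | A (pmul (pinv h) g)]) = mu (proj @` A).
Proof.
move=> oA; rewrite -translate_proj mu_inv //; first exact: set_valP.
by apply: sub_sigma_algebra; apply: open_proj.
Qed.

Lemma meas_proj (A : set points) : open A ->
  measurable (proj @` A : set (g_sigma_algebraType (@open X))).
Proof. by move=> oA; apply: sub_sigma_algebra; apply: open_proj. Qed.

Lemma open_pre (h : points) (A : set points) : open A -> open [set g | A (pmul h g)].
Proof.
move=> oA; have := open_translate h (pone Gr) oA; congr open.
by apply/seteqP; split=> x /=; congr A; apply: val_inj; rewrite !pmulE mulmx1.
Qed.

(** Since the group is separable, countably many translates of the image cover the quotient. They
    have equal measure, so a null image would make the total measure zero. *)
Lemma mu_open_gt0 (A : set points) (a : points) : open A -> A a -> (0 < mu (proj @` A))%E.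
Proof.
move=> oA Aa; rewrite lt_def measure_ge0 andbT; apply/eqP => mA0.
have [d dP] := @separable_subset n n Gr.
pose dp k : points := if pselect (mxset Gr (d k)) is left h then SigSub (mem_set h) else pone Gr.
have dpE k : mxset Gr (d k) -> val (dp k) = d k by rewrite /dp; case: pselect.
pose h k := pinv (pmul a (dp k)).
pose U k : set (g_sigma_algebraType (@open X)) := proj @` [set g | A (pmul (pinv (h k)) g)].
have mU k : measurable (U k) by exact: meas_proj (open_pre (pinv (h k)) oA).
have U0 k : mu (U k) = 0%E by apply: etrans (mu_translate (h k) oA) mA0.
have cover : setT `<=` \bigcup_k U k.
  move=> x _; have [g ->] := coset_proj_surj x.
  have [e e0 he] := (open_pointsP A).1 oA a Aa.
  pose c := 1 + nrm (val a) * nrm (val g).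
  have c0 : 0 < c by rewrite ltr_pwDl // mulr_ge0 ?nrm_ge0.
  have [k Gk hk] := dP (invmx (val g)) (e / c) (mxgroupV (set_valP g)) (divr_gt0 e0 c0).
  exists k => //; exists g => //=; apply: he.
  rewrite !pmulE pinvE /h pinvE invmxK pmulE dpE //.
  have -> : val a *m d k *m val g - val a = val a *m (d k - invmx (val g)) *m val g.
    by rewrite mulmxBr mulmxBl -[in RHS](mulmxA _ (invmx _)) mulVmx ?punit // mulmx1.
  apply: le_lt_trans (nrmM _ _) _.
  apply: (@le_lt_trans _ _ (nrm (val a) * nrm (d k - invmx (val g)) * nrm (val g))).
    by rewrite ler_wpM2r ?nrm_ge0 // nrmM.
  rewrite mulrAC; apply: (@le_lt_trans _ _ (c * nrm (d k - invmx (val g)))).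
    by rewrite ler_wpM2r ?nrm_ge0 // /c lerDr.
  by rewrite mulrC -ltr_pdivlMr.
have : (mu setT <= 0)%E.
  have := measure_sigma_subadditive mu mU (@measurableT _ _) cover.
  move=> /le_trans; apply; rewrite eseries0 // => k _ _; exact: U0.
by rewrite leNgt mu_gt0.
Qed.

(** * Boundedness of orbits in finite-dimensional representations *)

Section Bound.
Variables (m : nat) (rho : 'M[R]_n -> 'M[R]_m) (omega : 'cV[R]_m).
Hypothesis rhoM : forall g h, rho (g *m h) = rho g *m rho h.
Hypothesis rho1 : rho 1%:M = 1%:M.
Hypothesis rho_cont : forall g e, 0 < e -> exists2 d, 0 < d &
  forall g', nrm (g' - g) < d -> nrm (rho g' - rho g) < e.
Variable b0 : R.
Hypothesis orbit_b0 : forall k, mxset Gamma k -> nrm (rho k *m omega) <= b0.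

Let Psi (g : points) : 'cV[R]_m := rho (val g) *m omega.

Lemma Psi_cont g e : 0 < e -> exists2 d, 0 < d &
  forall g', nrm (val g' - val g) < d -> nrm (Psi g' - Psi g) < e.
Proof.
move=> e0; pose c := 1 + nrm omega; have c0 : 0 < c by rewrite ltr_pwDl // nrm_ge0.
have [d d0 hd] := rho_cont (val g) (divr_gt0 e0 c0).
exists d => // g' /hd h; rewrite /Psi -mulmxBl; apply: le_lt_trans (nrmM _ _) _.
apply: (@le_lt_trans _ _ (nrm (rho (val g') - rho (val g)) * c)).
  by rewrite ler_wpM2l ?nrm_ge0 // /c lerDr.
by rewrite -ltr_pdivlMr.
Qed.

Lemma open_big r : open [set g | r < nrm (Psi g)].
Proof.
apply/open_pointsP => g /= rg; have [] := @Psi_cont g (nrm (Psi g) - r).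
  by rewrite subr_gt0.
move=> d d0 hd; exists d => // g' /hd; rewrite nrmC => h.
have : nrm (Psi g) <= nrm (Psi g - Psi g') + nrm (Psi g').
  by rewrite -{1}[Psi g](subrK (Psi g')) nrmD.
lra.
Qed.

Lemma open_near w e : open [set g | nrm (Psi g - w) < e].
Proof.
apply/open_pointsP => g /= rg; have [] := @Psi_cont g (e - nrm (Psi g - w)).
  by rewrite subr_gt0.
move=> d d0 hd; exists d => // g' /hd h.
rewrite -[Psi g'](subrK (Psi g)) -addrA; apply: le_lt_trans (nrmD _ _) _; lra.
Qed.

Let D (k : nat) : set (g_sigma_algebraType (@open X)) := proj @` [set g | k%:R < nrm (Psi g)].

(** The sets [D k] decrease to the empty set: on a single coset all values of [Psi] are bounded,
    because the Gamma-orbit of omega is. As the measure is finite, their measures tend to 0. *)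
Lemma mu_D_small (c : \bar R) : (0 < c)%E -> exists k, (mu (D k) < c)%E.
Proof.
move=> c0.
have mD k : measurable (D k) by exact: meas_proj (@open_big _).
have niD : nonincreasing_seq D.
  move=> i j ij; apply/subsetPset => _ [g /= hg <-]; exists g => //=.
  by apply: le_lt_trans hg; rewrite ler_nat.
have D0 : \bigcap_k D k = set0.
  apply/seteqP; split=> // x h.
  have [g Eg] := coset_proj_surj x.
  pose k := Num.Def.archi_bound (nrm (rho (val g)) * `|b0|).
  have [g' /= hg' Eg'] := h k I.
  have [l Gl El] := (coset_projP Gamma g g').1 (etrans (esym Eg) (esym Eg')).
  move: hg'; apply/negP; rewrite -leNgt /Psi El rhoM -mulmxA.
  apply: le_trans (nrmM _ _) _; apply: (@le_trans _ _ (nrm (rho (val g)) * `|b0|)).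
    by rewrite ler_wpM2l ?nrm_ge0 // (le_trans (orbit_b0 Gl)) // ler_norm.
  by apply/ltW/archi_boundP; rewrite mulr_ge0 ?nrm_ge0.
have := @nonincreasing_cvg_mu _ _ R mu D _ mD _ niD.
rewrite D0 measure0 => /(_ _ measurable0) cv.
have fin0 : (mu (D 0%N) < +oo)%E.
  by apply: le_lt_trans mu_fin; apply: le_measure; rewrite ?inE.
have {}cv := cv fin0.
have /cv [k _ hk] : nbhs (0%E : \bar R) [set x : \bar R | (x < c)%E].
  by apply: open_nbhs_nbhs; split=> //; exact: open_ereal_lt_ereal.
by exists k; apply: hk => /=.
Qed.

(** Near each member of a basis of the span of the orbit there is a set whose image has measure at
    least c; choose r with [D r] of smaller measure. For every h the translate of each such set by h
    contains a point where [Psi] is at most r, so h is bounded on a slight perturbation of the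
    basis, hence on the basis and on omega. *)
Lemma orbit_bounded : exists b, forall g, mxset Gr g -> nrm (rho g *m omega) <= b.
Proof.
have [k [B [wP span]]] : exists k (B : 'I_k -> points),
   row_free (\matrix_i (Psi (B i))^T) /\ forall g, ((Psi g)^T <= \matrix_i (Psi (B i))^T)%MS.
  pose P k := exists B : 'I_k -> points, row_free (\matrix_i (Psi (B i))^T).
  have Pm k : P k -> (k <= m)%N by case=> B /eqP <-; rewrite rank_leq_col.
  have P0 : P 0%N by exists (fun=> pone Gr); rewrite /row_free flatmx0 mxrank0.
  have exP : exists k, `[< P k >] by exists 0%N; apply/asboolP.
  have ubP k : `[< P k >] -> (k <= m)%N by move=> /asboolP /Pm.
  case: (ex_maxnP exP ubP) => k /asboolP [B fB] kmax; exists k, B; split=> // g.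
  apply/negPn/negP => nle.
  suff /asboolP/kmax : P k.+1 by rewrite ltnn.
  exists (fun i : 'I_(1 + k) => match fintype.split i with inl _ => g | inr j => B j end).
  have -> : \matrix_i (Psi (match fintype.split i with inl _ => g | inr j => B j end))^T =
     col_mx (Psi g)^T (\matrix_i (Psi (B i))^T) :> 'M[R]_(1 + k, m).
    apply/matrixP=> i j; rewrite !mxE; case: fintype.split => l; rewrite ?ord1 ?mxE //.
  suff E : \rank (col_mx (Psi g)^T (\matrix_i (Psi (B i))^T)) = (1 + k)%N.
    by apply/eqP; exact: E.
  rewrite -addsmxE; apply/eqP; rewrite eqn_leq; apply/andP; split.
    by rewrite addsmxE rank_leq_row.
  have := mxrank_sum_cap (Psi g)^T (\matrix_i (Psi (B i))^T).
  have -> : ((Psi g)^T :&: \matrix_i (Psi (B i))^T)%MS = 0.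
    apply/eqP; rewrite -mxrank_eq0; rewrite -leqn0 -ltnS.
    have : (\rank ((Psi g)^T :&: \matrix_i (Psi (B i))^T)%MS < \rank (Psi g)^T)%N.
      by apply: rank_ltmx; rewrite /ltmx capmxSl sub_capmx submx_refl.
    by move=> /leq_trans; apply; rewrite rank_leq_row.
  rewrite mxrank0 addn0 (eqP fB) => ->.
  rewrite leq_add2r lt0n mxrank_eq0; apply: contraNneq nle => ->; exact: sub0mx.
set W := \matrix_i _ in wP span.
pose L := pinvmx W.
have L0 : 0 < 1 + nrm L by rewrite ltr_pwDl // nrm_ge0.
have k0 : 0 < 1 + k%:R :> R by rewrite ltr_pwDl.
(* With this radius the perturbed basis V satisfies |(V - W) L| <= 1/2. *)
pose e := 2^-1 / ((1 + k%:R) * (1 + nrm L)) : R.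
have e0 : 0 < e by rewrite divr_gt0 // mulr_gt0.
pose U i := [set g : points | nrm (Psi g - Psi (B i)) < e].
have U0 i : (0 < mu (proj @` U i))%E.
  by apply: (@mu_open_gt0 _ (B i)); [apply: open_near | rewrite /U /= subrr nrm0].
have [c c0 cU] : exists2 c : \bar R, (0 < c)%E & forall i, (c <= mu (proj @` U i))%E.
  elim: k {B wP span W L e L0 k0 e0} U U0 => [|k IH] U U0; first by exists 1%E => // -[].
  have [c c0 hc] := IH (fun i => U (lift ord0 i)) (fun i => U0 _).
  exists (mine c (mu (proj @` U ord0))); first by rewrite lt_min c0 U0.
  move=> i; case: (unliftP ord0 i) => [j ->|->]; last by rewrite ge_min lexx orbT.
  by rewrite ge_min hc.
have [r hr] := mu_D_small c0.
have [cf Ecf] : exists cf, omega^T = cf *m W.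
  by apply/submxP; have := span (pone Gr); rewrite /Psi /= rho1 mul1mx.
exists (nrm cf * (2 * (k * m)%:R * r%:R)) => h Gh.
have [hp Ehp] := point_of Gh; rewrite -Ehp.
(* If [Psi] exceeded r on the whole translate of [U i], this translate would lie in [D r], against
   the comparison of measures. *)
have vP i : exists g, nrm (Psi g - Psi (B i)) < e /\ nrm (Psi (pmul hp g)) <= r%:R.
  apply: contrapT => no.
  have sub : proj @` U i `<=` proj @` [set g | [set g | r%:R < nrm (Psi g)] (pmul (pinv (pinv hp)) g)].
    move=> _ [g gU <-]; exists g => //=; rewrite ltNge; apply/negP => hle; apply: no.
    exists g; split=> //; move: hle; congr (nrm (rho _ *m _) <= _).
    by rewrite !pmulE !pinvE invmxK.
  have : (mu (proj @` U i) <= mu (D r))%E.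
    rewrite -[leRHS](mu_translate (pinv hp)); last exact: open_big.
    apply: le_measure => //; rewrite inE; apply: meas_proj; first exact: open_near.
    exact/open_pre/open_big.
  by move=> /(le_trans (cU i)); rewrite leNgt hr.
pose V := \matrix_i (Psi (sval (cid (vP i))))^T.
pose Q := (rho (val hp))^T.
have VW : (V - W <= W)%MS.
  apply/row_subP => i; rewrite linearB /= !rowK; apply: addmx_sub; first exact: span.
  by rewrite eqmx_opp; apply: span.
have EV : V - W = (V - W) *m L *m W by rewrite mulmxKpV.
have nVW : nrm (V - W) <= k%:R * e.
  rewrite /nrm -[k in k%:R](card_ord k) mulr_natl -sumr_const; apply: ler_sum => i _.
  have [h1 _] := svalP (cid (vP i)); apply: le_trans (ltW h1).
  rewrite /nrm; apply: ler_sum => j _; rewrite big_ord1 !mxE.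
  by [].
have nV : nrm (V *m Q) <= (k * m)%:R * r%:R.
  apply: nrm_le => i j; have [_ h2] := svalP (cid (vP i)).
  apply: le_trans h2; apply: le_trans (nrm_entry _ j 0); rewrite le_eqVlt; apply/orP; left.
  apply/eqP; congr `|_|; rewrite /Psi pmulE rhoM -mulmxA !mxE; apply: eq_bigr => l _.
  by rewrite /V /Q /Psi mxE mulrC; congr (_ * _); rewrite !mxE.
have nWQ : nrm (W *m Q) <= 2 * ((k * m)%:R * r%:R).
  (* The error term contains the quantity to be bounded with a factor 1/2 and is absorbed into the
     left-hand side. *)
  have E1 : W *m Q = V *m Q - (V - W) *m L *m (W *m Q).
    by rewrite mulmxA -EV mulmxBl opprB addrC subrK.
  have h1 : nrm ((V - W) *m L) <= 2^-1.
    apply: le_trans (nrmM _ _) _; apply: (@le_trans _ _ (k%:R * e * nrm L)).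
      by rewrite ler_wpM2r ?nrm_ge0.
    have -> : k%:R * e * nrm L = (k%:R * nrm L) * e by rewrite mulrAC.
    rewrite /e mulrCA ler_piMr // ler_pdivrMr ?mulr_gt0 // mul1r.
    by apply: ler_pM; rewrite ?nrm_ge0 // lerDr.
  have h2 : nrm (W *m Q) <= nrm (V *m Q) + 2^-1 * nrm (W *m Q).
    rewrite {1}E1; apply: le_trans (nrmD _ _) _; rewrite nrmN lerD2l.
    by apply: le_trans (nrmM _ _) _; rewrite ler_wpM2r ?nrm_ge0.
  lra.
have -> : rho (val hp) *m omega = (cf *m (W *m Q))^T.
  by rewrite mulmxA -Ecf trmx_mul !trmxK.
have -> : nrm (cf *m (W *m Q))^T = nrm (cf *m (W *m Q)).
  by rewrite /nrm exchange_big; apply: eq_bigr => i _; apply: eq_bigr => j _; rewrite mxE.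
apply: le_trans (nrmM _ _) _; rewrite ler_wpM2l ?nrm_ge0 //.
by rewrite -mulrA.
Qed.

End Bound.
End Meas.
End MeasPart.

(** * Noetherian rings *)

Section Noeth.
Local Open Scope classical_set_scope.
Local Open Scope ring_scope.

Definition is_ideal (A : comNzRingType) (I : set A) : Prop :=
  [/\ I 0, forall x y, I x -> I y -> I (x + y) & forall a x, I x -> I (a * x)].

(** The coefficients form a sequence, read only below [size s], so that their type does not depend
    on s. *)
Definition span_of (A : comNzRingType) (s : seq A) (x : A) : Prop :=
  exists c : nat -> A, x = \sum_(k < size s) c k * s`_k.

Definition noetherian (A : comNzRingType) : Prop :=
  forall I : set A, is_ideal I -> exists s : seq A, (forall x, x \in s -> I x) /\ I `<=` span_of s.

Lemma span_ideal (A : comNzRingType) (s : seq A) : is_ideal (span_of s).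
Proof.
split; first by exists (fun=> 0); rewrite big1 // => k _; rewrite mul0r.
  move=> _ _ [c ->] [d ->]; exists (fun k => c k + d k).
  by rewrite -big_split /=; apply: eq_bigr => k _; rewrite mulrDl.
move=> a _ [c ->]; exists (fun k => a * c k).
by rewrite mulr_sumr; apply: eq_bigr => k _; rewrite mulrA.
Qed.

Lemma ideal_sum (A : comNzRingType) (I : set A) m (F : 'I_m -> A) :
  is_ideal I -> (forall k, I (F k)) -> I (\sum_k F k).
Proof.
move=> [I0 ID _] IF; elim/big_ind: _ => //; exact: ID.
Qed.

Lemma span_sub (A : comNzRingType) (s : seq A) (I : set A) :
  is_ideal I -> (forall x, x \in s -> I x) -> span_of s `<=` I.
Proof.
move=> iI Is _ [c ->]; apply: ideal_sum => // k.
by case: iI => _ _; apply; apply: Is; rewrite mem_nth.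
Qed.

Lemma span_mem (A : comNzRingType) (s : seq A) x : x \in s -> span_of s x.
Proof.
move=> xs; exists (fun k => if k == index x s then 1 else 0).
have ix : (index x s < size s)%N by rewrite index_mem.
rewrite (bigD1 (Ordinal ix)) //= eqxx mul1r nth_index // big1 ?addr0 // => k.
by rewrite -val_eqE /= => /negPf ->; rewrite mul0r.
Qed.

Lemma noetherian_field (K : fieldType) : noetherian K.
Proof.
move=> I [I0 ID IM]; have [[x [Ix x0]]|no] := pselect (exists x, I x /\ x != 0).
  exists [:: x]; split=> [y|y Iy]; first by rewrite inE => /eqP ->.
  by exists (fun=> y / x); rewrite big_ord1 /= divfK.
exists [::]; split=> // y Iy; exists (fun=> 0); rewrite big_ord0.
by apply/eqP; apply: contrapT => /negP y0; apply: no; exists y.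
Qed.

Lemma noetherian_surj (A B : comNzRingType) (f : {rmorphism A -> B}) :
  (forall b, exists a, f a = b) -> noetherian A -> noetherian B.
Proof.
move=> fsurj nA I [I0 ID IM].
have [|s [Is sI]] := nA (f @^-1` I).
  split=> [|x y|a x] /=; rewrite ?rmorph0 ?rmorphD ?rmorphM //; [exact: ID | exact: IM].
exists (map f s); split=> [_ /mapP [x /Is Ix ->]//|b].
have [a <-] := fsurj b => /sI [c ->].
exists (fun k => f (c k)); rewrite rmorph_sum size_map.
by apply: eq_bigr => k _; rewrite rmorphM /= (nth_map 0).
Qed.

(** Hilbert's basis theorem. An ideal that is not finitely generated yields a sequence of elements,
    each of least degree outside the span of its predecessors; a relation between their leading
    coefficients then lowers the degree of one of them. *)
Lemma noetherian_poly (A : comNzRingType) : noetherian A -> noetherian {poly A}.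
Proof.
move=> nA I iI; apply: contrapT => nfg.
have [I0 ID IM] := iI.
have nextP (s : seq {poly A}) : exists g, (forall x, x \in s -> I x) ->
   [/\ I g, ~ span_of s g & forall h, I h -> ~ span_of s h -> (size g <= size h)%N].
  have [Is|nIs] := pselect (forall x, x \in s -> I x); last by exists 0.
  have [g0 [Ig0 ng0]] : exists g, I g /\ ~ span_of s g.
    apply: contrapT => no; apply: nfg; exists s; split=> // g Ig.
    by apply: contrapT => ng; apply: no; exists g.
  pose P k := `[< exists g, [/\ I g, ~ span_of s g & size g = k] >].
  have exP : exists k, P k by exists (size g0); apply/asboolP; exists g0.
  case: (ex_minnP exP) => k /asboolP [g [Ig ng gk]] kmin; exists g => _; split=> // h Ih nh.
  by rewrite gk; apply: kmin; apply/asboolP; exists h.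
pose next s := sval (cid (nextP s)).
pose S k := iter k (fun s => rcons s (next s)) [::].
pose g k := next (S k).
have SI k : forall x, x \in S k -> I x.
  elim: k => [|k IH] x //; rewrite /S /= -/(S k) mem_rcons inE => /orP [/eqP ->|/IH //].
  by have [] := svalP (cid (nextP (S k))) IH.
have gP k : [/\ I (g k), ~ span_of (S k) (g k) &
    forall h, I h -> ~ span_of (S k) h -> (size (g k) <= size h)%N].
  exact: svalP (cid (nextP (S k))) (SI k).
have Ssub j k : (j < k)%N -> g j \in S k.
  elim: k => // k IH; rewrite ltnS leq_eqVlt /S /= -/(S k) mem_rcons inE => /orP [/eqP ->|/IH ->].
    by rewrite eqxx.
  by rewrite orbT.
have SS k x : x \in S k -> exists2 j, (j < k)%N & x = g j.
  elim: k => // k IH; rewrite /S /= -/(S k) mem_rcons inE => /orP [/eqP ->|/IH [j jk ->]].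
    by exists k.
  by exists j => //; apply: ltnW.
have gmono j k : (j <= k)%N -> (size (g j) <= size (g k))%N.
  move=> jk; have [_ _] := gP j; apply; first by case: (gP k).
  move=> h; have [_ + _] := gP k; apply; apply: span_sub h; first exact: span_ideal.
  by move=> x /SS [i ij ->]; apply/span_mem/Ssub/(leq_trans ij).
pose lc k := [seq lead_coef (g j) | j <- iota 0 k].
pose L : set A := [set a | exists k, span_of (lc k) a].
have lcmono j k : (j <= k)%N -> span_of (lc j) `<=` span_of (lc k).
  move=> jk; apply: span_sub; first exact: span_ideal.
  move=> _ /mapP [i + ->]; rewrite mem_iota /= add0n => ij.
  by apply/span_mem/(map_f (fun j => lead_coef (g j))); rewrite mem_iota /= add0n (leq_trans ij).
have iL : is_ideal L.
  split; first by exists 0%N; case: (span_ideal (lc 0)).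
    move=> x y [j xj] [k yk]; exists (maxn j k); have [_ D _] := span_ideal (lc (maxn j k)).
    by apply: D; [apply: lcmono xj; rewrite leq_maxl | apply: lcmono yk; rewrite leq_maxr].
  by move=> a x [j xj]; exists j; have [_ _ M] := span_ideal (lc j); apply: M.
have [s [sL Ls]] := nA L iL.
have [m hm] : exists m, forall x, x \in s -> span_of (lc m) x.
  elim: s sL {Ls} => [|x s IH] sL; first by exists 0%N.
  have [|m hm] := IH; first by move=> y ys; apply: sL; rewrite inE ys orbT.
  have [k hk] := sL x (mem_head _ _); exists (maxn k m) => y; rewrite inE => /orP [/eqP ->|/hm].
    by apply: lcmono hk; rewrite leq_maxl.
  by apply: lcmono; rewrite leq_maxr.
have : L (lead_coef (g m)).
  exists m.+1; apply/span_mem/(map_f (fun j => lead_coef (g j))); by rewrite mem_iota /= add0n.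
move=> /Ls /(span_sub (@span_ideal _ (lc m)) hm) [c Ec].
have [Igm ngm gmin] := gP m.
(* The leading terms cancel, while h stays outside the span of the predecessors: this contradicts
   the minimal degree of [g m]. *)
pose h := g m - \sum_(k < m) (c k)%:P * 'X^(size (g m) - size (g k)) * g k.
have spansum : span_of (S m) (\sum_(k < m) (c k)%:P * 'X^(size (g m) - size (g k)) * g k).
  apply: ideal_sum; first exact: span_ideal.
  move=> k; have [_ _ M] := span_ideal (S m); apply: M; apply/span_mem/Ssub; exact: ltn_ord.
have Ih : I h.
  have [_ D M] := iI; apply: D => //; rewrite -mulN1r; apply: M.
  by apply: span_sub spansum; [exact: iI | exact: SI].
have nh : ~ span_of (S m) h.
  move=> sh; apply: ngm; rewrite -[g m](subrK (\sum_(k < m) (c k)%:P * 'X^(size (g m) - size (g k)) * g k)).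
  by have [_ D _] := span_ideal (S m); apply: D.
have := gmin h Ih nh; apply/negP; rewrite -ltnNge.
have gm0 : (0 < size (g m))%N.
  rewrite lt0n size_poly_eq0; apply/eqP => g0; apply: ngm; rewrite g0.
  by case: (span_ideal (S m)).
have hle : (size h <= size (g m))%N.
  rewrite (leq_trans (size_polyD _ _)) // size_polyN geq_max leqnn /=.
  apply: leq_trans (size_sum _ _ _) _; apply/bigmax_leqP => k _.
  have km : (size (g k) <= size (g m))%N by rewrite gmono // ltnW.
  rewrite -mulrA mul_polyC; apply: leq_trans (size_scale_leq _ _) _.
  apply: leq_trans (size_polyMleq _ _) _.
  by rewrite size_polyXn addSn /= subnK.
rewrite ltn_neqAle hle andbT; apply/eqP => hs.
have : lead_coef h = 0.
  rewrite lead_coefE hs /h coefB coef_sum -lead_coefE Ec size_map size_iota.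
  rewrite [X in _ - X](_ : _ = \sum_(k < m) c k * (lc m)`_k) ?subrr //.
  apply: eq_bigr => k _.
  have km : (size (g k) <= size (g m))%N by rewrite gmono // ltnW.
  rewrite -mulrA coefCM coefXnM /lc (nth_map 0%N) ?size_iota // nth_iota // add0n.
  rewrite lead_coefE; congr (_ * _).
  have [gk0|gk0] := posnP (size (g k)).
    have -> : g k = 0 by apply/eqP; rewrite -size_poly_eq0 gk0.
    by rewrite !coef0 if_same.
  have -> : ((size (g m)).-1 < size (g m) - size (g k))%N = false.
    by apply/negbTE; rewrite -leqNgt; lia.
  by congr (_ `_ _); lia.
move/eqP; rewrite lead_coef_eq0 => /eqP h0; apply: nh; rewrite h0.
by case: (span_ideal (S m)).
Qed.

End Noeth.

(** * Linearization of polynomials *)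

Section MpolyNoeth.
Local Open Scope ring_scope.

Lemma mpoly_gen (K : fieldType) k (P : mpoly k K -> Prop) :
  (forall c, P (mpolyC k c)) -> (forall i, P (mpolyX K (mnm1 i))) ->
  (forall p q, P p -> P q -> P (p + q)) -> (forall p q, P p -> P q -> P (p * q)) ->
  forall p, P p.
Proof.
move=> PC PX PD PM p; rewrite [p]mpolyE.
have P0 : P 0 by have := PC 0; rewrite mpolyC0.
have P1 : P 1 by have := PC 1; rewrite mpolyC1.
apply: big_ind; [exact: P0 | exact: PD | move=> m _]; rewrite -mul_mpolyC; apply: (PM _ _) => //.
rewrite mpolyXE_id; apply: big_ind; [exact: P1 | exact: PM | move=> i _].
have PXe e : P (mpolyX K (mnm1 i) ^+ e) by elim: e => [|e IH]; rewrite ?expr0 // exprS; apply: (PM _ _).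
exact: PXe.
Qed.

(** The last variable is adjoined as a polynomial variable over the ring in the others. *)
Lemma mpoly_noetherian (K : fieldType) k : noetherian (mpoly k K).
Proof.
elim: k => [|k IH].
  apply: (@noetherian_surj K _ (@mpolyC 0 K : {rmorphism _ -> _})); last exact: noetherian_field.
  apply: mpoly_gen => [c|[]//|p q [a <-] [b <-]|p q [a <-] [b <-]]; first by exists c.
    by exists (a + b); rewrite rmorphD.
  by exists (a * b); rewrite rmorphM.
pose f := (horner_eval (mpolyX K (mnm1 (@ord_max k))) \o
   map_poly (@mwiden k K) : {rmorphism {poly mpoly k K} -> mpoly k.+1 K}).
apply: (@noetherian_surj _ _ f); last exact: noetherian_poly.
apply: mpoly_gen => [c|i|p q [a <-] [b <-]|p q [a <-] [b <-]].
- by exists (mpolyC k c)%:P; rewrite /f /= /horner_eval map_polyC /= hornerC mwidenC.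
- case: (unliftP ord_max i) => [j ->|->]; last first.
    by exists 'X; rewrite /f /= /horner_eval map_polyX hornerX.
  exists (mpolyX K (mnm1 j))%:P; rewrite /f /= /horner_eval map_polyC /= hornerC mwidenX mnmwiden1.
  by congr (mpolyX _ (mnm1 _)); apply: val_inj; rewrite /= /bump leqNgt ltn_ord.
- by exists (a + b); rewrite rmorphD.
- by exists (a * b); rewrite rmorphM.
Qed.
End MpolyNoeth.

(** * Polynomial functions as matrix coefficients *)

Section Lin.
Local Open Scope classical_set_scope.
Local Open Scope ring_scope.

(** The extra fixed basis vector contributes an entry equal to 1, so that products of d entries of
    [lft g] include all monomials of degree at most d in the entries of g. *)
Definition lft {A : comNzRingType} {n} (g : 'M[A]_n) : 'M[A]_(1 + n) := block_mx 1%:M 0 0 g.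
Definition rho {A : comNzRingType} (d : nat) {n} (g : 'M[A]_n) := tpow d (lft g).
Definition drho {A : comNzRingType} (d : nat) {n} (X : 'M[A]_n) := dtens d (block_mx 0 0 0 X : 'M[A]_(1 + n)).

Lemma lftM (A : comNzRingType) n (g h : 'M[A]_n) : lft (g *m h) = lft g *m lft h.
Proof. by rewrite /lft mulmx_block !mulmx0 !mul0mx !addr0 !add0r mulmx1. Qed.

Lemma lft1 (A : comNzRingType) n : lft (1%:M : 'M[A]_n) = 1%:M.
Proof. by rewrite /lft -scalar_mx_block. Qed.

Lemma rhoM (A : comNzRingType) d n (g h : 'M[A]_n) : rho d (g *m h) = rho d g *m rho d h.
Proof. by rewrite /rho lftM tpowM. Qed.

Lemma rho1 (A : comNzRingType) d n : rho d (1%:M : 'M[A]_n) = 1%:M.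
Proof. by rewrite /rho lft1 tpow1. Qed.

Lemma map_tpow (A B : comNzRingType) (f : {rmorphism A -> B}) k n m (g : 'M[A]_(n, m)) :
  map_mx f (tpow k g) = tpow k (map_mx f g).
Proof. by apply/matrixP=> i j; rewrite !mxE rmorph_prod; apply: eq_bigr => l _; rewrite !mxE. Qed.

Lemma map_rho (A B : comNzRingType) (f : {rmorphism A -> B}) d n (g : 'M[A]_n) :
  map_mx f (rho d g) = rho d (map_mx f g).
Proof. by rewrite /rho map_tpow /lft map_block_mx map_mx1 !map_mx0. Qed.

Variables (K C : fieldType) (iota : {rmorphism K -> C}) (n : nat).

(** Polynomials over K of degree at most d, as matrix coefficients of [rho d]. Linearity in [Phi]
    lets vanishing conditions be treated by linear algebra. *)
Definition lin (d : nat) (f : 'M[C]_n -> C) : Prop :=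
  exists Phi : 'M[K]_(tdim (1 + n) d), forall g, f g = \tr (map_mx iota Phi *m rho d g).

Lemma lin_ext d f h : f =1 h -> lin d f -> lin d h.
Proof. by move=> fh [Phi H]; exists Phi => g; rewrite -fh. Qed.

Lemma lin_sum d (I : Type) (r : seq I) (P : pred I) (F : I -> 'M[C]_n -> C) :
  (forall i, P i -> lin d (F i)) -> lin d (fun g => \sum_(i <- r | P i) F i g).
Proof.
move=> h; elim: r => [|i r [Phi IH]].
  by exists 0 => g; rewrite big_nil map_mx0 mul0mx mxtrace0.
have [Pi|nPi] := boolP (P i); last by exists Phi => g; rewrite big_cons (negPf nPi) IH.
have [Psi HP] := h i Pi; exists (Psi + Phi) => g.
by rewrite big_cons Pi IH HP map_mxD mulmxDl mxtraceD.
Qed.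

Lemma linZ d c f : lin d f -> lin d (fun g => iota c * f g).
Proof.
by move=> [Phi H]; exists (c *: Phi) => g; rewrite H map_mxZ -scalemxAl mxtraceZ.
Qed.

Lemma lin_entry d (a b : {ffun 'I_d -> 'I_(1 + n)}) :
  lin d (fun g => \prod_(l < d) lft g (a l) (b l)).
Proof.
exists (delta_mx (enum_rank b) (enum_rank a)) => g.
rewrite map_delta_mx -(mul_delta_mx (0 : 'I_1)) -mulmxA mxtrace_mulC -rowE -colE trace_mx11.
by rewrite !mxE /tidx !enum_rankK.
Qed.

Lemma lin_seq (s : seq ('I_(1 + n) * 'I_(1 + n))) d : size s = d ->
  lin d (fun g => \prod_(x <- s) lft g x.1 x.2).
Proof.
move=> sd; have x0 : 'I_(1 + n) * 'I_(1 + n) := (ord0, ord0).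
apply: lin_ext (lin_entry [ffun l : 'I_d => (nth x0 s l).1] [ffun l : 'I_d => (nth x0 s l).2]).
move=> g; rewrite [RHS](big_nth x0) big_mkord sd.
by apply: eq_bigr => l _; rewrite !ffunE.
Qed.

Lemma lft00 (A : comNzRingType) (g : 'M[A]_n) : lft g ord0 ord0 = 1.
Proof.
rewrite /lft mxE; case: splitP => [i _|//]; rewrite mxE; case: splitP => [j _|//].
by rewrite mxE !ord1 eqxx.
Qed.

(** A product is lengthened by the entry of [lft g] that equals 1. *)
Lemma lin_pad (s : seq ('I_(1 + n) * 'I_(1 + n))) d : (size s <= d)%N ->
  lin d (fun g => \prod_(x <- s) lft g x.1 x.2).
Proof.
move=> sd; apply: lin_ext (@lin_seq (s ++ nseq (d - size s) (ord0, ord0)) d _); last first.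
  by rewrite size_cat size_nseq subnKC.
move=> g; rewrite big_cat /= [X in _ * X]big1_seq ?mulr1 // => x.
by move=> /andP [_]; rewrite mem_nseq => /andP [_ /eqP ->]; rewrite lft00.
Qed.

Lemma lin_mono d e f : (d <= e)%N -> lin d f -> lin e f.
Proof.
move=> de [Phi H].
apply: (@lin_ext _ (fun g => \sum_a \sum_b iota (Phi a b) *
   \prod_(x <- [seq (tidx b l, tidx a l) | l <- enum 'I_d]) lft g x.1 x.2)).
  move=> g; rewrite H /mxtrace; apply: eq_bigr => a _; rewrite mxE; apply: eq_bigr => b _.
  by rewrite !mxE big_map -[in RHS]big_enum.
apply: lin_sum => a _; apply: lin_sum => b _; apply: linZ.
by apply: lin_pad; rewrite size_map size_enum_ord.
Qed.

Lemma lin_poly (p : mpoly (n * n) K) : exists d, lin d (fun g => eval_at iota p g).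
Proof.
pose fac (k : 'I_(n * n)) : seq ('I_(1 + n) * 'I_(1 + n)) :=
  [:: (rshift 1 (enum_val (cast_ord (esym (mxvec_cast n n)) k)).1,
       rshift 1 (enum_val (cast_ord (esym (mxvec_cast n n)) k)).2)].
have facE k (g : 'M[C]_n) : \prod_(x <- fac k) lft g x.1 x.2 = mxvec g 0 k.
  rewrite big_seq1 /= block_mxEdr.
  by case/mxvec_indexP: k => i j; rewrite mxvecE /mxvec_index cast_ordK enum_rankK.
pose s (m : multinom (n * n)) := flatten [seq flatten (nseq (m k) (fac k)) | k <- enum 'I_(n * n)].
exists (\sum_(m <- msupp p) size (s m))%N.
have : forall r : seq (multinom (n * n)), lin (\sum_(m <- r) size (s m))%N
    (fun g => \sum_(m <- r) iota (mcoeff m p) * mmap1 (fun i => mxvec g 0 i) m).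
  elim=> [|m r IH]; first by exists 0 => g; rewrite [LHS]big_nil map_mx0 mul0mx mxtrace0.
  rewrite big_cons.
  have lm : lin (size (s m) + \sum_(m0 <- r) size (s m0))%N
       (fun g => iota (mcoeff m p) * mmap1 (fun i => mxvec g 0 i) m).
    apply: linZ; apply: lin_ext (lin_pad (leq_addr _ (size (s m)))) => g.
    rewrite /s /mmap1 big_flatten big_map big_enum /=; apply: eq_bigr => k _.
    rewrite big_flatten big_nseq; elim: (m k) => [|e IHe] /=; first by rewrite expr0.
    by rewrite IHe exprS facE.
  have lr := lin_mono (leq_addl (size (s m)) _) IH.
  have [Phi H1] := lm; have [Psi H2] := lr; exists (Phi + Psi) => g.
  by rewrite big_cons map_mxD mulmxDl mxtraceD -H1 -H2.
by move=> /(_ (msupp p)); apply: lin_ext => g.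
Qed.

Lemma poly_lin d f : lin d f -> exists p : mpoly (n * n) K, forall g, f g = eval_at iota p g.
Proof.
move=> [Phi H].
pose gen : 'M[mpoly (n * n) K]_n := \matrix_(i, j) mpolyX K (mnm1 (mxvec_index i j)).
exists (\tr (map_mx (@mpolyC (n * n) K) Phi *m rho d gen)) => g.
rewrite H /eval_at.
pose e := (mmap iota (fun i => mxvec g 0 i) : {rmorphism mpoly (n * n) K -> C}).
have -> : mmap iota (fun i => mxvec g 0 i) (\tr (map_mx (@mpolyC (n * n) K) Phi *m rho d gen)) =
   e (\tr (map_mx (@mpolyC (n * n) K) Phi *m rho d gen)) by [].
rewrite -trace_map_mx map_mxM map_rho; congr (\tr (_ *m rho d _)).
  by apply/matrixP=> i j; rewrite !mxE /= mmapC.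
by apply/matrixP=> i j; rewrite !mxE /= mmapX mmap1U mxvecE.
Qed.

Lemma lin_common (s : seq (mpoly (n * n) K)) : exists d, forall p, p \in s ->
  lin d (fun g => eval_at iota p g).
Proof.
elim: s => [|p s [d hd]]; first by exists 0%N.
have [e he] := lin_poly p; exists (maxn d e) => q; rewrite inE => /orP [/eqP ->|/hd].
  by apply: lin_mono he; rewrite leq_maxr.
by apply: lin_mono; rewrite leq_maxl.
Qed.

Lemma eval_at_sum (p : mpoly (n * n) K) s g : span_of s p ->
  (forall q, q \in s -> eval_at iota q g = 0) -> eval_at iota p g = 0.
Proof.
move=> [c ->] h; rewrite /eval_at.
pose e := (mmap iota (fun i => mxvec g 0 i) : {rmorphism mpoly (n * n) K -> C}).
rewrite -[LHS]/(e _) rmorph_sum big1 // => k _; rewrite rmorphM /=.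
by have := h _ (mem_nth 0 (ltn_ord k)); rewrite /eval_at => ->; rewrite mulr0.
Qed.

(** By the basis theorem finitely many equations suffice, so a single degree d accommodates all of
    them. *)
Lemma zclosed_lin (S : set 'M[C]_n) : zclosed_over iota S ->
  exists d (J : set 'M[K]_(tdim (1 + n) d)),
    S = [set g | g \in unitmx /\ forall Phi, J Phi -> \tr (map_mx iota Phi *m rho d g) = 0].
Proof.
move=> [I ->].
pose II : set (mpoly (n * n) K) := [set p | exists s, (forall q, q \in s -> I q) /\ span_of s p].
have iII : is_ideal II.
  split; first by exists [::]; split=> //; exists (fun=> 0); rewrite big_ord0.
    move=> p q [s [sI ps]] [t [tI qt]]; exists (s ++ t); split.
      by move=> x; rewrite mem_cat => /orP [/sI|/tI].
    have [_ D _] := span_ideal (s ++ t).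
    apply: D; [apply: span_sub ps | apply: span_sub qt]; try exact: span_ideal.
      by move=> x xs; apply: span_mem; rewrite mem_cat xs.
    by move=> x xt; apply: span_mem; rewrite mem_cat xt orbT.
  move=> a p [s [sI ps]]; exists s; split=> //.
  by have [_ _ M] := span_ideal s; apply: M.
have [s [sI Is]] := mpoly_noetherian iII.
have [d hd] := lin_common s.
exists d, [set Phi | exists2 p, p \in s & forall g, eval_at iota p g = \tr (map_mx iota Phi *m rho d g)].
apply/seteqP; split=> g [ug hg]; split=> //.
  move=> Phi [p ps <-]; have [t [tI pt]] := sI _ ps.
  by apply: eval_at_sum pt _ => q /tI; apply: hg.
move=> p Ip; have /Is : II p.
  exists [:: p]; split; first by move=> q; rewrite inE => /eqP ->.
  by apply: span_mem; rewrite inE.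
move=> /eval_at_sum; apply=> q qs; have [Phi HP] := hd _ qs.
by rewrite HP; apply: hg; exists q.
Qed.

End Lin.

(** * Compactness criteria in the coset space *)

Section ArithPart.
Import numFieldNormedType.Exports.
Section Arith.
Local Open Scope classical_set_scope.
Local Open Scope ring_scope.

(** * Continuity and auxiliary bounds *)

Section Cont.
Variables (R : realType) (n m : nat).
Implicit Types f : 'M[R]_(n, m) -> R.

Lemma cont_sum (I : Type) (r : seq I) (F : I -> 'M[R]_(n, m) -> R) :
  (forall i, continuous (F i)) -> continuous (fun g => \sum_(i <- r) F i g).
Proof.
move=> h; elim: r => [|i r IH] g.
  rewrite (_ : (fun _ => _) = (fun=> 0)); first exact: cst_continuous.
  by apply/funext => x; rewrite big_nil.
rewrite (_ : (fun _ => _) = F i \+ (fun g => \sum_(i <- r) F i g)).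
  exact: (cvgD (h i g) (IH g)).
by apply/funext => x; rewrite big_cons.
Qed.

Lemma cont_prod (I : Type) (r : seq I) (F : I -> 'M[R]_(n, m) -> R) :
  (forall i, continuous (F i)) -> continuous (fun g => \prod_(i <- r) F i g).
Proof.
move=> h; elim: r => [|i r IH] g.
  rewrite (_ : (fun _ => _) = (fun=> 1)); first exact: cst_continuous.
  by apply/funext => x; rewrite big_nil.
rewrite (_ : (fun _ => _) = F i \* (fun g => \prod_(i <- r) F i g)).
  exact: (cvgM (h i g) (IH g)).
by apply/funext => x; rewrite big_cons.
Qed.

Lemma cont_eps f g e : continuous f -> 0 < e -> exists2 d, 0 < d &
  forall g', nrm (g' - g) < d -> `|f g' - f g| < e.
Proof.
move=> cf e0; have /cvgrPdist_lt /(_ e e0) := cf g.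
move=> /nbhs_mxP [d d0 hd]; exists d => // g' /hd /=.
by rewrite distrC.
Qed.

Lemma cont_mx_eps p q (F : 'M[R]_(n, m) -> 'M[R]_(p, q)) g e :
  (forall i j, continuous (fun g => F g i j)) -> 0 < e -> exists2 d, 0 < d &
  forall g', nrm (g' - g) < d -> nrm (F g' - F g) < e.
Proof.
move=> cF e0; pose e' := e / (p * q).+1%:R; have e'0 : 0 < e' by rewrite divr_gt0.
have [d d0 hd] : exists2 d, 0 < d & forall i j g', nrm (g' - g) < d -> `|F g' i j - F g i j| < e'.
  pose D (x : 'I_p * 'I_q) := s2val (cid2 (@cont_eps (fun g => F g x.1 x.2) g e' (cF x.1 x.2) e'0)).
  have D0 x : 0 < D x by rewrite /D; case: cid2.
  exists (\big[Num.min/1]_x D x).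
    by elim/big_ind: _ => // x y x0 y0; rewrite lt_min x0.
  move=> i j g' hg'.
  have := s2valP' (cid2 (@cont_eps (fun g => F g i j) g e' (cF i j) e'0)); apply.
  by apply: lt_le_trans hg' _; apply: (bigmin_le_cond _ (j := (i, j))).
exists d => // g' hg'; apply: (@le_lt_trans _ _ ((p * q)%:R * e')).
  by apply: nrm_le => i j; rewrite !mxE ltW // hd.
by rewrite /e' mulrCA -[ltRHS]mulr1 ltr_pM2l // ltr_pdivrMr // mul1r ltr_nat.
Qed.

Lemma nrm_tpow k (A : 'M[R]_(n, m)) : nrm (tpow k A) <= (tdim n k * tdim m k)%:R * nrm A ^+ k.
Proof.
apply: nrm_le => i j; rewrite mxE normr_prod.
rewrite -[X in _ <= _ ^+ X](card_ord k) -prodr_const; apply: ler_prod => l _.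
by rewrite normr_ge0 nrm_entry.
Qed.
End Cont.

Lemma cont_det (R : realType) n : continuous (fun g : 'M[R]_n => \det g).
Proof.
rewrite (_ : (fun _ => _) = (fun g : 'M[R]_n => \sum_(s <- index_enum {perm 'I_n})
   \prod_(o <- None :: map Some (index_enum (ordinal n))) (if o is Some i then g i (s i) else (-1) ^+ s))).
  apply: cont_sum => s; apply: cont_prod => -[i|]; first exact: coord_continuous.
  exact: cst_continuous.
by apply/funext => g; apply: eq_bigr => s _; rewrite big_cons big_map.
Qed.

Lemma finite_index_reps (F : fieldType) n (K S : set 'M[F]_n) : K 1%:M -> finite_index K S ->
  exists s : seq 'M[F]_n, (forall r, r \in s -> S r) /\
    forall g, S g -> exists2 r, r \in s & exists2 k, K k & g = r *m k.
Proof.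
move=> K1 [N /card_esym/ppcard_eqP [f]].
have P (i : 'I_N) : exists r, S r /\ lcoset_mx K r = f i.
  have : (lcoset_mx K @` S) (f i) by apply: funS; rewrite /= ltn_ord.
  by case=> r Sr <-; exists r.
pose r i := sval (cid (P i)).
exists [seq r i | i <- enum 'I_N]; split.
  by move=> _ /mapP [i _ ->]; case: (svalP (cid (P i))).
move=> g Sg; have [i iN fi] : (f @` `I_N) (lcoset_mx K g) by rewrite image_eq; exists g.
have [Sr Er] := svalP (cid (P (Ordinal iN))).
exists (r (Ordinal iN)); first by apply: map_f; rewrite mem_enum.
have : lcoset_mx K (r (Ordinal iN)) g.
  by rewrite Er fi; exists 1%:M; rewrite ?mulmx1.
by case=> k Kk <-; exists k.
Qed.

(** An independent family of maximal length inside P spans P. This converts subspaces given by a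
    property into row spaces. *)
Lemma subspace_basis (F : fieldType) m (P : set 'rV[F]_m) :
  P 0 -> (forall c u v, P u -> P v -> P (c *: u + v)) ->
  exists k (B : 'M[F]_(k, m)), row_free B /\ forall v, P v <-> (v <= B)%MS.
Proof.
move=> P0 PL.
pose Q k := exists B : 'M[F]_(k, m), row_free B /\ forall i, P (row i B).
have Qm k : Q k -> (k <= m)%N by case=> B [/eqP fB _]; move: (rank_leq_col B); rewrite fB.
have exQ : exists k, `[< Q k >].
  by exists 0%N; apply/asboolP; exists 0; split=> [|[]//]; rewrite /row_free mxrank0.
have ubQ k : `[< Q k >] -> (k <= m)%N by move=> /asboolP /Qm.
case: (ex_maxnP exQ ubQ) => k /asboolP [B [fB PB]] kmax; exists k, B; split=> // v.
split=> [Pv|/submxP [D ->]]; last first.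
  rewrite mulmx_sum_row; elim/big_ind: _ => // [x y Px Py|i _].
    by rewrite -[x]scale1r; apply: PL.
  by rewrite -[X in P X]addr0; apply: PL.
apply/negPn/negP => nle; suff /asboolP/kmax : Q k.+1 by rewrite ltnn.
exists (col_mx v B); split.
  rewrite -row_leq_rank; apply: (@leq_trans (\rank (v + B)%MS)); last first.
    by rewrite (addsmxE v B).
  have : (\rank B < \rank (v + B)%MS)%N.
    by apply: rank_ltmx; rewrite /ltmx addsmxSr addsmx_sub (negPf nle).
  by rewrite (eqP fB).
move=> i; case: (@fintype.split_ordP 1 k i) => j ->.
  exact: (eq_ind _ P Pv _ (esym (etrans (@rowKu _ 1 k m j v B) (row_id j v)))).
exact: (eq_ind _ P (PB j) _ (esym (@rowKd _ 1 k m j v B))).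
Qed.

Lemma le_seq_sum (F : numDomainType) (T : eqType) (s : seq T) (f : T -> F) x :
  (forall y, 0 <= f y) -> x \in s -> f x <= \sum_(y <- s) f y.
Proof.
move=> f0 xs; rewrite (perm_big _ (perm_to_rem xs)) big_cons /= lerDl.
by apply: sumr_ge0.
Qed.

(** Bernoulli's inequality makes the powers of a number above 1 unbounded. *)
Lemma bounded_pow_le1 (F : realType) (x b : F) : 0 <= x -> (forall m, x ^+ m <= b) -> x <= 1.
Proof.
move=> x0 h; rewrite leNgt; apply/negP => x1.
have B m : 1 + m%:R * (x - 1) <= x ^+ m.
  elim: m => [|m IH]; first by rewrite mul0r addr0 expr0.
  rewrite exprS; apply: (@le_trans _ _ (x * (1 + m%:R * (x - 1)))).
    have m0 : 0 <= m%:R * (x - 1) ^+ 2 by rewrite mulr_ge0 ?sqr_ge0.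
    rewrite -natr1; move: m0; lra.
  by rewrite ler_wpM2l.
pose m := Num.Def.archi_bound (`|b| / (x - 1)).
have d0 : 0 < x - 1 by rewrite subr_gt0.
have : `|b| / (x - 1) < m%:R by apply: archi_boundP; rewrite divr_ge0 // ltW.
rewrite ltr_pdivrMr // => lt; have := le_trans (B m) (h m).
have := ler_norm b; lra.
Qed.

Lemma cont_linear (R : realType) p q n1 n2 n3 n4 (L : {linear 'M[R]_(n1, n2) -> 'M[R]_(n3, n4)})
    (f : 'M[R]_(p, q) -> 'M[R]_(n1, n2)) :
  (forall i j, continuous (fun g => f g i j)) -> forall i j, continuous (fun g => L (f g) i j).
Proof.
move=> cf i j.
rewrite (_ : (fun _ => _) = (fun g => \sum_(a <- index_enum 'I_n1) \sum_(b <- index_enum 'I_n2)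
    \prod_(o <- [:: true; false]) (if o then f g a b else L (delta_mx a b) i j))).
  apply: cont_sum => a; apply: cont_sum => b; apply: cont_prod => o.
  by case: o; [exact: cf | exact: cst_continuous].
apply/funext => g; rewrite {1}[f g]matrix_sum_delta linear_sum summxE; apply: eq_bigr => a _.
rewrite linear_sum summxE; apply: eq_bigr => b _.
by rewrite linearZ mxE !big_cons big_nil mulr1.
Qed.

Lemma cont_tpow_comp (R : realType) p q n m (f : 'M[R]_(p, q) -> 'M[R]_(n, m)) k :
  (forall i j, continuous (fun g => f g i j)) -> forall i j, continuous (fun g => tpow k (f g) i j).
Proof.
move=> cf i j.
rewrite (_ : (fun _ => _) =
    (fun g => \prod_(l <- index_enum (ordinal k)) f g (tidx i l) (tidx j l))).
  by apply: cont_prod => l; apply: cf.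
by apply/funext => g; rewrite mxE.
Qed.

Lemma cont_lft (R : realType) n i j : continuous (fun g : 'M[R]_n => lft g i j).
Proof.
rewrite /lft; case: (fintype.split_ordP i) => k ->; case: (fintype.split_ordP j) => l ->.
- under eq_fun do rewrite block_mxEul; exact: cst_continuous.
- under eq_fun do rewrite block_mxEur; exact: cst_continuous.
- under eq_fun do rewrite block_mxEdl; exact: cst_continuous.
- under eq_fun do rewrite block_mxEdr; exact: coord_continuous.
Qed.

Lemma nrm_lft (R : realType) n (A : 'M[R]_n) : nrm (lft A) <= ((1 + n) * (1 + n))%:R * (1 + nrm A).
Proof.
apply: nrm_le => i j; rewrite /lft.
case: (fintype.split_ordP i) => k ->; case: (fintype.split_ordP j) => l ->.
- by rewrite block_mxEul mxE !ord1 eqxx normr1 lerDl nrm_ge0.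
- by rewrite block_mxEur mxE normr0 addr_ge0 ?nrm_ge0.
- by rewrite block_mxEdl mxE normr0 addr_ge0 ?nrm_ge0.
- by rewrite block_mxEdr (le_trans (nrm_entry _ _ _)) // lerDr.
Qed.

Lemma nrm_linear (R : realType) n1 n2 n3 n4 (L : {linear 'M[R]_(n1, n2) -> 'M[R]_(n3, n4)}) :
  exists2 c, 0 <= c & forall A, nrm (L A) <= c * nrm A.
Proof.
pose c := \sum_a \sum_b nrm (L (delta_mx a b)).
exists c => [|A].
  by apply: sumr_ge0 => a _; apply: sumr_ge0 => b _; apply: nrm_ge0.
rewrite {1}[A]matrix_sum_delta linear_sum; apply: le_trans (nrm_sum _ _ _) _.
rewrite mulr_suml; apply: ler_sum => a _; rewrite linear_sum; apply: le_trans (nrm_sum _ _ _) _.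
rewrite mulr_suml; apply: ler_sum => b _; rewrite linearZ nrmZ mulrC.
by rewrite ler_wpM2l ?nrm_ge0 ?nrm_entry.
Qed.

Lemma int_mx (R : realType) m n (A : 'M[R]_(m, n)) : (forall i j, A i j \is a Num.int) ->
  exists Z : 'M[int]_(m, n), A = imx R Z.
Proof.
move=> h; exists (map_mx Num.floor A); apply/matrixP=> i j.
by rewrite !mxE floorK.
Qed.

Lemma imx_inj (F : numFieldType) m n : injective (@imx F m n).
Proof. by move=> A B /matrixP E; apply/matrixP=> i j; have := E i j; rewrite !mxE => /intr_inj. Qed.

Lemma integral_pointsP (R : realType) n (G : mxgroup R[i] n) k : integral_points G k ->
  exists2 Z : 'M[int]_n, Z \in unitmx & k = imx R Z.
Proof.
case=> /mxgroup_unit uk h.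
have [Z EZ] := int_mx (fun i j => (h i j).1); have [Y EY] := int_mx (fun i j => (h i j).2).
exists Z => //; have /mulmx1_unit [//] : Z *m Y = 1%:M.
apply: (@imx_inj R); rewrite imxM -EZ -EY mulmxV //.
by apply/matrixP=> i j; rewrite !mxE; case: eqP.
Qed.

Lemma row_free_col_mx1 (F : fieldType) k m (v : 'rV[F]_m) (B : 'M[F]_(k, m)) :
  row_free B -> ~~ (v <= B)%MS -> row_free (col_mx v B).
Proof.
move=> fB nle; rewrite -row_leq_rank; apply: (@leq_trans (\rank (v + B)%MS)); last first.
  by rewrite (addsmxE v B).
have : (\rank B < \rank (v + B)%MS)%N.
  by apply: rank_ltmx; rewrite /ltmx addsmxSr addsmx_sub (negPf nle).
by rewrite (eqP fB).
Qed.

Lemma minor_col_mx1 (F : fieldType) k m (v : 'rV[F]_m) (A B : 'M[F]_(k, m)) f :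
  minors A = minors B -> minor (col_mx v A) f = minor (col_mx v B) f.
Proof.
move=> AB; rewrite /minor !(expand_det_row _ ord0); apply: eq_bigr => j _.
rewrite /cofactor; congr (_ * (_ * _)).
  rewrite ![colsub _ _ _ _]mxE (_ : ord0 = lshift k (ord0 : 'I_1)); last exact: val_inj.
  exact: etrans (@col_mxEu _ 1 k m v A ord0 (f j)) (esym (@col_mxEu _ 1 k m v B ord0 (f j))).
have E (C : 'M[F]_(k, m)) :
    row' ord0 (col' j (colsub f (col_mx v C))) = colsub (fun x => f (lift j x)) C.
  apply/matrixP=> x y; rewrite ![LHS]mxE (_ : lift ord0 x = rshift 1 x); last exact: val_inj.
  by rewrite (_ : fintype.split (rshift 1 x) = inr x) ?mxE //; exact: (unsplitK (inr x)).
have := minors_minor A (fun x => f (lift j x)); have := minors_minor B (fun x => f (lift j x)).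
by rewrite /minor !E AB => -> ->.
Qed.

(** If a row of A lay outside the row space of B, adjoining it to B would give an independent
    family. The minors of that family depend on B only through [minors B], so they agree with those
    of A with one of its rows repeated, which vanish. *)
Lemma minors_submx (F : fieldType) k m (A B : 'M[F]_(k, m)) :
  row_free B -> minors A = minors B -> (A <= B)%MS.
Proof.
move=> fB AB; apply/row_subP => i; apply/negPn/negP => nle.
have [f] := row_free_minor (row_free_col_mx1 fB nle).
rewrite -(minor_col_mx1 _ f AB) => /minor_row_free fr.
have : row_mx 1%:M (- delta_mx 0 i) *m col_mx (row i A) A = 0 :> 'rV_m.
  by rewrite mul_row_col mul1mx mulNmx -rowE subrr.
rewrite -[RHS](mul0mx _ (col_mx (row i A) A)) => /(row_free_inj fr).
rewrite -[RHS]row_mx0 => /eq_row_mx [/matrixP/(_ 0 0)/eqP].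
by rewrite !mxE oner_eq0.
Qed.

Lemma det_bound (F : numFieldType) m (A : 'M[F]_m) c : (forall i j, `|A i j| <= c) ->
  `|\det A| <= (m`!)%:R * c ^+ m.
Proof.
move=> h; apply: le_trans (ler_norm_sum _ _ _) _.
apply: (@le_trans _ _ (\sum_(s : {perm 'I_m}) c ^+ m)).
  apply: ler_sum => s _; rewrite normrM normrX normrN1 expr1n mul1r normr_prod.
  rewrite -[X in _ <= _ ^+ X](card_ord m) -prodr_const; apply: ler_prod => i _.
  by rewrite normr_ge0 h.
by rewrite sumr_const card_Sn mulr_natl.
Qed.

Lemma inv_bound (F : realType) m (c : F) : exists b, forall A : 'M[F]_m,
  `|\det A| = 1 -> nrm A <= c -> nrm (invmx A) <= b.
Proof.
exists ((m * m)%:R * ((m.-1)`!%:R * c ^+ m.-1)) => A dA nA.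
have uA : A \in unitmx by rewrite unitmxE unitfE -normr_gt0 dA.
rewrite /invmx uA nrmZ normrV -?unitmxE // dA invr1 mul1r; apply: nrm_le => i j.
rewrite mxE /cofactor normrM normrX normrN1 expr1n mul1r; apply: det_bound => x y.
by rewrite !mxE; apply: le_trans nA; apply: nrm_entry.
Qed.

Lemma cont_limit (F : realType) m p (f : 'M[F]_(m, p) -> F) (S : set 'M[F]_(m, p)) M c :
  continuous f -> (forall e, 0 < e -> exists2 g, S g & nrm (g - M) < e) ->
  (forall g, S g -> f g = c) -> f M = c.
Proof.
move=> cf lim fc; apply/eqP; rewrite eq_sym -subr_eq0 -normr_le0 leNgt; apply/negP => e0.
have [d d0 hd] := cont_eps M cf e0.
by have [g Sg /hd] := lim _ d0; rewrite fc // ltxx.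
Qed.

Lemma inord_absz_inj (x y : int) b : (absz x <= b)%N -> (absz y <= b)%N ->
  inord (absz (x + b%:Z)) = inord (absz (y + b%:Z)) :> 'I_(2 * b).+1 -> x = y.
Proof.
move=> hx hy; have x0 : 0 <= x + b%:Z by lia. have y0 : 0 <= y + b%:Z by lia.
have xb : (absz (x + b%:Z)%R < (2 * b).+1)%N by lia.
have yb : (absz (y + b%:Z)%R < (2 * b).+1)%N by lia.
move=> /(congr1 val) /=; rewrite !inordK // => /(congr1 Posz).
by rewrite !gez0_abs // => /addIr.
Qed.

(** The finiteness of the set of integral vectors with bounded entries, in the form of a code that
    is injective on them. *)
Lemma bounded_int_row_code m b : exists (T : finType) (code : 'rV[int]_m -> T),
  forall x y : 'rV[int]_m, (forall a, (absz (x 0%R a) <= b)%N) ->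
    (forall a, (absz (y 0%R a) <= b)%N) -> code x = code y -> x = y.
Proof.
exists {ffun 'I_m -> 'I_(2 * b).+1}, (fun x => [ffun a => inord (absz (x 0 a + b%:Z))]).
move=> x y hx hy /ffunP E; apply/rowP=> a; have := E a; rewrite !ffunE.
exact: inord_absz_inj.
Qed.

(** * Reduction theory for the arithmetic lattice *)

Section Reduction.
Variables (R : realType) (n : nat) (G : mxgroup R[i] n) (Gamma : mxgroup R n).
Hypothesis G_Q : zclosed_over iotaQ G.
Hypothesis arith : arithmetic_lattice G Gamma.
Local Notation Gr := (rpoints G).
Local Notation K := (mxset Gamma `&` integral_points G).

Lemma arith_sub : Gamma `<=` Gr. Proof. by have [[]] := arith. Qed.

Lemma integral1 : integral_points G 1%:M.
Proof.
split; first exact: mxgroup1.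
by move=> i j; rewrite invmx1 mxE; case: eqP.
Qed.

Lemma integralV k : integral_points G k -> integral_points G (invmx k).
Proof.
move=> [Gk h]; split; first exact: mxgroupV.
by move=> i j; rewrite invmxK; have [] := h i j.
Qed.

Lemma gamma_reps : exists s : seq 'M[R]_n, (forall r, r \in s -> mxset Gamma r) /\
  forall g, mxset Gamma g -> exists2 r, r \in s & exists2 k, K k & g = r *m k.
Proof.
apply: finite_index_reps; first by split; [exact: mxgroup1 | exact: integral1].
by have [_ []] := arith.
Qed.

Lemma integral_reps : exists s : seq 'M[R]_n, (forall r, r \in s -> integral_points G r) /\
  forall g, integral_points G g -> exists2 r, r \in s & exists2 k, K k & g = r *m k.
Proof.
apply: finite_index_reps; first by split; [exact: mxgroup1 | exact: integral1].
by have [_ []] := arith.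
Qed.

(** The determinant is bounded on Gamma, which is a finite union of translates of unimodular
    matrices, and hence on the whole group. As the bound holds for all powers of g and of its
    inverse, the absolute value is 1. *)
Lemma det_norm1 g : mxset Gr g -> `|\det g| = 1.
Proof.
pose rho1 (g : 'M[R]_n) : 'M[R]_1 := (\det g)%:M.
have nrm1 (x : R) : nrm (x%:M : 'M[R]_1) = `|x| by rewrite /nrm !big_ord1 mxE eqxx.
have [s [sG sP]] := gamma_reps.
have [b Hb] : exists b, forall g, mxset Gr g -> nrm (rho1 g *m (1%:M : 'M[R]_1)) <= b.
  apply: (@orbit_bounded R n Gr Gamma (proj1 arith) 1 rho1 _ _ _ _ (\sum_(r <- s) `|\det r|)).
  - by move=> x y; rewrite /rho1 det_mulmx scalar_mxM.
  - by rewrite /rho1 det1.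
  - move=> x e e0; have [d d0 hd] := cont_eps x (@cont_det R n) e0; exists d => // y /hd.
    by rewrite /rho1 -raddfB nrm1.
  - move=> k /sP [r rs [l [_ /integral_pointsP [Z uZ ->]] ->]].
    rewrite mulmx1 /rho1 nrm1 det_mulmx normrM unit_int_norm // mulr1.
    exact: (@le_seq_sum _ _ s (fun r => `|\det r|)).
have le1 h : mxset Gr h -> `|\det h| <= 1.
  move=> Gh; apply: (@bounded_pow_le1 _ _ b) => // m.
  have [h' Gh' <-] : exists2 h', mxset Gr h' & `|\det h'| = `|\det h| ^+ m.
    elim: m => [|m [h' Gh' E]]; first by exists 1%:M; [exact: mxgroup1 | rewrite det1 normr1].
    by exists (h *m h'); [exact: mxgroupM | rewrite det_mulmx normrM E exprS].
  by have := Hb _ Gh'; rewrite mulmx1 nrm1.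
move=> Gg; apply/eqP; rewrite eq_le le1 //=.
have ug := mxgroup_unit Gg.
have := le1 _ (mxgroupV Gg); rewrite det_inv normrV -?unitmxE // invf_le1 //.
by rewrite normr_gt0 -unitfE -unitmxE.
Qed.

(** A bounded representative g0 = g k has [k *m r] integral and unimodular for one of finitely many
    r. So L g^-1 (g0 r) is an integral lattice, of covolume at least 1, while g0 r is bounded. *)
Lemma compact_covolume (C : set (coset_space Gr Gamma)) : compact C ->
  exists2 delta : R, 0 < delta & forall g : points Gr, C (coset_proj Gamma g) ->
    forall i (L : 'M[int]_(i, n)), row_free (imx rat L) ->
      delta <= nrm (minors (imx R L *m invmx (val g))).
Proof.
move=> /(compact_bounded_reps arith_sub) [b Hb].
have [s [sG sP]] := gamma_reps.
pose a := `|b| * \sum_(r <- s) nrm r.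
pose c := 1 + \sum_(i < n.+1) (tdim n i * tdim n i)%:R * a ^+ i.
have a0 : 0 <= a by rewrite mulr_ge0 // sumr_ge0 // => *; apply: nrm_ge0.
have c0 : 0 < c by rewrite ltr_pwDl // sumr_ge0 // => i _; rewrite mulr_ge0 // exprn_ge0.
exists c^-1; first by rewrite invr_gt0.
move=> g /Hb [g0 /(coset_projP Gamma) [k Gk Ek] g0b] i L fL.
have uk := mxgroup_unit Gk; have ug : val g \in unitmx := punit g.
have [r rs [l [Gl Zl] El]] := sP _ (mxgroupV Gk).
have ul := mxgroup_unit Gl; have ur := mxgroup_unit (sG _ rs).
have [Z uZ EZ] := integral_pointsP (integralV Zl).
have i_n : (i <= n)%N by rewrite -(eqP fL) rank_leq_col.
have kr : k *m r = imx R Z.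
  by rewrite -EZ -[k *m r](mulmxK ul) -(mulmxA k) -El mulmxV // mul1mx.
have EL : imx R (L *m Z) = imx R L *m invmx (val g) *m (val g0 *m r).
  by rewrite Ek imxM -kr -!mulmxA mulKmx.
have ge1 : 1 <= nrm (minors (imx R (L *m Z))).
  apply: nrm_minors_ge1; rewrite imxM /row_free mxrankMfree //.
  by rewrite row_free_unit imx_unit.
rewrite -[c^-1]mul1r ler_pdivrMr //; apply: le_trans ge1 _.
rewrite EL minors_tpow; apply: le_trans (nrmM _ _) _; rewrite ler_wpM2l ?nrm_ge0 //.
apply: le_trans (nrm_tpow _ _) _.
rewrite /c (bigD1 (Ordinal (i_n : (i < n.+1)%N))) //= addrCA.
apply: (@le_trans _ _ ((tdim n i * tdim n i)%:R * a ^+ i)); last first.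
  rewrite lerDl addr_ge0 // sumr_ge0 // => j _; rewrite mulr_ge0 // exprn_ge0 //.
rewrite ler_wpM2l // lerXn2r ?nnegrE ?nrm_ge0 //.
apply: le_trans (nrmM _ _) _; rewrite ler_pM ?nrm_ge0 //.
  exact: le_trans g0b (ler_norm _).
by apply: le_seq_sum => // y; apply: nrm_ge0.
Qed.

Lemma rat_complex (x : rat) : @iotaQ R x = iotaR (ratr x : R).
Proof. exact/esym/fmorph_rat. Qed.

Lemma rpoints_lin d (J : set 'M[rat]_(tdim (1 + n) d)) :
  mxset G = [set g | g \in unitmx /\ forall Phi, J Phi -> \tr (map_mx iotaQ Phi *m rho d g) = 0] ->
  mxset Gr = [set g | g \in unitmx /\
    forall Phi, J Phi -> \tr (map_mx (ratr : rat -> R) Phi *m rho d g) = 0].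
Proof.
move=> GE.
have E Phi (g : 'M[R]_n) : \tr (map_mx iotaQ Phi *m rho d (complexify g)) =
    iotaR (\tr (map_mx (ratr : rat -> R) Phi *m rho d g)).
  rewrite /complexify -map_rho -[RHS]trace_map_mx map_mxM -map_mx_comp.
  by congr (\tr (_ *m _)); apply/matrixP=> i j; rewrite !mxE rat_complex.
rewrite [LHS]/= /rpoints /=; apply/seteqP; split=> g /=.
  rewrite GE /= map_unitmx => -[ug h]; split=> // Phi /h; rewrite E => /eqP.
  by rewrite fmorph_eq0 => /eqP.
by rewrite GE /= map_unitmx => -[ug h]; split=> // Phi /h; rewrite E => ->; rewrite rmorph0.
Qed.

Lemma lin_mulmxM (F : comNzRingType) m (A B : 'M[F]_m) :
  lin_mulmx (A *m B) = lin_mulmx B *m lin_mulmx A :> 'M[F]_(m * m).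
Proof.
apply/row_matrixP=> i; rewrite !rowE mulmxA !mul_rV_lin /= mxvecK mulmxA //.
Qed.

Lemma lin_mulmx1 (F : comNzRingType) m : lin_mulmx (1%:M : 'M[F]_m) = 1%:M :> 'M[F]_(m * m).
Proof. by apply/row_matrixP=> i; rewrite !rowE mul_rV_lin /= mul1mx vec_mxK mulmx1. Qed.

(** G is the stabilizer of the space W of its equations of degree d, and the orbit of the Plücker
    vector v of W is bounded. If Z^n g^-1 has no short vector, it has a basis P g^-1 of bounded
    size; then v (P) is integral and bounded, so P is one of finitely many matrices times an
    integral point of G, which corrects g to a bounded representative. *)
Lemma compact_no_short_vectors (e : R) : 0 < e ->
  exists2 C : set (coset_space Gr Gamma), compact C &
    forall g : points Gr,
      (forall x : 'rV[int]_n, x != 0 -> e <= nrm (imx R x *m invmx (val g))) ->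
      C (coset_proj Gamma g).
Proof.
move=> e0; have [d [J GE]] := zclosed_lin G_Q.
have GrE := rpoints_lin GE.
set N := tdim (1 + n) d in J GE GrE.
pose rr : rat -> R := ratr.
(* The rational equations of degree at most d that hold on G; the integral matrix [Z] below has a
   basis of this space as rows. *)
pose W : set 'rV[rat]_(N * N) := [set w | forall g, mxset Gr g ->
  \tr (map_mx rr (vec_mx w) *m rho d g) = 0].
have [|c u v Wu Wv g Gg|k [B0 [fB0 WB0]]] := @subspace_basis rat (N * N) W.
- by move=> g _; rewrite linear0 map_mx0 mul0mx mxtrace0.
- by rewrite linearP /= map_mxD map_mxZ mulmxDl mxtraceD -scalemxAl mxtraceZ Wu // Wv // mulr0 addr0.
have [D [Z [D0 EZ]]] := rat_mx_scale B0.
have WZ w : W w <-> (w <= imx rat Z)%MS.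
  by rewrite WB0 EZ; rewrite eqmx_scale ?intr_eq0.
have fZ : row_free (imx rat Z).
  by move: fB0; rewrite /row_free EZ mxrank_scale_nz ?intr_eq0.
pose lam (g : 'M[R]_n) : 'M[R]_(N * N) := lin_mulmx (rho d g).
have lamM g h : lam (g *m h) = lam h *m lam g by rewrite /lam rhoM lin_mulmxM.
pose lamZ (P : 'M[int]_n) : 'M[int]_(N * N) := lin_mulmx (rho d P).
have map_lam (F : comNzRingType) (P : 'M[int]_n) :
    imx F (lamZ P) = lin_mulmx (rho d (imx F P)) :> 'M[F]_(N * N).
  have ER : map_mx intr (rho d P) = rho d (imx F P) by rewrite map_rho.
  rewrite -ER; apply/row_matrixP=> i; rewrite !rowE mul_rV_lin.
  rewrite -(map_delta_mx (intr : {rmorphism int -> F})) -map_mxM mul_rV_lin map_mxvec.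
  by rewrite map_mxM map_vec_mx.
(* The Plücker vector of the translate of W by g; it is integral when g is. *)
pose v (g : 'M[R]_n) := minors (imx R Z *m lam g).
have vM g h : v (g *m h) = v h *m tpow k (lam g).
  by rewrite /v lamM mulmxA minors_tpow.
have v_int P : v (imx R P) = imx R (minors (Z *m lamZ P)).
  rewrite /v /lam -map_lam -imxM /imx; apply/rowP=> a; rewrite !mxE -det_map_mx.
  by congr (\det _); apply/matrixP=> i j; rewrite !mxE.
have trW (Phi : 'M[rat]_N) (P : 'M[int]_n) (x : 'M[R]_n) :
    \tr (map_mx rr (rho d (imx rat P) *m Phi) *m rho d x) =
    \tr (map_mx rr Phi *m rho d (x *m imx R P)).
  rewrite map_mxM rhoM mulmxA [RHS]mxtrace_mulC mulmxA; congr (\tr (_ *m _ *m _)).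
  rewrite map_rho; congr (rho d _); apply/matrixP=> i j; rewrite !mxE; exact: ratr_int.
have K_line kk : K kk -> exists2 p, v kk = p *: v 1%:M & v kk != 0.
  move=> [_ Zk]; have [P uP EP] := integral_pointsP Zk; have [Gk _] := Zk.
  have sub : (imx rat (Z *m lamZ P) <= imx rat Z)%MS.
    apply/row_subP=> i; apply/WZ => x Gx; rewrite imxM row_mul.
    rewrite map_lam mul_rV_lin mxvecK trW -EP.
    by have /WZ := row_sub i (imx rat Z); apply; apply: mxgroupM.
  have uL : imx rat (lamZ P) \in unitmx.
    rewrite map_lam; apply: (mulmx1_unit (B := lin_mulmx (rho d (invmx (imx rat P)))) _).1.
    by rewrite -lin_mulmxM -rhoM mulVmx ?imx_unit // rho1 lin_mulmx1.
  have fZP : row_free (imx rat (Z *m lamZ P)).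
    by rewrite imxM /row_free mxrankMfree // row_free_unit.
  have [p p0 H] := same_span R fZP sub.
  have := H 1%:M; rewrite !mulmx1 imxM => Hp.
  exists p; first by rewrite /v EP /lam -map_lam Hp rho1 lin_mulmx1 mulmx1.
  rewrite EP v_int -nrm_eq0.
  have h := nrm_minors_ge1 R fZP; rewrite (_ : minors _ = imx R (minors (Z *m lamZ P))) in h.
    by rewrite gt_eqF // (lt_le_trans ltr01 h).
  by rewrite -v_int /v /lam -map_lam imxM.
have nv1 kk : K kk -> 1 <= nrm (v kk).
  move=> Kk; have [_ _ nz] := K_line _ Kk; have [P uP EP] := integral_pointsP Kk.2.
  move: nz; rewrite EP v_int => nz.
  have [a ha] : exists a, minors (Z *m lamZ P) 0 a != 0.
    apply/existsP; apply: contraNT nz; rewrite negb_exists => /forallP h.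
    by apply/eqP/rowP=> a; rewrite !mxE; have := h a; rewrite negbK mxE => /eqP ->.
  apply: le_trans (nrm_entry _ 0 a); rewrite mxE -intr_norm ler1z -gtz0_ge1.
  by rewrite normr_gt0.
(* From v kk = p v 1 one gets v 1 = p v (kk^-1), and v (kk^-1) has norm at least 1; hence |p| is at
   most the norm of v 1. *)
have Kbound kk : K kk -> nrm (v kk) <= nrm (v 1%:M) ^+ 2.
  move=> Kk; have [p Ep nz] := K_line _ Kk.
  have KV : K (invmx kk) by case: Kk => Gk Zk; split; [exact: mxgroupV | exact: integralV].
  have uk : kk \in unitmx by have /mxgroup_unit := Kk.1.
  have := nv1 _ KV; have E1 : v 1%:M = p *: v (invmx kk).
    by rewrite -(mulVmx uk) vM Ep -scalemxAl -vM mulmx1.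
  have p1 : `|p| <= nrm (v 1%:M) -> nrm (v kk) <= nrm (v 1%:M) ^+ 2.
    by move=> h; rewrite Ep nrmZ expr2 ler_wpM2r ?nrm_ge0.
  move=> h; apply: p1; rewrite E1 nrmZ ler_peMr //.
have [s [sG sP]] := gamma_reps.
(* The invariant measure enters here: boundedness passes from the orbit under Gamma to the orbit
   under G. *)
have [b Hb] : exists b, forall g, mxset Gr g -> nrm (v g) <= b.
  have tr1 (X : 'rV[R]_(tdim (N * N) k)) : nrm X^T = nrm X.
    by rewrite /nrm exchange_big; apply: eq_bigr => i _; apply: eq_bigr => j _; rewrite mxE.
  have [||||b Hb] := @orbit_bounded R n Gr Gamma (proj1 arith) _
     (fun g => (tpow k (lam g))^T) (v 1%:M)^T _ _ _
     ((\sum_(r <- s) nrm (tpow k (lam r))) * nrm (v 1%:M) ^+ 2).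
  - by move=> x y; rewrite lamM tpowM trmx_mul.
  - by rewrite /lam rho1 lin_mulmx1 tpow1 trmx1.
  - move=> x e' e'0; have [||dd dd0 hd] := @cont_mx_eps R n n _ _ (fun g => (tpow k (lam g))^T) x e'.
    + move=> i j; under eq_fun do rewrite mxE; apply: cont_tpow_comp => a c.
      by apply: cont_linear => a' c'; apply: cont_tpow_comp; apply: cont_lft.
    + exact: e'0.
    + by exists dd.
  - move=> g /sP [r rs [kk Kk ->]]; rewrite -trmx_mul tr1 -vM mulmx1 vM.
    apply: le_trans (nrmM _ _) _; rewrite mulrC ler_pM ?nrm_ge0 ?Kbound //.
    by apply: (@le_seq_sum _ _ s (fun r => nrm (tpow k (lam r)))) => // y; apply: nrm_ge0.
  exists b => g /Hb; rewrite -trmx_mul tr1 -vM mulmx1 //.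
have [B HB] := @lattice_reduction R n e 1 e0.
have [c0 Hc0] : exists c0, forall A, nrm A <= B -> nrm (tpow k (lam A)) <= c0.
  have [cl cl0 Hcl] := nrm_linear (@lin_mulmx R N N N).
  pose c1 : R := (tdim (1 + n) d * tdim (1 + n) d)%:R *
    (((1 + n) * (1 + n))%:R * (1 + B)) ^+ d.
  exists ((tdim (N * N) k * tdim (N * N) k)%:R * (cl * c1) ^+ k) => A nA.
  apply: le_trans (nrm_tpow _ _) _; rewrite ler_wpM2l // lerXn2r ?nnegrE ?nrm_ge0 //.
    by rewrite mulr_ge0 // mulr_ge0 // exprn_ge0 // mulr_ge0 // addr_ge0 // (le_trans _ nA) ?nrm_ge0.
  apply: le_trans (Hcl _) _; rewrite ler_wpM2l //; apply: le_trans (nrm_tpow _ _) _.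
  have Bge0 := le_trans (nrm_ge0 A) nA.
  rewrite ler_wpM2l // lerXn2r ?nnegrE ?nrm_ge0 ?mulr_ge0 ?addr_ge0 //.
  by apply: le_trans (nrm_lft _) _; rewrite ler_wpM2l // lerD2l.
have [nu nuE] : exists nu, forall P, nu P = minors (Z *m lamZ P) by exists (fun P => minors (Z *m lamZ P)).
have [Nb NbP] : exists N : nat, `|b * c0| < N%:R.
  by exists (Num.Def.archi_bound `|b * c0|); exact: archi_boundP.
have nuP (g : 'M[R]_n) P : mxset Gr g -> nrm (imx R P *m invmx g) <= B ->
    forall a, (absz (nu P 0%R a) <= Nb)%N.
  move=> Gg hP a; have ug := mxgroup_unit Gg.
  have : nrm (v (imx R P)) <= b * c0.
    rewrite -[imx R P](mulmxKV ug) vM; apply: le_trans (nrmM _ _) _.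
    by rewrite ler_pM ?nrm_ge0 ?Hb ?Hc0.
  rewrite v_int -nuE => h; have := le_trans (nrm_entry _ 0 a) h.
  rewrite mxE -intr_norm => h1.
  have := le_lt_trans (le_trans h1 (ler_norm _)) NbP.
  by rewrite (_ : (Nb%:R : R) = (Nb%:Z)%:~R) // ltr_int -abszE ltz_nat => /ltnW.
have [T [code code_inj]] := bounded_int_row_code (tdim (N * N) k) Nb.
(* One unimodular matrix is chosen for each of the finitely many possible values of the integral
   vector, with 1 as default. *)
pose att f P := P \in unitmx /\ (forall a, (absz (nu P 0%R a) <= Nb)%N) /\ code (nu P) = f.
have reps f : exists P : 'M[int]_n, P \in unitmx /\ ((exists P, att f P) -> att f P).
  have [[P h]|no] := pselect (exists P, att f P); first by exists P; split=> //; case: h.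
  by exists 1%:M; split; [exact: unitmx1 | move=> /no].
pose Pf f := sval (cid (reps f)).
pose b2 := \sum_f nrm (imx R (invmx (Pf f))).
have [b3 Hb3] := @inv_bound R n (b2 * B).
have [t [tG tP]] := integral_reps.
pose b4 := b3 * \sum_(r <- t) nrm r.
exists (coset_proj Gamma @` [set g : points Gr | nrm (val g) <= b4]); last first.
  move=> g short; have Gg : mxset Gr (val g) := set_valP g.
  have ug := mxgroup_unit Gg.
  have [|P uP hP] := HB _ short; first by rewrite det_inv normrV -?unitmxE // det_norm1 // invr1.
  have aP : att (code (nu P)) P by split=> //; split=> //; exact: nuP hP.
  have [uPj /(_ (ex_intro _ P aP))] := svalP (cid (reps (code (nu P)))); rewrite -/(Pf (code (nu P))).
  set Pj := Pf (code (nu P)) in uPj *; move=> [_ [nuj codej]].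
  (* P and Pj move W to the same subspace, so this quotient satisfies the equations of G. *)
  pose kz := invmx Pj *m P; have ukz : kz \in unitmx by rewrite unitmx_mul unitmx_inv uPj.
  have nuPj : nu P = nu Pj by case: aP => _ [nuP' _]; exact: code_inj nuP' nuj (esym codej).
  have fZP (Q : 'M[int]_n) : Q \in unitmx -> row_free (imx rat (Z *m lamZ Q)).
    move=> uQ; rewrite imxM /row_free mxrankMfree // row_free_unit map_lam.
    apply: (mulmx1_unit (B := lin_mulmx (rho d (invmx (imx rat Q)))) _).1.
    by rewrite -lin_mulmxM -rhoM mulVmx ?imx_unit // rho1 lin_mulmx1.
  have sub : (imx rat (Z *m lamZ P) <= imx rat (Z *m lamZ Pj))%MS.
    apply: (minors_submx (fZP Pj uPj)).
    have E Q : minors (imx rat (Z *m lamZ Q)) = imx rat (nu Q).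
      rewrite nuE; apply/rowP=> a; rewrite !mxE -det_map_mx.
      by congr (\det _); apply/matrixP=> i j; rewrite !mxE.
    by rewrite !E nuPj.
  have Gk : mxset Gr (imx R kz).
    rewrite GrE; split; first exact: imx_unit.
    move=> Phi JP.
    have WP : W (mxvec Phi).
      by move=> x; rewrite mxvecK GrE => -[_]; apply.
    have /submxP [w Ew] := (WZ _).1 WP.
    have /submxP [w' Ew'] := submx_trans (submxMl w (imx rat (Z *m lamZ P))) sub.
    have e1 : rho d (imx rat P) *m Phi = rho d (imx rat Pj) *m vec_mx (w' *m imx rat Z).
      apply: (can_inj mxvecK); rewrite -!(mul_vec_lin (mulmx _)).
      rewrite -/(lin_mulmx (rho d (imx rat P))) -/(lin_mulmx (rho d (imx rat Pj))).
      by rewrite -!map_lam vec_mxK Ew -!mulmxA -!imxM.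
    have e2 := trW Phi P (imx R (invmx Pj)).
    rewrite imxM -e2 e1 trW -imxM mulVmx //.
    have -> : imx R 1%:M = 1%:M :> 'M[R]_n by rewrite /imx map_mx1.
    by have /WZ := submxMl w' (imx rat Z); apply; apply: mxgroup1.
  have Zk : integral_points G (imx R kz).
    split=> // i j; split; first by rewrite mxE intr_int.
    have -> : invmx (imx R kz) = imx R (invmx kz).
      have h1 : imx R kz *m imx R (invmx kz) = 1%:M by rewrite -imxM mulmxV // /imx map_mx1.
      by rewrite -[LHS]mulmx1 -h1 mulKmx ?imx_unit.
    by rewrite mxE intr_int.
  have [r rt [l [Gl Zl] El]] := tP _ Zk.
  have ul := mxgroup_unit Gl; have ukR : imx R kz \in unitmx by apply: imx_unit.
  have [g' Eg'] := point_of (mxgroupM Gg (mxgroupV (arith_sub Gl))).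
  exists g'; last first.
    by apply/esym/(coset_projP Gamma); exists (invmx l); first exact: mxgroupV.
  rewrite /= Eg'.
  have -> : val g *m invmx l = invmx (imx R kz *m invmx (val g)) *m r.
    have ex : (imx R kz *m invmx (val g)) *m (val g *m invmx l) = r.
      by rewrite mulmxA mulmxKV // El mulmxK.
    by rewrite -[in RHS]ex mulKmx // unitmx_mul ukR unitmx_inv.
  apply: le_trans (nrmM _ _) _; rewrite ler_pM ?nrm_ge0 //; last first.
    by apply: le_seq_sum => // y; apply: nrm_ge0.
  apply: Hb3.
    by rewrite det_mulmx normrM unit_int_norm // mul1r det_inv normrV -?unitmxE // det_norm1 // invr1.
  rewrite imxM -mulmxA; apply: le_trans (nrmM _ _) _; rewrite ler_pM ?nrm_ge0 //.
  rewrite /b2 (bigD1 (code (nu P))) //= lerDl; apply: sumr_ge0 => *; exact: nrm_ge0.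
(* The real points are closed in the space of all matrices: a limit satisfies the equations and has
   a determinant of square 1. *)
apply: (@bounded_closed_compact_proj R n Gr Gamma _ b4) => // M lim.
have lim' e' : 0 < e' -> exists2 g, mxset Gr g & nrm (g - M) < e'.
  by move=> /lim [g _ h]; exists (val g) => //; exact: set_valP.
have GM : mxset Gr M.
  rewrite GrE; split.
    have : \prod_(x <- [:: tt; tt]) \det M = 1.
      apply: (@cont_limit R n n (fun g => \prod_(x <- [:: tt; tt]) \det g) (mxset Gr) M 1) => //.
        by apply: cont_prod => _; exact: cont_det.
      move=> g Gg; rewrite !big_cons big_nil mulr1 -expr2 -real_normK ?num_real //.
      by rewrite det_norm1 // expr1n.
    rewrite !big_cons big_nil mulr1 /= unitmxE unitfE => h.
    by apply/negP => /eqP z; move: h; rewrite z mul0r => /eqP; rewrite eq_sym oner_eq0.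
  move=> Phi JP.
  apply: (@cont_limit R n n (fun g => \tr (map_mx rr Phi *m rho d g)) (mxset Gr) M 0) => //.
    apply: cont_sum => i; move: (i) {2}(i) => a c.
    apply: (@cont_linear R n n N N N N (mulmx (map_mx rr Phi)) (@rho R d n)).
    by move=> a' c'; apply: cont_tpow_comp; apply: cont_lft.
  by move=> g; rewrite GrE => -[_]; apply.
have [g Eg] := point_of GM; exists g => //=; rewrite Eg.
apply/ler_addgt0Pr => e' /lim [h /= hb he].
rewrite -[M](subrK (val h)) addrC; apply: le_trans (nrmD _ _) _.
by rewrite lerD // nrmC ltW.
Qed.
End Reduction.

End Arith.
End ArithPart.

(** * Irreducible sets and identity components *)

Section Irr.
Local Open Scope classical_set_scope.
Local Open Scope ring_scope.
Variables (C : fieldType) (n : nat).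
Implicit Types (f : 'M[C]_n -> C) (S T : set 'M[C]_n).

Definition polyf f : Prop := exists p : mpoly (n * n) C,
  forall g, f g = eval_at (idfun : {rmorphism C -> C}) p g.

Let ev g := (mmap (idfun : {rmorphism C -> C}) (fun i => mxvec g 0 i) : {rmorphism mpoly (n * n) C -> C}).

Lemma polyf_ext f h : f =1 h -> polyf f -> polyf h.
Proof. by move=> fh [p H]; exists p => g; rewrite -fh. Qed.

Lemma polyf_const c : polyf (fun=> c).
Proof. by exists (mpolyC _ c) => g; rewrite /eval_at mmapC. Qed.

Lemma polyfD f h : polyf f -> polyf h -> polyf (fun g => f g + h g).
Proof.
move=> [p H] [q K]; exists (p + q) => g; rewrite H K /eval_at.
by rewrite -!/(ev g _) rmorphD.
Qed.

Lemma polyfM f h : polyf f -> polyf h -> polyf (fun g => f g * h g).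
Proof.
move=> [p H] [q K]; exists (p * q) => g; rewrite H K /eval_at.
by rewrite -!/(ev g _) rmorphM.
Qed.

Lemma polyfZ c f : polyf f -> polyf (fun g => c * f g).
Proof. exact: (polyfM (polyf_const c)). Qed.

Lemma polyfB f h : polyf f -> polyf h -> polyf (fun g => f g - h g).
Proof.
move=> pf /(polyfZ (-1)) ph; apply: polyf_ext (polyfD pf ph) => g.
by rewrite mulN1r.
Qed.

Lemma polyf_sum (I : Type) (r : seq I) (P : pred I) (F : I -> 'M[C]_n -> C) :
  (forall i, P i -> polyf (F i)) -> polyf (fun g => \sum_(i <- r | P i) F i g).
Proof.
move=> h; elim: r => [|i r IH].
  by apply: polyf_ext (polyf_const 0) => g; rewrite big_nil.
have [Pi|nPi] := boolP (P i).
  by apply: polyf_ext (polyfD (h i Pi) IH) => g; rewrite big_cons Pi.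
by apply: polyf_ext IH => g; rewrite big_cons (negPf nPi).
Qed.

Lemma polyf_prod (I : Type) (r : seq I) (P : pred I) (F : I -> 'M[C]_n -> C) :
  (forall i, P i -> polyf (F i)) -> polyf (fun g => \prod_(i <- r | P i) F i g).
Proof.
move=> h; elim: r => [|i r IH].
  by apply: polyf_ext (polyf_const 1) => g; rewrite big_nil.
have [Pi|nPi] := boolP (P i).
  by apply: polyf_ext (polyfM (h i Pi) IH) => g; rewrite big_cons Pi.
by apply: polyf_ext IH => g; rewrite big_cons (negPf nPi).
Qed.

Lemma polyf_entry i j : polyf (fun g => g i j).
Proof.
exists (mpolyX C (mnm1 (mxvec_index i j))) => g.
by rewrite /eval_at mmapX mmap1U mxvecE.
Qed.

Lemma polyf_ind (P : ('M[C]_n -> C) -> Prop) :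
  (forall f h, f =1 h -> P f -> P h) -> (forall c, P (fun=> c)) ->
  (forall i j, P (fun g => g i j)) ->
  (forall f h, polyf f -> polyf h -> P f -> P h -> P (fun g => f g + h g)) ->
  (forall f h, polyf f -> polyf h -> P f -> P h -> P (fun g => f g * h g)) ->
  forall f, polyf f -> P f.
Proof.
move=> Pext PC PX PD PM f [p H]; apply: (Pext (fun g => ev g p)); first by move=> g; rewrite H.
have pev q : polyf (fun g => ev g q) by exists q.
elim/mpoly_gen: p {H} => [c|k|p q Pp Pq|p q Pp Pq].
- by apply: Pext (PC c) => g; rewrite /ev /= mmapC.
- by case/mxvec_indexP: k => i j; apply: Pext (PX i j) => g; rewrite /ev /= mmapX mmap1U mxvecE.
- by apply: Pext (PD _ _ (pev p) (pev q) Pp Pq) => g; rewrite rmorphD.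
- by apply: Pext (PM _ _ (pev p) (pev q) Pp Pq) => g; rewrite rmorphM.
Qed.

Lemma polyf_comp f (F : 'M[C]_n -> 'M[C]_n) :
  (forall i j, polyf (fun g => F g i j)) -> polyf f -> polyf (fun g => f (F g)).
Proof.
move=> hF; elim/polyf_ind => [f1 h fh|c|i j|f1 h _ _|f1 h _ _].
- by apply: polyf_ext => g; rewrite fh.
- exact: polyf_const.
- exact: hF.
- exact: polyfD.
- exact: polyfM.
Qed.

Lemma polyf_mulmx m p q (F : 'M[C]_n -> 'M[C]_(m, p)) (G : 'M[C]_n -> 'M[C]_(p, q)) :
  (forall i j, polyf (fun g => F g i j)) -> (forall i j, polyf (fun g => G g i j)) ->
  forall i j, polyf (fun g => (F g *m G g) i j).
Proof.
move=> hF hG i j.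
by apply: (polyf_ext (f := fun g => \sum_k F g i k * G g k j)) => [g|];
  [rewrite mxE | apply: polyf_sum => k _; apply: polyfM].
Qed.

Lemma polyf_mull f a b : polyf f -> polyf (fun g => f (a *m g *m b)).
Proof.
apply: polyf_comp; apply: polyf_mulmx => [|i j]; last exact: polyf_const.
by apply: polyf_mulmx => i j; [exact: polyf_const | exact: polyf_entry].
Qed.

Lemma polyf_tpow m p (F : 'M[C]_n -> 'M[C]_(m, p)) k :
  (forall i j, polyf (fun g => F g i j)) -> forall i j, polyf (fun g => tpow k (F g) i j).
Proof.
move=> hF i j; apply: (polyf_ext (f := fun g => \prod_(l < k) F g (tidx i l) (tidx j l))).
  by move=> g; rewrite mxE.
by apply: polyf_prod.
Qed.

Lemma polyfP f : polyf f <-> exists d Phi, forall g, f g = \tr (Phi *m rho d g).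
Proof.
split=> [[p H]|[d [Phi H]]].
  have [d [Phi K]] := lin_poly (idfun : {rmorphism C -> C}) p.
  by exists d, Phi => g; rewrite H K map_mx_id.
have [|p K] := @poly_lin C C (idfun : {rmorphism C -> C}) n d f; first by exists Phi => g; rewrite H map_mx_id.
by exists p.
Qed.

Lemma zclosed_polyf S : zclosed S <-> exists I : set ('M[C]_n -> C), (forall f, I f -> polyf f) /\
  S = [set g | g \in unitmx /\ forall f, I f -> f g = 0].
Proof.
split=> [[I ->]|[I [pI ->]]].
  exists [set f | exists2 p, I p & f = eval_at (idfun : {rmorphism C -> C}) p].
  split=> [f [p _ ->]|]; first by exists p.
  apply/seteqP; split=> g [ug h]; split=> //; first by move=> f [p Ip ->]; apply: h.
  by move=> p Ip; apply: h; exists p.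
exists [set p | exists2 f, I f & forall g, f g = eval_at (idfun : {rmorphism C -> C}) p g].
apply/seteqP; split=> g [ug h]; split=> //; first by move=> p [f If <-]; apply: h.
by move=> f If; have [p Hp] := pI f If; rewrite Hp; apply: h; exists f.
Qed.

(** The polynomials vanishing on S form a prime ideal, or S is empty. The set itself may fail to be
    closed, as is the case for subsets of Lambda. *)
Definition irr S : Prop := forall f h, polyf f -> polyf h ->
  (forall g, S g -> f g * h g = 0) -> (forall g, S g -> f g = 0) \/ (forall g, S g -> h g = 0).

(** For each y in T one of the two functions vanishes on S y. If neither vanishes on the whole
    product, points x1, x2 of S where they fail to vanish turn this into a product of two functions
    of y that vanishes on T. *)
Lemma irr_prod S T : irr S -> irr T -> irr (mxprod S T).
Proof.
move=> iS iT f h pf ph fh.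
have E y : T y -> (forall x, S x -> f (x *m y) = 0) \/ (forall x, S x -> h (x *m y) = 0).
  move=> Ty; apply: iS => [||x Sx].
  - by apply: polyf_ext (polyf_mull 1%:M y pf) => x; rewrite mul1mx.
  - by apply: polyf_ext (polyf_mull 1%:M y ph) => x; rewrite mul1mx.
  - by apply: fh; exists x => //; exists y.
apply: contrapT => /not_orP [/existsNP [_ /not_implyP [[x1 Sx1 [y1 Ty1 ->]] n1]]].
move=> /existsNP [_ /not_implyP [[x2 Sx2 [y2 Ty2 ->]] n2]].
have [||y Ty|K|K] := iT (fun y => f (x1 *m y)) (fun y => h (x2 *m y)).
- by apply: polyf_ext (polyf_mull x1 1%:M pf) => x; rewrite mulmx1.
- by apply: polyf_ext (polyf_mull x2 1%:M ph) => x; rewrite mulmx1.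
- by have [->//|->//] := E y Ty; rewrite ?mul0r ?mulr0.
- by apply: n1; apply: K.
- by apply: n2; apply: K.
Qed.

Lemma irr_translate S a b : irr S -> irr [set a *m g *m b | g in S].
Proof.
move=> iS f h pf ph fh.
have [g Sg|K|K] := iS _ _ (polyf_mull a b pf) (polyf_mull a b ph).
- by apply: fh; exists g.
- by left=> _ [g Sg <-]; apply: K.
- by right=> _ [g Sg <-]; apply: K.
Qed.

Lemma irr_closure S T : S `<=` T -> irr S ->
  (forall f, polyf f -> (forall g, S g -> f g = 0) -> forall g, T g -> f g = 0) -> irr T.
Proof.
move=> ST iS cl f h pf ph fh.
have [g Sg|K|K] := iS f h pf ph; first by apply: fh; apply: ST.
  by left; apply: cl.
by right; apply: cl.
Qed.

Definition fin_irr S : Prop := exists s : seq (set 'M[C]_n),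
  (forall T, List.In T s -> irr T /\ T `<=` S) /\ forall g, S g -> exists T, List.In T s /\ T g.

Lemma fin_irrU S S1 S2 : S1 `<=` S -> S2 `<=` S -> S `<=` S1 `|` S2 ->
  fin_irr S1 -> fin_irr S2 -> fin_irr S.
Proof.
move=> h1 h2 h [s1 [a1 b1]] [s2 [a2 b2]]; exists (s1 ++ s2); split.
  by move=> T /(@List.in_app_or _ s1 s2 T) [/a1|/a2] [iT TS]; split=> // g /TS; [apply: h1 | apply: h2].
move=> g /h [/b1|/b2] [T [Ts Tg]]; exists T; split=> //; apply: List.in_or_app; [by left | by right].
Qed.

(** Noetherian induction: a bad set is not irreducible, hence is the union of two relatively closed
    smaller pieces, one of which is bad again; the vanishing ideals of a chain of bad sets would
    increase strictly. *)
Lemma fin_irr_all S : fin_irr S.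
Proof.
apply: contrapT => bad0.
pose bad := {T : set 'M[C]_n | ~ fin_irr T}.
pose I (T : set 'M[C]_n) : set (mpoly (n * n) C) :=
  [set p | forall g, T g -> eval_at (idfun : {rmorphism C -> C}) p g = 0].
have step (T : bad) : exists T' : bad, sval T' `<=` sval T /\
    exists p, I (sval T') p /\ ~ I (sval T) p.
  case: T => T nT /=.
  have /existsNP [f /existsNP [h /not_implyP [pf /not_implyP [ph /not_implyP [fh]]]]] : ~ irr T.
    move=> iT; apply: nT; exists [:: T]; split; first by move=> T' [<-|[]]; split.
    by move=> g Tg; exists T; split=> //; left.
  move=> /not_orP [/existsNP [x /not_implyP [Tx nx]] /existsNP [y /not_implyP [Ty ny]]].
  have [p Hp] := pf; have [q Hq] := ph.
  have [b1|g1] := pselect (fin_irr (T `&` [set g | f g = 0])).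
    have [b2|g2] := pselect (fin_irr (T `&` [set g | h g = 0])).
      exfalso; apply: nT; apply: (@fin_irrU T _ _ _ _ _ b1 b2) => [g []//|g []//|g Tg].
      by have /eqP := fh g Tg; rewrite mulf_eq0 => /orP [/eqP|/eqP]; [left | right].
    exists (exist (fun T => ~ fin_irr T) _ g2); split=> [g []//|]; exists q; split; first by move=> g /= [_]; rewrite Hq.
    by move=> /(_ y Ty); rewrite -Hq.
  exists (exist (fun T => ~ fin_irr T) _ g1); split=> [g []//|]; exists p; split; first by move=> g /= [_]; rewrite Hp.
  by move=> /(_ x Tx); rewrite -Hp.
pose nxt (T : bad) : bad := sval (cid (step T)).
pose seqT (k : nat) : bad := iter k nxt (exist (fun T => ~ fin_irr T) S bad0).
have sub k l : (k <= l)%N -> sval (seqT l) `<=` sval (seqT k).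
  move=> /subnK <-; elim: (l - k)%N => [//|d IH] g; rewrite addSn.
  by have [h _] := svalP (cid (step (seqT (d + k)%N))) => /h /IH.
pose II : set (mpoly (n * n) C) := [set p | exists k, I (sval (seqT k)) p].
have Imono k l : (k <= l)%N -> I (sval (seqT k)) `<=` I (sval (seqT l)).
  by move=> kl p h g /(sub _ _ kl) /h.
have iII : is_ideal II.
  split; first by exists 0%N => g _; rewrite /eval_at -/(ev g _) rmorph0.
    move=> p q [k hk] [l hl]; exists (maxn k l) => g Tg.
    rewrite /eval_at -/(ev g _) rmorphD /=.
    have := Imono _ _ (leq_maxl k l) p hk g Tg; have := Imono _ _ (leq_maxr k l) q hl g Tg.
    by rewrite /eval_at -!/(ev g _) => -> ->; rewrite addr0.
  move=> a p [k hk]; exists k => g Tg; rewrite /eval_at -/(ev g _) rmorphM /=.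
  by have := hk g Tg; rewrite /eval_at -/(ev g _) => ->; rewrite mulr0.
have [s [sI Is]] := @mpoly_noetherian C (n * n) _ iII.
have [N hN] : exists N, forall p, p \in s -> I (sval (seqT N)) p.
  elim: s sI {Is} => [|p s IH] sI; first by exists 0%N.
  have [|N hN] := IH; first by move=> q qs; apply: sI; rewrite inE qs orbT.
  have [k hk] := sI p (mem_head _ _); exists (maxn k N) => q; rewrite inE => /orP [/eqP ->|/hN].
    exact: Imono (leq_maxl _ _) _ hk.
  exact: Imono (leq_maxr _ _) _.
have [_ [p [h1 h2]]] := svalP (cid (step (seqT N))).
apply: h2 => g Tg; have /Is sp : II p by exists N.+1.
by apply: (eval_at_sum sp) => q /hN; apply.
Qed.

(** * The identity component in the Zariski topology *)

Section IdComp.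
Variable L : mxgroup C n.

(** The union of all irreducible subsets of L through 1; it makes sense for groups that are not
    Zariski closed. *)
Definition idcomp_set : set 'M[C]_n := [set g | exists T, [/\ irr T, T `<=` L, T 1%:M & T g]].

Lemma idcomp_unit : idcomp_set `<=` [set g | g \in unitmx].
Proof. by move=> g [T [_ TL _ /TL /mxgroup_unit]]. Qed.

Lemma idcomp1 : idcomp_set 1%:M.
Proof.
exists [set 1%:M]; split=> //; last by move=> _ ->; exact: mxgroup1.
move=> f h pf ph /(_ _ erefl)/eqP; rewrite mulf_eq0 => /orP [/eqP e|/eqP e].
  by left=> _ ->.
by right=> _ ->.
Qed.

Lemma idcompM g h : idcomp_set g -> idcomp_set h -> idcomp_set (g *m h).
Proof.
move=> [S [iS SL S1 Sg]] [T [iT TL T1 Th]]; exists (mxprod S T); split.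
- exact: irr_prod.
- by move=> _ [a /SL La [b /TL Lb ->]]; apply: mxgroupM.
- by exists 1%:M => //; exists 1%:M => //; rewrite mulmx1.
- by exists g => //; exists h.
Qed.

Lemma idcompV g : idcomp_set g -> idcomp_set (invmx g).
Proof.
move=> [T [iT TL T1 Tg]]; have Lg := TL _ Tg; have ug := mxgroup_unit Lg.
exists [set invmx g *m x *m 1%:M | x in T]; split.
- exact: irr_translate.
- by move=> _ [x /TL Lx <-]; rewrite mulmx1; apply: mxgroupM => //; apply: mxgroupV.
- by exists g; rewrite // mulmx1 mulVmx.
- by exists 1%:M; rewrite // !mulmx1.
Qed.

Definition idcomp := MxGroup idcomp_unit idcomp1 idcompM idcompV.

Lemma idcomp_sub : idcomp `<=` L. Proof. by move=> g [T [_ TL _ /TL]]. Qed.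

(** Two irreducible subsets through 1 both lie in their product, which is irreducible. *)
Lemma irr_idcomp : irr idcomp.
Proof.
move=> f h pf ph fh.
apply: contrapT => /not_orP [/existsNP [x /not_implyP [[S [iS SL S1 Sx]] nx]]].
move=> /existsNP [y /not_implyP [[T [iT TL T1 Ty]] ny]].
have [g [a Sa [b Tb ->]]|K|K] := irr_prod iS iT pf ph.
- by apply: fh; apply: idcompM; [exists S | exists T].
- by apply: nx; apply: K; exists x => //; exists 1%:M => //; rewrite mulmx1.
- by apply: ny; apply: K; exists 1%:M => //; exists y => //; rewrite mul1mx.
Qed.

(** Each of the finitely many irreducible pieces of L lies in one coset: translated by the inverse
    of one of its points, it contains 1. *)
Lemma idcomp_reps : exists s : seq 'M[C]_n, (forall r, r \in s -> mxset L r) /\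
  forall g, mxset L g -> exists2 r, r \in s & exists2 k, mxset idcomp k & g = r *m k.
Proof.
have [s [sI sP]] := fin_irr_all L.
have [t [tL tP]] : exists t : seq 'M[C]_n, (forall r, r \in t -> mxset L r) /\
    forall T, List.In T s -> forall g, T g -> exists2 r, r \in t & T r.
  elim: s sI {sP} => [|T s IH] sI; first by exists [::]; split.
  have [|t [tL tP]] := IH; first by move=> S Ss; apply: sI; right.
  have [iT TL] := sI T (or_introl erefl).
  have [[x Tx]|no] := pselect (exists x, T x); last first.
    by exists t; split=> // S [<- g Tg|/tP//]; case: no; exists g.
  exists (x :: t); split=> [r|S [<- g Tg|/tP h g /h [r rt Sr]]].
  - by rewrite inE => /orP [/eqP ->|/tL//]; apply: TL.
  - by exists x; rewrite ?mem_head.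
  - by exists r; rewrite // inE rt orbT.
exists t; split=> // g /sP [T [Ts Tg]]; have [r rt Tr] := tP T Ts g Tg; exists r => //.
have [iT TL] := sI T Ts; have ur := mxgroup_unit (TL _ Tr).
exists (invmx r *m g); last by rewrite mulKVmx.
exists [set invmx r *m x *m 1%:M | x in T]; split.
- exact: irr_translate.
- by move=> _ [x /TL Lx <-]; rewrite mulmx1; apply: mxgroupM => //; apply/mxgroupV/TL.
- by exists r; rewrite // mulmx1 mulVmx.
- by exists g; rewrite // mulmx1.
Qed.

Lemma idcomp_conj a g : a \in unitmx -> (forall x, mxset L x -> mxset L (a *m x *m invmx a)) ->
  mxset idcomp g -> mxset idcomp (a *m g *m invmx a).
Proof.
move=> ua aL [T [iT TL T1 Tg]]; exists [set a *m x *m invmx a | x in T]; split.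
- exact: irr_translate.
- by move=> _ [x /TL Lx <-]; apply: aL.
- by exists 1%:M; rewrite // mulmx1 mulmxV.
- by exists g.
Qed.

(** The Zariski closure of the identity component is irreducible, contains 1 and stays inside the
    closed group L, so it is one of the sets in the union. *)
Lemma idcomp_closed : zclosed L -> zclosed idcomp.
Proof.
move=> /zclosed_polyf [I [pI EL]]; apply/zclosed_polyf.
exists [set f | polyf f /\ forall g, mxset idcomp g -> f g = 0]; split=> [f []//|].
apply/seteqP; split=> [g Lg|g [ug h]].
  by split; [exact: idcomp_unit | move=> f [_]; apply].
have sub g' : g' \in unitmx -> (forall f, polyf f -> (forall g, mxset idcomp g -> f g = 0) -> f g' = 0) ->
    mxset L g'.
  move=> u' h'; rewrite EL; split=> // f If; apply: h'; first exact: pI.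
  by move=> x /idcomp_sub; rewrite EL => -[_]; apply.
exists [set g' | g' \in unitmx /\ forall f, polyf f -> (forall g, mxset idcomp g -> f g = 0) -> f g' = 0].
split.
- apply: irr_closure irr_idcomp _ => [x Lx|f pf f0 x [_]]; last by apply.
  by split; [exact: idcomp_unit | move=> f _; apply].
- by move=> x [ux hx]; apply: sub.
- by split; [exact: unitmx1 | move=> f _; apply; exact: idcomp1].
- by split=> // f pf f0; apply: h.
Qed.
End IdComp.

Lemma irr_zconnected S : irr S -> zconnected S.
Proof.
move=> iS Z1 Z2 /zclosed_polyf [I1 [p1 ->]] /zclosed_polyf [I2 [p2 ->]] SZ _.
have uS g : S g -> g \in unitmx by move=> /SZ [[]|[]].
have [h1|/existsNP [f /not_implyP [If /existsNP [x /not_implyP [Sx nx]]]]] :=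
    pselect (forall f, I1 f -> forall g, S g -> f g = 0).
  by left=> g Sg; split=> [|f If]; [exact: uS | exact: h1].
right=> g Sg; split=> [|h Ih]; first exact: uS.
have [x' Sx'|K|K] := iS f h (p1 f If) (p2 h Ih).
- by have [[_ /(_ f If) ->]|[_ /(_ h Ih) ->]] := SZ _ Sx'; rewrite ?mul0r ?mulr0.
- by case: nx; apply: K.
- exact: K.
Qed.

End Irr.
Arguments polyf_const {C n} c.

(** * Lie algebras and the intersection theorem *)

Section Krull.
Local Open Scope classical_set_scope.
Local Open Scope ring_scope.
Variables (C : numFieldType) (n : nat).
Local Notation N := (n * n)%N.
Implicit Types (f h : 'M[C]_n -> C) (F : 'M[C]_n -> {poly C}).

(** Generators: the entries of g in degree 0 and those of g - 1 in degree 1. The power of ['X]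
    records the order of vanishing at 1. *)
Definition reesv (g : 'M[C]_n) (k : 'I_(N + N)) : {poly C} :=
  match fintype.split k with
  | inl i => (mxvec g 0 i)%:P
  | inr i => (mxvec (g - 1%:M) 0 i)%:P * 'X
  end.

Definition phi g : {rmorphism mpoly (N + N) C -> {poly C}} :=
  mmap (polyC : {rmorphism C -> {poly C}}) (reesv g).

(* Rees algebra of the ideal of functions vanishing at 1. *)
Definition rees F : Prop := exists Q, forall g, F g = phi g Q.

Lemma rees_ext F F' : F =1 F' -> rees F -> rees F'.
Proof. by move=> E [Q H]; exists Q => g; rewrite -E. Qed.

Lemma rees_const c : rees (fun=> c%:P).
Proof. by exists (mpolyC _ c) => g; rewrite /phi /= mmapC. Qed.

Lemma reesD F F' : rees F -> rees F' -> rees (fun g => F g + F' g).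
Proof. by move=> [Q H] [Q' H']; exists (Q + Q') => g; rewrite rmorphD H H'. Qed.

Lemma reesM F F' : rees F -> rees F' -> rees (fun g => F g * F' g).
Proof. by move=> [Q H] [Q' H']; exists (Q * Q') => g; rewrite rmorphM H H'. Qed.

Lemma reesB F F' : rees F -> rees F' -> rees (fun g => F g - F' g).
Proof. by move=> [Q H] [Q' H']; exists (Q - Q') => g; rewrite rmorphB H H'. Qed.

Lemma rees_sum (I : Type) (r : seq I) (P : pred I) (F : I -> 'M[C]_n -> {poly C}) :
  (forall i, rees (F i)) -> rees (fun g => \sum_(i <- r | P i) F i g).
Proof.
move=> h; elim: r => [|i r IH].
  by apply: rees_ext (rees_const 0) => g; rewrite big_nil.
have [Pi|nPi] := boolP (P i).
  by apply: rees_ext (reesD (h i) IH) => g; rewrite big_cons Pi.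
by apply: rees_ext IH => g; rewrite big_cons (negPf nPi).
Qed.

Lemma rees_x i j : rees (fun g => (g i j)%:P).
Proof.
exists (mpolyX C (mnm1 (lshift N (mxvec_index i j)))) => g.
by rewrite /phi /= mmapX mmap1U /reesv (unsplitK (inl _)) mxvecE.
Qed.

Lemma rees_z i j : rees (fun g => ((g - 1%:M) i j)%:P * 'X).
Proof.
exists (mpolyX C (mnm1 (rshift N (mxvec_index i j)))) => g.
by rewrite /phi /= mmapX mmap1U /reesv (unsplitK (inr _)) mxvecE.
Qed.

Lemma rees_ind (P : ('M[C]_n -> {poly C}) -> Prop) :
  (forall F F', F =1 F' -> P F -> P F') -> (forall c, P (fun=> c%:P)) ->
  (forall i j, P (fun g => (g i j)%:P)) -> (forall i j, P (fun g => ((g - 1%:M) i j)%:P * 'X)) ->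
  (forall F F', rees F -> rees F' -> P F -> P F' -> P (fun g => F g + F' g)) ->
  (forall F F', rees F -> rees F' -> P F -> P F' -> P (fun g => F g * F' g)) ->
  forall F, rees F -> P F.
Proof.
move=> Pext PC PX PZ PD PM F [Q H]; apply: (Pext (fun g => phi g Q)) => // {F H}.
have pe q : rees (fun g => phi g q) by exists q.
elim/mpoly_gen: Q => [c|k|p q Pp Pq|p q Pp Pq].
- by apply: Pext (PC c) => g; rewrite /phi /= mmapC.
- case: (fintype.split_ordP k) => k' ->; case/mxvec_indexP: k' => i j.
    apply: Pext (PX i j) => g.
    by rewrite /phi /= mmapX mmap1U /reesv (unsplitK (inl _)) mxvecE.
  apply: Pext (PZ i j) => g.
  by rewrite /phi /= mmapX mmap1U /reesv (unsplitK (inr _)) mxvecE.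
- by apply: Pext (PD _ _ (pe p) (pe q) Pp Pq) => g; rewrite rmorphD.
- by apply: Pext (PM _ _ (pe p) (pe q) Pp Pq) => g; rewrite rmorphM.
Qed.

Lemma rees_poly f : polyf f -> rees (fun g => (f g)%:P).
Proof.
elim/polyf_ind => [f1 f2 E|c|i j|f1 f2 _ _ h1 h2|f1 f2 _ _ h1 h2].
- by apply: rees_ext => g; rewrite E.
- exact: rees_const.
- exact: rees_x.
- by apply: rees_ext (reesD h1 h2) => g; rewrite polyCD.
- by apply: rees_ext (reesM h1 h2) => g; rewrite polyCM.
Qed.

Lemma rees_van1 f : polyf f -> rees (fun g => (f g - f 1%:M)%:P * 'X).
Proof.
elim/polyf_ind => [f1 f2 E|c|i j|f1 f2 p1 p2 h1 h2|f1 f2 p1 p2 h1 h2].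
- by apply: rees_ext => g; rewrite !E.
- by apply: rees_ext (rees_const 0) => g; rewrite subrr mul0r.
- by apply: rees_ext (rees_z i j) => g; rewrite !mxE.
- by apply: rees_ext (reesD h1 h2) => g; rewrite -mulrDl -polyCD; congr (_%:P * _); ring.
- apply: rees_ext (reesD (reesM (rees_poly p2) h1) (reesM (rees_const (f1 1%:M)) h2)) => g.
  by rewrite !mulrA -!polyCM -mulrDl -polyCD; congr (_%:P * _); ring.
Qed.

Lemma rees_sq F : rees F -> rees (fun g => F (g *m g)).
Proof.
elim/rees_ind => [F1 F2 E|c|i j|i j|F1 F2 _ _|F1 F2 _ _].
- by apply: rees_ext => g; rewrite E.
- exact: rees_const.
- apply: rees_poly; apply: polyf_mulmx; exact: polyf_entry.
- apply: (rees_ext (F := fun g => \sum_k ((g - 1%:M) i k)%:P * 'X * ((g + 1%:M) k j)%:P)).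
    move=> g; have -> : g *m g - 1%:M = (g - 1%:M) *m (g + 1%:M).
      by rewrite mulmxBl mul1mx mulmxDr mulmx1 opprD addrA addrK.
    rewrite [in RHS]mxE rmorph_sum mulr_suml; apply: eq_bigr => k _ /=.
    by rewrite polyCM mulrAC.
  apply: rees_sum => k; apply: reesM; first exact: rees_z.
  apply: rees_poly; apply: (polyf_ext (f := fun g => g k j + (1%:M : 'M[C]_n) k j)).
    by move=> g; rewrite [in RHS]mxE.
  by apply: polyfD; [exact: polyf_entry | exact: polyf_const].
- exact: reesD.
- exact: reesM.
Qed.

Lemma rees_scale F : rees F -> rees (fun g => F g \Po (2%:P * 'X)).
Proof.
elim/rees_ind => [F1 F2 E|c|i j|i j|F1 F2 _ _ h1 h2|F1 F2 _ _ h1 h2].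
- by apply: rees_ext => g; rewrite E.
- by apply: rees_ext (rees_const c) => g; rewrite comp_polyC.
- by apply: rees_ext (rees_x i j) => g; rewrite comp_polyC.
- apply: rees_ext (reesM (rees_const 2) (rees_z i j)) => g.
  by rewrite comp_polyM comp_polyC comp_polyX mulrCA.
- by apply: rees_ext (reesD h1 h2) => g; rewrite comp_polyD.
- by apply: rees_ext (reesM h1 h2) => g; rewrite comp_polyM.
Qed.

(* Squaring acts as the dilation by 2 on the associated graded ring. *)
Lemma rees_diff F : rees F -> rees (fun g => 'X * (F (g *m g) - (F g \Po (2%:P * 'X)))).
Proof.
elim/rees_ind => [F1 F2 E|c|i j|i j|F1 F2 _ _ h1 h2|F1 F2 r1 r2 h1 h2].
- by apply: rees_ext => g; rewrite !E.
- by apply: rees_ext (rees_const 0) => g; rewrite comp_polyC subrr mulr0.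
- apply: (rees_ext (F := fun g => \sum_k (g i k)%:P * (((g - 1%:M) k j)%:P * 'X))).
    move=> g; rewrite comp_polyC -polyCB.
    have -> : (g *m g) i j - g i j = (g *m (g - 1%:M)) i j.
      by rewrite mulmxBr mulmx1 [in RHS]mxE [X in _ = _ + X]mxE.
    rewrite [in RHS]mxE rmorph_sum mulr_sumr; apply: eq_bigr => k _ /=.
    by rewrite polyCM; ring.
  by apply: rees_sum => k; apply: reesM; [exact: rees_x | exact: rees_z].
- apply: (rees_ext (F := fun g => \sum_k (((g - 1%:M) i k)%:P * 'X) * (((g - 1%:M) k j)%:P * 'X))).
    move=> g; rewrite comp_polyM comp_polyC comp_polyX.
    have -> : g *m g - 1%:M = (g - 1%:M) *m (g - 1%:M) + ((g - 1%:M) + (g - 1%:M)).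
      by rewrite mulmxBl mul1mx mulmxBr mulmx1 addrA subrK addrA subrK.
    move: (g - 1%:M) => a.
    have -> : (a *m a + (a + a)) i j = \sum_k a i k * a k j + (a i j + a i j) by rewrite !mxE.
    rewrite !polyCD rmorph_sum /=.
    have -> : forall s x : {poly C}, 'X * ((s + (x + x)) * 'X - x * ((1%:P + 1%:P) * 'X)) = s * 'X * 'X.
      by move=> s x; rewrite polyC1; ring.
    rewrite !mulr_suml; apply: eq_bigr => k _; rewrite polyCM; ring.
  by apply: rees_sum => k; apply: reesM; exact: rees_z.
- by apply: rees_ext (reesD h1 h2) => g; rewrite comp_polyD; ring.
- apply: rees_ext (reesD (reesM h1 (rees_sq r2)) (reesM (rees_scale r1) h2)) => g.
  by rewrite comp_polyM; ring.
Qed.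

Lemma rees_coef F j : rees F -> polyf (fun g => (F g)`_j).
Proof.
move=> rF; elim/rees_ind: rF j => [F1 F2 E h j|c j|a b j|a b j|F1 F2 _ _ h1 h2 j|F1 F2 _ _ h1 h2 j].
- by apply: polyf_ext (h j) => g; rewrite E.
- exact: (polyf_const (c%:P)`_j).
- case: j => [|j]; first by apply: (polyf_ext (f := fun g => g a b)) => [g|]; [rewrite coefC | exact: polyf_entry].
  by apply: polyf_ext (polyf_const 0) => g; rewrite coefC.
- case: j => [|[|j]].
  + by apply: polyf_ext (polyf_const 0) => g; rewrite coefMX.
  + apply: (polyf_ext (f := fun g => g a b - (1%:M : 'M[C]_n) a b)).
      by move=> g; rewrite coefMX /= coefC /= [in RHS]mxE [X in _ = _ + X]mxE.
    by apply: polyfB; [exact: polyf_entry | exact: polyf_const].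
  + by apply: polyf_ext (polyf_const 0) => g; rewrite coefMX /= coefC.
- by apply: polyf_ext (polyfD (h1 j) (h2 j)) => g; rewrite coefD.
- apply: (polyf_ext (f := fun g => \sum_(i < j.+1) (F1 g)`_i * (F2 g)`_(j - i))).
    by move=> g; rewrite coefM.
  by apply: polyf_sum => i _; apply: polyfM.
Qed.

Lemma rees_coef1 F j : rees F -> (0 < j)%N -> (F 1%:M)`_j = 0.
Proof.
move=> rF j0; suff [c ->] : exists c, F 1%:M = c%:P by rewrite coefC gtn_eqF.
elim/rees_ind: rF => [F1 F2 E [c h]|c|a b|a b|F1 F2 _ _ [c h1] [d h2]|F1 F2 _ _ [c h1] [d h2]].
- by exists c; rewrite -E.
- by exists c.
- by exists ((1%:M : 'M[C]_n) a b).
- by exists 0; rewrite subrr mxE mul0r.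
- by exists (c + d); rewrite h1 h2 polyCD.
- by exists (c * d); rewrite h1 h2 polyCM.
Qed.

(** [l] is the differential of f at 1: the remainder lies in the square of the ideal of 1. *)
Definition jet f (l : 'M[C]_n -> C) : Prop := polyf f /\
  rees (fun g => (f g - f 1%:M - l (g - 1%:M))%:P * 'X^2).

(** * Powers of the ideal of 1 in the functions on a group *)

Section OnGroup.
Variable H : mxgroup C n.
Hypothesis irrH : irr H.

(** On H the function f agrees with an element of the k-th power of the ideal of 1. *)
Definition van k f : Prop := exists2 F, rees F & forall g, mxset H g -> F g = (f g)%:P * 'X^k.

Lemma van_ext k f h : (forall g, mxset H g -> f g = h g) -> van k f -> van k h.
Proof. by move=> E [F rF HF]; exists F => // g Hg; rewrite -E // HF. Qed.

Lemma vanD k f h : van k f -> van k h -> van k (fun g => f g + h g).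
Proof.
move=> [F rF HF] [F' rF' HF']; exists (fun g => F g + F' g); first exact: reesD.
by move=> g Hg; rewrite HF // HF' // polyCD mulrDl.
Qed.

Lemma vanM k l f h : van k f -> van l h -> van (k + l) (fun g => f g * h g).
Proof.
move=> [F rF HF] [F' rF' HF']; exists (fun g => F g * F' g); first exact: reesM.
by move=> g Hg; rewrite HF // HF' // polyCM exprD; ring.
Qed.

Lemma van_poly f : polyf f -> van 0 f.
Proof. by move=> /rees_poly rf; exists (fun g => (f g)%:P) => // g _; rewrite mulr1. Qed.

Lemma van1 f : polyf f -> f 1%:M = 0 -> van 1 f.
Proof.
move=> /rees_van1 rf f1; exists (fun g => (f g - f 1%:M)%:P * 'X) => // g _.
by rewrite f1 subr0.
Qed.

Lemma vanZ k c f : van k f -> van k (fun g => c * f g).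
Proof. exact: (@vanM 0 k _ _ (van_poly (polyf_const c))). Qed.

Lemma vanB k f h : van k f -> van k h -> van k (fun g => f g - h g).
Proof.
by move=> vf /(vanZ (-1)) vh; apply: van_ext (vanD vf vh) => g _; rewrite mulN1r.
Qed.

Lemma van_sum k (I : Type) (r : seq I) (F : I -> 'M[C]_n -> C) :
  (forall i, van k (F i)) -> van k (fun g => \sum_(i <- r) F i g).
Proof.
move=> h; elim: r => [|i r IH].
  exists (fun=> 0) => [|g _]; first exact: (rees_const 0).
  by rewrite big_nil mul0r.
by apply: van_ext (vanD (h i) IH) => g _; rewrite big_cons.
Qed.

Lemma van_sq k f : van k f -> van k.+1 (fun g => f (g *m g) - 2 ^+ k * f g).
Proof.
move=> [F rF HF]; exists (fun g => 'X * (F (g *m g) - (F g \Po (2%:P * 'X)))); first exact: rees_diff.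
move=> g Hg; rewrite HF; last exact: mxgroupM.
rewrite HF // comp_polyM comp_polyC comp_Xn_poly exprMn -polyC_exp polyCB polyCM exprS; ring.
Qed.

(** Artin-Rees argument: the elements f X^(k+2) generate a finitely generated ideal of the Rees
    algebra, and the coefficient of degree m + 2 in a relation gives f = d f on H with d (1) = 0. By
    irreducibility f or 1 - d vanishes on H, and 1 - d does not. *)
Lemma krull f : polyf f -> (forall k, van k.+2 f) -> forall g, mxset H g -> f g = 0.
Proof.
move=> pf vf.
have QP k : exists Q, forall g, mxset H g -> phi g Q = (f g)%:P * 'X^(k.+2).
  by have [F [Q HQ] HF] := vf k; exists Q => g Hg; rewrite -HQ HF.
pose Q k := sval (cid (QP k)).
have HQ k g : mxset H g -> phi g (Q k) = (f g)%:P * 'X^(k.+2) by exact: (svalP (cid (QP k))).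
(* The ideal generated by all [Q k], as the increasing union of the ideals generated by the first m
   of them. *)
pose II : set (mpoly (N + N) C) := [set q | exists m, forall I : set (mpoly (N + N) C),
  is_ideal I -> (forall k, (k < m)%N -> I (Q k)) -> I q].
have [s [sI Is]] : exists s : seq (mpoly (N + N) C), (forall x, x \in s -> II x) /\ II `<=` span_of s.
  apply: mpoly_noetherian; split.
  - by exists 0%N => I [].
  - move=> x y [m hx] [m' hy]; exists (maxn m m') => I iI IQ; have [_ ID _] := iI.
    by apply: ID; [apply: hx | apply: hy] => // k km; apply: IQ; rewrite leq_max km ?orbT.
  - move=> a x [m hx]; exists m => I iI IQ; have [_ _ IM] := iI.
    by apply: IM; apply: hx.
have [m hm] : exists m, forall q, q \in s -> forall I : set (mpoly (N + N) C),
    is_ideal I -> (forall k, (k < m)%N -> I (Q k)) -> I q.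
  elim: s sI {Is} => [|q s IH] sI; first by exists 0%N.
  have [|m hm] := IH; first by move=> x xs; apply: sI; rewrite inE xs orbT.
  have [m' hm'] := sI q (mem_head _ _); exists (maxn m' m) => x; rewrite inE => xs I iI IQ.
  case/orP: xs => [/eqP ->|/hm h]; [apply: hm' | apply: h] => // k km.
    by apply: IQ; rewrite leq_max km.
  by apply: IQ; rewrite leq_max km orbT.
have [c Ec] : span_of (mkseq Q m) (Q m).
  have IQm : II (Q m) by exists m.+1 => I _; apply.
  apply: (span_sub (span_ideal _) _ (Is _ IQm)) => q /hm; apply; first exact: span_ideal.
  by move=> k km; apply: span_mem; apply/mapP; exists k; rewrite ?mem_iota.
rewrite size_mkseq in Ec.
pose d g := \sum_(k < m) (phi g (c k))`_(m - k).
have pd : polyf d by apply: polyf_sum => k _; apply: rees_coef; exists (c k).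
have d1 : d 1%:M = 0.
  by apply: big1 => k _; apply: (@rees_coef1 (fun g => phi g (c k))); [exists (c k) | rewrite subn_gt0].
have df g : mxset H g -> (1 - d g) * f g = 0.
  move=> Hg; have := HQ m g Hg; rewrite Ec rmorph_sum /= => /(congr1 (fun p : {poly C} => p`_m.+2)).
  rewrite coefCM coefXn eqxx mulr1 coef_sum => E; rewrite mulrBl mul1r -[X in X - _]E.
  apply/eqP; rewrite subr_eq0 /d mulr_suml; apply/eqP/eq_bigr => k _.
  rewrite nth_mkseq // rmorphM HQ // mulrCA mulrC coefMC coefMXn.
  by rewrite ltnS ltnS ltnNge ltnW ?ltn_ord //= !subSS.
have [g Hg|K|//] := irrH (polyfB (polyf_const 1) pd) pf; first exact: df.
by have := K _ (mxgroup1 H); rewrite d1 subr0 => /eqP; rewrite oner_eq0.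
Qed.

(** If all f i lie in the k-th power of the ideal with k >= 2, then modulo the next power f i (g g)
    is congruent both to 2^k f i and, as the c i j vanish at 1, to 2 f i. Since 2^k differs from 2,
    the order of vanishing increases by one. *)
Lemma krull_system (I : finType) (f : I -> 'M[C]_n -> C) (c : I -> I -> 'M[C]_n -> C) :
  (forall i, polyf (f i)) -> (forall i j, polyf (c i j)) -> (forall i j, c i j 1%:M = 0) ->
  (forall i g, mxset H g -> f i (g *m g) = 2 * f i g + \sum_j c i j g * f j g) ->
  (forall i, van 2 (f i)) -> forall i g, mxset H g -> f i g = 0.
Proof.
move=> pf pc c1 sq v2 i; apply: krull (pf i) _ => k; elim: k i => [//|k IH] i.
have nz : (2 - 2 ^+ k.+2 : C) != 0.
  rewrite subr_eq0 -natrX eqr_nat; apply/eqP => E.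
  by have := ltn_expl k.+2 (ltnSn 1); rewrite -E.
have v := vanB (van_sq (IH i)) (van_sum (index_enum I) (fun j => vanM (van1 (pc i j) (c1 i j)) (IH j))).
apply: van_ext (vanZ (2 - 2 ^+ k.+2)^-1 v) => g Hg; rewrite sq //.
rewrite (_ : _ - _ - _ = (2 - 2 ^+ k.+2) * f i g) ?mulKf //; ring.
Qed.

(** The tangent space at 1 of the Zariski closure, expressed through the differentials of the matrix
    coefficients of all the [rho d], which exhaust the polynomial functions. *)
Definition lie : set 'M[C]_n := [set X | forall d Phi,
  (forall g, mxset H g -> \tr (Phi *m rho d g) = 0) -> \tr (Phi *m drho d X) = 0].

End OnGroup.

Lemma jet_ext f f' (l l' : 'M[C]_n -> C) : f =1 f' -> l =1 l' -> jet f l -> jet f' l'.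
Proof.
move=> Ef El [pf rf]; split; first exact: polyf_ext pf.
by apply: rees_ext rf => g; rewrite !Ef El.
Qed.

Lemma jet_entry i j : jet (fun g => g i j) (fun X => X i j).
Proof.
split; first exact: polyf_entry.
by apply: rees_ext (rees_const 0) => g; rewrite !mxE subrr mul0r.
Qed.

Lemma jet_const c : jet (fun=> c) (fun=> 0).
Proof.
split; first exact: polyf_const.
by apply: rees_ext (rees_const 0) => g; rewrite subrr subr0 mul0r.
Qed.

Lemma jetD f f' (l l' : 'M[C]_n -> C) : jet f l -> jet f' l' ->
  jet (fun g => f g + f' g) (fun X => l X + l' X).
Proof.
move=> [pf rf] [pf' rf']; split; first exact: polyfD.
by apply: rees_ext (reesD rf rf') => g; rewrite -mulrDl -polyCD; congr (_%:P * _); ring.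
Qed.

Lemma jetM f f' (l l' : 'M[C]_n -> C) : jet f l -> jet f' l' ->
  jet (fun g => f g * f' g) (fun X => l X * f' 1%:M + f 1%:M * l' X).
Proof.
move=> [pf rf] [pf' rf']; split; first exact: polyfM.
apply: rees_ext (reesD (reesM (rees_van1 pf) (rees_van1 pf'))
  (reesD (reesM (rees_const (f' 1%:M)) rf) (reesM (rees_const (f 1%:M)) rf'))) => g.
have -> : forall a b : {poly C}, a * 'X * (b * 'X) = a * b * 'X^2.
  by move=> a b; rewrite expr2; ring.
rewrite !(polyCB, polyCD, polyCM); ring.
Qed.

Lemma jetZ c f (l : 'M[C]_n -> C) : jet f l -> jet (fun g => c * f g) (fun X => c * l X).
Proof. by move=> /(jetM (jet_const c)); apply: jet_ext => // X; rewrite mul0r add0r. Qed.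

Lemma jet_sum (I : Type) (r : seq I) (F L : I -> 'M[C]_n -> C) :
  (forall i, jet (F i) (L i)) -> jet (fun g => \sum_(i <- r) F i g) (fun X => \sum_(i <- r) L i X).
Proof.
move=> h; elim: r => [|i r IH].
  by apply: jet_ext (jet_const 0) => g; rewrite big_nil.
by apply: jet_ext (jetD (h i) IH) => g; rewrite big_cons.
Qed.

Lemma jet_prod d (F L : 'I_d -> 'M[C]_n -> C) : (forall i, jet (F i) (L i)) ->
  jet (fun g => \prod_(i < d) F i g) (fun X => \sum_(i < d) L i X * \prod_(j < d | j != i) F j 1%:M).
Proof.
elim: d F L => [|d IH] F L h.
  by apply: jet_ext (jet_const 1) => g; rewrite big_ord0.
have := jetM (h ord0) (IH (fun i => F (lift ord0 i)) (fun i => L (lift ord0 i)) (fun i => h _)).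
apply: jet_ext => [g|X]; first by rewrite big_ord_recl.
rewrite big_ord_recl; congr (_ * _ + _).
  by rewrite [RHS]big_mkcond big_ord_recl /= mul1r; apply: eq_bigr => i _.
rewrite mulr_sumr; apply: eq_bigr => i _.
rewrite [in RHS]big_mkcond big_ord_recl /= mulrCA; congr (_ * (_ * _)).
by rewrite big_mkcond; apply: eq_bigr => j _; rewrite (inj_eq lift_inj).
Qed.

Definition Jet m p (F L : 'M[C]_n -> 'M[C]_(m, p)) : Prop :=
  forall i j, jet (fun g => F g i j) (fun X => L X i j).

Lemma Jet_id : Jet id id. Proof. exact: jet_entry. Qed.

Lemma Jet_lft : Jet (fun g : 'M[C]_n => lft g) (fun X => block_mx 0 0 0 X : 'M[C]_(1 + n)).
Proof.
move=> i j; case: (fintype.split_ordP i) => k ->; case: (fintype.split_ordP j) => l ->.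
- by apply: jet_ext (jet_const ((1%:M : 'M[C]_1) k l)) => g; rewrite /lft ?block_mxEul ?mxE.
- by apply: jet_ext (jet_const 0) => g; rewrite /lft ?block_mxEur ?mxE.
- by apply: jet_ext (jet_const 0) => g; rewrite /lft ?block_mxEdl ?mxE.
- by apply: jet_ext (jet_entry k l) => g; rewrite /lft ?block_mxEdr.
Qed.

Lemma Jet_tpow m (F L : 'M[C]_n -> 'M[C]_m) k : F 1%:M = 1%:M -> Jet F L ->
  Jet (fun g => tpow k (F g)) (fun X => dtens k (L X)).
Proof.
move=> F1 h i j.
apply: jet_ext (@jet_prod k (fun l g => F g (tidx i l) (tidx j l))
    (fun l X => L X (tidx i l) (tidx j l)) _) => [g|X|l]; rewrite ?mxE //.
by apply: eq_bigr => l _; congr (_ * _); apply: eq_bigr => l' _; rewrite F1 mxE.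
Qed.

Lemma Jet_rho d : Jet (fun g => rho d g) (fun X => drho d X).
Proof. by apply: (Jet_tpow (F := fun g => lft g)); [exact: lft1 | exact: Jet_lft]. Qed.

Lemma jet_tr m (Phi : 'M[C]_m) (F L : 'M[C]_n -> 'M[C]_m) : Jet F L ->
  jet (fun g => \tr (Phi *m F g)) (fun X => \tr (Phi *m L X)).
Proof.
move=> h; rewrite /mxtrace; apply: (@jet_sum _ (index_enum 'I_m) (fun i g => (Phi *m F g) i i)
  (fun i X => (Phi *m L X) i i)) => i.
apply: jet_ext (@jet_sum _ (index_enum 'I_m) (fun j g => Phi i j * F g j i)
  (fun j X => Phi i j * L X j i) _) => [g|X|j]; rewrite ?mxE //.
exact: jetZ.
Qed.

Definition row_of (l : 'M[C]_n -> C) : 'rV[C]_(n * n) := \row_k l (vec_mx (delta_mx 0 k)).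

Lemma row_ofE (l : 'M[C]_n -> C) X : (forall c X Y, l (c *: X + Y) = c * l X + l Y) ->
  (row_of l *m (mxvec X)^T) 0 0 = l X.
Proof.
move=> ll; have l0 : l 0 = 0 by have := ll (-1) 0 0; rewrite scaler0 addr0 mulN1r addNr.
rewrite -[in RHS](mxvecK X) [mxvec X in RHS]row_sum_delta mxE.
have -> : \sum_k row_of l 0 k * (mxvec X)^T k 0 = \sum_k mxvec X 0 k * l (vec_mx (delta_mx 0 k)).
  by apply: eq_bigr => k _; rewrite !mxE mulrC.
rewrite linear_sum; elim: (index_enum _) => [|k s IH]; first by rewrite !big_nil l0.
by rewrite !big_cons linearZ /= ll IH.
Qed.

Lemma drho_lin d Phi (c : C) (X Y : 'M[C]_n) :
  \tr (Phi *m drho d (c *: X + Y)) = c * \tr (Phi *m drho d X) + \tr (Phi *m drho d Y).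
Proof.
have -> : drho d (c *: X + Y) = c *: drho d X + drho d Y.
  rewrite /drho -linearP; congr dtens; rewrite scale_block_mx add_block_mx.
  by rewrite !scaler0 !addr0.
by rewrite mulmxDr -scalemxAr mxtraceD mxtraceZ.
Qed.

(** * From the Lie algebra to the group *)

Section Tangent.
Variable H : mxgroup C n.
Hypothesis irrH : irr H.

(** By duality l is a combination of differentials of polynomials vanishing on H. Subtracting the
    same combination of these polynomials changes nothing on H and leaves a function with zero
    differential. *)
Lemma tangent_van2 f (l : 'M[C]_n -> C) : jet f l -> f 1%:M = 0 ->
  (forall c X Y, l (c *: X + Y) = c * l X + l Y) -> (forall X, lie H X -> l X = 0) -> van H 2 f.
Proof.
move=> [pf rf] f1 ll l0.
pose van0 d Phi := forall g, mxset H g -> \tr (Phi *m rho d g) = 0.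
pose S : set 'rV[C]_(n * n) := [set v | forall P : set 'rV[C]_(n * n), P 0 ->
  (forall c u v, P u -> P v -> P (c *: u + v)) ->
  (forall d Phi, van0 d Phi -> P (row_of (fun X => \tr (Phi *m drho d X)))) -> P v].
have [||k [B [fB SB]]] := @subspace_basis C (n * n) S.
- by move=> P.
- by move=> c u v Su Sv P P0 PL Pg; apply: (PL); [apply: Su | apply: Sv].
have Sgen d Phi : van0 d Phi -> S (row_of (fun X => \tr (Phi *m drho d X))).
  by move=> h P P0 PL Pg; apply: Pg.
have lB : (row_of l <= B)%MS.
  rewrite submxE; apply/eqP/rowP => j; rewrite [RHS]mxE.
  pose X := vec_mx (col j (cokermx B))^T; have EX : (mxvec X)^T = col j (cokermx B).
    by rewrite vec_mxK trmxK.
  have colE u : (u *m cokermx B) 0 j = (u *m col j (cokermx B)) 0 0.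
    by rewrite !mxE; apply: eq_bigr => i _; rewrite !mxE.
  rewrite colE -EX row_ofE // l0 // => d Phi /Sgen /SB; rewrite submxE => /eqP/rowP/(_ j).
  by rewrite colE -EX row_ofE ?mxE // => c Y Z; exact: drho_lin.
pose P : set 'rV[C]_(n * n) := [set v | exists2 p, jet p (fun X => (v *m (mxvec X)^T) 0 0) &
  forall g, mxset H g -> p g = 0].
have [||d Phi h|p [pp rp] p0] := (SB _).2 lB P.
- by exists (fun=> 0) => //; apply: jet_ext (jet_const 0) => // X; rewrite mul0mx mxE.
- move=> c u v [p jp hp] [q jq hq]; exists (fun g => c * p g + q g).
    apply: jet_ext (jetD (jetZ c jp) jq) => // X.
    by rewrite mulmxDl -scalemxAl [in RHS]mxE [X in _ = X + _]mxE.
  by move=> g Hg; rewrite hp // hq // mulr0 addr0.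
- exists (fun g => \tr (Phi *m rho d g)) => //.
  have jr := jet_tr Phi (@Jet_rho d); apply: jet_ext jr => // X.
  by rewrite row_ofE // => c Y Z; exact: drho_lin.
exists (fun g => (f g - p g)%:P * 'X^2); last by move=> g Hg; rewrite p0 // subr0.
have p1 : p 1%:M = 0 by apply: p0; exact: mxgroup1.
apply: rees_ext (reesB rf rp) => g; rewrite -mulrBl -polyCB f1 p1 row_ofE //.
by congr (_%:P * _); ring.
Qed.

(** The displacement u (g) = w F (g) - w satisfies u (g g) = 2 u (g) + u (g) (F (g) - 1), and its
    differential vanishes on the Lie algebra. *)
Lemma lie_fixed m (F L : 'M[C]_n -> 'M[C]_m) (w : 'rV[C]_m) :
  Jet F L -> F 1%:M = 1%:M -> (forall x y, F (x *m y) = F x *m F y) ->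
  (forall c X Y, L (c *: X + Y) = c *: L X + L Y) ->
  (forall X, lie H X -> w *m L X = 0) -> forall g, mxset H g -> w *m F g = w.
Proof.
move=> JF F1 FM LL h g Hg.
have jw j : jet (fun g => (w *m F g - w) 0 j) (fun X => (w *m L X) 0 j).
  apply: jet_ext (jetD (@jet_sum _ (index_enum 'I_m) (fun k g => w 0 k * F g k j)
     (fun k X => w 0 k * L X k j) (fun k => jetZ _ (JF k j))) (jet_const (- w 0 j))) => [x|X].
    by rewrite !mxE.
  by rewrite addr0 mxE.
suff E : w *m F g - w = 0 by apply/eqP; rewrite -subr_eq0 E.
apply/rowP=> j; rewrite [RHS]mxE.
apply: (@krull_system H irrH 'I_m (fun j g => (w *m F g - w) 0 j)
   (fun j k g => (F g - 1%:M) k j)) => // {j} [j|j k|j k|j x Hx|j].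
- by have [] := jw j.
- apply: (polyf_ext (f := fun g => F g k j + (- (1%:M : 'M[C]_m) k j))).
    by move=> x; rewrite !mxE.
  by apply: polyfD; [have [] := JF k j | exact: polyf_const].
- by rewrite F1 subrr mxE.
- have -> : w *m F (x *m x) - w = 2 *: (w *m F x - w) + (w *m F x - w) *m (F x - 1%:M).
    rewrite FM mulmxA mulmxBr mulmx1 mulmxBl scaler_nat mulr2n.
    by move: (w *m F x *m F x) (w *m F x) => a b; apply/rowP=> k; rewrite !mxE; ring.
  by rewrite [LHS]mxE [X in X + _]mxE [X in _ + X]mxE; congr (_ + _); apply: eq_bigr => k _; rewrite mulrC.
- apply: tangent_van2 (jw j) _ _ _.
  + by rewrite F1 mulmx1 subrr mxE.
  + by move=> c X Y; rewrite LL mulmxDr -scalemxAr [LHS]mxE [X in X + _]mxE.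
  + by move=> X /h ->; rewrite mxE.
Qed.

(** The commutator c (g) = A F (g) - F (g) A satisfies c (g g) = 2 c + c (F - 1) + (F - 1) c at g.
    Its entries form a system indexed by pairs. *)
Lemma lie_commute m (F L : 'M[C]_n -> 'M[C]_m) (A : 'M[C]_m) :
  Jet F L -> F 1%:M = 1%:M -> (forall x y, F (x *m y) = F x *m F y) ->
  (forall c X Y, L (c *: X + Y) = c *: L X + L Y) ->
  (forall X, lie H X -> A *m L X = L X *m A) -> forall g, mxset H g -> A *m F g = F g *m A.
Proof.
move=> JF F1 FM LL h g Hg.
pose f g := A *m F g - F g *m A.
have jf i j : jet (fun g => f g i j) (fun X => (A *m L X - L X *m A) i j).
  have j1 := @jet_sum _ (index_enum 'I_m) (fun k g => A i k * F g k j)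
     (fun k X => A i k * L X k j) (fun k => jetZ _ (JF k j)).
  have j2 := @jet_sum _ (index_enum 'I_m) (fun k g => A k j * F g i k)
     (fun k X => A k j * L X i k) (fun k => jetZ _ (JF i k)).
  have E (P Q : 'M[C]_m) : (P - Q) i j = P i j - Q i j by rewrite !mxE.
  apply: jet_ext (jetD j1 (jetZ (-1) j2)) => [x|X]; rewrite mulN1r /f E ![in RHS]mxE.
    by congr (_ - _); apply: eq_bigr => k _; rewrite mulrC.
  by congr (_ - _); apply: eq_bigr => k _; rewrite mulrC.
suff E : f g = 0 by apply/eqP; rewrite -subr_eq0 -/(f g) E.
apply/matrixP=> i j; rewrite [RHS]mxE.
apply: (@krull_system H irrH ('I_m * 'I_m)%type (fun x g => f g x.1 x.2)
   (fun x y g => (y.1 == x.1)%:R * (F g - 1%:M) y.2 x.2 + (F g - 1%:M) x.1 y.1 * (y.2 == x.2)%:R)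
   _ _ _ _ _ (i, j)) => // {i j} [[i j]|[i j] [k l]|[i j] [k l]|[i j] x Hx|[i j]] /=.
- by have [] := jf i j.
- have pF a b : polyf (fun g => (F g - 1%:M) a b).
    apply: (polyf_ext (f := fun g => F g a b + (- (1%:M : 'M[C]_m) a b))).
      by move=> x; rewrite !mxE.
    by apply: polyfD; [have [] := JF a b | exact: polyf_const].
  apply: polyfD; first exact: polyfZ.
  by apply: polyfM; [exact: pF | exact: polyf_const].
- by rewrite F1 subrr !mxE mulr0 mul0r addr0.
- have -> : f (x *m x) = 2 *: f x + (f x *m (F x - 1%:M) + (F x - 1%:M) *m f x).
    rewrite /f FM mulmxBr mulmx1 [_ *m (A *m _ - _)]mulmxBl mul1mx.
    rewrite mulmxBl mulmxBr !mulmxA scaler_nat mulr2n.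
    move: (A *m F x *m F x) (F x *m A *m F x) (F x *m F x *m A) (A *m F x - F x *m A) => a b c d.
    by rewrite [_ - d + _]addrACA -opprD addrCA subrr addr0 addrA subrK.
  rewrite [LHS]mxE [X in X + _]mxE [X in _ + X]mxE; congr (_ + _).
  rewrite (eq_bigr (fun y : 'I_m * 'I_m => (y.1 == i)%:R * (F x - 1%:M) y.2 j * f x y.1 y.2 +
     (F x - 1%:M) i y.1 * (y.2 == j)%:R * f x y.1 y.2)); last by move=> y _; rewrite mulrDl.
  rewrite big_split /=; congr (_ + _).
    rewrite -(pair_bigA _ (fun k l => (k == i)%:R * (F x - 1%:M) l j * f x k l)) /=.
    rewrite [RHS](bigD1 i) //= [X in _ = _ + X]big1 ?addr0 => [|k /negPf ki].
      by rewrite mxE; apply: eq_bigr => l _; rewrite eqxx mul1r mulrC.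
    by rewrite big1 // => l _; rewrite ki !mul0r.
  rewrite -(pair_bigA _ (fun k l => (F x - 1%:M) i k * (l == j)%:R * f x k l)) /=.
  rewrite mxE; apply: eq_bigr => k _; rewrite [RHS](bigD1 j) //= [X in _ = _ + X]big1 ?addr0.
    by rewrite eqxx mulr1.
  by move=> l /negPf lj; rewrite lj mulr0 mul0r.
- apply: tangent_van2 (jf i j) _ _ _.
  + by rewrite /f F1 mulmx1 mul1mx subrr mxE.
  + move=> c X Y; rewrite LL mulmxDr mulmxDl -scalemxAr -scalemxAl opprD addrACA -scalerBr.
    by rewrite [LHS]mxE [X in X + _]mxE.
  + by move=> X /h ->; rewrite subrr mxE.
Qed.
End Tangent.
End Krull.

(** * The matrix exponential *)

Section Exp.
Local Open Scope ring_scope.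
Variable R : realType.

Definition half (j : nat) : R := 2^-1 ^+ j.
Lemma half_gt0 j : 0 < half j. Proof. by rewrite exprn_gt0. Qed.
Lemma half_ge0 j : 0 <= half j. Proof. exact/ltW/half_gt0. Qed.
Lemma half_le1 j : half j <= 1. Proof. by rewrite exprn_ile1 //; lra. Qed.
Lemma halfS j : half j.+1 = half j / 2. Proof. by rewrite /half exprS mulrC. Qed.
Lemma half2 j : half j * 2 ^+ j = 1. Proof. by rewrite /half -exprMn mulVf ?expr1n. Qed.

Lemma half_small e : 0 < e -> exists j, half j < e.
Proof.
move=> e0; pose j := Num.Def.archi_bound e^-1; exists j.
have h : e^-1 < j%:R by apply: archi_boundP; rewrite invr_ge0 ltW.
rewrite /half exprVn -[e]invrK ltf_pV2 ?posrE ?invr_gt0 ?exprn_gt0 //.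
by apply: lt_le_trans h _; rewrite -natrX ler_nat ltnW // ltn_expl.
Qed.

(** Convergence at the rate 2^-j is stable under sums and products and keeps all limits
    elementary. *)
Definition sconv (x : nat -> R) (l : R) : Prop := exists c, forall j, `|x j - l| <= c * half j.

Lemma sconv_ge0 x l : sconv x l -> exists2 c, 0 <= c & forall j, `|x j - l| <= c * half j.
Proof.
move=> [c h]; exists c => //; have := le_trans (normr_ge0 _) (h 0%N).
by rewrite /half expr0 mulr1.
Qed.

Lemma sconv_const l : sconv (fun=> l) l.
Proof. by exists 0 => j; rewrite subrr normr0 mul0r. Qed.

Lemma sconvD x y l m : sconv x l -> sconv y m -> sconv (fun j => x j + y j) (l + m).
Proof.
move=> [c hc] [d hd]; exists (c + d) => j; rewrite opprD addrACA mulrDl.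
by apply: le_trans (ler_normD _ _) _; rewrite lerD.
Qed.

Lemma sconvM x y l m : sconv x l -> sconv y m -> sconv (fun j => x j * y j) (l * m).
Proof.
move=> /sconv_ge0 [c c0 hc] /sconv_ge0 [d d0 hd]; exists (c * (d + `|m|) + `|l| * d) => j.
have -> : x j * y j - l * m = (x j - l) * y j + l * (y j - m) by ring.
apply: le_trans (ler_normD _ _) _; rewrite [leRHS]mulrDl !normrM lerD //; last first.
  by rewrite -mulrA ler_wpM2l.
rewrite mulrAC ler_pM // -[y j](subrK m); apply: le_trans (ler_normD _ _) _.
rewrite lerD2r; apply: le_trans (hd j) _; by rewrite ler_piMr ?half_le1.
Qed.

Lemma sconv_unique x l m : sconv x l -> sconv x m -> l = m.
Proof.
move=> /sconv_ge0 [c c0 hc] /sconv_ge0 [d d0 hd].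
apply/eqP; rewrite -subr_eq0 -normr_le0 leNgt; apply/negP => e0.
have [j hj] := @half_small (`|l - m| / (c + d + 1)) (divr_gt0 e0 (ltr_wpDl (addr_ge0 c0 d0) ltr01)).
have : `|l - m| <= (c + d) * half j.
  have -> : l - m = (x j - m) - (x j - l) by ring.
  apply: le_trans (ler_normB _ _) _; rewrite addrC mulrDl lerD //.
rewrite leNgt => /negP; apply.
move: hj; rewrite ltr_pdivlMr; last by rewrite ltr_wpDl // addr_ge0.
apply: le_lt_trans; rewrite mulrC ler_wpM2l ?half_ge0 //; lra.
Qed.

Lemma sconv_ext x y l : x =1 y -> sconv x l -> sconv y l.
Proof. by move=> E [c h]; exists c => j; rewrite -E. Qed.

Lemma sconv_sum (I : Type) (r : seq I) (x : I -> nat -> R) l :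
  (forall i, sconv (x i) (l i)) -> sconv (fun j => \sum_(i <- r) x i j) (\sum_(i <- r) l i).
Proof.
move=> h; elim: r => [|i r IH].
  by rewrite big_nil; apply: sconv_ext (sconv_const 0) => j; rewrite big_nil.
by rewrite big_cons; apply: sconv_ext (sconvD (h i) IH) => j; rewrite big_cons.
Qed.

Lemma sconv_le x l b : sconv x l -> (forall j, x j <= b) -> l <= b.
Proof.
move=> /sconv_ge0 [c c0 hc] xb; apply/ler_addgt0Pr => e e0.
have [j hj] := half_small (divr_gt0 e0 (ltr_wpDl c0 ltr01)).
have := hc j; rewrite ler_norml => /andP [h1 h2]; have := xb j.
have : c * half j <= e.
  move: hj; rewrite ltr_pdivlMr ?ltr_wpDl // => /ltW; apply: le_trans.
  by rewrite mulrC ler_wpM2l ?half_ge0 //; lra.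
lra.
Qed.

(** Nested intervals of radius 2 c / 2^j around the terms of the sequence. *)
Lemma sconv_exists x c : (forall j, `|x j.+1 - x j| <= c * half j) -> exists l, sconv x l.
Proof.
move=> h; have c0 : 0 <= c by have := le_trans (normr_ge0 _) (h 0%N); rewrite /half expr0 mulr1.
pose u j := x j - 2 * c * half j; pose v j := x j + 2 * c * half j.
have us j : u j <= u j.+1.
  by have := h j; rewrite ler_norml /u halfS => /andP [h1 _]; lra.
have vs j : v j.+1 <= v j.
  by have := h j; rewrite ler_norml /v halfS => /andP [_ h1]; lra.
have um i j : (i <= j)%N -> u i <= u j.
  by move=> /subnK <-; elim: (j - i)%N => [//|k IH]; apply: le_trans IH (us _).
have vm i j : (i <= j)%N -> v j <= v i.
  by move=> /subnK <-; elim: (j - i)%N => [//|k IH]; apply: le_trans (vs _) IH.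
have uv i j : u i <= v j.
  apply: le_trans (um _ _ (leq_maxl i j)) _; apply: le_trans (vm _ _ (leq_maxr i j)).
  have := mulr_ge0 c0 (half_ge0 (maxn i j)); rewrite /u /v; lra.
pose A : set R := fun y => exists j, y = u j.
have A0 : (A !=set0)%classic by exists (u 0%N), 0%N.
have Aub j : ubound A (v j) by move=> _ [i ->].
exists (sup A), (2 * c) => j; rewrite ler_norml.
have h1 : u j <= sup A by apply: ub_le_sup; [exists (v 0%N) | exists j].
have h2 : sup A <= v j by apply: ge_sup.
by move: h1 h2; rewrite /u /v => h1 h2; apply/andP; split; lra.
Qed.

Definition conv m p (A : nat -> 'M[R]_(m, p)) (L : 'M[R]_(m, p)) : Prop :=
  forall a b, sconv (fun j => A j a b) (L a b).

Lemma conv_unique m p (A : nat -> 'M[R]_(m, p)) L L' : conv A L -> conv A L' -> L = L'.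
Proof. by move=> h h'; apply/matrixP=> a b; apply: sconv_unique (h a b) (h' a b). Qed.

Lemma conv_ext m p (A B : nat -> 'M[R]_(m, p)) L : A =1 B -> conv A L -> conv B L.
Proof. by move=> E h a b; apply: sconv_ext (h a b) => j; rewrite E. Qed.

Lemma conv_mulmx m p q (A : nat -> 'M[R]_(m, p)) (B : nat -> 'M[R]_(p, q)) L M :
  conv A L -> conv B M -> conv (fun j => A j *m B j) (L *m M).
Proof.
move=> hA hB a b; rewrite mxE; apply: (sconv_ext (x := fun j => \sum_k A j a k * B j k b)).
  by move=> j; rewrite mxE.
by apply: sconv_sum => k; apply: sconvM.
Qed.

Lemma conv_pow m (A : nat -> 'M[R]_m) L k : conv A L -> conv (fun j => A j ^+ k) (L ^+ k).
Proof.
move=> h; elim: k => [|k IH]; first by move=> a b; exact: sconv_const.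
rewrite exprS; apply: conv_ext (conv_mulmx h IH) => j; by rewrite exprS.
Qed.

Lemma conv_polyf n (A : nat -> 'M[R]_n) L f : polyf f -> conv A L -> sconv (fun j => f (A j)) (f L).
Proof.
move=> pf h; elim/polyf_ind: pf => [f1 f2 E|c|i j|f1 f2 _ _ h1 h2|f1 f2 _ _ h1 h2].
- by rewrite E; apply: sconv_ext => j; rewrite E.
- exact: sconv_const.
- exact: h.
- exact: sconvD.
- exact: sconvM.
Qed.

Lemma conv_nrm_le m p (A : nat -> 'M[R]_(m, p)) L b :
  conv A L -> (forall j, nrm (A j) <= b) -> nrm L <= b.
Proof.
move=> h; apply: sconv_le; rewrite /nrm.
apply: sconv_sum => a; apply: sconv_sum => c; have [d hd] := h a c; exists d => j.
by apply: le_trans (ler_dist_dist _ _) (hd j).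
Qed.

(** * Powers near the identity and their limits *)

Section Pow.
Variable n : nat.
Implicit Types (X Y Z A : 'M[R]_n).
Local Notation n1 := (nrm (1%:M : 'M[R]_n)).

Lemma mulmxr (A B : 'M[R]_n) : A * B = A *m B. Proof. by []. Qed.

Lemma pow_bound Y y k : nrm Y <= y -> nrm ((1%:M + Y) ^+ k) <= n1 * (1 + y) ^+ k.
Proof.
move=> hY; have y0 := le_trans (nrm_ge0 Y) hY.
elim: k => [|k IH]; first by rewrite !expr0 mulr1.
rewrite exprSr mulmxr mulmxDr mulmx1 exprSr mulrA; apply: le_trans (nrmD _ _) _.
rewrite mulrDr mulr1; apply: lerD => //; apply: le_trans (nrmM _ _) _.
by rewrite ler_pM ?nrm_ge0.
Qed.

Lemma pow_diff Y Y' y d k : nrm Y <= y -> nrm Y' <= y -> nrm (Y - Y') <= d ->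
  nrm ((1%:M + Y) ^+ k - (1%:M + Y') ^+ k) <= k%:R * (n1 * (1 + y) ^+ k * d).
Proof.
move=> hY hY' hd; have y0 := le_trans (nrm_ge0 Y) hY; have d0 := le_trans (nrm_ge0 _) hd.
elim: k => [|k IH]; first by rewrite !expr0 subrr nrm0 mul0r.
have -> : (1%:M + Y) ^+ k.+1 - (1%:M + Y') ^+ k.+1 =
   (1%:M + Y) ^+ k *m (Y - Y') + (((1%:M + Y) ^+ k - (1%:M + Y') ^+ k) +
   ((1%:M + Y) ^+ k - (1%:M + Y') ^+ k) *m Y').
  rewrite !exprSr !mulmxr; move: (_ ^+ k) (_ ^+ k) => P Q.
  rewrite !mulmxDr !mulmxBl !mulmx1 mulmxN.
  by apply/matrixP=> a b; rewrite !mxE; ring.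
have P0 : 0 <= n1 * (1 + y) ^+ k by rewrite mulr_ge0 ?nrm_ge0 // exprn_ge0 // addr_ge0.
have P1 : n1 * (1 + y) ^+ k <= n1 * (1 + y) ^+ k.+1.
  by rewrite ler_wpM2l ?nrm_ge0 // exprSr ler_peMr ?exprn_ge0 ?lerDl // addr_ge0.
apply: le_trans (nrmD _ _) _; rewrite -natr1 mulrDl mul1r addrC; apply: lerD; last first.
  apply: le_trans (nrmM _ _) _; apply: le_trans (ler_pM _ _ (pow_bound k hY) hd) _; rewrite ?nrm_ge0 //.
  by rewrite ler_wpM2r.
apply: le_trans (nrmD _ _) _; apply: (@le_trans _ _ (k%:R * (n1 * (1 + y) ^+ k * d) * (1 + y))).
  rewrite mulrDr mulr1; apply: lerD => //; apply: le_trans (nrmM _ _) _.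
  by rewrite ler_pM ?nrm_ge0.
by rewrite exprSr -!mulrA !ler_wpM2l ?nrm_ge0 ?exprn_ge0 ?addr_ge0 // mulrC.
Qed.

Lemma pow_second Z k : nrm ((1%:M + Z) ^+ k - 1%:M - Z *+ k) <=
  (k * k)%:R * (n1 * (1 + nrm Z) ^+ k) * nrm Z ^+ 2.
Proof.
set z := nrm Z; have z0 : 0 <= z by apply: nrm_ge0.
elim: k => [|k IH]; first by rewrite expr0 subrr mulr0n subrr nrm0 !mul0r.
have -> : (1%:M + Z) ^+ k.+1 - 1%:M - Z *+ k.+1 =
   ((1%:M + Z) ^+ k - 1%:M - Z *+ k) + ((1%:M + Z) ^+ k - (1%:M + 0) ^+ k) *m Z.
  rewrite addr0 (expr1n _ k : (1%:M : 'M[R]_n) ^+ k = 1%:M) exprSr mulmxr mulmxDr mulmx1 mulrS mulmxBl mul1mx.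
  by move: (_ ^+ k) => P; apply/matrixP=> a b; rewrite !mxE; ring.
have h : nrm ((1%:M + Z) ^+ k - (1%:M + 0) ^+ k) <= k%:R * (n1 * (1 + z) ^+ k * z).
  by apply: pow_diff; rewrite ?nrm0 // subr0.
have P0 : 0 <= n1 * (1 + z) ^+ k by rewrite mulr_ge0 ?nrm_ge0 // exprn_ge0 // addr_ge0.
have P1 : n1 * (1 + z) ^+ k <= n1 * (1 + z) ^+ k.+1.
  by rewrite ler_wpM2l ?nrm_ge0 // exprSr ler_peMr ?exprn_ge0 ?lerDl // addr_ge0.
apply: le_trans (nrmD _ _) _.
apply: (@le_trans _ _ ((k * k)%:R * (n1 * (1 + z) ^+ k) * z ^+ 2 + k%:R * (n1 * (1 + z) ^+ k * z) * z)).
  apply: lerD => //; apply: le_trans (nrmM _ _) _; by rewrite ler_wpM2r.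
apply: (@le_trans _ _ (((k * k)%:R + k%:R) * (n1 * (1 + z) ^+ k) * z ^+ 2)).
  by rewrite le_eqVlt; apply/orP; left; apply/eqP; ring.
rewrite ler_wpM2r ?exprn_ge0 //; apply: ler_pM => //.
by rewrite -natrD ler_nat; nia.
Qed.

Lemma pow2_bound c j : 0 <= c -> (1 + c * half j) ^+ (2 ^ j) <= expR c.
Proof.
move=> c0; have h : 1 + c * half j <= expR (c * half j) by apply: expR_ge1Dx.
apply: (@le_trans _ _ (expR (c * half j) ^+ (2 ^ j))).
  by rewrite lerXn2r ?nnegrE ?expR_ge0 // addr_ge0 // mulr_ge0 ?half_ge0.
by rewrite -expRM_natr natrX -mulrA half2 mulr1.
Qed.

(** An error of order 4^-j in each factor accumulates over 2^j factors to the order 2^-j. *)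
Lemma near_pow X c (A : nat -> 'M[R]_n) : 0 <= c ->
  (forall j, nrm (A j - 1%:M - half j *: X) <= c * half j ^+ 2) ->
  exists K, forall j, nrm (A j ^+ (2 ^ j) - (1%:M + half j *: X) ^+ (2 ^ j)) <= K * half j.
Proof.
move=> c0 h; pose b := nrm X + c; have b0 : 0 <= b by rewrite addr_ge0 ?nrm_ge0.
exists (n1 * expR b * c) => j.
have EA : A j = 1%:M + (A j - 1%:M) by rewrite addrC subrK.
rewrite EA; apply: le_trans (@pow_diff _ _ (b * half j) (c * half j ^+ 2) _ _ _ _) _.
- have -> : A j - 1%:M = (A j - 1%:M - half j *: X) + half j *: X by rewrite subrK.
  apply: le_trans (nrmD _ _) _; rewrite nrmZ ger0_norm ?half_ge0 //.
  apply: (@le_trans _ _ (c * half j ^+ 2 + half j * nrm X)); first by rewrite lerD2r.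
  rewrite /b mulrDl addrC [half j * _]mulrC lerD2l ler_wpM2l // expr2 ler_piMr ?half_ge0 ?half_le1 //.
- rewrite nrmZ ger0_norm ?half_ge0 // mulrC ler_wpM2r ?half_ge0 // lerDl //.
- exact: h.
have -> : (2 ^ j)%:R * (n1 * (1 + b * half j) ^+ (2 ^ j) * (c * half j ^+ 2)) =
    n1 * (1 + b * half j) ^+ (2 ^ j) * c * half j.
  rewrite natrX expr2; transitivity (n1 * (1 + b * half j) ^+ (2 ^ j) * c * half j * (half j * 2 ^+ j)).
    by ring.
  by rewrite half2 mulr1.
by rewrite !ler_wpM2r ?half_ge0 // ler_wpM2l ?nrm_ge0 // pow2_bound.
Qed.

(** Passing from j to j + 1 replaces the base 1 + X / 2^j by the square of 1 + X / 2^(j+1), a change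
    of order 4^-j. *)
Lemma mexp_exists X : exists E, conv (fun j => (1%:M + half j *: X) ^+ (2 ^ j)) E.
Proof.
have sq j : nrm ((1%:M + half j.+1 *: X) ^+ 2 - 1%:M - half j *: X) <= nrm X ^+ 2 * half j ^+ 2.
  have -> : (1%:M + half j.+1 *: X) ^+ 2 - 1%:M - half j *: X = half j.+1 ^+ 2 *: (X *m X).
    rewrite expr2 mulmxr mulmxDl mul1mx mulmxDr mulmx1 -scalemxAl -scalemxAr scalerA -expr2.
    by move: (X *m X) => Y; apply/matrixP=> a b; rewrite !mxE halfS; field.
  rewrite nrmZ ger0_norm ?exprn_ge0 ?half_ge0 // mulrC ler_pM ?exprn_ge0 ?nrm_ge0 ?half_ge0 //.
    exact: nrmM.
  rewrite lerXn2r ?nnegrE ?half_ge0 // halfS; have := half_ge0 j; lra.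
have [|K HK] := near_pow _ sq; first by rewrite exprn_ge0 ?nrm_ge0.
pose P j := (1%:M + half j *: X) ^+ (2 ^ j).
have PS j : nrm (P j.+1 - P j) <= K * half j.
  by have := HK j; rewrite -exprM -expnS.
have L a b : exists l, sconv (fun j => P j a b) l.
  apply: (@sconv_exists _ K) => j; apply: le_trans (PS j).
  by apply: le_trans (nrm_entry _ a b); rewrite !mxE.
exists (\matrix_(a, b) sval (cid (L a b))) => a b; rewrite mxE.
exact: (svalP (cid (L a b))).
Qed.

Definition mexp X := sval (cid (mexp_exists X)).

Lemma mexpP X : conv (fun j => (1%:M + half j *: X) ^+ (2 ^ j)) (mexp X).
Proof. exact: (svalP (cid (mexp_exists X))). Qed.

(** The limit depends only on the base to first order; both the roots of the exponential and its
    compatibility with representations follow from this. *)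
Lemma mexp_near X c (A : nat -> 'M[R]_n) : 0 <= c ->
  (forall j, nrm (A j - 1%:M - half j *: X) <= c * half j ^+ 2) ->
  conv (fun j => A j ^+ (2 ^ j)) (mexp X).
Proof.
move=> c0 h; have [K HK] := near_pow c0 h; move=> a b.
have s0 : sconv (fun j => (A j ^+ (2 ^ j) - (1%:M + half j *: X) ^+ (2 ^ j)) a b) 0.
  exists K => j; rewrite subr0; apply: le_trans (HK j); exact: nrm_entry.
rewrite -[mexp X a b]add0r; apply: sconv_ext (sconvD s0 (mexpP X a b)) => j.
by rewrite mxE [X in _ + X + _]mxE subrK.
Qed.

Lemma mexp_root X m : (0 < m)%N -> mexp X = mexp (m%:R^-1 *: X) ^+ m.
Proof.
move=> m0; have mn : m%:R != 0 :> R by rewrite pnatr_eq0 -lt0n.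
pose Y := m%:R^-1 *: X; pose A j := (1%:M + half j *: Y) ^+ m.
pose c : R := (m * m)%:R * (n1 * (1 + nrm Y) ^+ m) * nrm Y ^+ 2.
have c0 : 0 <= c.
  by rewrite !mulr_ge0 ?exprn_ge0 ?nrm_ge0 ?addr_ge0 ?nrm_ge0.
apply: (@conv_unique _ _ (fun j => A j ^+ (2 ^ j))).
  apply: (mexp_near c0) => j; rewrite /A.
  have -> : half j *: X = (half j *: Y) *+ m.
    by rewrite /Y -scaler_nat !scalerA mulrAC divff // mul1r.
  apply: le_trans (pow_second _ _) _; rewrite nrmZ ger0_norm ?half_ge0 // /c.
  rewrite exprMn mulrCA [half j ^+ 2 * _]mulrC ler_wpM2r ?exprn_ge0 ?half_ge0 //.
  rewrite ler_wpM2r ?exprn_ge0 ?nrm_ge0 // ler_wpM2l // ler_wpM2l ?nrm_ge0 //.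
  rewrite lerXn2r ?nnegrE ?addr_ge0 ?mulr_ge0 ?nrm_ge0 ?half_ge0 // lerD2l.
  by rewrite ler_piMl ?nrm_ge0 ?half_le1.
apply: conv_ext (conv_pow m (mexpP Y)) => j; by rewrite -!exprM mulnC.
Qed.

Lemma mexp_second X : exists2 c, 0 <= c & forall s, `|s| <= 1 ->
  nrm (mexp (s *: X) - 1%:M - s *: X) <= c * s ^+ 2.
Proof.
exists (n1 * expR (nrm X) * nrm X ^+ 2).
  by rewrite !mulr_ge0 ?nrm_ge0 ?expR_ge0.
move=> s s1; set Y := s *: X.
have cv : conv (fun j => (1%:M + half j *: Y) ^+ (2 ^ j) + (- 1%:M - Y)) (mexp Y + (- 1%:M - Y)).
  by move=> a b; rewrite mxE; apply: sconv_ext (sconvD (mexpP Y a b) (sconv_const _)) => j; rewrite [RHS]mxE.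
rewrite -addrA; apply: (conv_nrm_le cv) => j; rewrite addrA.
have EY : Y = (half j *: Y) *+ (2 ^ j).
  by rewrite -scaler_nat scalerA natrX mulrC half2 scale1r.
rewrite {2}EY; apply: le_trans (pow_second _ _) _.
rewrite nrmZ ger0_norm ?half_ge0 //.
have nY : nrm Y = `|s| * nrm X by rewrite nrmZ.
have -> : (2 ^ j * 2 ^ j)%:R * (n1 * (1 + half j * nrm Y) ^+ (2 ^ j)) * (half j * nrm Y) ^+ 2 =
    n1 * (1 + nrm Y * half j) ^+ (2 ^ j) * nrm Y ^+ 2 * (half j * 2 ^+ j) ^+ 2.
  by rewrite natrM natrX [nrm Y * _]mulrC; ring.
rewrite half2 expr1n mulr1 nY exprMn real_normK ?num_real // mulrAC [leRHS]mulrAC mulrA.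
rewrite [leRHS](_ : _ = n1 * s ^+ 2 * nrm X ^+ 2 * expR (nrm X)); last by ring.
have P0 : 0 <= n1 * s ^+ 2 * nrm X ^+ 2.
  by apply: mulr_ge0; [apply: mulr_ge0; [exact: nrm_ge0 | exact: sqr_ge0] | exact: sqr_ge0].
apply: (ler_wpM2l P0).
apply: le_trans (pow2_bound j _) _; first by rewrite mulr_ge0 ?nrm_ge0.
by rewrite ler_expR ler_piMl ?nrm_ge0.
Qed.

(** Each approximation (1 + a X)^l - 1 is a combination of positive powers of X. *)
Lemma mexp_tr m (u : 'M[R]_(m, n)) (v : 'M[R]_(n, m)) X :
  (forall k, (0 < k)%N -> \tr (u *m X ^+ k *m v) = 0) -> \tr (u *m (mexp X - 1%:M) *m v) = 0.
Proof.
move=> h.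
have P a k l : (0 < k)%N -> \tr (u *m (X ^+ k *m (1%:M + a *: X) ^+ l) *m v) = 0.
  elim: l k => [|l IH] k k0; first by rewrite expr0 mulmx1 h.
  have -> : X ^+ k *m (1%:M + a *: X) ^+ l.+1 =
      X ^+ k *m (1%:M + a *: X) ^+ l + a *: (X ^+ k.+1 *m (1%:M + a *: X) ^+ l).
    by rewrite [in LHS]exprS mulmxr mulmxDl mul1mx mulmxDr -scalemxAl -scalemxAr exprSr mulmxr mulmxA.
  rewrite mulmxDr mulmxDl mxtraceD IH // add0r -scalemxAr -scalemxAl mxtraceZ IH //.
  by rewrite mulr0.
have Q a l : \tr (u *m ((1%:M + a *: X) ^+ l - 1%:M) *m v) = 0.
  elim: l => [|l IH]; first by rewrite expr0 subrr mulmx0 mul0mx mxtrace0.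
  rewrite exprS mulmxr mulmxDl mul1mx addrAC mulmxDr mulmxDl mxtraceD IH add0r.
  rewrite -scalemxAl -scalemxAr -scalemxAl mxtraceZ.
  by have := P a 1%N l isT; rewrite expr1 => ->; rewrite mulr0.
apply: (@sconv_unique (fun j => \tr (u *m ((1%:M + half j *: X) ^+ (2 ^ j) - 1%:M) *m v))); last first.
  by apply: sconv_ext (sconv_const 0) => j; rewrite Q.
have c1 : conv (fun j => (1%:M + half j *: X) ^+ (2 ^ j) - 1%:M) (mexp X - 1%:M).
  by move=> a b; rewrite mxE; apply: sconv_ext (sconvD (mexpP X a b) (sconv_const _)) => j; rewrite [RHS]mxE.
have cu : conv (fun=> u) u by move=> a b; exact: sconv_const.
have cv : conv (fun=> v) v by move=> a b; exact: sconv_const.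
by apply: sconv_sum => i; exact: (conv_mulmx (conv_mulmx cu c1) cv i i).
Qed.

(** The link between the algebraic order of vanishing at 1 and the size near 1; for products it is
    the Cauchy product of the two bounds. *)
Lemma rees_bound F j : rees F -> exists2 c, 0 <= c & forall g : 'M[R]_n, nrm (g - 1%:M) <= 1 ->
  `|(F g)`_j| <= c * nrm (g - 1%:M) ^+ j.
Proof.
move=> rF; elim/rees_ind: rF j => [F1 F2 E h j|c j|a b j|a b j|F1 F2 _ _ h1 h2 j|F1 F2 _ _ h1 h2 j].
- by have [c c0 hc] := h j; exists c => // g; rewrite -E; apply: hc.
- exists `|c| => // g _; rewrite coefC; case: eqP => [->|_]; first by rewrite expr0 mulr1.
  by rewrite normr0 mulr_ge0 ?exprn_ge0 ?nrm_ge0.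
- exists 2 => // g g1; rewrite coefC; case: eqP => [->|_]; last first.
    by rewrite normr0 mulr_ge0 ?exprn_ge0 ?nrm_ge0.
  rewrite expr0 mulr1; have -> : g a b = (g - 1%:M) a b + (a == b)%:R by rewrite !mxE subrK.
  apply: le_trans (ler_normD _ _) _; have := le_trans (nrm_entry (g - 1%:M) a b) g1.
  have : `|(a == b)%:R : R| <= 1 by case: (a == b); rewrite ?normr1 ?normr0.
  lra.
- exists 1 => // g g1; rewrite mul1r coefMX; case: j => [|[|j]] /=.
  + by rewrite normr0.
  + by rewrite coefC expr1 nrm_entry.
  + by rewrite coefC /= normr0 exprn_ge0 ?nrm_ge0.
- have [c c0 hc] := h1 j; have [d d0 hd] := h2 j; exists (c + d); first by rewrite addr_ge0.
  by move=> g g1; rewrite coefD mulrDl (le_trans (ler_normD _ _)) // lerD ?hc ?hd.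
- pose c1 i := s2val (cid2 (h1 i)); pose c2 i := s2val (cid2 (h2 i)).
  have c10 i : 0 <= c1 i by rewrite /c1; case: cid2.
  have c20 i : 0 <= c2 i by rewrite /c2; case: cid2.
  exists (\sum_(i < j.+1) c1 i * c2 (j - i)%N); first by apply: sumr_ge0 => i _; rewrite mulr_ge0.
  move=> g g1; rewrite coefM mulr_suml; apply: le_trans (ler_norm_sum _ _ _) _.
  apply: ler_sum => i _; rewrite normrM.
  have -> : nrm (g - 1%:M) ^+ j = nrm (g - 1%:M) ^+ i * nrm (g - 1%:M) ^+ (j - i).
    by rewrite -exprD subnKC // -ltnS.
  rewrite mulrACA ler_pM //.
    exact: (s2valP' (cid2 (h1 i))).
  exact: (s2valP' (cid2 (h2 (j - i)%N))).
Qed.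

Lemma jet_bound f (l : 'M[R]_n -> R) : jet f l -> exists2 c, 0 <= c & forall X, nrm X <= 1 ->
  `|f (1%:M + X) - f 1%:M - l X| <= c * nrm X ^+ 2.
Proof.
move=> [_ /(rees_bound 2) [c c0 hc]]; exists c => // X X1.
have := hc (1%:M + X); rewrite [_ + X - _]addrC addKr => /(_ X1).
by rewrite coefCM coefXn eqxx mulr1.
Qed.

End Pow.

(** By the jet of F, the matrices F (1 + X / 2^j) and 1 + L (X) / 2^j differ by an error of order
    4^-j. *)
Lemma mexp_hom n m (F L : 'M[R]_n -> 'M[R]_m) X : Jet F L -> F 1%:M = 1%:M ->
  (forall x y, F (x *m y) = F x *m F y) -> (forall c Y, L (c *: Y) = c *: L Y) ->
  F (mexp X) = mexp (L X).
Proof.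
move=> JF F1 FM LZ.
have Fpow g k : F (g ^+ k) = F g ^+ k by elim: k => [|k IH]; rewrite ?expr0 // !exprS FM IH.
pose N := nrm X + 1; have N0 : 0 < N by rewrite ltr_wpDl ?nrm_ge0.
apply: (@conv_unique _ _ (fun j => F (1%:M + half j *: X) ^+ (2 ^ j))).
  move=> a b; apply: sconv_ext (conv_polyf (proj1 (JF a b)) (mexpP X)) => j.
  by rewrite Fpow.
have [c c0 hc] : exists2 c, 0 <= c & forall Y, nrm Y <= 1 -> nrm (F (1%:M + Y) - 1%:M - L Y) <= c * nrm Y ^+ 2.
  pose c (x : 'I_m * 'I_m) := s2val (cid2 (jet_bound (JF x.1 x.2))).
  have c0 x : 0 <= c x by rewrite /c; case: cid2.
  exists (\sum_i \sum_j c (i, j)); first by apply: sumr_ge0 => i _; apply: sumr_ge0.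
  move=> Y Y1; rewrite /nrm !mulr_suml; apply: ler_sum => i _; rewrite mulr_suml; apply: ler_sum => j _.
  rewrite -F1; have := s2valP' (cid2 (jet_bound (JF i j))) Y Y1.
  by rewrite !mxE.
(* The sum takes care of the finitely many j for which X / 2^j need not have norm at most 1. *)
pose c' := c * nrm X ^+ 2 + \sum_(j < Num.Def.archi_bound (nrm X))
   nrm (F (1%:M + half j *: X) - 1%:M - half j *: L X) / half j ^+ 2.
have s0 (i : nat) : 0 <= nrm (F (1%:M + half i *: X) - 1%:M - half i *: L X) / half i ^+ 2.
  by rewrite divr_ge0 ?nrm_ge0 // exprn_ge0 ?half_ge0.
apply: (@mexp_near m (L X) c') => [|j].
  by rewrite addr_ge0 ?mulr_ge0 ?exprn_ge0 ?nrm_ge0 // sumr_ge0.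
have [lt|ge] := ltnP j (Num.Def.archi_bound (nrm X)).
  rewrite -ler_pdivrMr ?exprn_gt0 ?half_gt0 // /c' (bigD1 (Ordinal lt)) //= addrCA lerDl.
  by rewrite addr_ge0 ?mulr_ge0 ?exprn_ge0 ?nrm_ge0 // sumr_ge0.
have small : nrm (half j *: X) <= 1.
  rewrite nrmZ ger0_norm ?half_ge0 // -(half2 j) ler_wpM2l ?half_ge0 //.
  apply/ltW; apply: lt_le_trans (archi_boundP (nrm_ge0 X)) _.
  by rewrite -natrX ler_nat (leq_trans ge) // ltnW // ltn_expl.
rewrite -LZ; apply: le_trans (hc _ small) _; rewrite nrmZ ger0_norm ?half_ge0 // exprMn.
rewrite mulrCA mulrC ler_wpM2r ?exprn_ge0 ?half_ge0 // /c' lerDl sumr_ge0 // => i _; exact: s0.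
Qed.

End Exp.

(** * Conjugating the eigenvalues of a matrix *)

Section Jordan.
Local Open Scope ring_scope.
Variable C : numClosedFieldType.

(** Evaluation of a polynomial that also covers size 0, where matrices do not form a nontrivial
    ring. *)
Definition pmx {n} : {poly C} -> 'M[C]_n -> 'M[C]_n :=
  match n with 0 => fun _ _ => 0 | n'.+1 => fun q A => horner_mx A q end.

Lemma mx0_eq m (A B : 'M[C]_(0, m)) : A = B.
Proof. by rewrite [A]flatmx0 [B]flatmx0. Qed.

Lemma pmxD n p q (A : 'M[C]_n) : pmx (p + q) A = pmx p A + pmx q A.
Proof. by case: n A => [|n] A; [exact: mx0_eq | rewrite /= rmorphD]. Qed.

Lemma pmxB n p q (A : 'M[C]_n) : pmx (p - q) A = pmx p A - pmx q A.
Proof. by case: n A => [|n] A; [exact: mx0_eq | rewrite /= rmorphB]. Qed.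

Lemma pmxM n p q (A : 'M[C]_n) : pmx (p * q) A = pmx p A *m pmx q A.
Proof. by case: n A => [|n] A; [exact: mx0_eq | rewrite /= rmorphM]. Qed.

Lemma pmxC n c (A : 'M[C]_n) : pmx c%:P A = c%:M.
Proof. by case: n A => [|n] A; [exact: mx0_eq | rewrite /= horner_mx_C]. Qed.

Lemma scalar0_mx n : (0 : C)%:M = 0 :> 'M[C]_n.
Proof. by rewrite -scalemx1 scale0r. Qed.

Lemma pmxX n (A : 'M[C]_n) : pmx 'X A = A.
Proof. by case: n A => [|n] A; [exact: mx0_eq | rewrite /= horner_mx_X]. Qed.

Lemma pmx_exp n p k (A : 'M[C]_n) : pmx (p ^+ k) A = pmx p A ^+ k.
Proof.
elim: k => [|k IH]; first by rewrite !expr0 pmxC.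
by rewrite !exprS pmxM IH.
Qed.

Lemma pmx_XsubC n c (A : 'M[C]_n) : pmx ('X - c%:P) A = A - c%:M.
Proof. by rewrite pmxB pmxX pmxC. Qed.

Lemma pmx_char n (A : 'M[C]_n) : pmx (char_poly A) A = 0.
Proof. by case: n A => [|n] A; [exact: mx0_eq | exact: Cayley_Hamilton]. Qed.

Lemma pmx_ind n (A : 'M[C]_n) (P : 'M[C]_n -> Prop) :
  P 0 -> (forall c X Y, P X -> P Y -> P (c *: X + Y)) -> (forall k, P (A ^+ k)) ->
  forall q, P (pmx q A).
Proof.
move=> P0 PL PA q; rewrite -[q]coefK poly_def.
elim/big_ind: _ => [|x y Px Py|i _].
- by rewrite (_ : 0 = 0%:P) // pmxC scalar0_mx.
- by rewrite pmxD -[X in X + _]scale1r; apply: PL.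
- rewrite -mul_polyC pmxM pmxC mul_scalar_mx -[X in P X]addr0 pmx_exp pmxX.
  exact: PL.
Qed.

Lemma trX n (A : 'M[C]_n) k : (A ^+ k)^T = A^T ^+ k.
Proof.
elim: k => [|k IH]; first by rewrite !expr0 trmx1.
by rewrite exprS exprSr trmx_mul IH.
Qed.

Lemma pmx_tr n q (A : 'M[C]_n) : (pmx q A)^T = pmx q A^T.
Proof.
rewrite -[q]coefK poly_def; elim: (index_enum _) => [|i s IH].
  by rewrite !big_nil (_ : 0 = 0%:P) // !pmxC tr_scalar_mx.
rewrite !big_cons !pmxD linearD /= IH; congr (_ + _).
by rewrite -mul_polyC !pmxM !pmxC !pmx_exp !pmxX !mul_scalar_mx linearZ /= trX.
Qed.

Lemma pmx_conj n m q (A : 'M[C]_n) (B : 'M[C]_m) (U : 'M[C]_(n, m)) :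
  A *m U = U *m B -> pmx q A *m U = U *m pmx q B.
Proof.
move=> AU; rewrite -[q]coefK poly_def; elim: (index_enum _) => [|i s IH].
  by rewrite !big_nil (_ : 0 = 0%:P) // !pmxC mul_scalar_mx mul_mx_scalar.
rewrite !big_cons !pmxD mulmxDl mulmxDr IH; congr (_ + _).
rewrite -mul_polyC !pmxM !pmxC !pmx_exp !pmxX !mul_scalar_mx -scalemxAl -scalemxAr; congr (_ *: _).
elim: (nat_of_ord i) => [|k IHk]; first by rewrite !expr0 mul1mx mulmx1.
by rewrite exprS -mulmxE -mulmxA IHk mulmxA AU -mulmxA [in RHS]exprS mulmxE.
Qed.

(** The list of eigenvalues with multiplicity is the diagonal of a triangular form, which also gives
    the traces of all polynomials in A. *)
Lemma char_roots n (A : 'M[C]_n) : exists2 t : seq C,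
  char_poly A = \prod_(x <- t) ('X - x%:P) & size t = n /\ forall p, \tr (pmx p A) = \sum_(x <- t) p.[x].
Proof.
have [P Pu /andP [trA _]] := @cotrigonalization2 C n A A erefl.
have uP := unitarymx_unit Pu.
have : is_trig_mx (conjmx P A) := trA.
rewrite conjumx //; set T := P *m A *m _ => trT.
exists [seq T i i | i <- enum 'I_n].
  rewrite big_map big_enum /= -(char_poly_trig trT) /T.
  rewrite /char_poly /char_poly_mx !map_mxM.
  have -> : 'X%:M - map_mx polyC P *m map_mx polyC A *m map_mx polyC (invmx P) =
      map_mx polyC P *m ('X%:M - map_mx polyC A) *m map_mx polyC (invmx P).
    have PP : map_mx polyC P *m map_mx polyC (invmx P) = 1%:M by rewrite -map_mxM mulmxV // map_mx1.
    by rewrite mulmxBr mulmxBl mul_mx_scalar -scalemxAl PP scalemx1.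
  rewrite !det_mulmx mulrC mulrA -det_mulmx -map_mxM mulVmx // map_mx1 det1 mul1r //.
split=> [|p]; first by rewrite size_map size_enum_ord.
rewrite big_map big_enum /=.
have -> : \tr (pmx p A) = \tr (pmx p T).
  have E : A *m invmx P = invmx P *m T by rewrite /T !mulmxA mulVmx // mul1mx.
  rewrite -[pmx p A]mulmx1 -(mulVmx uP) mulmxA (pmx_conj p E) -mulmxA mxtrace_mulC.
  by rewrite -mulmxA mulmxV // mulmx1.
have [_ H] : (forall i j : 'I_n, (i < j)%N -> pmx p T i j = 0) /\ forall i, pmx p T i i = p.[T i i].
  move/is_trig_mxP: trT => trT; elim/poly_ind: p => [|p c [IH1 IH2]].
    by rewrite (_ : 0 = 0%:P) // pmxC; split=> [i j|i]; rewrite ?hornerC !mxE ?mul0rn.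
  rewrite pmxD pmxM pmxX pmxC; split=> [i j ij|i]; rewrite mxE [X in X + _]mxE.
    rewrite [X in _ + X]mxE -val_eqE ltn_eqF // addr0 big1 // => k _.
    by have [ik|ki] := ltnP i k; [rewrite IH1 ?mul0r | rewrite trT ?mulr0 // (leq_ltn_trans ki)].
  rewrite [X in _ + X]mxE eqxx hornerD hornerM hornerX hornerC (bigD1 i) //= IH2.
  rewrite big1 ?addr0 // => k ki; have [ik|ik] := ltnP i k; first by rewrite IH1 ?mul0r.
  by rewrite trT ?mulr0 // ltn_neqAle ik andbT.
by apply: eq_bigr => i _; rewrite H.
Qed.

(** Chinese remainder theorem for the pairwise coprime powers of X - x. *)
Lemma poly_interpolate (f : C -> C) K (s : seq C) : exists q : {poly C},
  forall x, x \in s -> ('X - x%:P) ^+ K %| q - (f x)%:P.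
Proof.
elim: s => [|y s [q IH]]; first by exists 0.
have [ys|ns] := boolP (y \in s).
  by exists q => x; rewrite inE => /orP [/eqP ->|]; apply: IH.
pose p := (\prod_(x <- s) ('X - x%:P)) ^+ K.
have cop : coprimep p (('X - y%:P) ^+ K).
  by rewrite coprimep_expl // coprimep_expr // coprimep_XsubC root_prod_XsubC.
have /Bezout_eq1_coprimepP [[u v] /= uv] := cop.
exists (q + p * (u * ((f y)%:P - q))) => x; rewrite inE => /orP [/eqP ->|xs].
  have -> : q + p * (u * ((f y)%:P - q)) - (f y)%:P = (q - (f y)%:P) * (1 - u * p) by ring.
  by rewrite -uv addrAC subrr add0r mulrA dvdp_mulIr.
rewrite addrAC dvdp_add ?IH // dvdp_mulr // dvdp_exp2r // (perm_big _ (perm_to_rem xs)) big_cons.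
exact: dvdp_mulIl.
Qed.

Lemma poly_values (f : C -> C) (s : seq C) : exists q : {poly C}, forall x, x \in s -> q.[x] = f x.
Proof.
have [q h] := poly_interpolate f 1 s; exists q => x /h.
by rewrite expr1 dvdp_XsubCl /root hornerD hornerN hornerC subr_eq0 => /eqP.
Qed.

Lemma sum_norm_eq0 (s : seq C) : \sum_(x <- s) x * x^* = 0 -> forall x, x \in s -> x = 0.
Proof.
elim: s => [//|y s IH]; rewrite big_cons => /eqP.
rewrite paddr_eq0 ?mul_conjC_ge0 // => [/andP [/eqP y0 /eqP s0]|]; last first.
  by apply: sumr_ge0 => x _; rewrite mul_conjC_ge0.
move=> x; rewrite inE => /orP [/eqP ->|]; last exact: IH.
by apply/eqP; rewrite -mul_conjC_eq0 y0.
Qed.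

Lemma nilp_roots n (A : 'M[C]_n) t : char_poly A = \prod_(x <- t) ('X - x%:P) -> size t = n ->
  (forall x, x \in t -> x = 0) -> A ^+ n = 0.
Proof.
move=> E st t0; rewrite -(pmx_char A) E -[in LHS](pmxX A) -pmx_exp; congr (pmx _ _).
rewrite -st (eq_big_seq (fun=> 'X)); first by rewrite big_const_seq count_predT iter_mulr_1.
by move=> x /t0 ->; rewrite subr0.
Qed.

(** For a polynomial q with the value conj (x)^k at each eigenvalue x, the trace of A^k q (A) is the
    sum of the |x|^(2 k); so all eigenvalues vanish. *)
Lemma nilp_tr0 n (A : 'M[C]_n) k : A ^+ k = 0 -> \tr A = 0.
Proof.
move=> Ak; have [t Et [st trt]] := char_roots A.
have [q hq] := poly_values (fun x => x^* ^+ k) t.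
have t0 x : x \in t -> x = 0.
  case: k Ak hq => [|k] Ak hq xt.
    have : (1%:M : 'M[C]_n) = 0 by rewrite -Ak expr0.
    case: n A {Ak Et trt} st => [|n] A st; first by move: xt; rewrite (size0nil st).
    by move=> /eqP; rewrite -[_ == _]/((1 : 'M[C]_n.+1) == 0) oner_eq0.
  have := trt ('X ^+ k.+1 * q); rewrite pmxM pmx_exp pmxX Ak mul0mx mxtrace0 => /esym.
  rewrite (eq_big_seq (fun x => x ^+ k.+1 * (x ^+ k.+1)^*)) => [|y yt]; last first.
    by rewrite hornerM hornerXn hq // rmorphXn.
  rewrite -(big_map (fun x => x ^+ k.+1) predT (fun x => x * x^*)) => /sum_norm_eq0 h.
  by have /eqP := h _ (map_f _ xt); rewrite expf_eq0 => /andP [_ /eqP].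
have := trt 'X; rewrite pmxX => ->; rewrite big_seq big1 // => x xt; by rewrite hornerX; exact: t0.
Qed.

(* B is obtained from A by conjugating the eigenvalues of its semisimple part. *)
Definition rel n (A B : 'M[C]_n) : Prop := exists2 q, B = pmx q A &
  forall x, root (char_poly A) x -> q.[x] = x^*.

(** The trace of A B is the sum of the |x|^2 over the eigenvalues x of A. *)
Lemma rel_tr0 n (A B : 'M[C]_n) : rel A B -> \tr (A *m B) = 0 -> A ^+ n = 0.
Proof.
move=> [q -> hq]; have [t Et [st trt]] := char_roots A.
rewrite -{1}(pmxX A) -pmxM trt => h; apply: (nilp_roots Et st); apply: sum_norm_eq0.
rewrite -[RHS]h; apply: eq_big_seq => x xt; rewrite hornerM hornerX hq //.
by rewrite Et root_prod_XsubC.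
Qed.

Lemma rel_comm n (A B X : 'M[C]_n) : rel A B -> A *m X = X *m A -> B *m X = X *m B.
Proof. by move=> [q -> _] /(pmx_conj q). Qed.

(* Generalized eigenvectors of A that B maps to conjugate multiples span. *)
Definition srel n (A B : 'M[C]_n) : Prop := forall P : 'rV[C]_n -> Prop, P 0 ->
  (forall c u v, P u -> P v -> P (c *: u + v)) ->
  (forall v x k, v *m (A - x%:M) ^+ k = 0 -> v *m B = x^* *: v -> P v) -> forall v, P v.

(** On a given vector B agrees with q (A) as soon as q satisfies finitely many congruences; those
    for all basis vectors are solved together with those at the roots. *)
Lemma srel_poly n (A B : 'M[C]_n) : srel A B -> exists2 q, B = pmx q A &
  forall x, root (char_poly A) x -> ('X - x%:P) ^+ n.+1 %| q - (x^*)%:P.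
Proof.
move=> S.
have vP (v : 'rV[C]_n) : exists s : seq C, exists K, forall q : {poly C},
    (forall x, x \in s -> ('X - x%:P) ^+ K %| q - (x^*)%:P) -> v *m pmx q A = v *m B.
  move: v; apply: S => [|c u v [s [K h]] [s' [K' h']]|v x k h hB].
  - by exists [::], 0%N => q _; rewrite !mul0mx.
  - exists (s ++ s'), (maxn K K') => q hq; rewrite !mulmxDl -!scalemxAl; congr (_ *: _ + _).
      apply: h => x xs; apply: dvdp_trans (hq x _); last by rewrite mem_cat xs.
      by rewrite dvdp_exp2l // leq_maxl.
    apply: h' => x xs; apply: dvdp_trans (hq x _); last by rewrite mem_cat xs orbT.
    by rewrite dvdp_exp2l // leq_maxr.
  - exists [:: x], k => q /(_ x (mem_head _ _)) /dvdpP [r Er].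
    rewrite -[q](subrK (x^*)%:P) Er pmxD pmxC mulrC pmxM pmx_exp pmx_XsubC.
    by rewrite mulmxDr mulmxA h mul0mx add0r hB mul_mx_scalar.
have [t Et _] := char_roots A.
have [s [K hs]] : exists (s : seq C) (K : nat), forall q : {poly C},
    (forall x, x \in s -> ('X - x%:P) ^+ K %| q - (x^*)%:P) -> pmx q A = B.
  have [s [K hs]] : exists (s : seq C) (K : nat), forall q : {poly C},
      (forall x, x \in s -> ('X - x%:P) ^+ K %| q - (x^*)%:P) ->
      forall i, i \in enum 'I_n -> row i (pmx q A) = row i B.
    elim: (enum 'I_n) => [|i l [s [K h]]]; first by exists [::], 0%N.
    have [s' [K' h']] := vP (delta_mx 0 i); exists (s ++ s'), (maxn K K') => q hq j.
    rewrite inE => /orP [/eqP ->|jl].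
      rewrite !rowE; apply: h' => x xs; apply: dvdp_trans (hq x _); last by rewrite mem_cat xs orbT.
      by rewrite dvdp_exp2l // leq_maxr.
    apply: h => // x xs; apply: dvdp_trans (hq x _); last by rewrite mem_cat xs.
    by rewrite dvdp_exp2l // leq_maxl.
  exists s, K => q /hs h; apply/row_matrixP => i; by apply: h; rewrite mem_enum.
have [q hq] := poly_interpolate (fun x => x^*) (K + n.+1) (s ++ t); exists q.
  apply/esym/hs => x xs; apply: dvdp_trans (hq x _); last by rewrite mem_cat xs.
  by rewrite dvdp_exp2l ?leq_addr.
move=> x; rewrite Et root_prod_XsubC => xt.
by apply: dvdp_trans (hq x _); [rewrite dvdp_exp2l ?leq_addl | rewrite mem_cat xt orbT].
Qed.

Lemma srel_rel n (A B : 'M[C]_n) : srel A B -> rel A B.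
Proof.
move=> /srel_poly [q EB hq]; exists q => // x rx.
have : 'X - x%:P %| q - (x^*)%:P by apply: dvdp_trans (hq x rx); rewrite exprS dvdp_mulIl.
by rewrite dvdp_XsubCl /root hornerD hornerN hornerC subr_eq0 => /eqP.
Qed.

(** Such a q sends A to its replica, which multiplies each generalized eigenspace by the conjugate
    of the eigenvalue. *)
Definition conj_poly n (A : 'M[C]_n) (q : {poly C}) : Prop :=
  forall x, root (char_poly A) x -> ('X - x%:P) ^+ n %| q - (x^*)%:P.

Lemma conj_poly_exists n (A : 'M[C]_n) : exists q, conj_poly A q.
Proof.
have [t Et _] := char_roots A; have [q hq] := poly_interpolate (fun x => x^*) n t.
by exists q => x; rewrite Et root_prod_XsubC; apply: hq.
Qed.

Lemma srel_conj_poly n (A B : 'M[C]_n) : srel A B -> exists2 q, conj_poly A q & B = pmx q A.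
Proof.
move=> /srel_poly [q EB hq]; exists q => // x rx.
by apply: dvdp_trans (hq x rx); rewrite dvdp_exp2l.
Qed.

Lemma conj_poly_tr n (A : 'M[C]_n) q : conj_poly A q -> conj_poly A^T q.
Proof.
move=> h x; rewrite /char_poly (_ : char_poly_mx A^T = (char_poly_mx A)^T) ?det_tr; first exact: h.
by rewrite /char_poly_mx linearB /= tr_scalar_mx map_trmx.
Qed.

(** Primary decomposition: by a Bezout relation one root at a time is split off, with its full
    multiplicity. *)
Lemma conj_poly_srel n (A : 'M[C]_n) q : conj_poly A q -> srel A (pmx q A).
Proof.
move=> hq P P0 PL Pg v; have [t Et [st _]] := char_roots A.
have good u x k : root (char_poly A) x -> (k <= n)%N -> u *m (A - x%:M) ^+ k = 0 -> P u.
  move=> rx kn h; apply: (Pg u x k) => //.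
  have /dvdpP [r Er] : ('X - x%:P) ^+ k %| q - (x^*)%:P.
    by apply: dvdp_trans (hq x rx); rewrite dvdp_exp2l.
  rewrite -[q](subrK (x^*)%:P) Er pmxD pmxC mulrC pmxM pmx_exp pmx_XsubC.
  by rewrite mulmxDr mulmxA h mul0mx add0r mul_mx_scalar.
have main m (s : seq C) : (size s <= m)%N -> {subset s <= t} -> (size s <= n)%N -> forall u,
    u *m pmx (\prod_(x <- s) ('X - x%:P)) A = 0 -> P u.
  elim: m s => [|m IH] [|x s] //= sm sub sn u.
  - by rewrite big_nil pmxC mulmx1 => ->.
  - by rewrite big_nil pmxC mulmx1 => ->.
  set a := ('X - x%:P) ^+ (count_mem x (x :: s)); set s' := seq.filter (predC1 x) (x :: s).
  set b := \prod_(y <- s') ('X - y%:P).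
  have E : \prod_(y <- x :: s) ('X - y%:P) = a * b.
    rewrite (bigID (pred1 x)) /b /s' big_filter; congr (_ * _).
    rewrite (eq_bigr (fun=> 'X - x%:P)) => [|y /eqP -> //].
    by rewrite big_const_seq iter_mulr_1.
  have cop : coprimep b a.
    rewrite coprimep_expr // coprimep_XsubC root_prod_XsubC mem_filter /= eqxx //.
  have /Bezout_eq1_coprimepP [[w z] /= wz] := cop.
  rewrite E => h.
  have -> : u = 1 *: (u *m pmx (w * b) A) + u *m pmx (z * a) A.
    by rewrite scale1r -mulmxDr -pmxD wz (_ : 1 = 1%:P) // pmxC mulmx1.
  have sz' : (size s' <= size s)%N by rewrite /s' /= eqxx /= size_filter count_size.
  apply: PL.
    apply: (good _ x (count_mem x (x :: s))).
    + by rewrite Et root_prod_XsubC sub // mem_head.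
    + by apply: leq_trans sn; apply: (count_size _ (x :: s)).
    + rewrite -pmx_XsubC -pmx_exp -/a -mulmxA -pmxM (_ : w * b * a = a * b * w); last by ring.
      by rewrite pmxM mulmxA h mul0mx.
  apply: (IH s').
  + by apply: leq_trans sz' _.
  + by move=> y; rewrite mem_filter => /andP [_ /sub].
  + by apply: leq_trans sz' (ltnW sn).
  + rewrite -/b -mulmxA -pmxM (_ : z * a * b = a * b * z); last by ring.
    by rewrite pmxM mulmxA h mul0mx.
apply: (main _ t (leqnn _)) => //; first by rewrite st.
by rewrite -Et pmx_char mulmx0.
Qed.

Lemma gev_ind n (A : 'M[C]_n) x k (v : 'rV[C]_n) : v *m (A - x%:M) ^+ k.+1 = 0 ->
  (v *m (A - x%:M)) *m (A - x%:M) ^+ k = 0.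
Proof. by rewrite exprS -mulmxE mulmxA. Qed.

(** A tensor product of generalized eigenvectors is a generalized eigenvector for the sum of the
    eigenvalues, and conjugation is additive. Such tensors span by multilinearity. *)
Lemma srel_dtens n k (A B : 'M[C]_n) : srel A B -> srel (dtens k A) (dtens k B).
Proof.
move=> S P P0 PL Pg v.
pose good (u : 'rV[C]_n) := exists x l, u *m (A - x%:M) ^+ l = 0 /\ u *m B = x^* *: u.
have key m (u : 'I_k -> 'rV[C]_n) (x : 'I_k -> C) (l : 'I_k -> nat) :
    (forall i, u i *m (A - (x i)%:M) ^+ l i = 0) -> (\sum_i l i < m)%N ->
    tvec u *m (dtens k A - (\sum_i x i)%:M) ^+ m = 0.
  elim: m u l => [//|m IH] u l hu hm.
  have -> : tvec u *m (dtens k A - (\sum_i x i)%:M) ^+ m.+1 =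
      \sum_i tvec (upd u i (u i *m (A - (x i)%:M))) *m (dtens k A - (\sum_i x i)%:M) ^+ m.
    rewrite exprS -mulmxE mulmxA -mulmx_suml; congr (_ *m _).
    rewrite mulmxBr tvec_dtens mul_mx_scalar scaler_suml -sumrB; apply: eq_bigr => i _.
    have -> : u i *m (A - (x i)%:M) = u i *m A + (- x i) *: u i by rewrite mulmxBr mul_mx_scalar scaleNr.
    rewrite tvec_updD tvec_updZ scaleNr; congr (_ - _ *: _).
    by apply: eq_tvec => j; rewrite /upd; case: eqP => [->|].
  apply: big1 => i _; case li: (l i) => [|li'].
    have u0 : u i = 0 by have := hu i; rewrite li expr0 mulmx1.
    by rewrite u0 mul0mx -[0](scale0r (0 : 'rV[C]_n)) tvec_updZ scale0r mul0mx.
  apply: (IH _ (fun j => if j == i then li' else l j)) => [j|].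
    rewrite /upd; case: eqP => [->|//]; by apply: gev_ind; rewrite -li.
  move: hm; rewrite (bigD1 i) //= li (bigD1 i (F := fun j => if j == i then li' else l j)) //= eqxx.
  rewrite [X in (_ + X < m)%N](eq_bigr l) => [|j /negPf -> //]; by rewrite addSn ltnS.
have goodP (u : 'I_k -> 'rV[C]_n) : (forall i, good (u i)) -> P (tvec u).
  move=> gu; have /fin_all_exists [x /fin_all_exists [l h]] := gu.
  apply: (Pg _ (\sum_i x i) (\sum_i l i).+1).
    by apply: (key _ _ _ l) => // i; have [] := h i.
  rewrite tvec_dtens rmorph_sum scaler_suml; apply: eq_bigr => i _.
  have [_ ->] := h i; rewrite tvec_updZ; congr (_ *: _).
  by apply: eq_tvec => j; rewrite /upd; case: eqP => [->|].
(* The first j factors are arbitrary; they are decomposed one at a time. *)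
have allP j (u : 'I_k -> 'rV[C]_n) : (forall i : 'I_k, (j <= i)%N -> good (u i)) -> P (tvec u).
  elim: j u => [|j IH] u gu; first by apply: goodP => i; apply: gu.
  have [jk|kj] := ltnP j k; last by apply: IH => i ji; have := leq_trans kj ji; rewrite leqNgt ltn_ord.
  pose i0 := Ordinal jk.
  suff H (w : 'rV[C]_n) : P (tvec (upd u i0 w)).
    rewrite (_ : tvec u = tvec (upd u i0 (u i0))) //.
    by apply: eq_tvec => i; rewrite /upd; case: eqP => [->|].
  move: w; apply: S => [|c w z Pw Pz|w x l h1 h2].
  - by rewrite -[0](scale0r (0 : 'rV[C]_n)) tvec_updZ scale0r.
  - by rewrite tvec_updD tvec_updZ; apply: PL.
  - apply: IH => i ji; rewrite /upd; case: (i =P i0) => [_|ni]; first by exists x, l.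
    apply: gu; rewrite ltn_neqAle ji andbT; apply/eqP => e; apply: ni.
    by apply: val_inj; rewrite /= -e.
rewrite [v]row_sum_delta; elim/big_ind: _ => // [a b Pa Pb|i _].
  by rewrite -[a]scale1r; apply: PL.
rewrite -[X in P X]addr0; apply: PL => //; rewrite delta_tvec.
by apply: (allP k) => j; rewrite leqNgt ltn_ord.
Qed.

Lemma srel_block n (A B : 'M[C]_n) :
  srel A B -> srel (block_mx 0 0 0 A : 'M[C]_(1 + n)) (block_mx 0 0 0 B).
Proof.
move=> S P P0 PL Pg v; rewrite -[v]hsubmxK.
move: (lsubmx v) (rsubmx v) => a w.
have -> : row_mx a w = 1 *: row_mx a 0 + row_mx 0 w by rewrite scale1r add_row_mx addr0 add0r.
apply: (PL).
  apply: (Pg _ 0 1%N).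
    by rewrite expr1 scalar0_mx subr0 mul_row_block !mulmx0 !mul0mx !addr0 row_mx0.
  by rewrite mul_row_block !mulmx0 !mul0mx !addr0 row_mx0 conjC0 scale0r.
move: w; apply: S => [|c u z Pu Pz|u x k h1 h2]; first by rewrite row_mx0.
  have -> : row_mx 0 (c *: u + z) = c *: row_mx 0 u + row_mx 0 z :> 'rV[C]_(1 + n).
    by rewrite scale_row_mx scaler0 add_row_mx addr0.
  exact: (PL).
apply: (Pg _ x k); last first.
  by rewrite mul_row_block !mulmx0 !add0r h2 scale_row_mx scaler0.
have E l : row_mx 0 u *m (block_mx 0 0 0 A - x%:M : 'M[C]_(1 + n)) ^+ l = row_mx 0 (u *m (A - x%:M) ^+ l).
  elim: l => [|l IH]; first by rewrite !expr0 !mulmx1.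
  rewrite !exprSr -!mulmxE !mulmxA IH; move: (u *m _) => z.
  rewrite (scalar_mx_block 1 n x) opp_block_mx add_block_mx mul_row_block.
  by rewrite !mul0mx !subr0 mulmx0 !add0r.
by rewrite E h1 row_mx0.
Qed.

Definition adm n (A : 'M[C]_n) : 'M[C]_(n * n) := lin_mulmxr A - lin_mulmx A.

Lemma admE n (A F : 'M[C]_n) : mxvec F *m adm A = mxvec (F *m A - A *m F).
Proof. by rewrite /adm mulmxBr !mul_vec_lin /= linearB. Qed.

(** If c is a generalized eigenvector of the transpose for y, and w one of A for x, then the rank
    one matrix c^T w is one of the commutator map for x - y. *)
Lemma adm_srel n (A : 'M[C]_n) q : conj_poly A q -> srel (adm A) (adm (pmx q A)).
Proof.
move=> hq P P0 PL Pg v.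
have S1 := conj_poly_srel hq; have S2 := conj_poly_srel (conj_poly_tr hq).
rewrite -pmx_tr in S2; set B := pmx q A in S1 S2 *.
have key m (c w : 'rV[C]_n) x y k l : c *m (A^T - y%:M) ^+ k = 0 -> w *m (A - x%:M) ^+ l = 0 ->
    (k + l < m)%N -> mxvec (c^T *m w) *m (adm A - (x - y)%:M) ^+ m = 0.
  elim: m c w k l => [//|m IH] c w k l hc hw; rewrite ltnS => klm.
  have -> : mxvec (c^T *m w) *m (adm A - (x - y)%:M) ^+ m.+1 =
     mxvec (c^T *m (w *m (A - x%:M))) *m (adm A - (x - y)%:M) ^+ m -
     mxvec ((c *m (A^T - y%:M))^T *m w) *m (adm A - (x - y)%:M) ^+ m.
    rewrite exprS -mulmxE mulmxA -mulmxBl; congr (_ *m _).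
    rewrite mulmxBr admE mul_mx_scalar -linearZ -!linearB /=; congr mxvec.
    have -> : (c *m (A^T - y%:M))^T = A *m c^T - y *: c^T.
      by rewrite mulmxBr mul_mx_scalar linearB /= linearZ /= trmx_mul trmxK.
    rewrite !mulmxBr mul_mx_scalar mulmxBl -scalemxAr -scalemxAl !mulmxA scalerBl.
    by move: (c^T *m w *m A) (A *m c^T *m w) (c^T *m w) => a b d; apply/matrixP=> i j; rewrite !mxE; ring.
  case: k hc klm => [|k] hc klm.
    have c0 : c = 0 by move: hc; rewrite expr0 mulmx1.
    by rewrite c0 mul0mx trmx0 !mul0mx !linear0 !mul0mx subr0.
  case: l hw klm => [|l] hw klm.
    have w0 : w = 0 by move: hw; rewrite expr0 mulmx1.
    by rewrite w0 mul0mx !mulmx0 !linear0 !mul0mx subr0.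
  rewrite (IH _ _ k.+1 l) //; last first.
  - by move: klm; rewrite addnS.
  - exact: gev_ind.
  rewrite (IH _ _ k l.+1) ?subr0 //.
  exact: gev_ind.
rewrite -[v]vec_mxK; move: (vec_mx v) => F.
have tens (c w : 'rV[C]_n) : P (mxvec (c^T *m w)).
  move: c; apply: S2 => [|a c c' Pc Pc'|c y k hc1 hc2].
  - by rewrite trmx0 mul0mx linear0.
  - by rewrite linearP /= mulmxDl -scalemxAl linearP /=; apply: PL.
  move: w; apply: S1 => [|a w w' Pw Pw'|w x l hw1 hw2].
  - by rewrite mulmx0 linear0.
  - by rewrite mulmxDr -scalemxAr linearP /=; apply: PL.
  apply: (Pg _ (x - y) (k + l).+1); first exact: (key _ _ _ _ _ k l).
  have e1 : B *m c^T = y^* *: c^T by rewrite -[B]trmxK -trmx_mul hc2 linearZ.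
  by rewrite admE -/B -mulmxA hw2 mulmxA e1 -scalemxAr -scalemxAl -scalerBl linearZ rmorphB.
rewrite [F]matrix_sum_delta linear_sum; elim/big_ind: _ => // [a b Pa Pb|i _].
  by rewrite -[a]scale1r; apply: PL.
rewrite linear_sum; elim/big_ind: _ => // [a b Pa Pb|j _].
  by rewrite -[a]scale1r; apply: PL.
rewrite linearZ /= -[X in P X]addr0; apply: PL => //.
by have := tens (delta_mx 0 i) (delta_mx 0 j); rewrite trmx_delta mul_delta_mx.
Qed.

End Jordan.

(** * Lie algebras of closed groups *)

Section DtensConj.
Local Open Scope ring_scope.
Lemma dtens_intertwine (A : comNzRingType) n k (a X Y : 'M[A]_n) :
  a *m X = Y *m a -> tpow k a *m dtens k X = dtens k Y *m tpow k a.
Proof.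
move=> E; apply: tens_eq => u; rewrite !mulmxA tvec_tpow !tvec_dtens mulmx_suml.
apply: eq_bigr => l _; rewrite tvec_tpow; apply: eq_tvec => j; rewrite /upd.
by case: eqP => // _; rewrite -!mulmxA E.
Qed.

Lemma drho_intertwine (A : comNzRingType) n d (a X Y : 'M[A]_n) :
  a *m X = Y *m a -> rho d a *m drho d X = drho d Y *m rho d a.
Proof.
move=> E; apply: dtens_intertwine; rewrite /lft !mulmx_block !mulmx0 !mul0mx !addr0 !add0r.
by rewrite E.
Qed.

Lemma drho_bracket (A : comNzRingType) n d (X Y : 'M[A]_n) :
  drho d (X *m Y - Y *m X) = drho d X *m drho d Y - drho d Y *m drho d X.
Proof.
rewrite /drho -dtens_bracket; congr dtens.
by rewrite !mulmx_block !mulmx0 !mul0mx !addr0 !add0r opp_block_mx add_block_mx !oppr0 !addr0.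
Qed.

Lemma map_drho (A B : comNzRingType) (f : {rmorphism A -> B}) d n (X : 'M[A]_n) :
  map_mx f (drho d X) = drho d (map_mx f X).
Proof.
rewrite /drho -[in RHS](map_mx0 f) -[in RHS](map_mx0 f 1 n) -[in RHS](map_mx0 f n 1) -map_block_mx.
apply/matrixP=> a b; rewrite !mxE rmorph_sum; apply: eq_bigr => l _.
rewrite rmorphM rmorph_prod [in RHS]mxE; congr (_ * _).
by apply: eq_bigr => j _; rewrite rmorph_nat.
Qed.
End DtensConj.

Section Lie.
Local Open Scope classical_set_scope.
Local Open Scope ring_scope.
Variables (C : numClosedFieldType) (n : nat) (H : mxgroup C n).
Local Notation m := (lie H).

Definition vanishes d (Phi : 'M[C]_(tdim (1 + n) d)) : Prop :=
  forall g, mxset H g -> \tr (Phi *m rho d g) = 0.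

Lemma lie0 : m 0.
Proof.
move=> d Phi _; have := @drho_lin C n d Phi (-1) 0 0; rewrite scaler0 addr0 mulN1r.
by rewrite addNr.
Qed.

Lemma lieP c X Y : m X -> m Y -> m (c *: X + Y).
Proof. by move=> hX hY d Phi h; rewrite drho_lin hX // hY // mulr0 addr0. Qed.

Lemma lieZ c X : m X -> m (c *: X).
Proof. by move=> mX; rewrite -[X in m X]addr0; apply: lieP mX lie0. Qed.

Lemma vanishes_mull d (Phi : 'M[C]_(tdim (1 + n) d)) h : vanishes Phi -> mxset H h ->
  vanishes (rho d h *m Phi).
Proof.
by move=> v Hh g Hg; rewrite -mulmxA mxtrace_mulC -mulmxA -rhoM v //; apply: mxgroupM.
Qed.

Lemma vanishes_mulr d (Phi : 'M[C]_(tdim (1 + n) d)) h : vanishes Phi -> mxset H h ->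
  vanishes (Phi *m rho d h).
Proof. by move=> v Hh g Hg; rewrite -mulmxA -rhoM v //; apply: mxgroupM. Qed.

(** A functional that vanishes on H has translates that vanish on H, and so do their derivatives at
    1 in the direction X. *)
Lemma vanishes_lie d (Phi : 'M[C]_(tdim (1 + n) d)) X : vanishes Phi -> m X ->
  vanishes (Phi *m drho d X).
Proof.
by move=> v mX g Hg; rewrite mxtrace_mulC mulmxA mX //; apply: vanishes_mull.
Qed.

Lemma vanishes_lieX d (Phi : 'M[C]_(tdim (1 + n) d)) X k : vanishes Phi -> m X ->
  vanishes (Phi *m drho d X ^+ k).
Proof.
move=> v mX; elim: k => [|k IH]; first by rewrite expr0 mulmx1.
by rewrite exprSr -mulmxE mulmxA; apply: vanishes_lie.
Qed.

Lemma vanishes_tr d (Phi : 'M[C]_(tdim (1 + n) d)) : vanishes Phi -> \tr Phi = 0.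
Proof. by move=> /(_ _ (mxgroup1 H)); rewrite rho1 mulmx1. Qed.

Lemma lie_bracket X Y : m X -> m Y -> m (X *m Y - Y *m X).
Proof.
move=> mX mY d Phi v; rewrite drho_bracket mulmxBr linearB /= !mulmxA.
by rewrite mY ?mX ?subrr //; apply: vanishes_lie.
Qed.

Lemma lie_Ad a X : mxset H a -> m X -> m (a *m X *m invmx a).
Proof.
move=> Ha mX d Phi v; have ua := mxgroup_unit Ha.
have E : rho d a *m drho d X = drho d (a *m X *m invmx a) *m rho d a.
  by apply: drho_intertwine; rewrite mulmxKV.
have -> : drho d (a *m X *m invmx a) = rho d a *m drho d X *m rho d (invmx a).
  by rewrite E -[RHS]mulmxA -rhoM mulmxV // rho1 mulmx1.
rewrite !mulmxA mxtrace_mulC !mulmxA mX // => g Hg.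
by have := vanishes_mull (vanishes_mulr v Ha) (mxgroupV Ha) Hg; rewrite mulmxA.
Qed.

(** In the tensor representation the replica of X is a polynomial in [drho d X], and all powers of
    [drho d X] have trace 0 against a functional that vanishes on H. *)
Lemma lie_replica X q : m X -> conj_poly X q -> m (pmx q X).
Proof.
move=> mX hq d Phi v.
have /srel_rel [q' -> _] : srel (drho d X) (drho d (pmx q X)).
  by apply: srel_dtens; apply: srel_block; apply: conj_poly_srel.
apply: (pmx_ind (P := fun Z => \tr (Phi *m Z) = 0)).
- by rewrite mulmx0 mxtrace0.
- by move=> c Z Z' E1 E2; rewrite mulmxDr mxtraceD -scalemxAr mxtraceZ E1 E2 mulr0 addr0.
- by move=> k; apply: vanishes_tr; apply: vanishes_lieX.
Qed.
End Lie.

(** * Exponentials in the real points of a closed group *)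

Section RealExp.
Local Open Scope classical_set_scope.
Local Open Scope ring_scope.
Variables (R : realType) (n : nat).
Implicit Types (X : 'M[R]_n).

Lemma iotaR_inj : injective (@iotaR R).
Proof. exact: fmorph_inj. Qed.

Lemma complexify_tr m (Phi : 'M[R]_m) : \tr (map_mx iotaR Phi) = iotaR (\tr Phi).
Proof. by rewrite trace_map_mx. Qed.

Lemma mapX m (Y : 'M[R]_m) k : map_mx iotaR (Y ^+ k) = map_mx iotaR Y ^+ k.
Proof.
elim: k => [|k IH]; first by rewrite !expr0 map_mx1.
by rewrite !exprS -!mulmxE map_mxM IH.
Qed.

Lemma re_im_mx p q (A : 'M[R[i]]_(p, q)) : exists A1 A2 : 'M[R]_(p, q),
  A = map_mx iotaR A1 + 'i *: map_mx iotaR A2.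
Proof.
exists (\matrix_(i, j) complex.Re (A i j)), (\matrix_(i, j) complex.Im (A i j)).
apply/matrixP=> i j; rewrite !mxE [LHS]complexE; congr (_ + _ * _).
Qed.

Lemma re_im0 (x y : R) : iotaR x + 'i * iotaR y = 0 :> R[i] -> x = 0 /\ y = 0.
Proof.
have -> : iotaR x + 'i * iotaR y = (x +i* y)%C by rewrite [RHS]complexE.
by move=> [-> ->].
Qed.

Lemma mexp_ctr X (u : 'M[R[i]]_n) :
  (forall k, (0 < k)%N -> \tr (u *m map_mx iotaR X ^+ k) = 0) ->
  \tr (u *m (map_mx iotaR (mexp X) - 1%:M)) = 0.
Proof.
have [u1 [u2 ->]] := re_im_mx u => h.
have E (Y : 'M[R]_n) : \tr ((map_mx iotaR u1 + 'i *: map_mx iotaR u2) *m map_mx iotaR Y) =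
    iotaR (\tr (u1 *m Y)) + 'i * iotaR (\tr (u2 *m Y)).
  by rewrite mulmxDl -scalemxAl mxtraceD mxtraceZ -!map_mxM !complexify_tr.
have h1 k : (0 < k)%N -> \tr (u1 *m X ^+ k) = 0 /\ \tr (u2 *m X ^+ k) = 0.
  by move=> /h; rewrite -mapX E => /re_im0.
have -> : map_mx iotaR (mexp X) - 1%:M = map_mx iotaR (mexp X - 1%:M).
  by rewrite map_mxB map_mx1.
rewrite E.
have e1 : \tr (u1 *m (mexp X - 1%:M)) = 0.
  by have := @mexp_tr R n n u1 1%:M X; rewrite mulmx1; apply => k /h1 []; rewrite mulmx1.
have e2 : \tr (u2 *m (mexp X - 1%:M)) = 0.
  by have := @mexp_tr R n n u2 1%:M X; rewrite mulmx1; apply => k /h1 []; rewrite mulmx1.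
by rewrite e1 e2 !rmorph0 mulr0 addr0.
Qed.

Lemma drhoZ (A : comNzRingType) d (c : A) (Y : 'M[A]_n) : drho d (c *: Y) = c *: drho d Y.
Proof.
rewrite /drho -linearZ; congr dtens; rewrite scale_block_mx !scaler0 //.
Qed.

(** The exponential is a power of a root so close to 1 that its determinant is not 0. *)
Lemma mexp_unit X : mexp X \in unitmx.
Proof.
pose e := \det (mexp X).
have [c c0 hc] := mexp_second X.
have [d d0 hd] := @cont_eps R n n (fun g : 'M[R]_n => \det g) 1%:M 1 (@cont_det R n) ltr01.
pose m := (Num.Def.archi_bound ((c + nrm X) / d)).+1.
have m0 : (0 < m)%N by [].
have detX (A : 'M[R]_n) k : \det (A ^+ k) = \det A ^+ k.
  elim: k => [|k IH]; first by rewrite !expr0 det1.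
  by rewrite !exprS -mulmxE det_mulmx IH.
rewrite (mexp_root X m0) unitmxE detX unitrX //.
have mR : 0 < m%:R :> R by rewrite ltr0n.
have m1 : `|m%:R^-1 : R| <= 1 by rewrite ger0_norm ?invr_ge0 ?ler0n // invf_le1 // ler1n.
have := hd (mexp (m%:R^-1 *: X)); rewrite det1.
have : nrm (mexp (m%:R^-1 *: X) - 1%:M) < d.
  rewrite -[X in nrm X](subrK (m%:R^-1 *: X)); apply: le_lt_trans (nrmD _ _) _.
  apply: (@le_lt_trans _ _ ((c + nrm X) * m%:R^-1)).
    rewrite mulrDl; apply: lerD.
      apply: le_trans (hc _ m1) _; rewrite ler_wpM2l // expr2 ler_piMr ?invr_ge0 ?ler0n //.
      by apply: le_trans m1; rewrite ler_norm.
    by rewrite nrmZ ger0_norm ?invr_ge0 ?ler0n // mulrC.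
  rewrite ltr_pdivrMr // mulrC -ltr_pdivrMr //.
  apply: lt_le_trans (archi_boundP _) _; first by rewrite divr_ge0 ?addr_ge0 ?nrm_ge0 // ltW.
  by rewrite ler_nat.
move=> lt /(_ lt) h; rewrite unitfE; apply: contraTneq h => ->.
by rewrite sub0r normrN normr1 ltxx.
Qed.

(** An equation of M has trace 0 against all powers of [drho d X], hence against their exponential,
    which is the image of [mexp X]. *)
Lemma mexp_closed (M : mxgroup R[i] n) X : zclosed_over iotaR M ->
  lie M (complexify X) -> mxset (rpoints M) (mexp X).
Proof.
move=> /zclosed_lin [d [J EM]] mX; rewrite /= EM; split.
  by rewrite /= /complexify map_unitmx mexp_unit.
move=> Phi JP; have v : vanishes M (map_mx iotaR Phi).
  by move=> g; rewrite EM => -[_]; apply.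
rewrite /complexify -map_rho.
have -> : rho d (mexp X) = mexp (drho d X).
  apply: mexp_hom; [exact: Jet_rho | exact: rho1 | exact: rhoM | exact: drhoZ].
rewrite -map_mxM complexify_tr -[mexp _](subrK 1%:M) mulmxDr mulmx1 mxtraceD.
have t0 k : \tr (Phi *m drho d X ^+ k) = 0.
  apply: iotaR_inj; rewrite rmorph0 -complexify_tr map_mxM mapX map_drho.
  by apply: (vanishes_tr (H := M)); apply: vanishes_lieX.
have := t0 0%N; rewrite expr0 mulmx1 => ->; rewrite addr0.
have := @mexp_tr R _ _ Phi 1%:M (drho d X); rewrite mulmx1 => ->; first by rewrite rmorph0.
by move=> k _; rewrite mulmx1.
Qed.

(** At small dyadic times the value lies in a finite set and close to 1, so it equals 1; the
    second-order expansion then bounds X by a multiple of 2^-j. *)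
Lemma mexp_finite X (s : seq 'M[R]_n) : (forall c : R, mexp (c *: X) \in s) -> X = 0.
Proof.
move=> fin; have [c c0 hc] := mexp_second X.
have [e e0 he] : exists2 e : R, 0 < e & forall g, g \in s -> g != 1%:M -> e <= nrm (g - 1%:M).
  elim: s {fin} => [|g s [e e0 he]]; first by exists 1.
  have [->|g1] := eqVneq g 1%:M.
    by exists e => // h; rewrite inE => /orP [/eqP ->|/he//]; rewrite eqxx.
  exists (Num.min e (nrm (g - 1%:M))).
    by rewrite lt_min e0 lt_def nrm_ge0 nrm_eq0 subr_eq0 g1.
  move=> h; rewrite inE => /orP [/eqP -> _|hs h1]; first by rewrite ge_min lexx orbT.
  by rewrite ge_min he.
have near j : half R j * (c + nrm X) < e -> nrm X <= c * half R j.
  move=> hj; have h1 : `|half R j| <= 1 by rewrite ger0_norm ?half_ge0 ?half_le1.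
  have := hc _ h1.
  have [E|ne] := eqVneq (mexp (half R j *: X)) 1%:M.
    rewrite E subrr sub0r nrmN nrmZ ger0_norm ?half_ge0 // expr2 mulrA [leRHS]mulrC.
    by rewrite ler_pM2l ?half_gt0.
  have := he _ (fin (half R j)) ne.
  have := nrmD (mexp (half R j *: X) - 1%:M - half R j *: X) (half R j *: X).
  rewrite subrK nrmZ ger0_norm ?half_ge0 // => h2 h3 h4.
  have : c * half R j ^+ 2 <= c * half R j by rewrite ler_wpM2l // expr2 ler_piMr ?half_ge0 ?half_le1.
  move: hj h2 h3 h4; rewrite mulrDr [_ * c]mulrC; lra.
apply/eqP; rewrite -nrm_eq0 eq_le nrm_ge0 andbT leNgt; apply/negP => X0.
have b0 : 0 < c + nrm X by rewrite ltr_wpDl.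
have b1 : 0 < c + 1 by rewrite ltr_wpDl.
have e1 : 0 < Num.min (e / (c + nrm X)) (nrm X / (c + 1)) by rewrite lt_min !divr_gt0.
have [j hj] := half_small e1.
move: hj; rewrite lt_min ltr_pdivlMr // ltr_pdivlMr // => /andP [/near h1 h2].
move: h2; rewrite mulrDr mulr1 mulrC ltNge => /negP; apply; apply: le_trans h1 _.
by rewrite lerDl half_ge0.
Qed.
End RealExp.

(** * Lie algebras of nilpotent matrices *)

Section EngelPart.
Local Open Scope ring_scope.

Lemma tr_bracket (A : comNzRingType) n (X Y Z : 'M[A]_n) :
  \tr ((X *m Y - Y *m X) *m Z) = \tr (X *m (Y *m Z - Z *m Y)).
Proof.
have e : \tr (Y *m X *m Z) = \tr (X *m Z *m Y) by rewrite -mulmxA mxtrace_mulC.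
by rewrite mulmxBl mulmxBr !mulmxA (linearB (@mxtrace A n)) (linearB (@mxtrace A n)) /= e.
Qed.

Section Engel.
Local Open Scope classical_set_scope.
Local Open Scope ring_scope.
Variables (C : numClosedFieldType) (n : nat).
Implicit Types (W U : set 'M[C]_n) (X Y Z : 'M[C]_n).

Definition subspace W : Prop := W 0 /\ forall c X Y, W X -> W Y -> W (c *: X + Y).

Lemma subspaceD W X Y : subspace W -> W X -> W Y -> W (X + Y).
Proof. by move=> [_ h] WX; rewrite -[X]scale1r; apply: h. Qed.

Lemma subspaceZ W c X : subspace W -> W X -> W (c *: X).
Proof. by move=> [h0 h] WX; rewrite -[_ *: _]addr0; apply: h. Qed.

Lemma subspaceB W X Y : subspace W -> W X -> W Y -> W (X - Y).
Proof. by move=> sW WX WY; rewrite -scaleN1r; apply: subspaceD => //; apply: subspaceZ. Qed.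

Lemma subspace_mx W : subspace W -> exists k (B : 'M[C]_(k, n * n)),
  row_free B /\ forall X, W X <-> (mxvec X <= B)%MS.
Proof.
move=> [W0 WL]; have [||k [B [fB H]]] := @subspace_basis C (n * n) [set v | W (vec_mx v)].
- by rewrite /= linear0.
- by move=> c u v /= hu hv; rewrite linearP; apply: WL.
by exists k, B; split=> // X; rewrite -H /= mxvecK.
Qed.

Definition word (s : seq 'M[C]_n) : 'M[C]_n := foldr (fun x y => x *m y) 1%:M s.
(** Nilpotency of the associative algebra generated by W, not merely of its elements. *)
Definition wnil W k : Prop := forall s, (forall x, x \in s -> W x) -> (k <= size s)%N -> word s = 0.

Lemma word_cat s t : word (s ++ t) = word s *m word t.
Proof. by elim: s => [|x s IH] /=; rewrite ?mul1mx // IH mulmxA. Qed.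

(* The right ideal generated by the products of a elements of W. *)
Inductive ide W : nat -> 'M[C]_n -> Prop :=
| ide_any Z : ide W 0 Z
| ide_mul a w Z : W w -> ide W a Z -> ide W a.+1 (w *m Z)
| ide_add a Z Z' : ide W a Z -> ide W a Z' -> ide W a (Z + Z')
| ide_zero a : ide W a 0.

Lemma ideZ W a c Z : ide W a Z -> ide W a (c *: Z).
Proof.
elim=> [Z'|b w Z' Ww _ IH|b Z1 Z2 _ h1 _ h2|b].
- exact: ide_any.
- by rewrite scalemxAr; apply: ide_mul.
- by rewrite scalerDr; apply: ide_add.
- by rewrite scaler0; apply: ide_zero.
Qed.

Lemma ide_subspace W a : subspace (ide W a).
Proof. by split=> [|c X Y hX hY]; [exact: ide_zero | apply: ide_add => //; apply: ideZ]. Qed.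

Lemma ideS W a Z : ide W a.+1 Z -> ide W a Z.
Proof.
move E: a.+1 => b h; elim: h a E => [//|c w Z' Ww h IH|c Z1 Z2 _ h1 _ h2|c] a E.
- case: a E => [|a] [E]; first exact: ide_any.
  by apply: ide_mul => //; apply: IH; rewrite E.
- by apply: ide_add; [apply: h1 | apply: h2].
- exact: ide_zero.
Qed.

Lemma ide_le W a b Z : (a <= b)%N -> ide W b Z -> ide W a Z.
Proof. by move=> /subnK <-; elim: (b - a)%N => [//|k IH] /ideS. Qed.

Lemma ide_word W k a Z : wnil W k -> ide W a Z -> forall s, (forall x, x \in s -> W x) ->
  (k <= size s + a)%N -> word s *m Z = 0.
Proof.
move=> nW; elim=> [Z'|b w Z' Ww _ IH|b Z1 Z2 _ h1 _ h2|b] s sW ks.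
- by rewrite (nW s sW) ?mul0mx //; move: ks; rewrite addn0.
- rewrite mulmxA -[w]mulmx1 -[w *m 1%:M]/(word [:: w]) -word_cat; apply: IH.
    by move=> x; rewrite mem_cat inE => /orP [/sW|/eqP ->].
  by rewrite size_cat addn1 addSnnS.
- by rewrite mulmxDr h1 // h2 // addr0.
- by rewrite mulmx0.
Qed.

Lemma ide_nil W k Z : wnil W k -> ide W k Z -> Z = 0.
Proof. by move=> nW /(ide_word nW) /(_ [::]); rewrite mul1mx; apply. Qed.

Lemma ide_normal W x a Z : (forall w, W w -> W (x *m w - w *m x)) -> ide W a Z -> ide W a (x *m Z).
Proof.
move=> nx; elim=> [Z'|b w Z' Ww h IH|b Z1 Z2 _ h1 _ h2|b].
- exact: ide_any.
- have -> : x *m (w *m Z') = (x *m w - w *m x) *m Z' + w *m (x *m Z').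
    by rewrite mulmxBl !mulmxA subrK.
  by apply: ide_add; apply: ide_mul => //; apply: nx.
- by rewrite mulmxDr; apply: ide_add.
- by rewrite mulmx0; apply: ide_zero.
Qed.

(** Modulo products with one more factor from W, a word in elements c x + w is a multiple of a power
    of x. As x^l = 0, each block of l letters contributes a factor from W. *)
Lemma wnil_extend W x k l : wnil W k -> (forall w, W w -> W (x *m w - w *m x)) -> x ^+ l = 0 ->
  wnil [set y | exists c w, W w /\ y = c *: x + w] (l * k).
Proof.
move=> nW nx xl.
have push s a Z : (forall y, y \in s -> exists c w, W w /\ y = c *: x + w) -> ide W a Z ->
    exists c, ide W a.+1 (word s *m Z - c *: (x ^+ size s *m Z)).
  elim: s => [|y s IH] hs hZ.
    by exists 1; rewrite expr0 /= scale1r subrr; apply: ide_zero.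
  have [|c hc] := IH _ hZ; first by move=> z zs; apply: hs; rewrite inE zs orbT.
  have [d [w [Ww Ey]]] := hs y (mem_head _ _); exists (d * c).
  have xZ j : ide W a (x ^+ j *m Z).
    elim: j => [|j IHj]; first by rewrite expr0 mul1mx.
    by rewrite exprS -mulmxE -mulmxA; apply: ide_normal.
  have wZ : ide W a (word s *m Z).
    rewrite -[_ *m Z](subrK (c *: (x ^+ size s *m Z))); apply: ide_add; first exact: ideS.
    exact: ideZ.
  have -> : word (y :: s) *m Z - (d * c) *: (x ^+ size (y :: s) *m Z) =
      d *: (x *m (word s *m Z - c *: (x ^+ size s *m Z))) + w *m (word s *m Z).
    rewrite /= Ey -mulmxA mulmxDl -scalemxAl mulmxBr scalerBr -scalemxAr scalerA exprS -mulmxE -mulmxA.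
    by rewrite addrAC.
  by apply: ide_add; [apply/ideZ/ide_normal | apply: ide_mul].
have iter j : forall s, (forall y, y \in s -> exists c w, W w /\ y = c *: x + w) ->
    (l * j <= size s)%N -> ide W j (word s).
  elim: j => [|j IH] s hs ls; first exact: ide_any.
  rewrite -(cat_take_drop l s) word_cat.
  have lsz : (l <= size s)%N by apply: leq_trans ls; rewrite mulnS leq_addr.
  have [||c] := push (take l s) j (word (drop l s)).
  - by move=> y /mem_take /hs.
  - apply: IH => [y /mem_drop /hs //|]; rewrite size_drop leq_subRL //.
    by rewrite -mulnS.
  - by rewrite size_takel // xl mul0mx scaler0 subr0.
move=> s hs ls; apply: (ide_nil nW); exact: iter.
Qed.

(** Take a subspace of U of maximal dimension whose long words vanish. If an element of U lies
    outside it, iterated brackets with the subspace must come to an end, and the last one that is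
    still outside normalizes it; then the subspace can be enlarged. *)
Lemma engel U : subspace U -> (forall X Y, U X -> U Y -> U (X *m Y - Y *m X)) ->
  (forall X, U X -> X ^+ n = 0) -> exists k, wnil U k.
Proof.
move=> sU bU nU.
pose sp r (B : 'M[C]_(r, n * n)) : set 'M[C]_n := [set X | (mxvec X <= B)%MS].
pose Q r := exists B : 'M[C]_(r, n * n), [/\ row_free B, sp r B `<=` U & exists k, wnil (sp r B) k].
have Qm r : Q r -> (r <= n * n)%N by case=> B [/eqP fB _ _]; move: (rank_leq_col B); rewrite fB.
have exQ : exists r, `[< Q r >].
  exists 0%N; apply/asboolP; exists 0; split.
  - by rewrite /row_free mxrank0.
  - by move=> X /submxP [D ED]; rewrite -[X]mxvecK ED (thinmx0 D) mul0mx linear0; case: sU.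
  - exists 1%N => -[//|x s] h _ /=.
    have /submxP [D ED] : sp 0%N 0 x by apply: h; rewrite mem_head.
    by rewrite -[x]mxvecK ED (thinmx0 D) mul0mx linear0 mul0mx.
have ubQ r : `[< Q r >] -> (r <= n * n)%N by move=> /asboolP /Qm.
case: (ex_maxnP exQ ubQ) => r /asboolP [B [fB BU [k nB]]] rmax; exists k.
suff UB : U `<=` sp r B by move=> s sU'; apply: nB => x /sU' /UB.
move=> x Ux; apply: contrapT => nx.
have sB : subspace (sp r B).
  split=> [|c X Y hX hY]; rewrite /sp /=; first by rewrite linear0 sub0mx.
  by rewrite linearP addmx_sub // scalemx_sub.
have [x' [Ux' nx' normx]] : exists x', [/\ U x', ~ sp r B x' &
    forall w, sp r B w -> sp r B (x' *m w - w *m x')].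
  apply: contrapT => no.
  have step y : U y -> ~ sp r B y -> exists2 w, sp r B w & ~ sp r B (y *m w - w *m y).
    move=> Uy ny; apply: contrapT => nw; apply: no; exists y; split=> // w hw.
    by apply: contrapT => nn; apply: nw; exists w.
  (* Z vanishes between words of total length at least 2 k - c. Each bracket with an element of the
     subspace raises c by one, and at c = 2 k the matrix itself is 0. *)
  pose F c Z := forall s t, (forall y, y \in s -> sp r B y) -> (forall y, y \in t -> sp r B y) ->
    (2 * k <= size s + size t + c)%N -> word s *m Z *m word t = 0.
  have xc c : exists y, [/\ U y, ~ sp r B y & F c y].
    elim: c => [|c [y [Uy ny Fy]]].
      exists x; split=> // s t hs ht; rewrite addn0 => le.
      have [ks|ks] := leqP k (size s); first by rewrite (nB s) // !mul0mx.
      by rewrite (nB t) ?mulmx0 //; lia.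
    have [w hw nw] := step y Uy ny; exists (y *m w - w *m y); split=> //.
      by apply: bU => //; apply: BU.
    move=> s t hs ht le; rewrite mulmxBr mulmxBl.
    have -> : word s *m (y *m w) *m word t = word s *m y *m word (w :: t) by rewrite /= !mulmxA.
    have -> : word s *m (w *m y) *m word t = word (s ++ [:: w]) *m y *m word t.
      by rewrite word_cat /= mulmx1 !mulmxA.
    rewrite !Fy ?subrr //; first by move=> z; rewrite mem_cat inE => /orP [/hs|/eqP ->].
    - by apply: leq_trans le _; rewrite size_cat /= addn1 addnS !addSn.
    - by move=> z; rewrite inE => /orP [/eqP ->|/ht].
    - by apply: leq_trans le _; rewrite /= !addnS !addSn.
  have [y [_ ny Fy]] := xc (2 * k)%N; apply: ny.
  have := Fy [::] [::]; rewrite /= mul1mx mulmx1 => -> //.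
  by case: sB.
suff /asboolP/rmax : Q r.+1 by rewrite ltnn.
have sub1 X : (mxvec X <= col_mx (mxvec x') B)%MS -> exists c w, sp r B w /\ X = c *: x' + w.
  move=> /submxP [D ED]; exists (lsubmx (D : 'rV_(1 + r)) 0 0), (vec_mx (rsubmx (D : 'rV_(1 + r)) *m B)); split.
    by rewrite /sp /= vec_mxK submxMl.
  rewrite -[X]mxvecK ED -{1}[D](@hsubmxK _ 1 1 r) mul_row_col linearD /=; congr (_ + _).
  by rewrite {1}[lsubmx _]mx11_scalar mul_scalar_mx linearZ /= mxvecK.
exists (col_mx (mxvec x') B); split.
- by apply: row_free_col_mx1 => //; apply/negP.
- move=> X /sub1 [c [w [hw ->]]]; apply: subspaceD => //; last exact: BU.
  exact: subspaceZ.
- exists (n * k)%N => s hs; apply: (wnil_extend nB normx (nU _ Ux')) => y /hs /sub1 //.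
Qed.

(* Perfectness is expressed by the spanning property of the brackets. *)
Definition perfect U : Prop := forall P, subspace P ->
  (forall X Y, U X -> U Y -> P (X *m Y - Y *m X)) -> U `<=` P.

(** Every element is a combination of brackets, hence of products of arbitrarily many factors, and
    long products vanish. *)
Lemma engel_perfect U k : wnil U k -> perfect U -> forall X, U X -> X = 0.
Proof.
move=> nU pU X UX.
have H a : forall X, U X -> ide U a.+1 X.
  elim: a => [|a IH] Y; first by move=> UY; rewrite -[Y]mulmx1; apply: ide_mul => //; exact: ide_any.
  apply: (pU (ide U a.+2)); first exact: ide_subspace.
  move=> V Z UV UZ; rewrite -scaleN1r; apply: ide_add; first by apply: ide_mul => //; apply: IH.
  by apply: ideZ; apply: ide_mul => //; apply: IH.
by apply: (ide_nil nU); apply: ideS; apply: H.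
Qed.

(** The k-th power of c y lies in the ideal generated by products of k elements of U, so c y is
    nilpotent. *)
Lemma nil_ideal_tr0 U k y c : wnil U k -> (forall w, U w -> U (y *m w - w *m y)) -> U c ->
  \tr (c *m y) = 0.
Proof.
move=> nU ny Uc; apply: (@nilp_tr0 _ _ _ k); apply: (ide_nil nU).
elim: k {nU} => [|k IH]; first exact: ide_any.
by rewrite exprS -mulmxE -mulmxA; apply: ide_mul => //; apply: ide_normal.
Qed.
End Engel.
End EngelPart.

(** * The trace form of a semisimple group *)

Section Semisimple.
Local Open Scope classical_set_scope.
Local Open Scope ring_scope.
Variables (R : realType) (n : nat) (M : mxgroup R[i] n).
Hypothesis M_R : zclosed_over iotaR M.
Local Notation C := R[i].
Local Notation conj := (@Num.conj C).

Lemma zclosed_real : zclosed M.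
Proof.
have [d [J EM]] := zclosed_lin M_R; apply/zclosed_polyf.
exists [set f | exists2 Phi, J Phi & f = fun g => \tr (map_mx iotaR Phi *m rho d g)].
split=> [f [Phi _ ->]|]; first by apply/polyfP; exists d, (map_mx iotaR Phi).
rewrite EM; apply/seteqP; split=> g [ug h]; split=> //; first by move=> f [Phi JP ->]; apply: h.
by move=> Phi JP; apply: (h (fun g => \tr (map_mx iotaR Phi *m rho d g))); exists Phi.
Qed.

Lemma conj_iotaR p q (A : 'M[R]_(p, q)) : map_mx conj (map_mx iotaR A) = map_mx iotaR A.
Proof. by apply/matrixP=> i j; rewrite !mxE; apply/eqP; rewrite eq_complex /= oppr0 !eqxx. Qed.

Lemma conj_M g : mxset M g -> mxset M (map_mx conj g).
Proof.
have [d [J EM]] := zclosed_lin M_R; rewrite EM => -[ug h]; split; first by rewrite /= map_unitmx.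
by move=> Phi JP; rewrite -map_rho -(conj_iotaR Phi) -map_mxM trace_map_mx h // rmorph0.
Qed.

Lemma conj_lie X : lie M X -> lie M (map_mx conj X).
Proof.
move=> mX d Phi v.
have v' : vanishes M (map_mx conj Phi).
  move=> g Mg; have := v _ (conj_M Mg); rewrite -map_rho => /(congr1 conj).
  rewrite -trace_map_mx map_mxM -map_mx_comp rmorph0 => <-; congr (\tr (_ *m _)).
  by apply/matrixP=> i j; rewrite !mxE /= conjCK.
have := mX _ _ v' => /(congr1 conj); rewrite -trace_map_mx map_mxM -map_mx_comp rmorph0 map_drho.
move=> <-; congr (\tr (_ *m _)).
by apply/matrixP=> i j; rewrite !mxE /= conjCK.
Qed.

(** Real and imaginary parts are combinations of X and its conjugate. *)
Lemma real_span (W : set 'M[C]_n) X : subspace W -> (forall Y, W Y -> W (map_mx conj Y)) -> W X ->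
  exists A B : 'M[R]_n, [/\ W (complexify A), W (complexify B) & X = complexify A + 'i *: complexify B].
Proof.
move=> sW cW WX; have [A [B EX]] := re_im_mx X; exists A, B.
have cX : map_mx conj X = complexify A - 'i *: complexify B.
  rewrite EX map_mxD map_mxZ !conj_iotaR /complexify.
  by rewrite -scaleNr; congr (_ + _ *: _); exact: conjCi.
have n2 : (2 : C) != 0 by rewrite pnatr_eq0.
split=> //.
  have E : X + map_mx conj X = 2 *: complexify A.
    by rewrite cX EX addrACA subrr addr0 scaler_nat mulr2n.
  have -> : complexify A = 2^-1 *: (X + map_mx conj X) by rewrite E scalerA mulVf // scale1r.
  by apply: subspaceZ => //; apply: subspaceD => //; apply: cW.
have E : X - map_mx conj X = (2 * 'i) *: complexify B.
  by rewrite cX EX opprB addrC addrA subrK -scalerA scaler_nat mulr2n.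
have -> : complexify B = (2 * 'i)^-1 *: (X - map_mx conj X).
  by rewrite E scalerA mulVf ?scale1r // mulf_neq0 // neq0Ci.
by apply: subspaceZ => //; apply: subspaceB => //; apply: cW.
Qed.

Lemma lie_subspace : subspace (lie M).
Proof. by split; [exact: lie0 | move=> c X Y; exact: lieP]. Qed.

Lemma mexp_comm (X A : 'M[R]_n) : X *m A = A *m X -> mexp X *m A = A *m mexp X.
Proof.
move=> E; have cA : conv (fun=> A) A by move=> a b; exact: sconv_const.
apply: (conv_unique (conv_mulmx (mexpP X) cA)).
apply: conv_ext (conv_mulmx cA (mexpP X)) => j.
elim: (2 ^ j)%N => [|k IH]; first by rewrite expr0 mulmx1 mul1mx.
rewrite exprS -mulmxE mulmxA -[RHS]mulmxA -IH !mulmxA; congr (_ *m _).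
by rewrite mulmxDl mulmxDr mul1mx mulmx1 -scalemxAl -scalemxAr E.
Qed.

Hypothesis M_ss : semisimple M.

(** The identity component of U is trivial because M is semisimple, so U is finite and contains no
    nonconstant one-parameter group. *)
Lemma normal_solvable_exp (U : mxgroup C n) (X : 'M[R]_n) : zclosed U -> normal_in U M ->
  solvable_mx (idcomp U) -> (forall c : R, mxset U (complexify (mexp (c *: X)))) -> X = 0.
Proof.
move=> cU [UM nU] sU hX.
have U1 : mxset (idcomp U) = [set 1%:M].
  apply: M_ss sU; [exact: idcomp_closed | exact/irr_zconnected/irr_idcomp|].
  split=> [g /idcomp_sub /UM //|g h Mg Uh].
  by apply: idcomp_conj Uh; [exact: mxgroup_unit Mg | move=> x; apply: nU].
have [s [_ sP]] := idcomp_reps U.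
apply: (@mexp_finite _ _ X [seq map_mx (@complex.Re R) r | r <- s]) => c.
have [r rs [k]] := sP _ (hX c); rewrite U1 => -> Er; apply/mapP; exists r => //.
have <- : complexify (mexp (c *: X)) = r by rewrite Er mulmx1.
by apply/matrixP=> i j; rewrite !mxE.
Qed.

Lemma mem_derived (S : set 'M[C]_n) (K : mxgroup C n) :
  (forall g h, S g -> S h -> mxset K (g *m h *m invmx g *m invmx h)) -> derived S `<=` K.
Proof. by move=> h g; apply=> _ [x [y [Sx Sy ->]]]; apply: h. Qed.

Lemma derived1 (S : set 'M[C]_n) : derived S 1%:M.
Proof. by move=> K _; exact: mxgroup1. Qed.

Program Definition triv_group : mxgroup C n := @MxGroup C n [set 1%:M] _ _ _ _.
Next Obligation. by move=> _ ->; exact: unitmx1. Qed.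
Next Obligation. by []. Qed.
Next Obligation. by move=> _ _ -> ->; rewrite mulmx1. Qed.
Next Obligation. by move=> _ ->; rewrite invmx1. Qed.

Lemma lie_idcomp X : lie (idcomp M) X -> lie M X.
Proof. by move=> h d Phi v; apply: h => g /idcomp_sub; apply: v. Qed.

(* Keeping the Lie algebra abstract prevents conversion from unfolding it. *)
Variable m : set 'M[C]_n.
Hypothesis mE : m = lie M.

Let l0 : m 0. Proof. by rewrite mE; exact: lie0. Qed.
Let lP c X Y : m X -> m Y -> m (c *: X + Y). Proof. rewrite mE; exact: lieP. Qed.
Let lZ c X : m X -> m (c *: X). Proof. rewrite mE; exact: lieZ. Qed.
Let lbr X Y : m X -> m Y -> m (X *m Y - Y *m X). Proof. rewrite mE; exact: lie_bracket. Qed.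
Let lAd g X : mxset M g -> m X -> m (g *m X *m invmx g). Proof. rewrite mE; exact: lie_Ad. Qed.
Let lrep X q : m X -> conj_poly X q -> m (pmx q X). Proof. rewrite mE; exact: lie_replica. Qed.
Let lconj X : m X -> m (map_mx conj X). Proof. rewrite mE; exact: conj_lie. Qed.
Let lsub : subspace m. Proof. by rewrite mE; exact: lie_subspace. Qed.
Let lexp X : m (complexify X) -> mxset (rpoints M) (mexp X).
Proof. rewrite mE; exact: mexp_closed. Qed.

(** * The centre of the Lie algebra *)

Section Center.
Definition cent_set : set 'M[C]_n := [set g | mxset M g /\ forall X, m X -> g *m X = X *m g].

Lemma cent_unit : cent_set `<=` [set g | g \in unitmx].
Proof. by move=> g [/mxgroup_unit]. Qed.
Lemma cent1 : cent_set 1%:M.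
Proof. by split; [exact: mxgroup1 | move=> X _; rewrite mul1mx mulmx1]. Qed.
Lemma centM g h : cent_set g -> cent_set h -> cent_set (g *m h).
Proof.
move=> [Mg cg] [Mh ch]; split; first exact: mxgroupM.
by move=> X mX; rewrite -mulmxA (ch X mX) [LHS]mulmxA (cg X mX) -mulmxA.
Qed.
Lemma centV g : cent_set g -> cent_set (invmx g).
Proof.
move=> [Mg cg]; have ug := mxgroup_unit Mg; split; first exact: mxgroupV.
by move=> X mX; rewrite -[LHS](mulmxK ug) -[_ *m X *m g]mulmxA -cg // mulKmx.
Qed.
Definition cent := MxGroup cent_unit cent1 centM centV.

Lemma cent_closed : zclosed cent.
Proof.
apply/zclosed_polyf; exists [set f | polyf f /\ forall g, mxset cent g -> f g = 0]; split=> [f []//|].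
apply/seteqP; split=> [g cg|g [ug h]]; first by split; [exact: cent_unit cg | move=> f [_]; apply].
split=> [|X mX].
  have /zclosed_polyf [I [pI EM]] := zclosed_real; rewrite EM; split=> // f If; apply: h.
  by split; [exact: pI | move=> x [Mx _]; move: Mx; rewrite EM => -[_]; apply].
apply/matrixP=> i j; apply/eqP; rewrite -subr_eq0; apply/eqP.
apply: (h (fun g => (g *m X) i j - (X *m g) i j)); split.
  by apply: polyfB; apply: polyf_mulmx => a b; [exact: polyf_entry | exact: polyf_const |
    exact: polyf_const | exact: polyf_entry].
by move=> x [_ cx]; rewrite cx // subrr.
Qed.

Definition lcent : set 'M[C]_n := [set Z | m Z /\ forall Y, m Y -> Z *m Y = Y *m Z].

Lemma lcent_subspace : subspace lcent.
Proof.
split=> [|c Y Z [mY cY] [mZ cZ]]; first by split=> [|Y _]; [exact: l0 | rewrite mul0mx mulmx0].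
split=> [|T mT]; first exact: (lP c mY mZ).
by rewrite mulmxDl mulmxDr -scalemxAl -scalemxAr cY // cZ.
Qed.

(** The centralizer of the Lie algebra in M is closed and normal. Its elements commute with the
    identity component of M, so its own identity component is abelian; and it contains the
    exponentials of the real central elements. *)
Lemma lie_centerless X : m X -> (forall Y, m Y -> X *m Y = Y *m X) -> X = 0.
Proof.
move=> mX cX.
have main (A : 'M[R]_n) : m (complexify A) ->
    (forall Y, m Y -> complexify A *m Y = Y *m complexify A) -> A = 0.
  move=> mA cA; apply: (normal_solvable_exp cent_closed).
  - split=> [g []//|g h Mg [Mh ch]]; have ug := mxgroup_unit Mg.
    split=> [|Y mY]; first by apply: mxgroupM; [exact: mxgroupM | exact: mxgroupV].
    have := ch _ (lAd (mxgroupV Mg) mY); rewrite invmxK => E.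
    have EY : Y = g *m (invmx g *m Y *m g) *m invmx g by rewrite !mulmxA mulmxV // mul1mx mulmxK.
    rewrite {1}EY [in RHS]EY; move: (invmx g *m Y *m g) E => Z E.
    by rewrite -!mulmxA !(mulKmx ug) (mulmxA h) E -mulmxA.
  - exists 1%N; rewrite /=; apply/seteqP; split=> [|_ ->]; last exact: derived1.
    have comm g h : mxset (idcomp cent) g -> mxset (idcomp cent) h -> g *m h = h *m g.
      move=> Bg [S [iS SB S1 Sh]].
      have Hh : mxset (idcomp M) h by exists S; split=> // x /SB [].
      have [_ cg] := idcomp_sub Bg.
      apply: (@lie_commute C n (idcomp M) (@irr_idcomp _ _ M) n id id g) => //.
        exact: Jet_id.
      by move=> Y /lie_idcomp mY; apply: cg; rewrite mE.
    apply: (@mem_derived _ triv_group) => g h Bg Bh; have := comm _ _ Bg Bh.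
    have ug := idcomp_unit Bg; have uh := idcomp_unit Bh.
    by move=> E; rewrite /= E mulmxK // mulmxV.
  - move=> c; have mcA : m (complexify (c *: A)).
      by rewrite /complexify map_mxZ; apply: lZ.
    split; first exact: (lexp mcA).
    move=> Y mY; have [P [Q [mP mQ ->]]] := real_span lsub lconj mY.
    have cR (P' : 'M[R]_n) : m (complexify P') -> complexify (mexp (c *: A)) *m complexify P' =
        complexify P' *m complexify (mexp (c *: A)).
      move=> mP'; rewrite /complexify -!map_mxM mexp_comm //.
      rewrite -scalemxAl -scalemxAr; congr (_ *: _).
      have := cA _ mP'; rewrite /complexify -!map_mxM; exact: map_mx_inj.
    by rewrite mulmxDr mulmxDl -scalemxAl -scalemxAr !cR.
have cW Z : lcent Z -> lcent (map_mx conj Z).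
  move=> [mZ cZ]; split=> [|Y mY]; first exact: lconj.
  have := cZ _ (lconj mY) => /(congr1 (map_mx conj)); rewrite !map_mxM -!map_mx_comp.
  have -> : map_mx (conj \o conj) Y = Y by apply/matrixP=> i j; rewrite !mxE /= conjCK.
  by [].
have [A [B [[mA cA] [mB cB] ->]]] := real_span lcent_subspace cW (Logic.conj mX cX).
by rewrite (main A) // (main B) // /complexify map_mx0 scaler0 addr0.
Qed.
End Center.

(** * The radical of the trace form *)

Section Radical.
Definition radical : set 'M[C]_n := [set X | m X /\ forall Y, m Y -> \tr (X *m Y) = 0].
Local Notation r := radical.

Lemma radical_subspace : subspace r.
Proof.
split=> [|c X Y [mX hX] [mY hY]]; first by split=> [|Y _]; [exact: l0 | rewrite mul0mx mxtrace0].
split=> [|Z mZ]; first exact: (lP c mX mY).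
by rewrite mulmxDl -scalemxAl mxtraceD mxtraceZ hX // hY // mulr0 addr0.
Qed.

Lemma radical_ideal X Y : r X -> m Y -> r (X *m Y - Y *m X).
Proof.
move=> [mX hX] mY; split=> [|Z mZ]; first exact: (lbr mX mY).
by rewrite tr_bracket hX //; apply: (lbr mY mZ).
Qed.

Lemma radical_Ad g X : mxset M g -> r X -> r (g *m X *m invmx g).
Proof.
move=> Mg [mX hX]; split=> [|Y mY]; first exact: lAd.
rewrite -!mulmxA mxtrace_mulC -!mulmxA hX //.
by have := lAd (mxgroupV Mg) mY; rewrite invmxK mulmxA.
Qed.

(** The replica of X belongs to the Lie algebra, so X is orthogonal to it, and the sum of the |x|^2
    over the eigenvalues of X is 0. *)
Lemma radical_nil X : r X -> X ^+ n = 0.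
Proof.
move=> [mX hX]; have [q hq] := conj_poly_exists X.
have /srel_rel rl := conj_poly_srel hq.
by apply: (rel_tr0 rl); apply: hX; apply: lrep.
Qed.

Lemma conj_radical X : r X -> r (map_mx conj X).
Proof.
move=> [mX hX]; split=> [|Y mY]; first exact: lconj.
have := hX _ (lconj mY) => /(congr1 conj); rewrite -trace_map_mx map_mxM -map_mx_comp rmorph0.
have -> : map_mx (conj \o conj) Y = Y by apply/matrixP=> i j; rewrite !mxE /= conjCK.
by [].
Qed.

Lemma ide_Ad g a Z : mxset M g -> ide r a Z -> ide r a (g *m Z).
Proof.
move=> Mg; have ug := mxgroup_unit Mg; elim=> [Z'|b w Z' rw _ IH|b Z1 Z2 _ h1 _ h2|b].
- exact: ide_any.
- rewrite (_ : g *m (w *m Z') = (g *m w *m invmx g) *m (g *m Z')).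
    by apply: ide_mul => //; apply: radical_Ad.
  by rewrite !mulmxA mulmxKV.
- by rewrite mulmxDr; apply: ide_add.
- by rewrite mulmx0; apply: ide_zero.
Qed.

(** The elements g for which g - 1 moves the filtration by powers of the radical j steps further.
    For nilpotent radical and j = 1 these are unipotent. *)
Definition unip_set j : set 'M[C]_n := [set g | mxset M g /\
  forall a Z, ide r a Z -> ide r (a + j) ((g - 1%:M) *m Z)].

Lemma unip_unit j : unip_set j `<=` [set g | g \in unitmx].
Proof. by move=> g [/mxgroup_unit]. Qed.
Lemma unip1 j : unip_set j 1%:M.
Proof.
split=> [|a Z _]; first exact: mxgroup1.
by rewrite subrr mul0mx; apply: ide_zero.
Qed.
Lemma unipM j g h : unip_set j g -> unip_set j h -> unip_set j (g *m h).
Proof.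
move=> [Mg hg] [Mh hh]; split=> [|a Z hZ]; first exact: mxgroupM.
have -> : (g *m h - 1%:M) *m Z = (g - 1%:M) *m (h *m Z) + (h - 1%:M) *m Z.
  by rewrite !mulmxBl !mul1mx mulmxA addrA subrK.
by apply: ide_add; [apply/hg/ide_Ad | apply: hh].
Qed.
Lemma unipV j g : unip_set j g -> unip_set j (invmx g).
Proof.
move=> [Mg hg]; have ug := mxgroup_unit Mg; split=> [|a Z hZ]; first exact: mxgroupV.
have -> : (invmx g - 1%:M) *m Z = (-1) *: ((g - 1%:M) *m (invmx g *m Z)).
  by rewrite !mulmxBl !mul1mx mulKVmx // scaleN1r opprB.
by apply/ideZ/hg/ide_Ad => //; apply: mxgroupV.
Qed.
Definition unip j := MxGroup (@unip_unit j) (@unip1 j) (@unipM j) (@unipV j).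

(** The difference g h - h g is the commutator of g - 1 and h - 1, which moves the filtration by i +
    j steps. *)
Lemma unip_comm i j g h : unip_set i g -> unip_set j h ->
  unip_set (i + j) (g *m h *m invmx g *m invmx h).
Proof.
move=> [Mg hg] [Mh hh]; have ug := mxgroup_unit Mg; have uh := mxgroup_unit Mh.
have [Mgi Mhi] := (mxgroupV Mg, mxgroupV Mh).
split=> [|a Z hZ]; first by do 3!apply: mxgroupM => //.
have -> : (g *m h *m invmx g *m invmx h - 1%:M) *m Z =
   (g - 1%:M) *m ((h - 1%:M) *m (invmx g *m (invmx h *m Z))) -
   (h - 1%:M) *m ((g - 1%:M) *m (invmx g *m (invmx h *m Z))).
  have E : (g *m h - h *m g) *m (invmx g *m (invmx h *m Z)) = (g *m h *m invmx g *m invmx h - 1%:M) *m Z.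
    by rewrite !mulmxBl !mul1mx !mulmxA (mulmxK ug) (mulmxV uh) mul1mx.
  rewrite -E !(mulmxA (_ - 1%:M)) -mulmxBl; congr (_ *m _).
  by rewrite !mulmxBl !mulmxBr !mul1mx !mulmx1; apply/matrixP=> x y; rewrite !mxE; ring.
have hZ' : ide r a (invmx g *m (invmx h *m Z)) by do 2!apply: ide_Ad => //.
apply: (subspaceB (ide_subspace _ _)).
  by rewrite [(i + j)%N]addnC addnA; apply/hg/hh.
by rewrite addnA; apply/hh/hg.
Qed.

Lemma unip_closed j : zclosed (unip j).
Proof.
apply/zclosed_polyf; exists [set f | polyf f /\ forall g, mxset (unip j) g -> f g = 0]; split=> [f []//|].
apply/seteqP; split=> [g cg|g [ug h]]; first by split; [exact: unip_unit cg | move=> f [_]; apply].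
split=> [|a Z hZ].
  have /zclosed_polyf [I [pI EM]] := zclosed_real; rewrite EM; split=> // f If; apply: h.
  by split; [exact: pI | move=> x [Mx _]; move: Mx; rewrite EM => -[_]; apply].
have [k [B [_ HB]]] := subspace_mx (ide_subspace r (a + j)); apply/HB.
rewrite submxE; apply/eqP/rowP => c; rewrite [RHS]mxE.
apply: (h (fun g => (mxvec ((g - 1%:M) *m Z) *m cokermx B) 0 c)); split; last first.
  by move=> x [_ /(_ a Z hZ) /HB]; rewrite submxE => /eqP ->; rewrite mxE.
apply: polyf_mulmx => x y; last exact: polyf_const.
case/mxvec_indexP: y => y1 y2; apply: (polyf_ext (f := fun g => ((g - 1%:M) *m Z) y1 y2)).
  by move=> g'; rewrite (ord1 x) mxvecE.
apply: polyf_mulmx => u v; last exact: polyf_const.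
apply: (polyf_ext (f := fun g => g u v - (1%:M : 'M[C]_n) u v)) => [g'|]; first by rewrite !mxE.
by apply: polyfB; [exact: polyf_entry | exact: polyf_const].
Qed.

Lemma linear_tr (f : 'M[C]_n -> C) : (forall c X Y, f (c *: X + Y) = c * f X + f Y) ->
  exists u, forall X, f X = \tr (u *m X).
Proof.
move=> lf; exists (vec_mx (row_of f))^T => X; rewrite -(row_ofE X lf).
have -> : (row_of f *m (mxvec X)^T) 0 0 = \sum_a \sum_b row_of f 0 (mxvec_index a b) *
    (mxvec X)^T (mxvec_index a b) 0.
  by rewrite mxE (reindex _ (curry_mxvec_bij _ _)) /= pair_bigA; apply: eq_bigr => -[a b] _.
rewrite exchange_big /=.
by apply: eq_bigr => b _; rewrite mxE; apply: eq_bigr => a _; rewrite !mxE mxvecE.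
Qed.

(** By Engel the powers of the radical end. The j-th derived group of [idcomp (unip 1)] lies in
    [unip j.+1], so it is solvable, and [unip 1] contains the exponentials of the real elements of
    the radical. *)
Lemma radical0 X : r X -> X = 0.
Proof.
have [k nk] : exists k, wnil r k.
  apply: engel; [exact: radical_subspace | | exact: radical_nil].
  by move=> Y Z rY [mZ _]; apply: radical_ideal.
have main (A : 'M[R]_n) : r (complexify A) -> A = 0.
  move=> rA; apply: (normal_solvable_exp (unip_closed 1)).
  - split=> [g []//|g h Mg [Mh hh]]; have ug := mxgroup_unit Mg; have Mgi := mxgroupV Mg.
    split=> [|a Z hZ]; first by do 2!apply: mxgroupM => //.
    have -> : (g *m h *m invmx g - 1%:M) *m Z = g *m ((h - 1%:M) *m (invmx g *m Z)).
      by rewrite !mulmxBl mulmxBr !mul1mx !mulmxA mulmxV // mul1mx.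
    by apply: ide_Ad => //; apply: hh; apply: ide_Ad.
  - exists k; apply/seteqP; split=> [g|_ ->]; last first.
      by case: k {nk} => [|k]; [exact: mxgroup1 | exact: derived1].
    have H j : iter j derived (mxset (idcomp (unip 1))) `<=` mxset (unip j.+1).
      elim: j => [|j IH]; first exact: idcomp_sub.
      apply: mem_derived => x y /IH hx /IH hy; have [Mxy hxy] := unip_comm hx hy.
      by split=> // a Z /hxy; apply: ide_le; rewrite leq_add2l addnS ltnS addSn ltnS leq_addr.
    move=> /H [_ /(_ 0%N 1%:M (ide_any _ _))]; rewrite mulmx1 add0n => /ideS/(ide_nil nk).
    by move=> /eqP; rewrite subr_eq0 => /eqP.
  - move=> c; have rcA : r (complexify (c *: A)).
      by rewrite /complexify map_mxZ; apply: subspaceZ => //; exact: radical_subspace.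
    have [mcA _] := rcA; split=> [|a Z hZ]; first exact: (lexp mcA).
    have [l [B [_ HB]]] := subspace_mx (ide_subspace r (a + 1)); apply/HB.
    rewrite submxE; apply/eqP/rowP => x; rewrite [RHS]mxE.
    pose f (Y : 'M[C]_n) := (mxvec (Y *m Z) *m cokermx B) 0 x.
    have lf d Y Y' : f (d *: Y + Y') = d * f Y + f Y'.
      by rewrite /f mulmxDl -scalemxAl linearP /= mulmxDl -scalemxAl !mxE.
    have [u Hu] := linear_tr lf; rewrite -/(f _) Hu.
    apply: mexp_ctr => j j0; rewrite -Hu /f.
    suff : ide r (a + 1) (complexify (c *: A) ^+ j *m Z).
      by move=> /HB; rewrite submxE => /eqP ->; rewrite mxE.
    case: j j0 => [//|j _]; rewrite addn1; elim: j => [|j IH]; first by rewrite expr1; apply: ide_mul.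
    by rewrite exprS -mulmxE -mulmxA; apply: ide_mul => //; apply: ideS.
move=> rX; have [A [B [rA rB ->]]] := real_span radical_subspace conj_radical rX.
by rewrite (main A) // (main B) // /complexify map_mx0 scaler0 addr0.
Qed.
End Radical.
End Semisimple.

(** * Complete reducibility *)

Section TraceForm.
Local Open Scope classical_set_scope.
Local Open Scope ring_scope.
Variables (C : numClosedFieldType) (N : nat).
Local Notation br X Y := (X *m Y - Y *m X).
Implicit Types U W K : set 'M[C]_N.

Lemma subspace_sum U (I : finType) (x : I -> 'M[C]_N) : subspace U -> (forall a, U (x a)) -> U (\sum_a x a).
Proof. by move=> sU Ux; elim/big_ind: _ => [|X Y|//]; [exact: sU.1 | exact: subspaceD]. Qed.

Lemma subspaceN U X : subspace U -> U X -> U (- X).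
Proof. by move=> sU UX; rewrite -scaleN1r; apply: subspaceZ. Qed.

Definition nondegenerate U : Prop := forall X, U X -> (forall Y, U Y -> \tr (X *m Y) = 0) -> X = 0.

Lemma dual_basis U : subspace U -> nondegenerate U -> exists k (x y : 'I_k -> 'M[C]_N),
  [/\ forall a, U (x a), forall a, U (y a), forall a b, \tr (x a *m y b) = (a == b)%:R,
      forall Z, U Z -> Z = \sum_a \tr (Z *m y a) *: x a
    & forall Z, U Z -> Z = \sum_a \tr (x a *m Z) *: y a].
Proof.
move=> sU nU; have [k [B [fB HB]]] := subspace_mx sU.
pose x a := vec_mx (row a B); pose G := \matrix_(a, b) \tr (x a *m x b).
have Ux a : U (x a) by apply/HB; rewrite vec_mxK row_sub.
have xE (w : 'rV_k) : vec_mx (w *m B) = \sum_a w 0 a *: x a.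
  by rewrite mulmx_sum_row linear_sum /=; apply: eq_bigr => a _; rewrite linearZ.
have UE Z : U Z -> exists w : 'rV_k, Z = \sum_a w 0 a *: x a.
  by move=> /HB /submxP [w E]; exists w; rewrite -xE -E mxvecK.
have trs (I : finType) (c : I -> C) (z : I -> 'M[C]_N) T : \tr ((\sum_a c a *: z a) *m T) = \sum_a c a * \tr (z a *m T).
  rewrite mulmx_suml raddf_sum /=; apply: eq_bigr => a _.
  by rewrite -scalemxAl mxtraceZ.
have Gu : G \in unitmx.
  rewrite -row_free_unit -kermx_eq0; apply/eqP/row_matrixP => i.
  set w := row i (kermx G); have wG : w *m G = 0 by apply/sub_kermxP; exact: row_sub.
  have Z0 : vec_mx (w *m B) = 0 :> 'M[C]_N.
    apply: nU => [|Y]; first by rewrite xE; apply: subspace_sum => // a; apply: subspaceZ.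
    move=> /UE [v ->]; rewrite mxtrace_mulC trs big1 // => b _.
    rewrite mxtrace_mulC xE trs; have -> : \sum_a w 0 a * \tr (x a *m x b) = (w *m G) 0 b.
      by rewrite [RHS]mxE; apply: eq_bigr => a _; congr (_ * _); rewrite [RHS]mxE.
    by rewrite wG mxE mulr0.
  have wB : w *m B = 0 by rewrite -[w *m B]vec_mxK Z0 linear0.
  by rewrite row0; apply: (row_free_inj fB); rewrite wB mul0mx.
pose y b := \sum_c invmx G c b *: x c.
have xy a b : \tr (x a *m y b) = (a == b)%:R.
  rewrite mxtrace_mulC trs; have -> : (a == b)%:R = (G *m invmx G) a b by rewrite mulmxV // mxE.
  by rewrite [RHS]mxE; apply: eq_bigr => c _; rewrite mulrC mxtrace_mulC [in RHS]mxE.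
have Uy b : U (y b) by apply: subspace_sum => // c; apply: subspaceZ.
have Zx Z : U Z -> Z = \sum_a \tr (Z *m y a) *: x a.
  move=> /UE [w ->]; apply: eq_bigr => a _; congr (_ *: _); rewrite trs (bigD1 a) //= xy eqxx mulr1.
  by rewrite big1 ?addr0 // => b ba; rewrite xy (negPf ba) mulr0.
exists k, x, y; split=> // Z UZ; apply/eqP; rewrite -subr_eq0; apply/eqP; apply: nU.
  by apply: subspaceB => //; apply: subspace_sum => // a; apply: subspaceZ.
move=> Y /Zx ->; rewrite mxtrace_mulC trs big1 // => b _.
have tb : \tr (x b *m (\sum_a \tr (x a *m Z) *: y a)) = \tr (x b *m Z).
  rewrite mxtrace_mulC trs (bigD1 b) //= [\tr (y b *m _)]mxtrace_mulC xy eqxx mulr1 big1 ?addr0 // => a ab.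
  by rewrite [\tr (y a *m _)]mxtrace_mulC xy eq_sym (negPf ab) mulr0.
by rewrite mulmxBr linearB /= tb subrr mulr0.
Qed.

Lemma dual_functional U (f : 'M[C]_N -> C) : subspace U -> nondegenerate U ->
  (forall c X Y, f (c *: X + Y) = c * f X + f Y) -> exists2 X, U X & forall Y, U Y -> f Y = \tr (X *m Y).
Proof.
move=> sU nU lf; have [k [x [y [Ux Uy _ _ E]]]] := dual_basis sU nU.
have f0 : f 0 = 0 by have := lf (-1) 0 0; rewrite scaler0 addr0 mulN1r addNr.
exists (\sum_a f (y a) *: x a); first by apply: subspace_sum => // a; apply: subspaceZ.
move=> Y UY; rewrite {1}(E Y UY) mulmx_suml raddf_sum /=.
elim/big_rec2: _ => [//|a u v _ <-]; rewrite lf; congr (_ + _).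
by rewrite -scalemxAl mxtraceZ mulrC.
Qed.

Lemma pmx_closed K A q : subspace K -> (forall a b, K a -> K b -> K (a *m b)) -> K A -> K (A *m pmx q A).
Proof.
move=> sK mK KA; apply: (pmx_ind (P := fun X => K (A *m X))) => [|c X Y KX KY|k].
- by rewrite mulmx0; exact: sK.1.
- by rewrite mulmxDr -scalemxAr; apply: sK.2.
- elim: k => [|k IH]; first by rewrite expr0 mulmx1.
  by rewrite exprS -mulmxE; apply: mK.
Qed.

(** A sum of products of dual basis vectors. Its trace is the dimension of U, hence not 0, and the
    invariance of the trace form makes it commute with U. *)
Lemma casimir U : subspace U -> (forall X Y, U X -> U Y -> U (br X Y)) -> nondegenerate U ->
  (exists2 X, U X & X != 0) -> exists A : 'M[C]_N, [/\ forall Z, U Z -> Z *m A = A *m Z, \tr A != 0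
    & forall K, subspace K -> U `<=` K -> (forall a b, K a -> K b -> K (a *m b)) -> K A].
Proof.
move=> sU bU nU [X0 UX0 nX0]; have [k [x [y [Ux Uy xy Ex Ey]]]] := dual_basis sU nU.
exists (\sum_a x a *m y a); split.
- move=> Z UZ; apply/eqP; rewrite -subr_eq0 mulmx_sumr mulmx_suml -sumrB.
  have -> : \sum_a (Z *m (x a *m y a) - x a *m y a *m Z) = \sum_a (br Z (x a)) *m y a + \sum_a x a *m (br Z (y a)).
    rewrite -big_split /=; apply: eq_bigr => a _.
    by rewrite mulmxBl mulmxBr !mulmxA addrA subrK.
  have -> : \sum_a (br Z (x a)) *m y a = \sum_a \sum_b \tr (br Z (x b) *m y a) *: (x a *m y b).
    rewrite exchange_big; apply: eq_bigr => b _ /=.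
    rewrite {1}(Ex _ (bU _ _ UZ (Ux b))) mulmx_suml; apply: eq_bigr => a _.
    by rewrite scalemxAl.
  rewrite -big_split /= big1 // => a _.
  rewrite (Ey _ (bU _ _ UZ (Uy a))) mulmx_sumr -big_split /= big1 // => b _.
  rewrite -scalemxAr -scalerDl -tr_bracket -opprB mulNmx linearN /= addNr.
  by rewrite scale0r.
- rewrite raddf_sum /= (eq_bigr (fun=> 1)) => [|a _]; last by rewrite xy eqxx.
  rewrite sumr_const card_ord pnatr_eq0; apply: contraNneq nX0 => k0.
  by rewrite (Ex _ UX0) big1 // => a; have := ltn_ord a; rewrite {2}k0.
- by move=> K sK UK mK; apply: subspace_sum => // a; apply: mK; apply: UK.
Qed.

(* The projection onto the part on which A is invertible, a polynomial in A without constant term. *)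
Lemma fitting (A : 'M[C]_N) : (forall k, A ^+ k != 0) -> exists q,
  let e := A *m pmx q A in e *m e = e /\ e != 0.
Proof.
move=> nA; have [h [c [cop E]]] : exists h c, coprimep ('X ^+ c.+1) h /\ char_poly A = 'X ^+ c * h.
  have [c [h /implyP nr E]] := multiplicity_XsubC (char_poly A) 0.
  exists h, c; rewrite subr0 in E; split; last by rewrite mulrC.
  rewrite coprimep_pexpl // coprimep_sym.
  have -> : 'X = 'X - 0%:P :> {poly C} by rewrite subr0.
  rewrite coprimep_XsubC.
  by apply: nr; apply: monic_neq0; exact: char_poly_monic.
have /Bezout_eq1_coprimepP [[u v] /= uv] := cop.
exists (u * 'X ^+ c); set q := u * 'X ^+ c.
have EA : A *m pmx q A = pmx (u * 'X^(c.+1)) A.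
  by rewrite -{1}[A]pmxX -pmxM /q exprS; congr (pmx _ _); ring.
rewrite /= EA; split.
  have -> : u * 'X^(c.+1) = 1 - v * h by rewrite -uv addrK.
  rewrite -pmxM; have -> : (1 - v * h) * (1 - v * h) = (1 - v * h) - (u * 'X * v) * char_poly A.
    have e1 : 1 - v * h = u * 'X^(c.+1) by rewrite -uv addrK.
    by rewrite mulrBl mul1r {2}e1 E exprS; ring.
  by rewrite pmxB [pmx (_ * char_poly A) A]pmxM pmx_char mulmx0 subr0.
apply: contraNneq (nA c) => e0; apply/eqP; rewrite -[A]pmxX -pmx_exp.
rewrite -['X ^+ c]mulr1 -uv mulrDr pmxD pmxM e0 mulmx0 add0r.
have -> : 'X^c * (v * h) = v * char_poly A by rewrite E; ring.
by rewrite pmxM pmx_char mulmx0.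
Qed.

(** On the image of f nothing changes; on its kernel both matrices act by 0, which is its own
    conjugate. *)
Lemma srel_corner (A B f : 'M[C]_N) : f *m f = f -> f *m A = A *m f -> f *m B = B *m f ->
  srel A B -> srel (A *m f) (B *m f).
Proof.
move=> ff fA fB S P P0 PL Pg.
suff H v : P (v *m f) /\ P (v *m (1%:M - f)).
  by move=> v; have [h1 h2] := H v; have := PL 1 _ _ h1 h2; rewrite scale1r -mulmxDr addrCA subrr addr0 mulmx1.
move: v; apply: S => [|c u v [u1 u2] [v1 v2]|v x k h hB].
- by rewrite !mul0mx.
- by split; rewrite mulmxDl -scalemxAl; apply: PL.
- split.
    apply: (Pg _ x k); last by rewrite -mulmxA -fB (mulmxA f) ff fB mulmxA hB scalemxAl.
    rewrite -(mul0mx _ f) -h -!mulmxA; congr (v *m _).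
    elim: (k) => [|l IH]; first by rewrite !expr0 mulmx1 mul1mx.
    rewrite exprSr -mulmxE mulmxA IH [in RHS]exprSr -mulmxE -!mulmxA; congr (_ *m _).
    by rewrite mulmxBr mulmxBl mul_mx_scalar mul_scalar_mx (mulmxA f) fA -mulmxA ff.
  have f0 : (1%:M - f) *m f = 0 by rewrite mulmxBl mul1mx ff subrr.
  apply: (Pg _ 0 1%N).
    rewrite expr1 scalar0_mx subr0 -fA mulmxA -[v *m _ *m f]mulmxA f0.
    by rewrite mulmx0 mul0mx.
  by rewrite conjC0 scale0r -fB mulmxA -[v *m _ *m f]mulmxA f0 mulmx0 mul0mx.
Qed.
End TraceForm.

(** * Lie algebras that contain the replicas of their elements *)

Section Reductive.
Local Open Scope classical_set_scope.
Local Open Scope ring_scope.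
Variables (C : numClosedFieldType) (n : nat) (m : set 'M[C]_n).
Local Notation br X Y := (X *m Y - Y *m X).
Hypothesis ms : subspace m.
Hypothesis mb : forall X Y, m X -> m Y -> m (br X Y).
Hypothesis mr : forall X q, m X -> conj_poly X q -> m (pmx q X).
Hypothesis mn : nondegenerate m.
Hypothesis mc : forall X, m X -> (forall Y, m Y -> X *m Y = Y *m X) -> X = 0.

Definition ideal (I : set 'M[C]_n) : Prop :=
  [/\ subspace I, I `<=` m & forall X Y, I X -> m Y -> I (br X Y)].

Definition span_br (A B : set 'M[C]_n) : set 'M[C]_n :=
  [set Z | forall P, subspace P -> (forall X Y, A X -> B Y -> P (br X Y)) -> P Z].

Lemma span_br_subspace A B : subspace (span_br A B).
Proof.
split=> [P sP _|c X Y hX hY P sP h]; first exact: sP.1.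
by apply: sP.2; [exact: hX | exact: hY].
Qed.

(** Let c be the span of the brackets of I with m. The replica of an element X of c commutes with I,
    so it is orthogonal to X, and X is nilpotent. By Engel long products in c vanish; hence c is
    orthogonal to m, so it is 0, and I is central. *)
Lemma abelian_ideal0 I : ideal I -> (forall X Y, I X -> I Y -> X *m Y = Y *m X) -> forall X, I X -> X = 0.
Proof.
move=> [sI Im bI] abI; pose c := span_br I m.
have cI Z : c Z -> I Z by move=> h; apply: h.
have sc : subspace c := span_br_subspace I m.
have bc X Y : c X -> m Y -> c (br X Y) by move=> cX mY P sP h; apply: h => //; apply: cI.
have nc X : c X -> X ^+ n = 0.
  move=> cX; have IX := cI _ cX; have mX := Im _ IX.
  have [q hq] := conj_poly_exists X; have rl := srel_rel (conj_poly_srel hq).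
  apply: (rel_tr0 rl); set Y := pmx q X in rl *.
  have Yc b : I b -> Y *m b = b *m Y by move=> Ib; apply: (rel_comm rl); apply: abI.
  apply: (cX [set Z | \tr (Z *m Y) = 0]) => [|b x Ib mx /=].
    by split=> [|a Z T /= h1 h2]; rewrite /= ?mul0mx ?mxtrace0 // mulmxDl -scalemxAl mxtraceD mxtraceZ h1 h2 mulr0 addr0.
  by rewrite -opprB mulNmx linearN /= tr_bracket Yc // subrr mulmx0 mxtrace0 oppr0.
have [k nk] := engel sc (fun X Y cX cY => bc X Y cX (Im _ (cI _ cY))) nc.
have c0 X : c X -> X = 0.
  move=> cX; apply: mn => [|Y mY]; first by apply: Im; apply: cI.
  apply: (nil_ideal_tr0 nk (y := Y) _ cX) => w cw; rewrite -opprB; apply: (subspaceN sc); exact: bc.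
move=> X IX; apply: mc => [|Y mY]; first exact: Im.
by apply/eqP; rewrite -subr_eq0; apply/eqP; apply: c0 => P sP h; apply: h.
Qed.

(** The radical of the restricted form is an ideal of m, and it is abelian because its brackets are
    orthogonal to all of m. *)
Lemma ideal_nondegenerate I : ideal I -> nondegenerate I.
Proof.
move=> [sI Im bI] X IX hX.
have bI' U V : m U -> I V -> I (br U V) by move=> mU IV; rewrite -opprB; apply: subspaceN => //; apply: bI.
apply: (@abelian_ideal0 [set Z | I Z /\ forall Y, I Y -> \tr (Z *m Y) = 0]) => //; last first.
  move=> U V [IU hU] [IV hV]; apply/eqP; rewrite -subr_eq0; apply/eqP; apply: mn => [|Z mZ].
    by apply: mb; apply: Im.
  by rewrite tr_bracket hU //; apply: bI.
split=> [|Z [/Im] //|U V [IU hU] mV].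
  split=> [|c U V [IU hU] [IV hV]]; first by split=> [|Y _]; [exact: sI.1 | rewrite mul0mx mxtrace0].
  split=> [|Z IZ]; first exact: sI.2.
  by rewrite mulmxDl -scalemxAl mxtraceD mxtraceZ hU // hV // mulr0 addr0.
by split=> [|Z IZ]; [exact: bI | rewrite tr_bracket hU //; apply: bI'].
Qed.

(** A functional that vanishes on the brackets is represented by some Z in I, which is then central
    in I; and the centre of I is an abelian ideal of m. *)
Lemma ideal_perfect I : ideal I -> perfect I.
Proof.
move=> iI; have [sI Im bI] := iI; have nI := ideal_nondegenerate iI.
have bII X Y : I X -> I Y -> I (br X Y) by move=> IX IY; apply: bI => //; apply: Im.
suff H X : I X -> span_br I I X by move=> P sP h X /H; apply.
move=> IX; have [k [B [_ HB]]] := subspace_mx (span_br_subspace I I); apply/HB.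
rewrite submxE; apply/eqP/rowP => j; rewrite [RHS]mxE.
pose f (Y : 'M[C]_n) := (mxvec Y *m cokermx B) 0 j.
have lf c Y Z : f (c *: Y + Z) = c * f Y + f Z.
  by rewrite /f linearP /= mulmxDl -scalemxAl !mxE.
have [Z IZ EZ] := dual_functional sI nI lf; rewrite -/(f X) EZ //.
have f0 Y : span_br I I Y -> f Y = 0 by move=> /HB; rewrite submxE /f => /eqP ->; rewrite mxE.
suff -> : Z = 0 by rewrite mul0mx mxtrace0.
apply: (@abelian_ideal0 [set X | I X /\ forall Y, I Y -> X *m Y = Y *m X]).
- split=> [|U [/Im] //|U V [IU cU] mV].
    split=> [|c U V [IU cU] [IV cV]]; first by split=> [|Y _]; [exact: sI.1 | rewrite mul0mx mulmx0].
    split=> [|W IW]; first exact: sI.2.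
    by rewrite mulmxDl mulmxDr -scalemxAl -scalemxAr cU // cV.
  split=> [|W IW]; first exact: bI.
  have IVW : I (br V W) by rewrite -opprB; apply: subspaceN => //; apply: bI.
  have := cU _ IVW; have := cU _ IW; rewrite !mulmxBl !mulmxBr !mulmxA => E1 E2.
  have E3 : U *m W *m V = W *m U *m V by rewrite E1.
  have E4 : V *m U *m W = V *m W *m U by rewrite -!mulmxA E1.
  rewrite E4 -E3; move: E2 => /(congr1 (fun T => T + U *m W *m V - V *m W *m U)).
  rewrite subrK => ->; rewrite E3 addrAC [X in X + _]addrAC subrr add0r addrC.
  by [].
- by move=> U V [IU cU] [IV _]; exact: cU.
- split=> // Y IY; apply/eqP; rewrite -subr_eq0; apply/eqP; apply: nI; first exact: bII.
  by move=> T IT; rewrite tr_bracket -EZ ?f0 //; [move=> P sP h; apply: h | apply: bII].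
Qed.

(** * Representations and the projection onto invariants *)

Section Reynolds.
Variable N : nat.
(** The last condition says that replicas act as replicas; it keeps the argument with conjugate
    eigenvalues available in the representation. *)
Definition repr_of (r : 'M[C]_n -> 'M[C]_N) : Prop :=
  [/\ forall c X Y, r (c *: X + Y) = c *: r X + r Y,
      forall X Y, m X -> m Y -> r (br X Y) = br (r X) (r Y)
    & forall X, m X -> exists2 Y, m Y & srel (r X) (r Y)].

Definition img (I : set 'M[C]_n) (r : 'M[C]_n -> 'M[C]_N) : set 'M[C]_N := [set Z | exists2 X, I X & Z = r X].

Lemma img_subspace I r : repr_of r -> subspace I -> subspace (img I r).
Proof.
move=> [lr _ _] sI; split.
  by exists 0; [exact: sI.1 | have := lr (-1) 0 0; rewrite scaler0 addr0 scaleN1r addNr].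
by move=> c _ _ [X IX ->] [Y IY ->]; exists (c *: X + Y); [exact: sI.2 | rewrite lr].
Qed.

(** The elements whose image is orthogonal to the whole image form an ideal. Its image consists of
    nilpotent matrices by the replica argument and is perfect, so it is 0 by Engel. *)
Lemma repr_nondegenerate r : repr_of r -> nondegenerate (img m r).
Proof.
move=> rr; have [lr brr Sr] := rr.
pose J := [set X | m X /\ forall Y, m Y -> \tr (r X *m r Y) = 0].
have r0 : r 0 = 0 by have := lr (-1) 0 0; rewrite scaler0 addr0 scaleN1r addNr.
have iJ : ideal J.
  split=> [|X [] //|X Y [mX hX] mY].
    split=> [|c X Y [mX hX] [mY hY]]; first by split=> [|Y _]; [exact: ms.1 | rewrite r0 mul0mx mxtrace0].
    split=> [|Z mZ]; first exact: ms.2.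
    by rewrite lr mulmxDl -scalemxAl mxtraceD mxtraceZ hX // hY // mulr0 addr0.
  split=> [|Z mZ]; first exact: mb.
  by rewrite brr // tr_bracket -brr // hX //; apply: mb.
have [sJ Jm bJ] := iJ; have pJ := ideal_perfect iJ.
have nJ Z : img J r Z -> Z ^+ N = 0.
  by move=> [X [mX hX] ->]; have [Y mY /srel_rel S] := Sr _ mX; apply: (rel_tr0 S); apply: hX.
have bU X Y : img J r X -> img J r Y -> img J r (br X Y).
  move=> [X' JX ->] [Y' JY ->]; exists (br X' Y'); first by apply: bJ => //; apply: Jm.
  by rewrite brr //; apply: Jm.
have [k nk] := engel (img_subspace rr sJ) bU nJ.
have pU : perfect (img J r).
  move=> P sP h _ [X JX ->]; apply: (pJ [set X | P (r X)]) => // [|U V JU JV].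
    by split=> [|c U V /= PU PV]; rewrite /= ?r0 ?lr; [exact: sP.1 | exact: sP.2].
  by rewrite /= brr; [apply: h; [exists U | exists V] | exact: Jm | exact: Jm].
move=> _ [X mX ->] hX; apply: (engel_perfect nk pU); exists X => //; split=> // Y mY.
by apply: hX; exists Y.
Qed.

(** The algebra without unit: if 1 - g belongs to it, then g fixes all vectors killed by the
    representation. *)
Definition gen_alg (r : 'M[C]_n -> 'M[C]_N) : set 'M[C]_N := [set e | forall K, subspace K ->
  (forall X, m X -> K (r X)) -> (forall a b, K a -> K b -> K (a *m b)) -> K e].

(** Induction on the rank of an idempotent f that commutes with the representation and has 1 - f in
    the algebra. Unless f kills the representation, the idempotent obtained from the Casimir element
    of its corner commutes with it, lies in the algebra, and can be subtracted from f. *)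
Lemma reynolds r : repr_of r -> exists2 g, gen_alg r (1%:M - g) & forall X, m X -> g *m r X = 0.
Proof.
move=> rr; have [lr brr Sr] := rr.
suff H k (f : 'M[C]_N) : (\rank f <= k)%N -> f *m f = f -> (forall X, m X -> f *m r X = r X *m f) ->
    gen_alg r (1%:M - f) -> exists2 g, gen_alg r (1%:M - g) & forall X, m X -> g *m r X = 0.
  apply: (H N 1%:M) => [||X _|]; first exact: rank_leq_row.
  - by rewrite mulmx1.
  - by rewrite mulmx1 mul1mx.
  - by rewrite subrr => K sK _ _; exact: sK.1.
elim: k f => [|k IH] f rf ff fc gf.
  move: rf; rewrite leqn0 mxrank_eq0 => /eqP f0; exists f => // X _.
  by rewrite f0 mul0mx.
pose r' X := r X *m f.
have rr' : repr_of r'.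
  split=> [c X Y|X Y mX mY|X mX]; first by rewrite /r' lr mulmxDl scalemxAl.
    rewrite /r' brr // mulmxBl -!mulmxA (mulmxA f) fc // (mulmxA f (r X)) fc //.
    by rewrite -!(mulmxA _ f f) ff !mulmxA.
  have [Y mY S] := Sr _ mX; exists Y => //; apply: srel_corner => //; exact: fc.
have [all0|] := pselect (forall X, m X -> r' X = 0).
  by exists f => // X mX; rewrite fc // -/(r' X) all0.
move=> /existsNP [X0 /not_implyP [mX0 /eqP nX0]].
have [_ brr' _] := rr'.
have [||A [cA trA genA]] := casimir (img_subspace rr' ms) _ (repr_nondegenerate rr').
- by move=> _ _ [X mX ->] [Y mY ->]; exists (br X Y); [exact: mb | rewrite brr'].
- by exists (r' X0) => //; exists X0.
have [q] : exists q, let e := A *m pmx q A in e *m e = e /\ e != 0.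
  by apply: fitting => l; apply: contraNneq trA => /nilp_tr0 ->.
set e := A *m pmx q A => /= -[ee en0].
have Ke K : subspace K -> (forall X, m X -> K (r' X)) -> (forall a b, K a -> K b -> K (a *m b)) -> K e.
  by move=> sK h mK; apply: pmx_closed => //; apply: genA => // _ [X mX ->]; apply: h.
have [fe ef] : f *m e = e /\ e *m f = e.
  apply: (Ke [set a | f *m a = a /\ a *m f = a]) => [|X mX|a b [fa af] [fb bf]] /=.
  - split=> [|c a b [fa af] [fb bf]] /=; first by rewrite mulmx0 mul0mx.
    by rewrite mulmxDr mulmxDl -scalemxAl -scalemxAr fa af fb bf.
  - by rewrite /r' mulmxA fc // -mulmxA ff.
  - by rewrite mulmxA fa -mulmxA bf.
have ce X : m X -> e *m r X = r X *m e.
  move=> mX; have h : A *m r' X = r' X *m A by rewrite cA //; exists X.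
  have h' : e *m r' X = r' X *m e.
    by rewrite /e -[LHS]mulmxA (pmx_conj q h) [LHS]mulmxA h -mulmxA.
  by rewrite -{1}ef -mulmxA fc // h' /r' -mulmxA fe.
apply: (IH (f - e)).
- have f'f' : (f - e) *m f = f - e by rewrite mulmxBl ff ef.
  rewrite -ltnS; apply: leq_trans rf; rewrite ltn_neqAle; apply/andP; split; last first.
    by rewrite -[f - e]f'f'; exact: mxrankM_maxr.
  have sub : (f - e <= f)%MS by rewrite -f'f' submxMl.
  have := mxrank_leqif_sup sub => -[_ ->]; apply/negP => /submxP [D ED].
  move: en0; rewrite -fe {1}ED -mulmxA mulmxBl fe ee subrr mulmx0 eqxx.
  by [].
- by rewrite mulmxBl !mulmxBr ff fe ef ee subrr subr0.
- by move=> X mX; rewrite mulmxBl mulmxBr fc // ce.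
- move=> K sK hK mK; rewrite opprB addrCA addrC; apply: subspaceD => //; first exact: gf.
  apply: Ke => // X mX; have -> : r' X = r X - r X *m (1%:M - f) by rewrite mulmxBr mulmx1 opprB addrC subrK.
  by apply: (subspaceB sK); [exact: hK | apply: (mK _ _ (hK _ mX)); exact: gf].
Qed.
End Reynolds.

(** The projection onto invariants is applied to the commutator representation on matrices. Brackets
    with [D X] map the matrices with image in B that are scalar on B to those that are zero on B. So
    averaging the projection [F0] changes it only by a matrix that is zero on B. *)
Lemma weyl N (D : 'M[C]_n -> 'M[C]_N) k (B : 'M[C]_(k, N)) :
  (forall c X Y, D (c *: X + Y) = c *: D X + D Y) -> (forall X Y, D (br X Y) = br (D X) (D Y)) ->
  (forall X Y, srel X Y -> srel (D X) (D Y)) -> (forall X, m X -> (B *m D X <= B)%MS) ->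
  exists P : 'M[C]_N, [/\ (P <= B)%MS, B *m P = B & forall X, m X -> P *m D X = D X *m P].
Proof.
move=> dl db ds hB; pose r (X : 'M[C]_n) : 'M[C]_(N * N) := adm (D X).
have rr : repr_of r.
  split=> [c X Y|X Y mX mY|X mX].
  - rewrite /r dl; apply/row_matrixP => a; rewrite !rowE.
    rewrite -[delta_mx 0 a]vec_mxK; move: (vec_mx _) => F.
    rewrite [RHS]mulmxDr -[X in _ = X + _]scalemxAr !admE -[c *: mxvec _]linearZ -[mxvec (_ *: _) + _]linearD /=; congr (mxvec _).
    rewrite mulmxDr mulmxDl -scalemxAr -scalemxAl scalerBr opprD.
    by rewrite addrACA.
  - rewrite /r db; apply/row_matrixP => a; rewrite !rowE.
    rewrite -[delta_mx 0 a]vec_mxK; move: (vec_mx _) => F.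
    rewrite [RHS]mulmxBr ![in RHS]mulmxA !admE -[mxvec _ - mxvec _]linearB /=; congr (mxvec _).
    move: (D X) (D Y) F => U V F.
    rewrite !mulmxBr !mulmxBl ?mulmxBr !mulmxA.
    move: (F *m U *m V) (F *m V *m U) (U *m V *m F) (V *m U *m F) (U *m F *m V) (V *m F *m U).
    by move=> x1 x2 x3 x4 x5 x6; apply/matrixP=> x y; rewrite !mxE; ring.
  - have [q hq] := conj_poly_exists X; exists (pmx q X); first exact: mr.
    have [q' hq' E] := srel_conj_poly (ds _ _ (conj_poly_srel hq)).
    by rewrite /r E; apply: adm_srel.
have [g gen0 g0] := reynolds rr.
pose F0 := pinvmx B *m B.
have BF0 : B *m F0 = B by rewrite mulmxA mulmxKpV.
pose T0 (F : 'M[C]_(N)) := (F <= B)%MS /\ B *m F = 0.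
pose T F := (F <= B)%MS /\ exists c, B *m F = c *: B.
have : T0 (vec_mx (mxvec F0 *m (1%:M - g))).
  apply: (gen0 [set e | forall F, T F -> T0 (vec_mx (mxvec F *m e))]).
  - split=> [F _|c a b ha hb F TF] /=; first by rewrite mulmx0 linear0; split; rewrite ?sub0mx ?mulmx0.
    have [[a1 a2] [b1 b2]] := (ha _ TF, hb _ TF).
    rewrite mulmxDr -scalemxAr linearP /=; split; first by rewrite addmx_sub // scalemx_sub.
    by rewrite mulmxDr -scalemxAr a2 b2 scaler0 addr0.
  - move=> X mX F [FB [c BF]]; rewrite admE mxvecK; have /submxP [E BE] := hB _ mX.
    split.
      apply: addmx_sub; first by apply: submx_trans (submxMr _ FB) (hB _ mX).
      by rewrite eqmx_opp; apply: submx_trans (submxMl _ _) FB.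
    by rewrite mulmxBr !mulmxA BF BE -mulmxA BF -scalemxAl -scalemxAr BE subrr.
  - move=> a b ha hb F TF /=; have [a1 a2] := ha _ TF.
    rewrite mulmxA -[mxvec F *m a]vec_mxK; apply: hb; split=> //.
    by exists 0; rewrite scale0r.
  - by split; [exact: submxMl | exists 1; rewrite scale1r].
rewrite mulmxBr mulmx1 linearB /= mxvecK; set F := vec_mx _ => -[F1 F2].
exists F; split.
- have -> : F = F0 - (F0 - F) by rewrite opprB addrC subrK.
  by rewrite addmx_sub ?submxMl // eqmx_opp.
- by move/eqP: F2; rewrite mulmxBr subr_eq0 BF0 => /eqP.
- move=> X mX; apply/eqP; rewrite -subr_eq0 -(inj_eq (can_inj mxvecK)) -admE linear0.
  by rewrite vec_mxK -mulmxA g0 // mulmx0.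
Qed.
End Reductive.

(** * Zariski dense subgroups *)

Section ClosurePart.
Section Zcl.
Local Open Scope classical_set_scope.
Local Open Scope ring_scope.
Variables (C : fieldType) (n : nat) (K : mxgroup C n).

Definition zcl : set 'M[C]_n := [set g | g \in unitmx /\
  forall f, polyf f -> (forall k, mxset K k -> f k = 0) -> f g = 0].

Lemma zcl_sub k : mxset K k -> zcl k.
Proof. by move=> Kk; split=> [|f _]; [exact: mxgroup_unit Kk | apply]. Qed.

Lemma zclM g h : zcl g -> zcl h -> zcl (g *m h).
Proof.
move=> [ug hg] [uh hh]; split=> [|f pf f0]; first by rewrite unitmx_mul ug.
have := hg (fun x => f (x *m h)); apply.
  by apply: polyf_ext (polyf_mull 1%:M h pf) => x; rewrite mul1mx.
move=> k Kk; have := hh (fun x => f (k *m x)); apply.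
  by apply: polyf_ext (polyf_mull k 1%:M pf) => x; rewrite mulmx1.
by move=> k' Kk'; apply: f0; apply: mxgroupM.
Qed.

(* The functionals vanishing on K form a space that is mapped injectively, hence onto itself. *)
Lemma zclV q : zcl q -> zcl (invmx q).
Proof.
move=> hq; have [uq _] := hq; split=> [|f /polyfP [d [Phi fE]] f0]; first by rewrite unitmx_inv.
pose W (Psi : 'M[C]_(tdim (1 + n) d)) := forall k, mxset K k -> \tr (Psi *m rho d k) = 0.
have [||r [B [fB HB]]] := @subspace_basis C _ [set v | W (vec_mx v)].
- by move=> k _; rewrite linear0 mul0mx mxtrace0.
- move=> c u v hu hv k Kk.
  by rewrite linearP mulmxDl -scalemxAl mxtraceD mxtraceZ hu // hv // mulr0 addr0.
have WB Psi : W Psi <-> (mxvec Psi <= B)%MS by rewrite -HB /= mxvecK.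
have Wq Psi : W Psi -> W (rho d q *m Psi).
  move=> hP k Kk; rewrite -mulmxA mxtrace_mulC -mulmxA -rhoM.
  have [_ h] := zclM (zcl_sub Kk) hq; apply: (h (fun g => \tr (Psi *m rho d g))) => //.
  by apply/polyfP; exists d, Psi.
pose A : 'M[C]_(tdim (1 + n) d * tdim (1 + n) d) := lin_mulmx (rho d q).
have uA : A \in unitmx.
  have : lin_mulmx (rho d (invmx q)) *m A = 1%:M by rewrite -lin_mulmxM -rhoM mulmxV // rho1 lin_mulmx1.
  by move/mulmx1_unit => [].
have BA : (B *m A <= B)%MS.
  apply/row_subP => i; rewrite row_mul -[row i B]vec_mxK mul_vec_lin /=; apply/WB/Wq/WB.
  by rewrite vec_mxK row_sub.
have AB : (B <= B *m A)%MS.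
  have [_ <-] := mxrank_leqif_sup BA; rewrite mxrankMfree //.
  by rewrite row_free_unit.
have : W Phi by move=> k Kk; rewrite -fE f0.
move=> /WB h; have /submxP [D ED] := submx_trans h AB.
pose Psi := vec_mx (D *m B).
have EP : Phi = rho d q *m Psi.
  by apply: (can_inj mxvecK); rewrite ED mulmxA -[D *m B]vec_mxK mul_vec_lin.
have WP : W Psi by apply/WB; rewrite vec_mxK submxMl.
rewrite fE EP -mulmxA mxtrace_mulC -mulmxA -rhoM mulVmx // .
by apply: WP; exact: mxgroup1.
Qed.

Lemma zclX q k : zcl q -> zcl (q ^+ k).
Proof.
move=> hq; elim: k => [|k IH]; first by rewrite expr0; apply: zcl_sub; exact: mxgroup1.
by rewrite exprS -mulmxE; apply: zclM.
Qed.
End Zcl.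

Local Open Scope classical_set_scope.
Local Open Scope ring_scope.

(** If x lay in no translate by a representative, a product of separating polynomials, one for each
    representative, would vanish on L but not at x. *)
Lemma zcl_cover (C : fieldType) n (L : mxgroup C n) : exists s : seq 'M[C]_n,
  forall x, x \in unitmx -> (forall f, polyf f -> (forall g, mxset L g -> f g = 0) -> f x = 0) ->
  exists2 r, r \in s & mxset L r /\ zcl (idcomp L) (invmx r *m x).
Proof.
have [s [sL sP]] := idcomp_reps L; exists s => x ux hx; apply: contrapT => no.
have [F [pF F0 Fx]] : exists F, [/\ polyf F,
    forall g, (exists2 r, r \in s & exists2 k, mxset (idcomp L) k & g = r *m k) -> F g = 0 & F x != 0].
  have : forall r, r \in s -> ~ zcl (idcomp L) (invmx r *m x).
    by move=> r rs h; apply: no; exists r => //; split=> //; apply: sL.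
  elim: s {no sP} sL => [|r s IH] sL nz.
    by exists (fun=> 1); split=> [|g [r]|]; [exact: polyf_const | | exact: oner_neq0].
  have [|t ts|F [pF F0 Fx]] := IH; first by move=> t ts; apply: sL; rewrite inE ts orbT.
    by apply: nz; rewrite inE ts orbT.
  have Lr := sL _ (mem_head _ _); have ur := mxgroup_unit Lr.
  have := nz _ (mem_head _ _) => /not_andP [[]|]; first by rewrite unitmx_mul unitmx_inv ux andbT.
  move=> /existsNP [f /not_implyP [pf /not_implyP [f0 /eqP fx]]].
  exists (fun g => f (invmx r *m g) * F g); split.
  - apply: polyfM => //; apply: polyf_ext (polyf_mull (invmx r) 1%:M pf) => g.
    by rewrite mulmx1.
  - move=> g [t]; rewrite inE => /orP [/eqP -> [k Kk ->]|ts [k Kk ->]].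
      by rewrite mulKmx // f0 // mul0r.
    by rewrite F0 ?mulr0 //; exists t => //; exists k.
  - by rewrite mulf_neq0.
by move: Fx; rewrite hx ?eqxx // => g /sP; apply: F0.
Qed.

Section DenseGroup.
Local Open Scope classical_set_scope.
Local Open Scope ring_scope.
Variables (R : realType) (n : nat) (M : mxgroup R[i] n) (Lam : mxgroup R n).
Hypothesis M_R : zclosed_over iotaR M.
Hypothesis Lam_sub : Lam `<=` rpoints M.
Hypothesis Lam_dense : zdense_real Lam M.
Local Notation L0 := (idcomp Lam).

(** A real polynomial defines a closed condition over the complex numbers, to which density
    applies. *)
Lemma dense_vanish f x : polyf f -> (forall g, mxset Lam g -> f g = 0) -> mxset (rpoints M) x -> f x = 0.
Proof.
move=> /polyfP [d [Phi fE]] f0 Mx; rewrite fE; apply: iotaR_inj.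
rewrite rmorph0 -complexify_tr map_mxM map_rho.
pose Z : set 'M[R[i]]_n := [set g | g \in unitmx /\ \tr (map_mx iotaR Phi *m rho d g) = 0].
have cZ : zclosed Z.
  apply/zclosed_polyf; exists [set fun g => \tr (map_mx iotaR Phi *m rho d g)]; split.
    by move=> _ ->; apply/polyfP; exists d, (map_mx iotaR Phi).
  apply/seteqP; split=> [g [ug h]|g [ug h]]; split=> //; first by move=> _ ->.
  exact: (h _ erefl).
have [_ dZ] := Lam_dense; have := dZ Z cZ.
have sub : complexify @` Lam `<=` Z.
  move=> _ [g Lg <-]; split; first by rewrite map_unitmx (mxgroup_unit Lg).
  by rewrite /complexify -map_rho -map_mxM complexify_tr -fE f0 // rmorph0.
move=> /(_ sub (complexify x)) []; first by exists x.
by [].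
Qed.

Lemma rpoints_cover : exists s : seq 'M[R]_n, forall x, mxset (rpoints M) x ->
  exists2 r, r \in s & mxset Lam r /\ zcl L0 (invmx r *m x).
Proof.
have [s hs] := zcl_cover Lam; exists s => x Mx; apply: hs => [|f pf f0].
  exact: mxgroup_unit Mx.
exact: dense_vanish Mx.
Qed.

(* Some power y ^+ k with 0 < k <= size s lies in the closure of L0. *)
Lemma mexp_zcl X : lie M (complexify X) -> zcl L0 (mexp X).
Proof.
move=> mX; have [s hs] := rpoints_cover; set r := size s.
pose y := mexp ((r`!)%:R^-1 *: X).
have My : mxset (rpoints M) y.
  by apply: (mexp_closed M_R); rewrite /complexify map_mxZ; apply: lieZ.
have Mk k : mxset (rpoints M) (y ^+ k).
  elim: k => [|k IH]; first by rewrite expr0; exact: mxgroup1.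
  by rewrite exprS -mulmxE; apply: mxgroupM.
have uy k : y ^+ k \in unitmx := mxgroup_unit (Mk k).
pose g (a : 'I_r.+1) : 'I_r.+1 := inord (index (s2val (cid2 (hs _ (Mk a)))) s).
have gP a : mxset Lam (nth 0 s (g a)) /\ zcl L0 (invmx (nth 0 s (g a)) *m y ^+ a) /\ (g a < r)%N.
  rewrite /g; case: cid2 => t ts [Lt zt] /=.
  have it : (index t s < r)%N by rewrite index_mem.
  by rewrite inordK ?nth_index // ltnS ltnW.
(* Two of the r + 1 exponents 0, ..., r fall into the same coset, and their difference divides
   r!. *)
have : ~~ injectiveb g.
  apply/negP => /injectiveP inj.
  pose g' a : 'I_r := Ordinal (proj2 (proj2 (gP a))).
  have := @leq_card _ _ g'; rewrite !card_ord ltnn => h; suff: false by [].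
  by apply: h => a b /(congr1 val) /= e; apply: inj; apply: val_inj.
move=> /injectivePn [a [b ab gab]].
wlog lt : a b ab gab / (a < b)%N.
  move=> h; have := ab; rewrite -val_eqE /= neq_ltn => /orP [lt|lt]; first exact: (h a b).
  by apply: (h b a) => //; rewrite eq_sym.
have [Lt [za _]] := gP a; have [_ [zb _]] := gP b; rewrite -gab in zb.
set t := nth 0 s (g a) in Lt za zb; have ut := mxgroup_unit Lt.
have zk : zcl L0 (y ^+ (b - a)).
  have := zclM (zclV za) zb; rewrite -{1}(subnKC (ltnW lt)) exprD -mulmxE (mulmxA (invmx t)) mulKmx //.
  by rewrite unitmx_mul unitmx_inv ut uy.
rewrite (@mexp_root _ _ X r`!) ?fact_gt0 // -/y.
have /dvdnP [k ->] : ((b - a) %| r`!)%N.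
  by rewrite dvdn_fact // subn_gt0 lt /= (leq_trans (leq_subr _ _)) // -ltnS.
by rewrite mulnC exprM; apply: zclX.
Qed.

Lemma tr_nrm m (A : 'M[R]_m) : `|\tr A| <= nrm A.
Proof.
rewrite /mxtrace; apply: le_trans (ler_norm_sum _ _ _) _; rewrite /nrm.
by apply: ler_sum => i _; rewrite (bigD1 i) //= lerDl; apply: sumr_ge0.
Qed.

(** The function s -> tr (Phi rho (exp (s X))) vanishes identically. Its expansion to second order
    at s = 2^-j shows that the derivative at 0 vanishes. *)
Lemma lie_dense X : lie M (complexify X) -> lie L0 X.
Proof.
move=> mX d Phi v; set Y := drho d X.
have t0 s : \tr (Phi *m mexp (s *: Y)) = 0.
  have -> : mexp (s *: Y) = rho d (mexp (s *: X)).
    rewrite -drhoZ; apply/esym/mexp_hom; [exact: Jet_rho | exact: rho1 | exact: rhoM | exact: drhoZ].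
  have [_ h] : zcl L0 (mexp (s *: X)).
    by apply: mexp_zcl; rewrite /complexify map_mxZ; apply: lieZ.
  by apply: (h (fun g => \tr (Phi *m rho d g))) => //; apply/polyfP; exists d, Phi.
have t1 : \tr Phi = 0 by have := v _ (mxgroup1 L0); rewrite rho1 mulmx1.
have [c c0 hc] := mexp_second Y.
apply: (@sconv_unique R (fun=> \tr (Phi *m Y))); first exact: sconv_const.
exists (nrm Phi * c) => j; rewrite subr0.
have hj : `|half R j| <= 1 by rewrite ger0_norm ?half_ge0 ?half_le1.
have := le_trans (tr_nrm (Phi *m (mexp (half R j *: Y) - 1%:M - half R j *: Y))) (nrmM _ _).
rewrite !mulmxBr mulmx1 -scalemxAr !linearB /= linearZ /= t0 t1 !sub0r oppr0 add0r normrN.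
rewrite normrM ger0_norm ?half_ge0 // => h.
rewrite -(ler_pM2l (half_gt0 R j)); apply: le_trans h _.

rewrite (_ : half R j * (nrm Phi * c * half R j) = nrm Phi * (c * half R j ^+ 2)); last by ring.
by apply: ler_wpM2l; [exact: nrm_ge0 | exact: hc].
Qed.

Lemma lie_complexify X : lie L0 X -> lie M (complexify X).
Proof.
move=> lX d Phi v; have [A [B E]] := re_im_mx Phi.
have AB g : mxset L0 g -> \tr (A *m rho d g) = 0 /\ \tr (B *m rho d g) = 0.
  move=> /idcomp_sub /Lam_sub Mg; have := v _ Mg.
  rewrite E mulmxDl -scalemxAl mxtraceD mxtraceZ /complexify -map_rho -!map_mxM !complexify_tr.
  exact: re_im0.
have trA : \tr (A *m drho d X) = 0 by apply: lX => g /AB [].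
have trB : \tr (B *m drho d X) = 0 by apply: lX => g /AB [].
rewrite E mulmxDl -scalemxAl mxtraceD mxtraceZ /complexify -map_drho -!map_mxM !complexify_tr trA trB.
by rewrite !rmorph0 mulr0 addr0.
Qed.
End DenseGroup.
End ClosurePart.

(** * Decomposition into irreducible summands *)

Section RepsPart.
Local Open Scope classical_set_scope.
Local Open Scope ring_scope.

Section Tangent.
Variables (R : realType) (n : nat).

(** The two linear maps differ by a quadratic error near 0; X is scaled into the unit ball and the
    dyadic factor tends to 0. *)
Lemma jet_unique (f : 'M[R]_n -> R) l l' : (forall c X Y, l (c *: X + Y) = c * l X + l Y) ->
  (forall c X Y, l' (c *: X + Y) = c * l' X + l' Y) -> jet f l -> jet f l' -> l =1 l'.
Proof.
move=> hl hl' /jet_bound [c c0 hc] /jet_bound [c' c'0 hc'] X.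
have l0 : l 0 = 0 by have := hl (-1) 0 0; rewrite scaler0 addr0 mulN1r addNr.
have l'0 : l' 0 = 0 by have := hl' (-1) 0 0; rewrite scaler0 addr0 mulN1r addNr.
have lZ a Y : l (a *: Y) = a * l Y by rewrite -[a *: Y]addr0 hl l0 addr0.
have l'Z a Y : l' (a *: Y) = a * l' Y by rewrite -[a *: Y]addr0 hl' l'0 addr0.
have [Y [a [a0 Y1 ->]]] : exists (Y : 'M[R]_n) (a : R), [/\ 0 < a, nrm Y <= 1 & X = a *: Y].
  exists ((1 + nrm X)^-1 *: X), (1 + nrm X); have p : 0 < 1 + nrm X by rewrite ltr_pwDl ?nrm_ge0.
  split=> //; last by rewrite scalerA mulfV ?scale1r // gt_eqF.
  rewrite nrmZ ger0_norm ?invr_ge0; last exact: ltW.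
  rewrite ler_pdivrMl // mulr1 lerDr.
  exact: ler01.
rewrite lZ l'Z; congr (_ * _).
apply: (@sconv_unique R (fun=> l Y)); first exact: sconv_const.
exists (c + c') => j; rewrite -(ler_pM2l (half_gt0 R j)).
have nj : nrm (half R j *: Y) <= half R j.
  by rewrite nrmZ ger0_norm ?half_ge0 // ler_piMr ?half_ge0.
have n2 : nrm (half R j *: Y) ^+ 2 <= half R j ^+ 2 by rewrite ler_sqr // nnegrE ?nrm_ge0 ?half_ge0.
have h1 := hc _ (le_trans nj (half_le1 R j)); have h2 := hc' _ (le_trans nj (half_le1 R j)).
have e : half R j * `|l Y - l' Y| = `|half R j * l Y - half R j * l' Y|.
  by rewrite -mulrBr normrM ger0_norm ?half_ge0.
rewrite e -lZ -l'Z.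
rewrite (_ : half R j * ((c + c') * half R j) = c * half R j ^+ 2 + c' * half R j ^+ 2); last by ring.
set u := f _ - f _ in h1 h2.
rewrite (_ : l _ - l' _ = (u - l' (half R j *: Y)) - (u - l (half R j *: Y))); last by ring.
apply: le_trans (ler_normB _ _) _; rewrite addrC; apply: lerD.
  by apply: le_trans h1 _; apply: ler_wpM2l.
by apply: le_trans h2 _; apply: ler_wpM2l.
Qed.

Lemma lie_vanish (H : mxgroup R n) f l X : (forall c X Y, l (c *: X + Y) = c * l X + l Y) -> jet f l ->
  (forall g, mxset H g -> f g = 0) -> lie H X -> l X = 0.
Proof.
move=> hl jl f0 lX; have [pf _] := jl; have [d [Phi fE]] := (polyfP f).1 pf.
have jr : jet f (fun X => \tr (Phi *m drho d X)).
  by apply: (jet_ext (fun g => esym (fE g)) (frefl _)); apply: jet_tr; exact: Jet_rho.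
rewrite (jet_unique hl _ jl jr) => [|c Y Z]; last exact: drho_lin.
by apply: lX => g Hg; rewrite -fE f0.
Qed.

(** Stability is the vanishing of certain matrix coefficients of F, whose differentials vanish on
    the Lie algebra. *)
Lemma stable_lie (H : mxgroup R n) N (F L : 'M[R]_n -> 'M[R]_N) k (B : 'M[R]_(k, N)) : Jet F L ->
  (forall c X Y, L (c *: X + Y) = c *: L X + L Y) ->
  (forall g, mxset H g -> (B *m F g <= B)%MS) -> forall X, lie H X -> (B *m L X <= B)%MS.
Proof.
move=> jF hL st X lX; rewrite submxE; apply/eqP/matrixP => i j; rewrite [RHS]mxE.
pose Phi := col j (cokermx B) *m row i B.
have E (Y : 'M[R]_N) : (B *m Y *m cokermx B) i j = \tr (Phi *m Y).
  rewrite /Phi -(mulmxA (col j _)) [RHS]mxtrace_mulC /mxtrace big_ord1 -row_mul [LHS]mxE [RHS]mxE.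
  by apply: eq_bigr => x _; congr (_ * _); rewrite [RHS]mxE.
have jr := jet_tr Phi jF.
rewrite E; apply: (lie_vanish _ jr _ lX) => [c Y Z|g /st].
  by rewrite hL mulmxDr -scalemxAr mxtraceD mxtraceZ.
by rewrite submxE -E => /eqP ->; rewrite mxE.
Qed.
End Tangent.

Lemma eigen_lin (C : fieldType) (V : lmodType C) N (L : V -> 'M[C]_N) (w : 'rV[C]_N) c X Y :
  (forall c X Y, L (c *: X + Y) = c *: L X + L Y) -> (exists a, w *m L X = a *: w) ->
  (exists a, w *m L Y = a *: w) -> exists a, w *m L (c *: X + Y) = a *: w.
Proof.
move=> hL [a ha] [b hb]; exists (c * a + b).
by rewrite hL mulmxDr -scalemxAr ha hb scalerA scalerDl.
Qed.

(** The operators L X and L Y act on w by scalars, so their commutator kills w. *)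
Lemma perfect_eigen (C : numClosedFieldType) n N (m : set 'M[C]_n) (L : 'M[C]_n -> 'M[C]_N) (w : 'rV[C]_N) :
  perfect m -> (forall c X Y, L (c *: X + Y) = c *: L X + L Y) ->
  (forall X Y, L (X *m Y - Y *m X) = L X *m L Y - L Y *m L X) ->
  (forall X, m X -> exists a, w *m L X = a *: w) -> forall X, m X -> w *m L X = 0.
Proof.
move=> pm hL bL eig; apply: (pm [set X | w *m L X = 0]) => [|X Y mX mY /=].
  split=> [/=|c X Y /= hX hY]; last by rewrite hL mulmxDr -scalemxAr hX hY scaler0 addr0.
  by have := hL (-1) 0 0; rewrite scaler0 addr0 scaleN1r addNr => ->; rewrite mulmx0.
have [a ha] := eig _ mX; have [b hb] := eig _ mY.
by rewrite bL mulmxBr !mulmxA ha hb -!scalemxAl ha hb !scalerA mulrC subrr.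
Qed.

(** * Semisimplicity of the real tensor representations *)

Section Reps.
Variables (R : realType) (n : nat) (M : mxgroup R[i] n) (Lam : mxgroup R n).
Hypothesis M_R : zclosed_over iotaR M.
Hypothesis M_ss : semisimple M.
Hypothesis Lam_sub : Lam `<=` rpoints M.
Hypothesis Lam_dense : zdense_real Lam M.
Local Notation L0 := (idcomp Lam).
Variable d : nat.
Local Notation N := (tdim (1 + n) d).
Local Notation T g := (rho d g : 'M[R]_N).

Lemma drhoP (A : comNzRingType) (c : A) (X Y : 'M[A]_n) : drho d (c *: X + Y) = c *: drho d X + drho d Y.
Proof. by rewrite /drho -dtens_is_linear scale_block_mx add_block_mx !scaler0 !addr0. Qed.

Lemma mn_M : nondegenerate (lie M).
Proof. by move=> X mX hX; apply: (radical0 M_R M_ss erefl); split. Qed.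

Lemma lie_span (P : 'M[R[i]]_n -> Prop) : (forall c X Y, P X -> P Y -> P (c *: X + Y)) ->
  (forall X : 'M[R]_n, lie L0 X -> P (complexify X)) -> forall X, lie M X -> P X.
Proof.
move=> PL PR X mX; have [A [B [mA mB ->]]] := real_span (lie_subspace M) (conj_lie M_R) mX.
rewrite addrC; apply: (PL); apply: PR; exact: (lie_dense M_R).
Qed.

Lemma re_im_mx0 p q (A B : 'M[R]_(p, q)) : map_mx iotaR A + 'i *: map_mx iotaR B = 0 -> A = 0.
Proof.
by move=> /matrixP h; apply/matrixP => a b; have := h a b; rewrite !mxE => /re_im0 [].
Qed.

(** Stability passes to the Lie algebra and to its complexification, where an equivariant projection
    exists. Its real part is again a projection and commutes with the real Lie algebra, hence with
    the irreducible group [L0]. *)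
Lemma reducible k (B : 'M[R]_(k, N)) : (forall g, mxset L0 g -> (B *m T g <= B)%MS) ->
  exists P : 'M[R]_N, [/\ (P <= B)%MS, B *m P = B & forall g, mxset L0 g -> P *m T g = T g *m P].
Proof.
move=> st.
have st1 : forall X, lie L0 X -> (B *m drho d X <= B)%MS.
  by apply: stable_lie st; [exact: Jet_rho | exact: drhoP].
pose Bc := map_mx iotaR B : 'M[R[i]]_(k, N).
have st2 X : lie M X -> (Bc *m drho d X <= Bc)%MS.
  move: X; apply: lie_span => [c X Y hX hY|X /st1 h].
    rewrite drhoP mulmxDr -scalemxAr; apply: addmx_sub; last exact: hY.
    exact: scalemx_sub hX.
  by rewrite /complexify -map_drho -map_mxM map_submx.
have [|P [P1 P2 P3]] := weyl (lie_subspace M) (@lie_bracket _ _ M) (@lie_replica _ _ M) mn_M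
  (lie_centerless M_R M_ss erefl) (@drhoP _) (@drho_bracket _ _ _) _ st2.
  by move=> X Y S; apply: srel_dtens; apply: srel_block.
have [A1 [A2 EP]] := re_im_mx P; exists A1; split.
- move: P1; rewrite !submxE EP -map_cokermx mulmxDl -scalemxAl -!map_mxM => /eqP /re_im_mx0 ->.
  by [].
- apply/eqP; rewrite -subr_eq0; apply/eqP; apply: (@re_im_mx0 _ _ _ (B *m A2)).
  move/eqP: P2; rewrite EP mulmxDr -scalemxAr /Bc -!map_mxM -subr_eq0 addrAC -map_mxB => /eqP <-.
  by [].
- apply: (@lie_commute R n L0 (@irr_idcomp _ _ Lam) N (fun g => T g) (fun X => drho d X));
    [exact: Jet_rho | exact: rho1 | exact: rhoM | exact: drhoP|] => X lX.
  have := P3 _ (lie_complexify Lam_sub lX); rewrite /complexify -map_drho EP.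
  rewrite mulmxDl mulmxDr -scalemxAl -scalemxAr -!map_mxM => /eqP.
  rewrite -subr_eq0 opprD addrACA -map_mxB -scalerBr -map_mxB => /eqP /re_im_mx0 /eqP.
  by rewrite subr_eq0 => /eqP.
Qed.

(** The wedge of a basis of the subspace spans an invariant line. The perfect Lie algebra of M acts
    on it by 0, so [L0] fixes the wedge, which it multiplies by the determinant. *)
Lemma stable_det1 k (B : 'M[R]_(k, N)) : row_free B -> (forall g, mxset L0 g -> (B *m T g <= B)%MS) ->
  forall g, mxset L0 g -> \det (B *m T g *m pinvmx B) = 1.
Proof.
move=> fB st; pose w := minors B; pose F (g : 'M[R]_n) := tpow k (T g).
pose L (X : 'M[R]_n) := dtens k (drho d X).
have jF : Jet F L by apply: Jet_tpow; [exact: rho1 | exact: Jet_rho].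
have wF g : mxset L0 g -> w *m F g = \det (B *m T g *m pinvmx B) *: w.
  by move=> /st h; rewrite /w /F -minors_tpow -minorsMl mulmxKpV.
have LL (A : comNzRingType) c (X Y : 'M[A]_n) : dtens k (drho d (c *: X + Y)) = c *: dtens k (drho d X) + dtens k (drho d Y).
  by rewrite drhoP dtens_is_linear.
have w1 X : lie L0 X -> (w *m L X <= w)%MS.
  apply: (stable_lie jF (LL _)) => g /wF ->; exact: scalemx_sub.
pose wc := map_mx iotaR w.
have mapL X : map_mx iotaR (L X) = dtens k (drho d (complexify X)).
  rewrite /L /complexify -map_drho; apply/matrixP => a b; rewrite !mxE rmorph_sum; apply: eq_bigr => l _.
  rewrite rmorphM rmorph_prod; congr (_ * _); first by rewrite [RHS]mxE.
  by apply: eq_bigr => j _; rewrite rmorph_nat.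
have Lb (X Y : 'M[R[i]]_n) : dtens k (drho d (X *m Y - Y *m X)) = dtens k (drho d X) *m dtens k (drho d Y) -
    dtens k (drho d Y) *m dtens k (drho d X) by rewrite drho_bracket; exact: dtens_bracket.
have w2 X : lie M X -> exists a, wc *m dtens k (drho d X) = a *: wc.
  move: X; apply: lie_span => [c X Y hX hY|X /w1 /sub_rVP [a ha]].
    exact: (@eigen_lin _ _ _ (fun X => dtens k (drho d X)) wc c X Y (LL _) hX hY).
  by exists (iotaR a); rewrite -mapL -map_mxM ha map_mxZ.
have pm : perfect (lie M).
  apply: (ideal_perfect (@lie_bracket _ _ M) mn_M (lie_centerless M_R M_ss erefl)).
  by split; [exact: lie_subspace | move=> Z hZ; exact: hZ | exact: lie_bracket].
have w3 := perfect_eigen pm (LL _) Lb w2.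
have fix1 : forall g, mxset L0 g -> w *m F g = w.
  apply: (@lie_fixed R n L0 (@irr_idcomp _ _ Lam) _ F L w jF) => [||c X Y|X lX].
  - by rewrite /F rho1 tpow1.
  - by move=> x y; rewrite /F rhoM tpowM.
  - exact: LL.
  - have := w3 _ (lie_complexify Lam_sub lX); rewrite -mapL -map_mxM => /eqP.
    by rewrite map_mx_eq0 => /eqP.
move=> g Lg; have := wF g Lg; rewrite fix1 // => E.
have [f nf] := row_free_minor fB.
have : minor B f = \det (B *m T g *m pinvmx B) * minor B f.
  have [a <-] : exists a, w 0 a = minor B f by rewrite minors_minor; eexists.
  by rewrite {1}E mxE.
by move=> /(congr1 (fun x => x / minor B f)); rewrite mulfK // mulfV.
Qed.

Definition equiv_mx (e : 'M[R]_N) : Prop := forall g, mxset L0 g -> e *m T g = T g *m e.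

Definition irred_idem (e : 'M[R]_N) : Prop := [/\ e *m e = e, equiv_mx e, e != 0 &
  forall U : 'M[R]_N, (U <= e)%MS -> (forall g, mxset L0 g -> (U *m T g <= U)%MS) ->
    U = 0 \/ (e <= U)%MS].

(** Induction on the rank: for a proper stable subspace U of the image and an equivariant projection
    P onto U, the idempotents [e *m P] and its complement in e have smaller rank. *)
Lemma idem_decomp (e : 'M[R]_N) : e *m e = e -> equiv_mx e -> exists s : seq 'M[R]_N,
  (forall a, a \in s -> irred_idem a) /\ \sum_(a <- s) a = e.
Proof.
have [k] := ubnP (\rank e); elim: k e => [//|k IH] e; rewrite ltnS => re ee ce.
have [e0|en0] := eqVneq e 0; first by exists [::]; rewrite big_nil.
have [irr_e|] := pselect (forall U : 'M[R]_N, (U <= e)%MS ->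
    (forall g, mxset L0 g -> (U *m T g <= U)%MS) -> U = 0 \/ (e <= U)%MS).
  by exists [:: e]; rewrite big_seq1; split=> // a; rewrite inE => /eqP ->.
move=> /existsNP [U /not_implyP [Ue /not_implyP [stU /not_orP [U0 eU]]]].
have [P [PU UP cP]] := reducible stU.
have U_e : U *m e = U by have /submxP [D ->] := Ue; rewrite -mulmxA ee.
have Pe : P *m e = P by have /submxP [D ->] := PU; rewrite -mulmxA U_e.
have PP : P *m P = P by have /submxP [D ED] := PU; rewrite {1}ED -mulmxA UP -ED.
pose f := e *m P.
have ff : f *m f = f by rewrite /f -mulmxA (mulmxA P) Pe PP.
have fe : f *m e = f by rewrite /f -mulmxA Pe.
have ef : e *m f = f by rewrite /f mulmxA ee.
have cf : equiv_mx f by move=> g Lg; rewrite /f -mulmxA cP // mulmxA ce // mulmxA.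
have fU : (f <= U)%MS by apply: submx_trans (submxMl _ _) PU.
have Uf : U *m f = U by rewrite /f mulmxA U_e.
have rk (a : 'M[R]_N) : (a <= e)%MS -> ~ (e <= a)%MS -> (\rank a < k)%N.
  move=> ae nea; apply: leq_trans re; rewrite ltn_neqAle mxrankS // andbT.
  by have := mxrank_leqif_sup ae => -[_ ->]; apply/negP.
have fsub : (f <= e)%MS by rewrite -fe submxMl.
have [|s1 [h1 E1]] := IH f _ ff cf; first by apply: rk => // h; apply: eU; exact: submx_trans fU.
have gg : (e - f) *m (e - f) = e - f by rewrite mulmxBl !mulmxBr ee ef fe ff subrr subr0.
have gsub : (e - f <= e)%MS by apply: addmx_sub => //; rewrite eqmx_opp.
have [||s2 [h2 E2]] := IH (e - f) _ gg.
- apply: rk => // h; apply: U0; have /submxP [D ED] := submx_trans Ue h.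
  have : U *m (e - f) = U by rewrite ED -mulmxA gg.
  by rewrite mulmxBr U_e Uf subrr => <-.
- by move=> g Lg; rewrite mulmxBl mulmxBr ce // cf.
exists (s1 ++ s2); split=> [a|]; last by rewrite big_cat E1 E2 /= addrC subrK.
by rewrite mem_cat => /orP [/h1|/h2].
Qed.

Lemma idem_lower (a : 'M[R]_N) : a *m a = a -> equiv_mx a -> a != 0 ->
  exists2 c : R, 0 < c & forall g, mxset L0 g -> c <= nrm (a *m T g).
Proof.
move=> aa ca a0; pose B := row_base a; pose k := \rank a.
have fB : row_free B := row_base_free a.
have aB : (B :=: a)%MS := eq_row_base a.
have Ba : B *m a = B.
  have /submxP [D ED] : (B <= a)%MS by rewrite aB submx_refl.
  by rewrite ED -mulmxA aa.
have st g : mxset L0 g -> (B *m T g <= B)%MS.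
  by move=> Lg; rewrite -{1}Ba -mulmxA ca // mulmxA aB submxMl.
pose q := nrm B * nrm (pinvmx B).
have q0 : 0 <= q by rewrite mulr_ge0 ?nrm_ge0.
have f0 : 0 < (k`!%:R : R) by rewrite ltr0n fact_gt0.
exists ((k`!%:R * (1 + q))^-1) => [|g Lg]; first by rewrite invr_gt0 mulr_gt0 // ltr_pwDl.
pose D := B *m T g *m pinvmx B.
have ED : D = B *m (a *m T g) *m pinvmx B by rewrite /D -{1}Ba !mulmxA.
set x := nrm (a *m T g).
have hD : nrm D <= q * x.
  rewrite ED (_ : q * x = nrm B * x * nrm (pinvmx B)); last by rewrite /q; ring.
  by apply: le_trans (nrmM _ _) _; rewrite ler_wpM2r ?nrm_ge0 // nrmM.
have := det_bound (fun i j => nrm_entry D i j); rewrite stable_det1 // normr1 => h.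
have k0 : (0 < k)%N by rewrite lt0n mxrank_eq0.
have h1 : 1 <= k`!%:R * (q * x).
  have [D1|D1] := lerP 1 (nrm D).
    apply: le_trans (le_trans D1 hD) _; rewrite ler_peMl ?mulr_ge0 ?nrm_ge0 //.
    by rewrite ler1n fact_gt0.
  apply: le_trans h _; apply: ler_wpM2l; first exact: ltW.
  apply: le_trans hD.
  have hx (y : R) j : (0 < j)%N -> 0 <= y -> y < 1 -> y ^+ j <= y.
    by case: j => // j _ y0 y1; rewrite exprS ler_piMr // exprn_ile1 // ltW.
  by apply: hx => //; exact: nrm_ge0.
rewrite -[leLHS]mul1r ler_pdivrMr ?mulr_gt0 ?ltr_pwDl //; apply: le_trans h1 _.
have x0 : 0 <= x := nrm_ge0 _.
rewrite [leRHS]mulrCA; apply: ler_wpM2l; first exact: ltW.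
by rewrite mulrC ler_wpM2l // lerDr.
Qed.
End Reps.
End RepsPart.

(** * Bounded summands *)

Section FormPart.
Local Open Scope classical_set_scope.
Local Open Scope ring_scope.

Section Frobenius.
Variables (R : realType) (p q : nat).
Implicit Types A B : 'M[R]_(p, q).

Definition frob A : R := \sum_i \sum_j A i j ^+ 2.

Lemma frob_ge0 A : 0 <= frob A.
Proof. by apply: sumr_ge0 => i _; apply: sumr_ge0 => j _; exact: sqr_ge0. Qed.

Lemma frob_entry A i j : A i j ^+ 2 <= frob A.
Proof.
rewrite /frob (bigD1 i) //= (bigD1 j) //= -addrA lerDl addr_ge0 //.
  by apply: sumr_ge0 => k _; exact: sqr_ge0.
by apply: sumr_ge0 => k _; apply: sumr_ge0 => l _; exact: sqr_ge0.
Qed.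

Lemma frob_le A : frob A <= nrm A ^+ 2.
Proof.
rewrite expr2 /frob; apply: (@le_trans _ _ (\sum_i \sum_j nrm A * `|A i j|)).
  apply: ler_sum => i _; apply: ler_sum => j _.
  by rewrite -real_normK ?num_real // expr2 ler_wpM2r // nrm_entry.
by rewrite /nrm mulr_sumr le_eqVlt; apply/orP; left; apply/eqP/eq_bigr => i _; rewrite mulr_sumr.
Qed.

Lemma nrm_frob A : nrm A <= (p * q)%:R * Num.sqrt (frob A).
Proof.
apply: nrm_le => i j; rewrite -sqrtr_sqr ler_wsqrtr //.
exact: frob_entry.
Qed.

Lemma frob_mid A B : frob (2^-1 *: (A + B)) = 2^-1 * frob A + 2^-1 * frob B - 4^-1 * frob (A - B).
Proof.
rewrite /frob !mulr_sumr -big_split -sumrB /=; apply: eq_bigr => i _.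
rewrite !mulr_sumr -big_split -sumrB /=; apply: eq_bigr => j _.
by rewrite !mxE; field.
Qed.

Lemma conv_frob (A : nat -> 'M[R]_(p, q)) L : conv A L -> sconv (fun j => frob (A j)) (frob L).
Proof.
move=> h; apply: sconv_sum => i; apply: sconv_sum => j.
by have := sconvM (h i j) (h i j); rewrite -expr2; apply: sconv_ext => k; rewrite expr2.
Qed.
End Frobenius.

Lemma sqrt_le_half (R : realType) (x k h : R) : 0 <= k -> 0 <= h -> x ^+ 2 <= (k * h) ^+ 2 -> `|x| <= k * h.
Proof.
move=> k0 h0 H; rewrite -(ger0_norm (mulr_ge0 k0 h0)).
by rewrite -ler_sqr ?nnegrE // !real_normK ?num_real.
Qed.

Definition qf (R : realType) N (s : 'M[R]_N) (v : 'rV[R]_N) : R := (v *m s *m v^T) 0 0.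

(** * An invariant definite form for a bounded group *)

Section InvariantForm.
Variables (R : realType) (N : nat) (G : set 'M[R]_N) (C : R).
Hypothesis G1 : G 1%:M.
Hypothesis GM : forall s t, G s -> G t -> G (s *m t).
Hypothesis GV : forall t, G t -> exists2 t', G t' & t' *m t = 1%:M.
Hypothesis GC : forall t, G t -> nrm t <= C.

Local Notation act t s := (t *m s *m t^T).

(** All translates of the form dominate the standard one. This condition is convex and invariant
    under the group, and it keeps the minimizer definite. *)
Let pos (s : 'M[R]_N) : Prop := forall t v, G t -> qf 1%:M v <= qf (act t s) v.
Let le_phi (s : 'M[R]_N) (x : R) : Prop := forall t, G t -> frob (act t s) <= x.

Let C0 : 0 <= C. Proof. exact: le_trans (nrm_ge0 _) (GC G1). Qed.

Lemma nrm_tr p q (A : 'M[R]_(p, q)) : nrm A^T = nrm A.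
Proof. by rewrite /nrm exchange_big; apply: eq_bigr => i _; apply: eq_bigr => j _; rewrite mxE. Qed.

Let C1 : R := C * C * (N * N)%:R.

Let frob_act t D : G t -> frob D <= C1 ^+ 2 * frob (act t D).
Proof.
move=> Gt; have [t' Gt' tt] := GV Gt; set B := act t D.
have tt2 : t *m t' = 1%:M by apply: mulmx1C.
have ED : D = t' *m B *m t'^T.
  by rewrite /B !mulmxA tt mul1mx -mulmxA -trmx_mul tt trmx1 mulmx1.
have h : nrm D <= C1 * Num.sqrt (frob B).
  rewrite {1}ED (_ : C1 * _ = C * ((N * N)%:R * Num.sqrt (frob B)) * C); last by rewrite /C1; ring.
  apply: le_trans (nrmM _ _) _; rewrite nrm_tr.
  apply: ler_pM; rewrite ?nrm_ge0 //; last exact: GC.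
  apply: le_trans (nrmM _ _) _; apply: ler_pM; rewrite ?nrm_ge0 //; first exact: GC.
  exact: nrm_frob.
apply: le_trans (frob_le D) _; rewrite -[X in _ <= _ * X](@sqr_sqrtr R) ?frob_ge0 //.
by rewrite -exprMn ler_sqr ?nnegrE ?nrm_ge0 // (le_trans (nrm_ge0 D)).
Qed.

Let qfD (s s' : 'M[R]_N) v : qf (2^-1 *: (s + s')) v = 2^-1 * (qf s v + qf s' v).
Proof. by rewrite /qf -scalemxAr mulmxDr -scalemxAl mulmxDl !mxE. Qed.

Let actD (t s s' : 'M[R]_N) : act t (2^-1 *: (s + s')) = 2^-1 *: (act t s + act t s').
Proof. by rewrite -scalemxAr mulmxDr -scalemxAl mulmxDl. Qed.

Let pos_mid s s' : pos s -> pos s' -> pos (2^-1 *: (s + s')).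
Proof.
move=> ps ps' t v Gt; rewrite actD qfD; have := ps t v Gt; have := ps' t v Gt.
by move: (qf 1%:M v) (qf (act t s) v) (qf (act t s') v) => a b c; lra.
Qed.

Let S : set R := [set x | exists2 s, pos s & le_phi s x].
Let mu := inf S.

Let S_lb : lbound S 0.
Proof. by move=> x [s _ /(_ _ G1)]; apply: le_trans; exact: frob_ge0. Qed.

Let mu_le x : S x -> mu <= x.
Proof. by move=> Sx; apply: ge_inf => //; exists 0; exact: S_lb. Qed.

Let qf1 (v : 'rV[R]_N) : qf 1%:M v = frob v.
Proof.
rewrite /qf mulmx1 mxE /frob big_ord1; apply: eq_bigr => i _.
by rewrite mxE expr2.
Qed.

Let S_n0 : S !=set0.
Proof.
(* A multiple of the identity so large that all its translates dominate the standard form. *)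
pose c := ((1 * N)%:R * C) ^+ 2; have c0 : 0 <= c := sqr_ge0 _.
exists ((nrm (c%:M : 'M[R]_N) * C ^+ 2) ^+ 2); exists c%:M => [t v Gt|t Gt].
  have [t' Gt' tt] := GV Gt; have tt2 : t *m t' = 1%:M by apply: mulmx1C.
  rewrite qf1; have -> : qf (act t c%:M) v = c * frob (v *m t).
    rewrite -qf1 /qf mulmx1 mul_mx_scalar -scalemxAl -scalemxAr -scalemxAl mxE; congr (_ * _).
    by rewrite trmx_mul !mulmxA.
  have -> : v = v *m t *m t' by rewrite -mulmxA tt2 mulmx1.
  rewrite -[v *m t *m t' *m t]mulmxA tt mulmx1; move: (v *m t) => u.
  apply: le_trans (frob_le _) _.
  rewrite -[X in _ <= _ * X](@sqr_sqrtr R) ?frob_ge0 // /c -exprMn.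
  have h : nrm (u *m t') <= (1 * N)%:R * C * Num.sqrt (frob u).
    apply: le_trans (nrmM _ _) _; rewrite mulrAC; apply: ler_pM; rewrite ?nrm_ge0 //.
      exact: nrm_frob.
    exact: GC.
  by rewrite ler_sqr ?nnegrE ?nrm_ge0 // (le_trans (nrm_ge0 (u *m t'))).
apply: le_trans (frob_le _) _; rewrite ler_sqr ?nnegrE ?nrm_ge0 //; last first.
  by rewrite mulr_ge0 ?nrm_ge0 // exprn_ge0.
apply: le_trans (nrmM _ _) _; rewrite nrm_tr expr2 mulrA; apply: ler_pM; rewrite ?nrm_ge0 //; last exact: GC.
by apply: le_trans (nrmM _ _) _; rewrite mulrC ler_wpM2l ?nrm_ge0 //; exact: GC.
Qed.

(* The parallelogram identity makes near-minimisers close to each other. *)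
Let near_min s s' x : pos s -> pos s' -> le_phi s x -> le_phi s' x ->
  frob (s - s') <= 4 * C1 ^+ 2 * (x - mu).
Proof.
move=> ps ps' fs fs'; set D := s - s'.
have [C10|C1n] := eqVneq (C1 ^+ 2) 0.
  by have := frob_act D G1; rewrite C10 mul0r mulr0 mul0r.
have C1p : 0 < C1 ^+ 2 by rewrite lt_def C1n sqr_ge0.
have Sx : S (x - 4^-1 * (frob D / C1 ^+ 2)).
  exists (2^-1 *: (s + s')); first exact: pos_mid.
  move=> t Gt; rewrite actD frob_mid; have := fs t Gt; have := fs' t Gt.
  have := frob_act D Gt; rewrite mulrC -ler_pdivrMr // /D mulmxBr mulmxBl.
  move: (frob (act t s)) (frob (act t s')) (frob (act t s - act t s')) => a b c.
  by move: (frob _ / _) => e; lra.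
have h := mu_le Sx; have FE : frob D = frob D / C1 ^+ 2 * C1 ^+ 2 by rewrite divfK.
rewrite FE; move: (frob D / _) h => e h.
rewrite (_ : 4 * C1 ^+ 2 * (x - mu) = 4 * (x - mu) * C1 ^+ 2); last by ring.
by rewrite ler_pM2r //; lra.
Qed.

(** Circumcentre argument: the supremum over the group of the squared Frobenius norms of the
    translates is uniformly convex, so its minimizer is unique, hence invariant. Near-minimizers
    within 4^-j of the infimum converge geometrically. *)
Lemma invariant_form : exists s : 'M[R]_N, (forall t, G t -> act t s = s) /\ forall v, qf 1%:M v <= qf s v.
Proof.
have ex j : exists s, pos s /\ le_phi s (mu + half R j ^+ 2).
  have h0 : 0 < half R j ^+ 2 by rewrite exprn_gt0 // half_gt0.
  have [|x [s ps fs] lx] := inf_adherent h0 (E := S); first by split; [exact: S_n0 | exists 0; exact: S_lb].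
  by exists s; split=> // t Gt; apply: le_trans (fs t Gt) (ltW lx).
pose f j := sval (cid (ex j)).
have fP j : pos (f j) /\ le_phi (f j) (mu + half R j ^+ 2) := svalP (cid (ex j)).
have C10 : 0 <= C1 by rewrite /C1 !mulr_ge0 // ler0n.
have step j a b : `|f j.+1 a b - f j a b| <= 2 * C1 * half R j.
  have [[p1 f1] [p2 f2]] := (fP j, fP j.+1).
  have le2 : le_phi (f j.+1) (mu + half R j ^+ 2).
    move=> t Gt; apply: le_trans (f2 t Gt) _; rewrite lerD2l ler_sqr ?nnegrE ?half_ge0 //.
    by rewrite halfS ler_pdivrMr // ler_peMr ?half_ge0 // ler1n.
  apply: sqrt_le_half; [by rewrite mulr_ge0 | exact: half_ge0 |].
  have := near_min p2 p1 le2 f1; rewrite (_ : mu + _ - mu = half R j ^+ 2) => [h|]; last by ring.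
  have -> : (2 * C1 * half R j) ^+ 2 = 4 * C1 ^+ 2 * half R j ^+ 2 by ring.
  apply: le_trans h; apply: le_trans (frob_entry _ a b).
  by rewrite !mxE.
pose s := \matrix_(a, b) sval (cid (sconv_exists (step^~ a ^~ b))).
have fs : conv f s by move=> a b; rewrite mxE; exact: svalP (cid (sconv_exists (step^~ a ^~ b))).
have cst p q (A : 'M[R]_(p, q)) : conv (fun=> A) A by move=> a b; exact: sconv_const.
have fact t : conv (fun j => act t (f j)) (act t s) by apply: conv_mulmx => //; apply: conv_mulmx.
have ps : pos s.
  move=> t v Gt; have : sconv (fun j => (-1) * qf (act t (f j)) v) ((-1) * qf (act t s) v).
    apply: sconvM; first exact: sconv_const.
    by apply: (conv_mulmx _ _ 0 0); [apply: conv_mulmx | ].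
  move=> /sconv_le h; have := h (- qf 1%:M v); rewrite mulN1r lerN2; apply=> j.
  by rewrite mulN1r lerN2; have [p _] := fP j; exact: p.
have fm : le_phi s mu.
  move=> t Gt; have h2 : sconv (fun j => half R j ^+ 2) 0.
    exists 1 => j; rewrite subr0 mul1r ger0_norm ?exprn_ge0 ?half_ge0 //.
    by rewrite expr2 ler_piMr ?half_ge0 ?half_le1.
  have := sconvD (conv_frob (fact _ t)) (sconvM (sconv_const (-1)) h2).
  rewrite mulr0 addr0 => /sconv_le; apply=> j; rewrite mulN1r lerBlDr.
  by have [_ h] := fP j; exact: h.
exists s; split=> [t Gt|v]; last by have := ps _ v G1; rewrite mul1mx trmx1 mulmx1.
have aa t' : act t' (act t s) = act (t' *m t) s by rewrite trmx_mul !mulmxA.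
have := @near_min s (act t s) mu ps _ fm _; rewrite subrr mulr0 => h.
have {h} : frob (s - act t s) <= 0.
  apply: h => [t' v Gt'|t' Gt']; rewrite aa.
    by apply: ps; apply: GM.
  by apply: fm; apply: GM.
move=> h; apply/matrixP => a b; apply/eqP; rewrite eq_sym -subr_eq0 -sqrf_eq0 eq_le sqr_ge0 andbT.
by apply: le_trans h; apply: le_trans (frob_entry _ a b); rewrite !mxE.
Qed.
End InvariantForm.

Section BoundedPart.
Variables (R : realType) (n : nat) (Lam : mxgroup R n) (d : nat).
Local Notation L0 := (idcomp Lam).
Local Notation N := (tdim (1 + n) d).
Local Notation T g := (rho d g : 'M[R]_N).

Lemma polyf_rho_entry i j : polyf (fun g : 'M[R]_n => (T g) i j).
Proof.
apply: polyf_tpow => u v; case: (fintype.split_ordP u) => k ->; case: (fintype.split_ordP v) => l ->.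
- by apply: polyf_ext (polyf_const ((1%:M : 'M[R]_1) k l)) => g; rewrite /lft block_mxEul.
- by apply: polyf_ext (polyf_const 0) => g; rewrite /lft block_mxEur mxE.
- by apply: polyf_ext (polyf_const 0) => g; rewrite /lft block_mxEdl mxE.
- apply: (polyf_ext (f := fun g : 'M[R]_n => g k l)); first by move=> g; rewrite /lft block_mxEdr.
  exact: polyf_entry.
Qed.

Lemma zcl_ext p (F H : 'M[R]_n -> 'M[R]_p) : (forall i j, polyf (fun g => F g i j)) ->
  (forall i j, polyf (fun g => H g i j)) -> (forall g, mxset L0 g -> F g = H g) ->
  forall g, zcl L0 g -> F g = H g.
Proof.
move=> pF pH FH g [_ zg]; apply/matrixP => i j; apply/eqP; rewrite -subr_eq0; apply/eqP.
apply: (zg (fun g => F g i j - H g i j)); first exact: polyfB.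
by move=> k Lk; rewrite FH // subrr.
Qed.

Lemma zcl_equiv (a : 'M[R]_N) g : equiv_mx Lam a -> zcl L0 g -> a *m T g = T g *m a.
Proof.
move=> ca; apply: (zcl_ext (F := fun g => a *m T g) (H := fun g => T g *m a)) => [i j|i j|//].
- by apply: polyf_mulmx => x y; [exact: polyf_const | exact: polyf_rho_entry].
- by apply: polyf_mulmx => x y; [exact: polyf_rho_entry | exact: polyf_const].
Qed.

(** Completed by the identity on the kernel of a, the action becomes a bounded group, and its
    invariant form defines [nu]. Invariance is a polynomial identity in g, so it extends to the
    Zariski closure. *)
Lemma bounded_norm (a : 'M[R]_N) C : a *m a = a -> equiv_mx Lam a ->
  (forall g, mxset L0 g -> nrm (a *m T g) <= C) ->
  exists (nu : 'rV[R]_N -> R) (c1 c2 : R), [/\ [/\ 0 <= c1, 0 <= c2 & forall v, 0 <= nu v], forall c v, nu (c *: v) = `|c| * nu v,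
    forall v, nrm (v *m a) <= c1 * nu v, forall v, nu v <= c2 * nrm v
    & forall g v, zcl L0 g -> nu (v *m T g) = nu v].
Proof.
move=> aa ca bd; pose tt g := a *m T g + (1%:M - a).
have ab : a *m (1%:M - a) = 0 by rewrite mulmxBr mulmx1 aa subrr.
have ba : (1%:M - a) *m a = 0 by rewrite mulmxBl mul1mx aa subrr.
have bb : (1%:M - a) *m (1%:M - a) = 1%:M - a by rewrite {1}mulmxBl mul1mx ab subr0.
have ttM g h : mxset L0 g -> tt (g *m h) = tt g *m tt h.
  move=> Lg; rewrite /tt; move: (1%:M - a) ab ba bb => b ab ba bb.
  rewrite mulmxDl !mulmxDr bb (mulmxA b) ba mul0mx add0r.
  have e1 : a *m T g *m b = 0 by rewrite ca // -mulmxA ab mulmx0.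
  rewrite e1 addr0; congr (_ + _).
  rewrite rhoM (mulmxA (a *m T g)) -[a *m T g *m a]mulmxA -ca // (mulmxA a a) aa.
  by rewrite !mulmxA.
pose G : set 'M[R]_N := [set t | exists2 g, mxset L0 g & t = tt g].
have [||||s [sinv spos]] := @invariant_form R N G (C + nrm (1%:M - a)).
- by exists 1%:M; [exact: mxgroup1 | rewrite /tt rho1 mulmx1 addrC subrK].
- by move=> _ _ [g Lg ->] [h Lh ->]; exists (g *m h); [exact: mxgroupM | rewrite ttM].
- move=> _ [g Lg ->]; exists (tt (invmx g)); first by exists (invmx g) => //; exact: mxgroupV.
  rewrite -ttM; last exact: mxgroupV.
  by rewrite mulVmx ?(mxgroup_unit Lg) // /tt rho1 mulmx1 addrC subrK.
- by move=> _ [g Lg ->]; apply: le_trans (nrmD _ _) _; rewrite lerD2r; apply: bd.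
have prho i j : polyf (fun g : 'M[R]_n => (T g) i j) := polyf_rho_entry i j.
have pl (A : 'M[R]_N) i j : polyf (fun g : 'M[R]_n => (A *m T g) i j).
  by apply: polyf_mulmx => // x y; exact: polyf_const.
have ptt i j : polyf (fun g : 'M[R]_n => tt g i j).
  by apply: (polyf_ext (f := fun g => (a *m T g) i j + (1%:M - a) i j)) => [g|];
    [rewrite [RHS]mxE | apply: polyfD => //; exact: polyf_const].
have zca g : zcl L0 g -> a *m T g = T g *m a by exact: zcl_equiv.
have zs g : zcl L0 g -> tt g *m s *m (tt g)^T = s.
  apply: (zcl_ext (F := fun g => tt g *m s *m (tt g)^T) (H := fun=> s)) => [i j|i j|h Lh].
  - apply: polyf_mulmx => [x y|x y]; last by apply: polyf_ext (ptt y x) => h; rewrite [RHS]mxE.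
    by apply: polyf_mulmx => // u v; exact: polyf_const.
  - exact: polyf_const.
  - by apply: sinv; exists h.
have q0 v : 0 <= qf s v.
  apply: le_trans (spos v); rewrite /qf mulmx1 mxE; apply: sumr_ge0 => i _.
  by rewrite mxE -expr2 sqr_ge0.
exists (fun v => Num.sqrt (qf s (v *m a))), (1 * N)%:R, (Num.sqrt (nrm a * nrm s * nrm a)); split.
- by split=> [||v]; [exact: ler0n | exact: sqrtr_ge0 | exact: sqrtr_ge0].
- move=> c v; rewrite -scalemxAl (_ : qf s (c *: (v *m a)) = c ^+ 2 * qf s (v *m a)).
    by rewrite sqrtrM ?sqr_ge0 // sqrtr_sqr.
  by rewrite /qf linearZ /= -scalemxAr -!scalemxAl scalerA mxE expr2.
- move=> v; apply: le_trans (nrm_frob _) _; rewrite ler_wpM2l ?ler0n // ler_wsqrtr //.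
  apply: le_trans (spos _); rewrite /qf mulmx1 mxE /frob big_ord1.
  by apply: ler_sum => i _; rewrite [X in _ <= _ * X]mxE expr2.
- move=> v; have n0 : 0 <= nrm a * nrm s * nrm a by rewrite !mulr_ge0 ?nrm_ge0.
  rewrite -(ger0_norm (nrm_ge0 v)) -sqrtr_sqr -sqrtrM // ler_wsqrtr //.
  apply: le_trans (ler_norm _) _; apply: le_trans (nrm_entry _ _ _) _.
  rewrite (_ : _ * nrm v ^+ 2 = (nrm v * nrm a) * nrm s * (nrm v * nrm a)); last by ring.
  apply: le_trans (nrmM _ _) _; rewrite nrm_tr; apply: ler_pM; rewrite ?nrm_ge0 ?nrmM //.
  by apply: le_trans (nrmM _ _) _; rewrite ler_wpM2r ?nrm_ge0 // nrmM.
- move=> g v zg; congr Num.sqrt.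
  have E : v *m T g *m a = (v *m a) *m tt g.
    rewrite /tt; move: (1%:M - a) ab => b ab'; rewrite mulmxDr -[v *m a *m b]mulmxA ab' mulmx0 addr0.
    by rewrite -!mulmxA (mulmxA a) aa zca.
  rewrite E /qf trmx_mul -[in RHS](zs g zg) !mulmxA.
  by [].
Qed.
End BoundedPart.
End FormPart.

(** * Unbounded summands *)

Section GpPart.
Import numFieldNormedType.Exports.
Local Open Scope classical_set_scope.
Local Open Scope ring_scope.

Section MatrixContinuity.
Variables (R : realType) (D : nat).
Local Notation cmx F := (forall i j, continuous (fun x : 'rV[R]_D => F x i j)).

Lemma cmx_mul p q r (F : 'rV[R]_D -> 'M[R]_(p, q)) (G : 'rV[R]_D -> 'M[R]_(q, r)) :
  cmx F -> cmx G -> cmx (fun x => F x *m G x).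
Proof.
move=> cF cG i j; rewrite (_ : (fun _ => _) = fun x => \sum_k F x i k * G x k j).
  by apply: cont_sum => k x; exact: (cvgM (cF i k x) (cG k j x)).
by apply/funext => x; rewrite mxE.
Qed.

Lemma cmx_const p q (A : 'M[R]_(p, q)) : cmx (fun=> A).
Proof. by move=> i j; exact: cst_continuous. Qed.

Lemma cmx_vec p q (F : 'rV[R]_D -> 'rV[R]_(p * q)) : cmx F -> cmx (fun x => vec_mx (F x)).
Proof.
move=> cF i j; rewrite (_ : (fun _ => _) = fun x => F x 0 (mxvec_index i j)); first exact: cF.
by apply/funext => x; rewrite mxE.
Qed.

Lemma cont_nrm p q (F : 'rV[R]_D -> 'M[R]_(p, q)) : cmx F -> continuous (fun x => nrm (F x)).
Proof.
move=> cF; apply: cont_sum => i; apply: cont_sum => j x.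
exact: (cvg_norm (cF i j x)).
Qed.
End MatrixContinuity.

Lemma nrm_big_row (R : realType) p q (A : 'M[R]_(p.+1, q)) : exists i, nrm A <= p.+1%:R * nrm (row i A).
Proof.
apply: contrapT => /forallNP h.
have E : nrm A = \sum_i nrm (row i A).
  by rewrite /nrm; apply: eq_bigr => i _; rewrite big_ord1; apply: eq_bigr => j _; rewrite mxE.
have : \sum_(i < p.+1) p.+1%:R * nrm (row i A) < \sum_(i < p.+1) nrm A.
  apply: ltr_sum => [|i _]; first by apply/hasP; exists ord0; rewrite ?mem_index_enum.
  by have /negP := h i; rewrite -ltNge.
by rewrite -mulr_sumr -E sumr_const card_ord mulr_natl ltxx.
Qed.

(** * General position and expansion *)

Section GeneralPosition.
Variables (R : realType) (n : nat) (Lam : mxgroup R n) (d : nat).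
Local Notation L0 := (idcomp Lam).
Local Notation N := (tdim (1 + n) d).
Local Notation T g := (rho d g : 'M[R]_N).
Variables (m : nat) (e : 'I_m -> 'M[R]_N).
Hypothesis irr_e : forall j, irred_idem Lam (e j).

Lemma polyf_rho (A : 'rV[R]_N) (B : 'M[R]_N) i j : polyf (fun g : 'M[R]_n => (A *m T g *m B) i j).
Proof.
apply/polyfP; exists d, (col j B *m row i A) => g.
rewrite -(mulmxA (col j _)) [RHS]mxtrace_mulC /mxtrace big_ord1 -row_mul [LHS]mxE [RHS]mxE.
by apply: eq_bigr => x _; congr (_ * _); rewrite [RHS]mxE.
Qed.

(** The vectors in the image of e j whose orbit is killed by A form a stable subspace. By
    irreducibility it is 0 or the whole image, and the latter would make A zero. *)
Lemma coef_nonzero j (w : 'rV[R]_N) (A : 'M[R]_N) : w *m e j = w -> e j *m A = A -> w != 0 -> A != 0 ->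
  exists2 g, mxset L0 g & w *m T g *m A != 0.
Proof.
move=> we eA w0 A0; apply: contrapT => no; have [ee ce e0 irr_j] := irr_e j.
have [||k [B [_ HB]]] := @subspace_basis R N
  [set u | u *m e j = u /\ forall g, mxset L0 g -> u *m T g *m A = 0].
- by split=> [|g _]; rewrite ?mul0mx.
- move=> c u v [ue uA] [ve vA]; split=> [|g Lg]; first by rewrite mulmxDl -scalemxAl ue ve.
  by rewrite !mulmxDl -!scalemxAl uA // vA // scaler0 addr0.
have [||U0|eU] := irr_j <<B>>%MS.
- rewrite genmxE; apply/row_subP => i; have /HB [h _] := row_sub i B.
  by rewrite -h submxMl.
- move=> g Lg; rewrite (eqmxMr _ (genmxE B)) genmxE; apply/row_subP => i; rewrite row_mul; apply/HB.
  have /HB [h1 h2] := row_sub i B; split=> [|h Lh]; first by rewrite -mulmxA -ce // mulmxA h1.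
  by rewrite -[_ *m T g *m T h]mulmxA -rhoM h2 //; apply: mxgroupM.
- have : (w <= <<B>>)%MS.
    rewrite genmxE; apply/HB; split=> // g Lg; apply/eqP/negP => h; apply: no; exists g => //.
    exact/negP.
  by rewrite U0 submx0 (negPf w0).
- move: A0; rewrite -eA; suff -> : e j *m A = 0 by rewrite eqxx.
  apply/row_matrixP => i; rewrite row_mul row0.
  have : (row i (e j) <= <<B>>)%MS by apply: submx_trans (row_sub _ _) eU.
  by rewrite genmxE => /HB [_ /(_ _ (mxgroup1 L0))]; rewrite rho1 mulmx1.
Qed.

(** Each condition fails only on the zero set of a polynomial that is not identically 0 on [L0]; by
    irreducibility the product of these polynomials is not identically 0 either. *)
Lemma coefs_nonzero (w : 'I_m -> 'rV[R]_N) (A : 'I_m -> 'M[R]_N) :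
  (forall j, [/\ w j *m e j = w j, e j *m A j = A j, w j != 0 & A j != 0]) ->
  exists2 g, mxset L0 g & forall j, w j *m T g *m A j != 0.
Proof.
move=> h.
have [F [pF [g Lg Fg] nF]] : exists F, [/\ polyf F, exists2 g, mxset L0 g & F g != 0 &
    forall g j, j \in enum 'I_m -> F g != 0 -> w j *m T g *m A j != 0].
  elim: (enum 'I_m) => [|j s [F [pF [g Lg Fg] nF]]].
    exists (fun=> 1); split=> //; [exact: polyf_const | exists 1%:M; [exact: mxgroup1 | exact: oner_neq0]].
  have [h1 h2 h3 h4] := h j; have [g' Lg' ng'] := coef_nonzero h1 h2 h3 h4.
  have [k nk] : exists k, (w j *m T g' *m A j) 0 k != 0.
    by have /rV0Pn := ng'.
  exists (fun g => (w j *m T g *m A j) 0 k * F g); split.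
  - by apply: polyfM => //; exact: polyf_rho.
  - apply: contrapT => no.
    have [|K|K] := @irr_idcomp _ _ Lam (fun g => (w j *m T g *m A j) 0 k) F (polyf_rho _ _ _ _) pF.
    + by move=> x Lx; apply/eqP/negP => nx; apply: no; exists x => //; exact/negP.
    + by rewrite K ?eqxx in nk.
    + by rewrite K ?eqxx in Fg.
  - move=> x l; rewrite inE => /orP [/eqP ->|ls]; rewrite mulf_eq0 negb_or => /andP [n1 n2].
      by apply: contraNneq n1 => ->; rewrite mxE.
    exact: nF.
by exists g => // j; apply: nF => //; rewrite mem_enum.
Qed.

(** All the vectors and matrices are packed into one row vector, for which the compactness of cubes
    is available. [P j] and [Q j] extract the components, [P j] followed by the projection e j. *)
Local Notation D := (m * (N + N * N))%N.
Local Notation P j := (lin1_mx (row j \o @lsubmx R m N (N * N) \o @vec_mx R m (N + N * N)) *m e j).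
Local Notation Q j := (lin1_mx (row j \o @rsubmx R m N (N * N) \o @vec_mx R m (N + N * N))).

(** Tuples of unit vectors and unit matrices form a compact set. It is covered by the open sets
    where, for a fixed h, the product of the norms of all coefficients exceeds 1 / (k + 1); a finite
    subcover gives the set H and the constant. *)
Lemma general_position : exists (H : seq 'M[R]_n) (c : R), [/\ 0 < c, forall h, h \in H -> mxset L0 h &
  forall (w : 'I_m -> 'rV[R]_N) (A : 'I_m -> 'M[R]_N),
  (forall j, w j *m e j = w j) -> (forall j, e j *m A j = A j) ->
  exists2 h, h \in H & forall j, c * (nrm (w j) * nrm (A j)) <= nrm (w j *m T h *m A j)].
Proof.
pose W (x : 'rV[R]_D) j : 'rV[R]_N := x *m P j.
pose V (x : 'rV[R]_D) j : 'M[R]_N := e j *m vec_mx (x *m Q j).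
have cW j : forall a b, continuous (fun x => W x j a b).
  by apply: cmx_mul; [move=> a b; exact: coord_continuous | exact: cmx_const].
have cV j : forall a b, continuous (fun x => V x j a b).
  apply: cmx_mul; first exact: cmx_const.
  by apply: cmx_vec; apply: cmx_mul; [move=> a b; exact: coord_continuous | exact: cmx_const].
have ee j : e j *m e j = e j by have [] := irr_e j.
have We x j : W x j *m e j = W x j by rewrite /W -!mulmxA ee.
have eV x j : e j *m V x j = V x j by rewrite /V mulmxA ee.
pose S := [set x : 'rV[R]_D | (forall i, `[-1, 1]%classic (x ord0 i)) /\
  forall j, nrm (W x j) = 1 /\ nrm (V x j) = 1].
have cS : compact S.
  apply: (@subclosed_compact _ _ [set x : 'rV[R]_D | forall i, `[-1, 1]%classic (x ord0 i)]); last first.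
  - by move=> x [].
  - exact: (@rV_compact R D (fun=> `[-1, 1]%classic) (fun=> @segment_compact _ _ _)).
  - rewrite (_ : S = (\bigcap_(i in [set: 'I_D]) [set x : 'rV[R]_D | `[-1, 1]%classic (x ord0 i)]) `&`
      \bigcap_(j in [set: 'I_m]) ([set x : 'rV[R]_D | nrm (W x j) = 1] `&` [set x : 'rV[R]_D | nrm (V x j) = 1])).
      apply: closedI; apply: closed_bigI => i _.
        apply: (@closed_comp _ _ (fun x : 'rV[R]_D => x ord0 i)); last exact: interval_closed.
        by move=> x _; exact: coord_continuous.
      apply: closedI; [apply: (@closed_comp _ _ (fun x => nrm (W x i)) [set 1])
        | apply: (@closed_comp _ _ (fun x => nrm (V x i)) [set 1])]; try exact: closed_eq.
        by move=> x _; exact: (cont_nrm (cW i)).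
      by move=> x _; exact: (cont_nrm (cV i)).
    apply/seteqP; split=> [x [h1 h2]|x [h1 h2]].
      by split=> [i _|j _]; [exact: h1 | exact: h2].
    by split=> [i|j]; [exact: h1 | exact: h2].
pose f (h : 'M[R]_n) j x := nrm (W x j *m T h *m V x j).
pose U (hk : 'M[R]_n * nat) := [set x : 'rV[R]_D | hk.2.+1%:R^-1 < \prod_j f hk.1 j x].
have oU hk : [set hk | mxset L0 hk.1] hk -> open (U hk).
  move=> _; apply: (@open_comp _ _ (fun x => \prod_j f hk.1 j x) [set y | hk.2.+1%:R^-1 < y]); last exact: open_gt.
  move=> x _; apply: (cont_prod (F := fun j x => f hk.1 j x)) => j; apply: cont_nrm.
  by apply: cmx_mul => //; apply: cmx_mul => //; exact: cmx_const.
move: cS; rewrite compact_cover => /(_ _ _ _ oU) [|DH DL SD].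
  move=> x [_ Sx]; have [|g Lg ng] := @coefs_nonzero (W x) (V x).
    by move=> j; have [S1 S2] := Sx j; rewrite -!nrm_eq0 S1 S2 oner_neq0.
  have p0 : 0 < \prod_j f g j x by apply: prodr_gt0 => j _; rewrite lt_def nrm_eq0 ng nrm_ge0.
  exists (g, Num.Def.archi_bound (\prod_j f g j x)^-1) => //=.
  rewrite /U /= invf_plt ?posrE ?ltr0n //; apply: lt_le_trans (archi_boundP _) _; first by rewrite invr_ge0 ltW.
  by rewrite ler_nat.
(* [K h] bounds the product of all factors but one, so that a lower bound on the whole product
   yields one for each factor. *)
pose K (h : 'M[R]_n) : R := (1 + nrm (T h)) ^+ m.
pose z (hk : 'M[R]_n * nat) : R := hk.2.+1%:R * K hk.1.
have K0 h : 0 < K h by rewrite exprn_gt0 // ltr_pwDl // nrm_ge0.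
have z0 hk : 0 < z hk by rewrite mulr_gt0 ?ltr0n.
pose Z := \sum_(hk <- finmap.enum_fset DH) z hk.
have Z0 : 0 <= Z by apply: sumr_ge0 => hk _; exact: ltW.
have c0 : 0 < (1 + Z)^-1 by rewrite invr_gt0 ltr_pwDl.
have main x : S x -> exists2 hk, hk \in finmap.enum_fset DH & forall j, (1 + Z)^-1 <= f hk.1 j x.
  move=> Sx; have [hk /= hD Ux] := SD _ Sx; exists hk => // j.
  have h1 : z hk <= 1 + Z.
    by apply: (@le_trans _ _ Z); [apply: le_seq_sum => // y; exact: ltW | rewrite lerDr].
  apply: (@le_trans _ _ (z hk)^-1); first by rewrite lef_pV2 ?posrE // ltr_pwDl.
  have fK l : f hk.1 l x <= 1 + nrm (T hk.1).
    have [_ /(_ l) [S1 S2]] := Sx.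
    apply: le_trans (nrmM _ _) _; rewrite S2 mulr1; apply: le_trans (nrmM _ _) _.
    by rewrite S1 mul1r lerDr ler01.
  have k1 : 1 <= 1 + nrm (T hk.1) by rewrite lerDl nrm_ge0.
  have h2 : \prod_l f hk.1 l x <= f hk.1 j x * K hk.1.
    rewrite (bigD1 j) //=; apply: ler_wpM2l; first exact: nrm_ge0.
    apply: (@le_trans _ _ (\prod_(l < m | l != j) (1 + nrm (T hk.1)))).
      by apply: ler_prod => l _; rewrite fK nrm_ge0.
    apply: (@le_trans _ _ (\prod_(l < m) (1 + nrm (T hk.1)))); last by rewrite prodr_const card_ord.
    rewrite [X in _ <= X](bigD1 j) //= ler_peMl //; apply: prodr_ge0 => l _.
    exact: le_trans k1.
  rewrite /z invfM mulrC ler_pdivrMl // [K _ * _]mulrC; apply: le_trans h2; exact: ltW.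
exists (map fst (finmap.enum_fset DH)), ((1 + Z)^-1); split=> //.
  by move=> _ /mapP [hk hD ->]; have := DL _ hD; rewrite inE.
move=> w A we eA.
have [r0 r0P] : exists r0 : 'I_m -> 'I_N, forall j, row (r0 j) (e j) != 0.
  have ex j : exists i, row i (e j) != 0.
    have [_ _ e0 _] := irr_e j; apply: contrapT => /forallNP no; case/negP: e0; apply/eqP/row_matrixP => i.
    by rewrite row0; apply/eqP/negP => h; apply: (no i); apply/negP.
  by exists (fun j => sval (cid (ex j))) => j; exact: svalP (cid (ex j)).
(* The conclusion is homogeneous, so the data are normalized, and zero data are replaced by
   arbitrary unit ones. *)
pose u j := if w j == 0 then (nrm (row (r0 j) (e j)))^-1 *: row (r0 j) (e j) else (nrm (w j))^-1 *: w j.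
pose B j := if A j == 0 then (nrm (e j))^-1 *: e j else (nrm (A j))^-1 *: A j.
have n1 p q (X : 'M[R]_(p, q)) : X != 0 -> nrm ((nrm X)^-1 *: X) = 1.
  by rewrite -nrm_eq0 => h; rewrite nrmZ ger0_norm ?invr_ge0 ?nrm_ge0 // mulVf.
have nu j : nrm (u j) = 1 by rewrite /u; have [_|w0] := eqVneq (w j) 0; apply: n1 => //; exact: r0P.
have nB j : nrm (B j) = 1.
  by rewrite /B; have [_|w0] := eqVneq (A j) 0; apply: n1 => //; have [] := irr_e j.
have ue j : u j *m e j = u j.
  by rewrite /u; case: ifP => _; rewrite -scalemxAl ?we // -row_mul ee.
have eB j : e j *m B j = B j by rewrite /B; case: ifP => _; rewrite -scalemxAr ?eA // ee.
have wu j : w j = nrm (w j) *: u j.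
  rewrite /u; have [->|w0] := eqVneq (w j) 0; first by rewrite nrm0 scale0r.
  by rewrite scalerA mulfV ?scale1r // nrm_eq0.
have AB j : A j = nrm (A j) *: B j.
  rewrite /B; have [->|w0] := eqVneq (A j) 0; first by rewrite nrm0 scale0r.
  by rewrite scalerA mulfV ?scale1r // nrm_eq0.
pose x : 'rV[R]_D := mxvec (row_mx (\matrix_j u j) (\matrix_j mxvec (B j)) : 'M[R]_(m, N + N * N)).
have Wx j : W x j = u j.
  by rewrite /W mulmxA mul_rV_lin1 /= /x mxvecK row_mxKl rowK.
have Vx j : V x j = B j.
  by rewrite /V mul_rV_lin1 /= /x mxvecK row_mxKr rowK mxvecK.
have Sx : S x.
  split=> [i|j]; last by rewrite Wx Vx nu nB.
  rewrite /= in_itv /= -ler_norml; case/mxvec_indexP: i => i k; rewrite /x mxvecE.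
  case: (fintype.split_ordP k) => l ->; rewrite ?row_mxEl ?row_mxEr mxE.
    by rewrite -(nu i) nrm_entry.
  by case/mxvec_indexP: l => a b; rewrite mxvecE -(nB i) nrm_entry.
have [hk hD hm] := main x Sx; exists hk.1; first by apply: map_f.
move=> j; have := hm j; rewrite /f Wx Vx => h.
rewrite [in leRHS](wu j) [in leRHS](AB j) -scalemxAr -!scalemxAl scalerA nrmZ ger0_norm; last first.
  by rewrite mulr_ge0 ?nrm_ge0.
apply: (@le_trans _ _ (nrm (w j) * nrm (A j) * nrm (u j *m T hk.1 *m B j))); last first.
  by rewrite le_eqVlt; apply/orP; left; apply/eqP; ring.
by rewrite mulrC; apply: ler_wpM2l => //; rewrite mulr_ge0 ?nrm_ge0.
Qed.

Hypothesis unbounded_e : forall j (C : R), exists2 g, mxset L0 g & C < nrm (e j *m T g).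

Hypothesis lower_e : forall j, exists2 c : R, 0 < c & forall g, mxset L0 g -> c <= nrm (e j *m T g).

(* A product lam h mu with h in general position is large wherever lam or mu is. *)
Lemma simultaneously_large (X : R) : exists2 g, mxset L0 g & forall j, X <= nrm (e j *m T g).
Proof.
have [H [c [c0 HL gp]]] := general_position.
have ee j : e j *m e j = e j by have [] := irr_e j.
have ce j : equiv_mx Lam (e j) by have [] := irr_e j.
have [c' c'0 low] : exists2 c' : R, 0 < c' & forall j g, j \in enum 'I_m -> mxset L0 g -> c' <= nrm (e j *m T g).
  elim: (enum 'I_m) => [|j s [c1 c10 h1]]; first by exists 1.
  have [c2 c20 h2] := lower_e j.
  exists (Num.min c1 c2); first by rewrite lt_min c10 c20.
  move=> l g; rewrite inE => /orP [/eqP -> Lg|ls Lg]; first by rewrite ge_min h2 ?orbT.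
  by rewrite ge_min h1.
pose k : R := N%:R.
have prodl (g1 g2 : 'M[R]_n) : mxset L0 g1 -> mxset L0 g2 -> exists2 g, mxset L0 g &
    forall j, c * (nrm (e j *m T g1) * nrm (e j *m T g2)) <= k * nrm (e j *m T g).
  move=> L1 L2.
  have big p q (A : 'M[R]_(p, q)) : A != 0 -> exists i, nrm A <= p%:R * nrm (row i A).
    case: p A => [|p] A A0; first by rewrite [A]flatmx0 eqxx in A0.
    exact: nrm_big_row.
  have nz j : e j *m T g1 != 0.
    by rewrite -nrm_eq0 gt_eqF // (lt_le_trans c'0) // low ?mem_enum.
  have [r rP] : exists r : 'I_m -> 'I_N, forall j, nrm (e j *m T g1) <= k * nrm (row (r j) (e j *m T g1)).
    by exists (fun j => sval (cid (big _ _ _ (nz j)))) => j; exact: svalP (cid (big _ _ _ (nz j))).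
  have [j|j|h hH hP] := gp (fun j => row (r j) (e j *m T g1)) (fun j => e j *m T g2).
  - by rewrite -row_mul -mulmxA -ce // mulmxA ee.
  - by rewrite mulmxA ee.
  exists (g1 *m h *m g2) => [|j]; first by apply: mxgroupM => //; apply: mxgroupM => //; exact: HL.
  have k0 : 0 <= k by rewrite ler0n.
  apply: (@le_trans _ _ (k * (c * (nrm (row (r j) (e j *m T g1)) * nrm (e j *m T g2))))).
    rewrite [leRHS]mulrCA; apply: ler_wpM2l; first exact: ltW.
    by rewrite mulrA; apply: ler_wpM2r; [exact: nrm_ge0 | exact: rP].
  apply: ler_wpM2l => //; apply: le_trans (hP j) _.
  have -> : row (r j) (e j *m T g1) *m T h *m (e j *m T g2) = row (r j) (e j *m T (g1 *m h *m g2)).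
    rewrite -!row_mul; congr row; rewrite !rhoM !mulmxA; congr (_ *m _).
    rewrite -[LHS]mulmxA -(ce j h (HL _ hH)) [LHS]mulmxA; congr (_ *m _).
    by rewrite -[LHS]mulmxA -(ce j g1 L1) [LHS]mulmxA ee.
  rewrite /nrm big_ord1 [leRHS](bigD1 (r j)) //=.
  rewrite (eq_bigr (fun l => `|(e j *m T (g1 *m h *m g2)) (r j) l|)) ?lerDl; last by move=> l _; rewrite mxE.
  by apply: sumr_ge0 => a _; apply: sumr_ge0.
have H' (s : seq 'I_m) : forall X : R, exists2 g, mxset L0 g & forall j, j \in s -> X <= nrm (e j *m T g).
  elim: s => [|l s IH] Y; first by exists 1%:M => //; exact: mxgroup1.
  (* With one factor at least Z and the other at least c', the product exceeds the bound Y after the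
     losses by c and k. *)
  pose Z := `|Y| * k / (c * c').
  have cc0 : 0 < c * c' by rewrite mulr_gt0.
  have [g1 L1 h1] := IH Z; have [g2 L2 h2] := unbounded_e l Z.
  have [g Lg hg] := prodl _ _ L1 L2; exists g => // j js.
  have ej := low j _ (mem_enum _ _).
  have k0 : 0 < k.
    rewrite lt_def ler0n andbT; apply/eqP => kz; have := hg j; rewrite kz mul0r => hh.
    have := mulr_gt0 c0 (mulr_gt0 (lt_le_trans c'0 (ej _ L1)) (lt_le_trans c'0 (ej _ L2))).
    by rewrite ltNge hh.
  have Zk : Z * (c * c') = `|Y| * k by rewrite /Z divfK // gt_eqF.
  have Z0 : 0 <= Z by rewrite /Z divr_ge0 ?mulr_ge0 // ltW.
  have key : Z * c' <= nrm (e j *m T g1) * nrm (e j *m T g2).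
    move: js; rewrite inE => /orP [/eqP jl|js].
      rewrite [Z * c']mulrC; apply: (ler_pM (ltW c'0) Z0 (ej _ L1)).
      by rewrite jl ltW.
    exact: (ler_pM Z0 (ltW c'0) (h1 j js) (ej _ L2)).
  apply: le_trans (ler_norm Y) _; rewrite -(ler_pM2r k0) -Zk [Z * _]mulrCA [nrm _ * k]mulrC.
  by apply: le_trans (hg j); apply: ler_wpM2l; [exact: ltW | exact: key].
have [g Lg hg] := H' (enum 'I_m) X; exists g => // j; apply: hg; exact: mem_enum.
Qed.

(** An h in general position is followed by one fixed l for which all the e j T l are large: the
    factor c lost in the first step is regained by 2 / c. *)
Lemma expanding : exists F : seq 'M[R]_n, (forall g, g \in F -> mxset L0 g) /\
  forall w : 'I_m -> 'rV[R]_N, (forall j, w j *m e j = w j) ->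
  exists2 g, g \in F & forall j, 2 * nrm (w j) <= nrm (w j *m T g).
Proof.
have [H [c [c0 HL gp]]] := general_position.
have ee j : e j *m e j = e j by have [] := irr_e j.
have ce j : equiv_mx Lam (e j) by have [] := irr_e j.
have [l Ll hl] := simultaneously_large (2 / c).
exists [seq h *m l | h <- H]; split=> [_ /mapP [h hH ->]|w we].
  by apply: mxgroupM => //; exact: HL.
have [//|j|h hH hP] := gp w (fun j => e j *m T l); first by rewrite mulmxA ee.
exists (h *m l) => [|j]; first exact: map_f.
have <- : w j *m T h *m (e j *m T l) = w j *m T (h *m l).
  rewrite rhoM !mulmxA; congr (_ *m _).
  by rewrite -[LHS]mulmxA -(ce j h (HL _ hH)) [LHS]mulmxA we.
apply: le_trans (hP j); rewrite mulrCA mulrC; apply: ler_wpM2l; first exact: nrm_ge0.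
by rewrite mulrC -ler_pdivrMr //; exact: hl.
Qed.
End GeneralPosition.
End GpPart.

(** * Expansion in tensor powers *)

Section DynamicsPart.
Local Open Scope classical_set_scope.
Local Open Scope ring_scope.

(** * One tensor power for all ranks *)

Section Padding.
Variables (R : realType) (n : nat).

(* Tensoring on the left with the first basis vector, which is fixed by every lft g. *)
Definition pad k : 'M[R]_(tdim (1 + n) k, tdim (1 + n) k.+1) := \matrix_(a, b)
  ((tidx b ord0 == ord0)%:R * \prod_(l < k) (tidx a l == tidx b (lift ord0 l))%:R).

Lemma padE k (v : 'rV[R]_(tdim (1 + n) k)) b : (v *m pad k) 0 b =
  (tidx b ord0 == ord0)%:R * v 0 (enum_rank [ffun l => tidx b (lift ord0 l)]).
Proof.
rewrite mxE (bigD1 (enum_rank [ffun l => tidx b (lift ord0 l)])) //= mxE big1 => [|l _]; last first.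
  by rewrite /tidx enum_rankK ffunE eqxx.
rewrite mulr1 mulrC big1 ?addr0 // => a na; rewrite mxE.
have [l nl] : exists l, tidx a l != tidx b (lift ord0 l).
  apply: contrapT => /forallNP h; case/negP: na; apply/eqP; rewrite -[a]enum_valK; congr enum_rank.
  by apply/ffunP => l; rewrite ffunE; apply/eqP/negP => /negP; exact: h.
by rewrite (bigD1 l) //= (negPf nl) mul0r !mulr0.
Qed.

Definition tcons k (x : 'rV[R]_(1 + n)) (u : 'I_k -> 'rV[R]_(1 + n)) (l : 'I_k.+1) : 'rV[R]_(1 + n) :=
  if unlift ord0 l is Some l' then u l' else x.

Lemma tvec_pad k (u : 'I_k -> 'rV[R]_(1 + n)) : tvec u *m pad k = tvec (tcons (delta_mx 0 ord0) u).
Proof.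
apply/rowP => b; rewrite padE !tvecE big_ord_recl /tcons unlift_none mxE eqxx /=; congr (_ * _).
by apply: eq_bigr => l _; rewrite liftK /tidx enum_rankK ffunE.
Qed.

Lemma delta_lft (g : 'M[R]_n) : delta_mx 0 ord0 *m lft g = delta_mx 0 ord0 :> 'rV[R]_(1 + n).
Proof.
have -> : delta_mx 0 ord0 = row_mx 1%:M 0 :> 'rV[R]_(1 + n).
  apply/rowP => j; rewrite mxE; case: (fintype.split_ordP j) => l ->.
    by rewrite row_mxEl mxE (ord1 l).
  by rewrite row_mxEr mxE.
have := @mul_row_block R 1 1 n 1 n 1%:M 0 1%:M 0 0 g; rewrite !mulmx0 !mul0mx mul1mx !addr0 => h.
exact: h.
Qed.

Lemma pad_rho k (g : 'M[R]_n) : tpow k (lft g) *m pad k = pad k *m tpow k.+1 (lft g).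
Proof.
apply: tens_eq => u; rewrite !mulmxA tvec_tpow !tvec_pad tvec_tpow; apply: eq_tvec => l.
rewrite /tcons; case: (unlift ord0 l) => [//|]; by rewrite delta_lft.
Qed.

Lemma pad_free k : exists X, pad k *m X = 1%:M.
Proof.
exists (pinvmx (pad k)); apply: mulmxVp; rewrite -kermx_eq0; apply/eqP/row_matrixP => i.
have : row i (kermx (pad k)) *m pad k = 0 by apply/sub_kermxP; exact: row_sub.
move: (row i _) => w w0; rewrite row0; apply/rowP => a; rewrite mxE.
pose f : {ffun 'I_k.+1 -> 'I_(1 + n)} := [ffun l => if unlift ord0 l is Some l' then tidx a l' else ord0].
have := padE w (enum_rank f); rewrite w0 mxE /tidx enum_rankK ffunE unlift_none eqxx mul1r => ->.
congr (w 0 _); rewrite -[LHS]enum_valK; congr enum_rank; apply/ffunP => l.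
by rewrite !ffunE liftK.
Qed.

(** The tensor powers of all degrees up to n are placed in the single representation [rho n], so
    that one decomposition and one finite set serve all ranks. *)
Lemma embed i : (i <= n)%N -> exists (J : 'M[R]_(tdim n i, tdim (1 + n) n)) (X : 'M[R]_(tdim (1 + n) n, tdim n i)),
  J *m X = 1%:M /\ forall g, tpow i g *m J = J *m rho n g.
Proof.
move=> lin.
have [J [X [JX EJ]]] : exists (J : 'M[R]_(tdim (1 + n) i, tdim (1 + n) n)) X,
    J *m X = 1%:M /\ forall g : 'M[R]_n, tpow i (lft g) *m J = J *m tpow n (lft g).
  have main k : exists (J : 'M[R]_(tdim (1 + n) i, tdim (1 + n) (i + k))) X,
      J *m X = 1%:M /\ forall g : 'M[R]_n, tpow i (lft g) *m J = J *m tpow (i + k) (lft g).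
    elim: k => [|k [J [X [JX EJ]]]].
      by rewrite addn0; exists 1%:M, 1%:M; split=> [|g]; rewrite ?mulmx1 // mul1mx.
    rewrite addnS; have [Y PY] := pad_free (i + k); exists (J *m pad (i + k)), (Y *m X); split.
      by rewrite -mulmxA (mulmxA (pad _)) PY mul1mx.
    by move=> g; rewrite mulmxA EJ -!mulmxA pad_rho.
  by have := main (n - i)%N; rewrite subnKC.
pose p : 'M[R]_(n, 1 + n) := row_mx 0 1%:M.
exists (tpow i p *m J), (X *m tpow i p^T); split.
  rewrite -mulmxA (mulmxA J) JX mul1mx -tpowM /p tr_row_mx mul_row_col trmx0 trmx1 mulmx0 mulmx1 add0r.
  exact: tpow1.
move=> g; rewrite mulmxA -tpowM -mulmxA -EJ mulmxA -tpowM; congr (tpow i _ *m _).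
by rewrite /p /lft mul_mx_row mul_row_block !mul0mx !mulmx0 mulmx1 mul1mx !add0r.
Qed.
End Padding.

(** * Norms and expansion adapted to the decomposition *)

Section Dynamics.
Variables (R : realType) (n : nat) (M : mxgroup R[i] n) (Lam : mxgroup R n).
Hypothesis M_R : zclosed_over iotaR M.
Hypothesis M_ss : semisimple M.
Hypothesis Lam_sub : Lam `<=` rpoints M.
Hypothesis Lam_dense : zdense_real Lam M.
Variable d : nat.
Local Notation L0 := (idcomp Lam).
Local Notation N := (tdim (1 + n) d).
Local Notation T g := (rho d g : 'M[R]_N).

Definition unbounded (a : 'M[R]_N) : Prop := forall C, exists2 g, mxset L0 g & C < nrm (a *m T g).

(** [nu] is the invariant norm on a bounded component and the ambient norm on an unbounded one. *)
Lemma component_norm (a : 'M[R]_N) : irred_idem Lam a ->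
  exists (nu : 'rV[R]_N -> R) (c1 c2 : R), [/\ [/\ 0 <= c1, 0 <= c2 & forall v, 0 <= nu v],
    forall c v, nu (c *: v) = `|c| * nu v, forall v, nrm (v *m a) <= c1 * nu v, forall v, nu v <= c2 * nrm v
    & (unbounded a -> forall v, nu v = nrm (v *m a)) /\
      (~ unbounded a -> forall g v, zcl L0 g -> nu (v *m T g) = nu v)].
Proof.
move=> [aa ca a0 _]; have [ub|bd] := pselect (unbounded a).
  exists (fun v => nrm (v *m a)), 1, (nrm a); split=> //.
  - by split=> [||v]; rewrite ?ler01 ?nrm_ge0.
  - by move=> c v; rewrite -scalemxAl nrmZ.
  - by move=> v; rewrite mul1r.
  - by move=> v; rewrite mulrC nrmM.
have [C hC] : exists C, forall g, mxset L0 g -> nrm (a *m T g) <= C.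
  have /existsNP [C nC] := bd; exists C => g Lg; rewrite leNgt; apply/negP => lt.
  by apply: nC; exists g.
have [nu [c1 [c2 [h1 h2 h3 h4 h5]]]] := bounded_norm aa ca hC.
by exists nu, c1, c2; split=> //; split.
Qed.

(** [Nv] sums the norms over all components, [Ev] over the unbounded ones. Expansion is applied
    simultaneously to all pairs of a vector and an unbounded component, which yields a common g. If
    [Ev v = 0], only invariant norms remain, and these bound the orbit under the closure of [L0]. *)
Lemma dynamics k : exists (Nv Ev : 'rV[R]_N -> R) (c1 c2 c3 : R) (F : seq 'M[R]_n),
  [/\ [/\ 0 < c1, 0 <= c3 & forall g, g \in F -> mxset L0 g],
     [/\ forall c v, Nv (c *: v) = `|c| * Nv v, forall v, c1 * nrm v <= Nv v & forall v, Nv v <= c2 * nrm v],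
     [/\ forall c v, Ev (c *: v) = `|c| * Ev v, forall v, Ev v <= Nv v & forall v, 0 <= Ev v],
     forall v : 'I_k -> 'rV[R]_N, exists2 g, g \in F & forall i, Nv (v i) <= Nv (v i *m T g) /\
       2 * Ev (v i) <= Ev (v i *m T g)
   & forall v g, Ev v = 0 -> zcl L0 g -> nrm (v *m T g) <= c3 * Nv v].
Proof.
have [||s [sI sE]] := @idem_decomp R n M Lam M_R M_ss Lam_sub Lam_dense d 1%:M.
- by rewrite mulmx1.
- by move=> g _; rewrite mul1mx mulmx1.
have [nu [a1 [a2 [H0 H]]]] : exists (nu : 'M[R]_N -> 'rV[R]_N -> R) (a1 a2 : 'M[R]_N -> R),
  (forall a, [/\ 0 <= a1 a, 0 <= a2 a & forall v, 0 <= nu a v]) /\ forall a, a \in s ->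
  [/\ forall c v, nu a (c *: v) = `|c| * nu a v, forall v, nrm (v *m a) <= a1 a * nu a v,
    forall v, nu a v <= a2 a * nrm v, unbounded a -> forall v, nu a v = nrm (v *m a)
    & ~ unbounded a -> forall g v, zcl L0 g -> nu a (v *m T g) = nu a v].
  have ex (a : 'M[R]_N) : exists t : ('rV[R]_N -> R) * R * R,
    [/\ 0 <= t.1.2, 0 <= t.2 & forall v, 0 <= t.1.1 v] /\ (a \in s ->
    [/\ forall c v, t.1.1 (c *: v) = `|c| * t.1.1 v, forall v, nrm (v *m a) <= t.1.2 * t.1.1 v,
      forall v, t.1.1 v <= t.2 * nrm v, unbounded a -> forall v, t.1.1 v = nrm (v *m a)
      & ~ unbounded a -> forall g v, zcl L0 g -> t.1.1 (v *m T g) = t.1.1 v]).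
    have [/sI /component_norm [nu [x1 [x2 [h1 h2 h3 h4 [h5 h6]]]]]|_] := boolP (a \in s).
      by exists (nu, x1, x2).
    by exists (fun=> 0, 0, 0).
  exists (fun a => (sval (cid (ex a))).1.1), (fun a => (sval (cid (ex a))).1.2), (fun a => (sval (cid (ex a))).2).
  by split=> a; have [h1 h2] := svalP (cid (ex a)).
pose K1 := 1 + \sum_(a <- s) a1 a; pose K2 := \sum_(a <- s) a2 a.
have s0 : 0 <= \sum_(a <- s) a1 a by apply: sumr_ge0 => a _; have [] := H0 a.
have K1p : 0 < K1 by rewrite ltr_pwDl.
have aK a : a \in s -> a1 a <= K1.
  move=> as_; apply: (@le_trans _ _ (\sum_(a <- s) a1 a)); last by rewrite lerDr ler01.
  by apply: le_seq_sum => // b; have [] := H0 b.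
have nu0 a v : 0 <= nu a v by have [_ _] := H0 a.
have vsum (v : 'rV[R]_N) : v = \sum_(a <- s) v *m a by rewrite -mulmx_sumr sE mulmx1.
pose Nv v := \sum_(a <- s) nu a v.
pose su := [seq a <- s | `[<unbounded a>]].
pose Ev v := \sum_(a <- su) nu a v.
have suP a : a \in su -> a \in s /\ unbounded a by rewrite mem_filter => /andP [/asboolP].
have bound (v w : 'rV[R]_N) : (forall a, a \in s -> nrm (v *m a) <= K1 * nu a w) -> nrm v <= K1 * Nv w.
  move=> h; rewrite {1}(vsum v); apply: le_trans (nrm_sum _ _ _) _.
  by rewrite /Nv mulr_sumr big_seq [leRHS]big_seq; apply: ler_sum.
have nrmK a v : a \in s -> nrm (v *m a) <= K1 * nu a v.
  move=> as_; have [_ h _ _ _] := H a as_; apply: le_trans (h v) _.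
  by apply: ler_wpM2r => //; exact: aK.
pose L := [seq (i, a) | i <- enum 'I_k, a <- su].
pose e (j : 'I_(size L)) := (tnth (in_tuple L) j).2.
have eL j : e j \in su.
  by have := mem_tnth j (in_tuple L) => /allpairsP [[i a] /= [_ h E]]; rewrite /e E.
have [|||F [FL FP]] := @expanding R n Lam d (size L) e.
- by move=> j; have [/sI] := suP _ (eL j).
- by move=> j; have [_ h] := suP _ (eL j); exact: h.
- move=> j; have [/sI [aa ca a0 _] _] := suP _ (eL j).
  exact: (idem_lower M_R M_ss Lam_sub Lam_dense aa ca a0).
exists Nv, Ev, K1^-1, K2, K1, F; split.
- by split=> //; [rewrite invr_gt0 | exact: ltW].
- split=> [c v|v|v].
  + by rewrite /Nv mulr_sumr; apply: eq_big_seq => a /H [h _ _ _ _]; exact: h.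
  + by rewrite mulrC ler_pdivrMr // mulrC; apply: bound => a; exact: nrmK.
  + rewrite /Nv /K2 mulr_suml big_seq [leRHS]big_seq; apply: ler_sum => a /H [_ _ h _ _]; exact: h.
- split=> [c v|v|v].
  + by rewrite /Ev mulr_sumr; apply: eq_big_seq => a /suP [/H [h _ _ _ _] _]; exact: h.
  + rewrite /Ev /su big_filter big_mkcond; apply: ler_sum => a _.
    by case: ifP.
  + by apply: sumr_ge0.
- move=> v; pose w j := v (tnth (in_tuple L) j).1 *m e j.
  have [j|g gF gP] := FP w.
    by have [/sI [aa _ _ _] _] := suP _ (eL j); rewrite /w -mulmxA aa.
  exists g => // i; have Lg := FL _ gF.
  have key a : a \in su -> 2 * nu a (v i) <= nu a (v i *m T g).
    move=> asu; have [as_ ua] := suP _ asu; have [_ _ _ /(_ ua) h _] := H a as_.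
    have : (i, a) \in L by apply/allpairsP; exists (i, a); split=> //=; rewrite mem_enum.
    move=> /seq_tnthP [j Ej]; have := gP j; rewrite /w /e -Ej /= !h.
    have [_ ca _ _] := sI _ as_.
    by rewrite -!mulmxA ca.
  split; last by rewrite /Ev mulr_sumr big_seq [leRHS]big_seq; apply: ler_sum => a; exact: key.
  rewrite /Nv big_seq [leRHS]big_seq; apply: ler_sum => a as_.
  have [ua|nua] := pselect (unbounded a).
    apply: le_trans (key a _); first by rewrite ler_peMl ?ler1n.
    by rewrite mem_filter as_ andbT; apply/asboolP.
  have [_ _ _ _ h] := H a as_; rewrite h //.
  exact: zcl_sub.
- move=> v g E0 zg; apply: bound => a as_.
  have [ua|nua] := pselect (unbounded a); last first.
    by have [_ _ _ _ h] := H a as_; rewrite -(h nua g v zg); exact: nrmK.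
  have asu : a \in su by rewrite mem_filter as_ andbT; apply/asboolP.
  have va0 : v *m a = 0.
    apply/eqP; rewrite -nrm_eq0 eq_le nrm_ge0 andbT.
    have [_ _ _ /(_ ua) h _] := H a as_; rewrite -h -E0 /Ev.
    exact: (@le_seq_sum _ _ su (fun a => nu a v)).
  have [_ ca _ _] := sI _ as_.
  rewrite -mulmxA -(zcl_equiv ca zg) mulmxA va0 mul0mx nrm0.
  by apply: mulr_ge0 => //; exact: ltW.
Qed.
End Dynamics.
End DynamicsPart.

(** * Conclusion *)

Section MainPart.
Local Open Scope classical_set_scope.
Local Open Scope ring_scope.

(** * Recurrence of lattices under the dense subgroup *)

Section Recurrence.
Variables (R : realType) (n : nat) (M : mxgroup R[i] n) (Lam : mxgroup R n).
Hypothesis M_R : zclosed_over iotaR M.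
Hypothesis M_ss : semisimple M.
Hypothesis Lam_sub : Lam `<=` rpoints M.
Hypothesis Lam_dense : zdense_real Lam M.

Lemma nrm_minors1 (v : 'rV[R]_n) : nrm (minors v) <= (1 * tdim n 1)%:R * nrm v.
Proof.
apply: nrm_le => i j; rewrite (ord1 i) minorsE /minor.
apply: le_trans (det_bound (c := nrm v) _) _; last by rewrite expr1 mul1r.
by move=> a b; rewrite mxE; exact: nrm_entry.
Qed.

(** The orbit [u *m l] is fed into the abstract recurrence. Its hypothesis on sublattices without
    unbounded part is transported from the lattice at [u *m m], since elements of M change their
    covolume by a bounded factor only. *)
Lemma dense_recurrence (delta : R) : 0 < delta -> exists2 eps : R, 0 < eps &
  forall u m, u \in unitmx -> mxset (rpoints M) m ->
    (forall i (L : 'M[int]_(i, n)), row_free (imx rat L) -> delta <= nrm (minors (imx R L *m u *m m))) ->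
    exists2 l, mxset Lam l & forall x : 'rV[int]_n, x != 0 -> eps <= nrm (imx R x *m (u *m l)).
Proof.
move=> d0.
have emb (i : nat) : exists JX : 'M[R]_(tdim n i, tdim (1 + n) n) * 'M[R]_(tdim (1 + n) n, tdim n i),
    (i <= n)%N -> JX.1 *m JX.2 = 1%:M /\ forall g, tpow i g *m JX.1 = JX.1 *m rho n g.
  have [lin|_] := boolP (i <= n)%N; last by exists (0, 0).
  by have [J [X h]] := @embed R n i lin; exists (J, X).
pose J i := (sval (cid (emb i))).1; pose X i := (sval (cid (emb i))).2.
have JX i : (i <= n)%N -> J i *m X i = 1%:M by move=> lin; have [] := svalP (cid (emb i)) lin.
have JT i g : (i <= n)%N -> tpow i g *m J i = J i *m rho n g.
  by move=> lin; have [] := svalP (cid (emb i)) lin.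
have [Nv [Ev [c1 [c2 [c3 [F [[c10 c30 FL] [NZ Nge Nle] [EZ ENle E0] Fgood Efix]]]]]]] :=
  dynamics M_R M_ss Lam_sub Lam_dense n n.+1.
pose N i (v : 'rV[R]_(tdim n i)) := Nv (v *m J i).
pose E i (v : 'rV[R]_(tdim n i)) := Ev (v *m J i).
pose K := 1 + \sum_(i < n.+1) (nrm (J i) + nrm (X i)).
have Ks : 0 <= \sum_(i < n.+1) (nrm (J i) + nrm (X i)).
  by apply: sumr_ge0 => i _; rewrite addr_ge0 ?nrm_ge0.
have K0 : 0 < K by rewrite ltr_pwDl.
have KJX i : (i <= n)%N -> nrm (J i) <= K /\ nrm (X i) <= K.
  move=> lin; have le1 : nrm (J i) + nrm (X i) <= K.
    rewrite /K (bigD1 (inord i)) //= inordK ?ltnS // addrCA lerDl addr_ge0 //.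
    by apply: sumr_ge0 => l _; rewrite addr_ge0 ?nrm_ge0.
  by split; apply: le_trans le1; rewrite ?lerDl ?lerDr nrm_ge0.
have vX i (v : 'rV[R]_(tdim n i)) : (i <= n)%N -> nrm v <= K * nrm (v *m J i).
  move=> lin; have -> : nrm v = nrm (v *m J i *m X i) by rewrite -mulmxA JX // mulmx1.
  apply: le_trans (nrmM _ _) _; rewrite mulrC; apply: ler_wpM2r; first exact: nrm_ge0.
  by have [] := KJX i lin.
have [s hs] := rpoints_cover Lam_dense.
pose K' := 1 + \sum_(r <- s) nrm (rho n (invmx r) : 'M[R]_(tdim (1 + n) n)).
have K's : 0 <= \sum_(r <- s) nrm (rho n (invmx r) : 'M[R]_(tdim (1 + n) n)).
  by apply: sumr_ge0 => r _; exact: nrm_ge0.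
have K'0 : 0 < K' by rewrite ltr_pwDl.
pose B := K * (K' * (1 + c3)).
have B0 : 0 < B by rewrite !mulr_gt0 // ltr_pwDl.
(* The inverse of x lies in one of finitely many translates of the closure of [L0]; [K'] bounds the
   representatives and [c3] the action of the closure. *)
have Bfix i (v : 'rV[R]_(tdim n i)) x : (i <= n)%N -> E i v = 0 -> mxset (rpoints M) x ->
    nrm (v *m tpow i x) <= B * N i v.
  move=> lin Ev0 Mx; apply: le_trans (vX _ _ lin) _; rewrite /B -[leRHS]mulrA.
  apply: ler_wpM2l; first exact: ltW.
  rewrite -mulmxA JT // mulmxA.
  have [r rs [Lr zr]] := hs _ (mxgroupV Mx).
  have ur := mxgroup_unit Lr; have ux := mxgroup_unit Mx.
  have -> : x = invmx (invmx r *m invmx x) *m invmx r.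
    have E1 : (invmx r *m invmx x) *m (x *m r) = 1%:M.
      by rewrite -mulmxA mulKmx // mulVmx.
    have u1 : invmx r *m invmx x \in unitmx by rewrite unitmx_mul !unitmx_inv ur ux.
    have -> : invmx (invmx r *m invmx x) = x *m r by rewrite -[RHS](mulKmx u1) E1 mulmx1.
    by rewrite mulmxK.
  rewrite rhoM mulmxA; apply: le_trans (nrmM _ _) _; rewrite mulrC -[leRHS]mulrA.
  apply: ler_pM; rewrite ?nrm_ge0 //.
    apply: (@le_trans _ _ (\sum_(r <- s) nrm (rho n (invmx r) : 'M[R]_(tdim (1 + n) n)))); last by rewrite lerDr ler01.
    by apply: (@le_seq_sum _ _ s (fun r => nrm (rho n (invmx r) : 'M[R]_(tdim (1 + n) n)))) => // y; exact: nrm_ge0.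
  apply: le_trans (Efix _ _ Ev0 (zclV zr)) _; apply: ler_wpM2r; last by rewrite lerDr ler01.
  by apply: le_trans (ENle _); exact: E0.
have [||||||||||eps e0 He] := @orbit_nondivergent R n N E (c1 / K) (`|c2| * K) F _ _ _ _ _ _ _ _ _ (delta / B).
- by rewrite divr_gt0.
- by move=> i c v _; rewrite /N -scalemxAl NZ.
- move=> i v lin; apply: le_trans (Nge _); rewrite -mulrA; apply: ler_wpM2l; first exact: ltW.
  by rewrite ler_pdivrMl //; exact: vX.
- move=> i v lin; apply: le_trans (Nle _) _.
  apply: (@le_trans _ _ (`|c2| * nrm (v *m J i))); first by apply: ler_wpM2r; [exact: nrm_ge0 | exact: ler_norm].
  rewrite -mulrA; apply: ler_wpM2l; first exact: normr_ge0.
  apply: le_trans (nrmM _ _) _; rewrite mulrC; apply: ler_wpM2r; first exact: nrm_ge0.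
  by have [] := KJX i lin.
- by move=> i c v _; rewrite /E -scalemxAl EZ.
- by move=> i v _; exact: ENle.
- by move=> i v _; exact: E0.
- by move=> g /FL /idcomp_unit.
- move=> v; have [g gF hg] := Fgood (fun i : 'I_n.+1 => v i *m J i); exists g => // i lin.
  have lin' : (i < n.+1)%N by rewrite ltnS.
  by have := hg (Ordinal lin'); rewrite /N /E /= -!mulmxA -JT.
- by rewrite divr_gt0.
have t0 : 0 <= (1 * tdim n 1)%:R :> R by rewrite ler0n.
have t1 : 0 < 1 + (1 * tdim n 1)%:R :> R by rewrite ltr_pwDl.
exists (eps / (1 + (1 * tdim n 1)%:R)) => [|u m uu Mm hL]; first by rewrite divr_gt0.
have [|||u0 i L [l Ll ->] fL Ez|_ [l Ll ->] hl] := He (fun o => exists2 l, mxset Lam l & o = u *m l).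
- by move=> _ [l Ll ->]; rewrite unitmx_mul uu (mxgroup_unit Ll).
- move=> _ g [l Ll ->] gF; exists (l *m g); last by rewrite mulmxA.
  by apply: mxgroupM => //; apply: idcomp_sub; exact: FL.
- by exists (u *m 1%:M), 1%:M => //; exact: mxgroup1.
- have lin : (i <= n)%N by move: (rank_leq_col (imx rat L)); rewrite (eqP fL).
  have ul := mxgroup_unit Ll.
  (* This element of M carries the lattice at [u *m l] to the one at [u *m m]. *)
  have Mx : mxset (rpoints M) (invmx l *m m) by apply: mxgroupM => //; apply: mxgroupV; exact: Lam_sub.
  rewrite ler_pdivrMr // mulrC; apply: le_trans (Bfix _ _ _ lin Ez Mx).
  rewrite -minors_tpow (_ : _ *m (u *m l) *m (invmx l *m m) = imx R L *m u *m m); first exact: hL.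
  by rewrite !mulmxA mulmxK.
exists l => // x x0.
have fx : row_free (imx rat x).
  rewrite /row_free rank_rV (_ : imx rat x != 0) //; apply: contraNneq x0 => h; apply/eqP.
  by apply: (@imx_inj rat); rewrite h; apply/matrixP => a b; rewrite !mxE.
rewrite ler_pdivrMr //; apply: le_trans (hl _ _ fx) _; apply: le_trans (nrm_minors1 _) _.
by rewrite mulrC; apply: ler_wpM2l; [exact: nrm_ge0 | rewrite lerDr ler01].
Qed.
End Recurrence.

Lemma invmx_mul (F : fieldType) n (A B : 'M[F]_n) : A \in unitmx -> B \in unitmx ->
  invmx (A *m B) = invmx B *m invmx A.
Proof.
move=> uA uB; have uAB : A *m B \in unitmx by rewrite unitmx_mul uA.
by rewrite -[RHS](mulKmx uAB) -[A *m B *m (_ *m _)]mulmxA (mulmxA B) mulmxV // mul1mx mulmxV // mulmx1.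
Qed.
End MainPart.

Theorem corollary1p9 (R : realType) (n : nat)
  (G : mxgroup R[i] n)
  (G_Q : zclosed_over iotaQ G) (G_connected : zconnected G)
  (G_semisimple : semisimple G)
  (Gamma : mxgroup R n) (Gamma_arithmetic : arithmetic_lattice G Gamma)
  (T : mxgroup R[i] n)
  (T_maximal : maximal_split_torus iotaR G T)
  (T_contains : exists S : mxgroup R[i] n,
     maximal_split_torus iotaQ G S /\ S `<=` T)
  (M : mxgroup R[i] n)
  (M_R : zclosed_over iotaR M) (M_sub : M `<=` G)
  (M_semisimple : semisimple M) (M_noncompact : no_compact_factors M)
  (D : mxgroup R[i] n)
  (D_maximal : maximal_split_torus iotaR (mxcentralizer G M) D)
  (A : mxgroup R n) (A_lie : lie_subgroup A) (A_sub : A `<=` rpoints D)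
  (D_sub : D `<=` T)
  (Lambda : mxgroup R n) (Lambda_sub : Lambda `<=` rpoints M)
  (Lambda_fg : finitely_generated Lambda)
  (Lambda_dense : zdense_real Lambda M) :
  uniformly_nondivergent (rpoints G) Gamma (mxprod A Lambda) <->
  uniformly_nondivergent (rpoints G) Gamma (mxprod A (rpoints M)).
Proof.
split=> -[C [cC hC]].
  (* An orbit under A Lambda is contained in the orbit under A M. *)
  exists C; split=> // x; have [y [[h [a Aa [l Ll ->]] tr] Cy]] := hC x.
  exists y; split=> //; exists (a *m l)%R => //; exists a => //; exists l => //.
  exact: Lambda_sub.
have [delta d0 hd] := compact_covolume Gamma_arithmetic cC.
have [eps e0 he] := dense_recurrence M_R M_semisimple Lambda_sub Lambda_dense d0.
have [C' cC' hC'] := compact_no_short_vectors G_Q Gamma_arithmetic e0.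
have [_ DS _] := D_maximal.
have comm a m : mxset A a -> mxset (rpoints M) m -> (a *m m = m *m a)%R.
  move=> /A_sub Da Mm; have [_ /(_ _ Mm)] := DS _ Da.
  by rewrite /complexify -!map_mxM; exact: map_mx_inj.
exists C'; split=> // x.
have [y [[h [a Aa [m Mm ->]] [g [g' [xE g'E yE]]]] Cy]] := hC x.
have ug := punit g; have ua := mxgroup_unit Aa; have um := mxgroup_unit Mm.
have uag : (a *m val g \in unitmx)%R by rewrite unitmx_mul ua.
(* As m commutes with a, the lattice of g' = a m g is Z^n (a g)^-1 m^-1; since g' lies over C, its
   sublattices have covolume at least delta. *)
have [|//|i L fL|l Ll hl] := he (invmx (a *m val g)) (invmx m).
- by rewrite unitmx_inv.
- exact: mxgroupV.
- have := hd g'; rewrite -yE => /(_ Cy i L fL).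
  by rewrite g'E comm // -(mulmxA m) invmx_mul // mulmxA.
have Ml := Lambda_sub _ Ll; have ul := mxgroup_unit Ll.
have Ga : mxset (rpoints G) a by have [] := DS _ (A_sub _ Aa).
have Gl : mxset (rpoints G) (invmx l) by apply: mxgroupV; apply: M_sub; exact: Ml.
(* As l commutes with a, the lattice of this point is Z^n (a g)^-1 l, which has no short vectors. *)
have [k kE] : exists k : points (rpoints G), val k = (a *m invmx l *m val g)%R.
  by apply: point_of; apply: mxgroupM; [exact: mxgroupM | exact: (set_valP g)].
have kI : invmx (val k) = (invmx (a *m val g) *m l)%R.
  rewrite kE (comm _ _ Aa (mxgroupV Ml)).
  by rewrite -mulmxA invmx_mul ?unitmx_inv // invmxK.
exists (coset_proj Gamma k); split; last by apply: hC' => v v0; rewrite kI; exact: hl.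
exists (a *m invmx l)%R; last by exists g, k.
by exists a => //; exists (invmx l) => //; exact: mxgroupV.
Qed.
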